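(* Let \[ f_{300}(q)=\sum_{k=1}^{2}\sum_{j=1}^4\left(\frac j5\right)\sum_{m,n\in\mathbb{Z}}\beta_{j,k}(m,n)^2q^{|\beta_{j,k}(m,n)|^2}-\frac12\sum_{m,n\in\mathbb{Z}}(5m+n\sqrt{-3})^2q^{25m^2+3n^2}+\frac12\sum_{m,n\in\mathbb{Z}}(m+5n\sqrt{-3})^2q^{m^2+75n^2}, \] where $\beta_{j,k}(m,n)=5m+(5n+k)(j+\sqrt{-3})$, $\left(\frac j5\right)$ is the Legendre symbol, and in the last two sums $(m,n)=(0,0)$ is excluded. (This is the newform with LMFDB label $300.3.g.b$.) Then \[ L(f_{300},2)=\frac{4}{25}\pi^2E_4(\sqrt{-3})^{1/2}=\frac{4}{25}\pi^2\,{}_3F_2\!\left[\begin{matrix}\tfrac12&\tfrac16&\tfrac56\\ &1&1\end{matrix};\tfrac{4}{125}\right]. \]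
   Context: $E_4(\tau)=1+240\sum_{n\ge1}\sigma_3(n)q^n$, $q=e^{2\pi i\tau}$ (positive real at $\tau=\sqrt{-3}$, positive square root taken). ${}_3F_2$ is the generalized hypergeometric series $\sum_{n\ge0}\frac{(a_1)_n(a_2)_n(a_3)_n}{n!^3}t^n$. $L(f,s)=\sum a_nn^{-s}$ analytically continued. *)

(* Defs.v *)
From Stdlib Require Import Reals Lra Lia Psatz ZArith List Bool.
From Coquelicot Require Import Coquelicot.
Open Scope R_scope.

(** * Complex exponential and complex series *)

Definition Cexp (z : C) : C :=
  Cmult (RtoC (exp (Re z))) (cos (Im z), sin (Im z)).

(* Like [Series], meaningful only when the series converges. *)
Definition CSeries (u : nat -> C) : C :=
  (Series (fun n => Re (u n)), Series (fun n => Im (u n))).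

(** * The Eisenstein series E_4 *)

Definition sigma (k n : nat) : nat :=
  list_sum (map (fun d => Nat.pow d k)
                (filter (fun d => Nat.eqb (Nat.modulo n d) 0) (seq 1 n))).

Definition nome (tau : C) : C := Cexp (RtoC (2 * PI) * Ci * tau)%C.

Definition E4 (tau : C) : C :=
  (RtoC 1 + RtoC 240 *
     CSeries (fun n => RtoC (INR (sigma 3 (S n))) * Cpow (nome tau) (S n)))%C.

(** * The hypergeometric series 3F2 *)

Fixpoint poch (a : R) (n : nat) : R :=
  match n with
  | O => 1
  | S p => poch a p * (a + INR p)
  end.

Definition hyp3F2 (a1 a2 a3 b1 b2 t : R) : R :=
  Series (fun n => poch a1 n * poch a2 n * poch a3 n
                   / (poch b1 n * poch b2 n * INR (fact n)) * t ^ n).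

(** * Values of analytically continued Dirichlet series *)

(* n^{-s}, for n >= 1 *)
Definition npow_opp (n : nat) (s : C) : C := Cexp (- (s * RtoC (ln (INR n))))%C.

Definition holomorphic_right_of (sigma1 : R) (L : C -> C) : Prop :=
  forall s : C, sigma1 < Re s ->
    ex_derive (K := C_AbsRing) (V := C_NormedModule) L s.

(* [is_L_value a s v]: the Dirichlet series sum_{n>=1} a_n n^{-s} converges on
   some right half-plane, continues analytically to a right half-plane that
   contains s, and the continuation takes the value v at s.  Right half-planes
   are nested and connected, so the identity theorem makes v unique. *)
Definition is_L_value (a : nat -> C) (s v : C) : Prop :=
  exists (L : C -> C) (sigma0 sigma1 : R),
    (forall z : C, sigma0 < Re z ->
       is_series (K := C_AbsRing) (V := C_NormedModule)
         (fun n => Cmult (a (S n)) (npow_opp (S n) z)) (L z)) /\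
    holomorphic_right_of sigma1 L /\
    sigma1 < Re s /\
    L s = v.

(** * q-series indexed by pairs of integers *)

Definition zsum (B : nat) (F : Z -> C) : C :=
  sum_n (fun i => F (Z.of_nat i - Z.of_nat B)%Z) (2 * B).

(* Coefficient of q^N in  sum_{m,n in Z, D m n} P(m,n) q^{Q(m,n)}.  The box
   |m|, |n| <= N contains every representation Q(m,n) = N for the forms Q used
   here: see [form_25_3_box], [form_1_75_box] and [beta_norm_box]. *)
Definition qcoeff (D : Z -> Z -> bool) (P : Z -> Z -> C) (Q : Z -> Z -> Z)
    (N : nat) : C :=
  zsum N (fun m => zsum N (fun n =>
    if D m n && (Q m n =? Z.of_nat N)%Z then P m n else RtoC 0)).

Definition all_pairs (m n : Z) : bool := true.
Definition nonzero_pairs (m n : Z) : bool := negb ((m =? 0) && (n =? 0))%Z.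

(** * The form f_300 *)

Definition ZtoC (m : Z) : C := RtoC (IZR m).

Definition sqrt_m3 : C := (RtoC (sqrt 3) * Ci)%C.

Definition legendre (a p : Z) : Z :=
  (if a mod p =? 0 then 0
   else if existsb (fun x => (Z.of_nat x * Z.of_nat x) mod p =? a mod p)
                   (seq 0 (Z.to_nat p))
   then 1 else -1)%Z.

Definition beta (j k m n : Z) : C :=
  (ZtoC (5 * m) + ZtoC (5 * n + k) * (ZtoC j + sqrt_m3))%C.

(* |beta_{j,k}(m,n)|^2, as an integer *)
Definition beta_norm (j k m n : Z) : Z :=
  ((5 * m + (5 * n + k) * j) ^ 2 + 3 * (5 * n + k) ^ 2)%Z.

Lemma beta_normE (j k m n : Z) :
  Cmod (beta j k m n) ^ 2 = IZR (beta_norm j k m n).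
Proof.
set (X := (5 * m + (5 * n + k) * j)%Z); set (Y := (5 * n + k)%Z).
assert (Hb : beta j k m n = (IZR X, sqrt 3 * IZR Y)).
{ unfold beta, sqrt_m3, ZtoC, X, Y.
  apply injective_projections; simpl;
    rewrite ?plus_IZR, ?mult_IZR, ?plus_IZR, ?mult_IZR; ring. }
rewrite Hb; unfold Cmod, beta_norm; fold X Y; simpl fst; simpl snd.
rewrite pow2_sqrt by (apply Rplus_le_le_0_compat; apply pow2_ge_0).
rewrite Rpow_mult_distr, pow2_sqrt by lra.
rewrite plus_IZR, mult_IZR, !Z.pow_2_r, !mult_IZR; ring.
Qed.

Lemma form_25_3_box (m n : Z) (N : nat) :
  (25 * m ^ 2 + 3 * n ^ 2 = Z.of_nat N ->
   Z.abs m <= Z.of_nat N /\ Z.abs n <= Z.of_nat N)%Z.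
Proof. intros H; split; nia. Qed.

Lemma form_1_75_box (m n : Z) (N : nat) :
  (m ^ 2 + 75 * n ^ 2 = Z.of_nat N ->
   Z.abs m <= Z.of_nat N /\ Z.abs n <= Z.of_nat N)%Z.
Proof. intros H; split; nia. Qed.

Lemma beta_norm_box (j k m n : Z) (N : nat) :
  (1 <= j <= 4 -> 1 <= k <= 2 -> beta_norm j k m n = Z.of_nat N ->
   Z.abs m <= Z.of_nat N /\ Z.abs n <= Z.of_nat N)%Z.
Proof.
unfold beta_norm; intros Hj Hk H.
set (u := (5 * n + k)%Z) in *.
set (x := (5 * m + u * j)%Z) in *.
assert (Hu : (Z.abs u <= u ^ 2)%Z) by nia.
assert (Hx : (Z.abs x <= x ^ 2)%Z) by nia.
assert (Huj : (Z.abs (u * j) <= 4 * Z.abs u)%Z) by (rewrite Z.abs_mul; nia).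
assert (Hu0 : (1 <= Z.abs u)%Z) by (unfold u; lia).
split; lia.
Qed.

(* f_300 as the sequence of its q-expansion coefficients. *)
Definition f300 (N : nat) : C :=
  (sum_n_m (fun k : nat =>
     sum_n_m (fun j : nat =>
       (ZtoC (legendre (Z.of_nat j) 5) *
        qcoeff all_pairs
          (fun m n => Cpow (beta (Z.of_nat j) (Z.of_nat k) m n) 2)
          (beta_norm (Z.of_nat j) (Z.of_nat k)) N)%C) 1 4) 1 2
   - RtoC (1 / 2) *
     qcoeff nonzero_pairs
       (fun m n => Cpow (ZtoC (5 * m) + ZtoC n * sqrt_m3) 2)
       (fun m n => (25 * m ^ 2 + 3 * n ^ 2)%Z) N
   + RtoC (1 / 2) *
     qcoeff nonzero_pairs
       (fun m n => Cpow (ZtoC m + ZtoC (5 * n) * sqrt_m3) 2)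
       (fun m n => (m ^ 2 + 75 * n ^ 2)%Z) N)%C.

(* Main.v *)
(* Up to the factor 1/2, the n-th coefficient of f_300 is (n/5) times the sum of
   (x + y sqrt(-3))^2 over x^2 + 3 y^2 = n.  Its Dirichlet series, grouped into
   blocks modulo 10 Z[om] with om = e^(2 pi i/3), converges absolutely for
   Re s > 15/8 because the twist sums to zero over a block, and its value at 2
   is a finite combination of values at 10-torsion points of the Weierstrass
   function R of Z[om].  The relation R(om z) = om R(z) and the distribution
   relation for multiplication by 5 leave only translates of the 5-torsion
   points sqrt(-3)/5 and 2 sqrt(-3)/5 by 1/2; the duplication formula gives a
   quintic for their coordinates, whence L(2) = 3 sqrt(5) f / 25 with f = R(1/2).

   Products of the Lambert series sum_n n^k u^n/(1 - q^n) yield the Weierstrass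
   equation and Ramanujan's differential equations.  Comparing the lattices
   Z[om] and Z[sqrt(-3)], whose nomes are q and q^2, gives E4 = 45 e^2 and
   E6 = -297 e^3 at sqrt(-3) with e = -f/(4 pi^2); so the square root of E4 is
   3 sqrt(5) f/(4 pi^2) and t = 1 - E6^2/E4^3 = 4/125.  Finally 3F2(t)/sqrt(E4)
   is annihilated by (q d/dq)^3 and tends to 1 at q = 0, hence is constant. *)
From Stdlib Require Import Reals Lra Lia Psatz ZArith List Bool Permutation.
From Stdlib Require Import Classical ClassicalEpsilon FunctionalExtensionality.
From Coquelicot Require Import Coquelicot.
Require Import Defs.
Open Scope R_scope.

(** * Unordered sums *)

(** Identities between elliptic functions are derived by series manipulation. They rest on the
    weight 1/(1 - q^n): a product of two such weights is a third one times a difference, so the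
    Cauchy coefficients of a product of Lambert series reduce to power sums. Unknown constants are
    pinned down by blow-up: a polynomial relation in the Weierstrass function holds at points where
    its value is arbitrarily large, so its coefficients vanish.

    On the lattice side the obstacle is that weight 2 is the borderline of absolute convergence.
    Only differences of sums of (z + lambda)^(-2) converge, which leaves one additive constant open.
    Multiplication by om fixes it, and the same symmetry shows that the constants in the
    distribution relations vanish. Unordered sums allow the lattice to be regrouped by rows, by
    residue classes and by norms.

    Numerical estimates decide signs: f > 0 selects the positive square root of E4, and the position
    of R(sqrt(-3)/5) relative to f and 0 selects the root of the quintic. *)

Definition rsum {I : Type} (l : list I) (f : I -> R) : R :=
  fold_right (fun i acc => f i + acc) 0 l.

Definition csum {I : Type} (l : list I) (F : I -> C) : C :=
  fold_right (fun i acc => (F i + acc)%C) (RtoC 0) l.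

Definition summable {I : Type} (F : I -> C) : Prop :=
  exists M, forall l, NoDup l -> rsum l (fun i => Cmod (F i)) <= M.

Definition has_sum {I : Type} (F : I -> C) (s : C) : Prop :=
  forall eps, 0 < eps -> exists l0, forall l, NoDup l -> incl l0 l ->
    Cmod (csum l F - s) <= eps.

(* Junk unless [F] is summable. *)
Definition tsum {I : Type} (F : I -> C) : C :=
  epsilon (inhabits (RtoC 0)) (has_sum F).

(** Extension by zero outside [P]. Fibres are summed over the full index type in this form, which
    avoids subtypes. *)
Definition mask {I : Type} (P : I -> Prop) (F : I -> C) (i : I) : C :=
  if excluded_middle_informative (P i) then F i else RtoC 0.

Section Finite.
Context {I : Type}.
Implicit Types (l : list I) (f g : I -> R) (F G : I -> C).

Lemma rsum_app l1 l2 f : rsum (l1 ++ l2) f = rsum l1 f + rsum l2 f.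
Proof. induction l1 as [|i l1 IH]; simpl; [ring|]. rewrite IH; ring. Qed.

Lemma csum_app l1 l2 F : csum (l1 ++ l2) F = (csum l1 F + csum l2 F)%C.
Proof. induction l1 as [|i l1 IH]; simpl; [ring|]. rewrite IH; ring. Qed.

Lemma rsum_le l f g : (forall i, In i l -> f i <= g i) -> rsum l f <= rsum l g.
Proof.
induction l as [|i l IH]; simpl; intros H; [lra|].
specialize (IH (fun j Hj => H j (or_intror Hj))).
specialize (H i (or_introl eq_refl)); lra.
Qed.

Lemma rsum_ge0 l f : (forall i, 0 <= f i) -> 0 <= rsum l f.
Proof. intros H; induction l as [|i l IH]; simpl; [lra|]. specialize (H i); lra. Qed.

Lemma rsum_plus l f g : rsum l (fun i => f i + g i) = rsum l f + rsum l g.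
Proof. induction l as [|i l IH]; simpl; [ring|]. rewrite IH; ring. Qed.

Lemma rsum_scal l c f : rsum l (fun i => c * f i) = c * rsum l f.
Proof. induction l as [|i l IH]; simpl; [ring|]. rewrite IH; ring. Qed.

Lemma csum_ext l F G : (forall i, In i l -> F i = G i) -> csum l F = csum l G.
Proof.
induction l as [|i l IH]; simpl; intros H; [reflexivity|].
rewrite (H i (or_introl eq_refl)), IH by auto; reflexivity.
Qed.

Lemma csum_plus l F G : csum l (fun i => (F i + G i)%C) = (csum l F + csum l G)%C.
Proof. induction l as [|i l IH]; simpl; [ring|]. rewrite IH; ring. Qed.

Lemma csum_scal l c F : csum l (fun i => (c * F i)%C) = (c * csum l F)%C.
Proof. induction l as [|i l IH]; simpl; [ring|]. rewrite IH; ring. Qed.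

Lemma Cmod_csum l F : Cmod (csum l F) <= rsum l (fun i => Cmod (F i)).
Proof.
induction l as [|i l IH]; simpl; [rewrite Cmod_0; lra|].
eapply Rle_trans; [apply Cmod_triangle|]; lra.
Qed.

Lemma csum_Re_Im l F : csum l F = (rsum l (fun i => Re (F i)), rsum l (fun i => Im (F i))).
Proof.
induction l as [|i l IH]; simpl; [reflexivity|].
rewrite IH; reflexivity.
Qed.

Lemma nodup_same l : exists l', NoDup l' /\ forall i, In i l' <-> In i l.
Proof.
exists (nodup (fun x y => excluded_middle_informative (x = y)) l).
split; [apply NoDup_nodup|intros i; apply nodup_In].
Qed.

Lemma rsum_perm l l' f : NoDup l -> NoDup l' -> (forall i, In i l <-> In i l') ->
  rsum l f = rsum l' f.
Proof.
intros H H' E.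
pose proof (NoDup_Permutation H H' E) as P; clear H H' E.
induction P; simpl; lra.
Qed.

Lemma csum_perm l l' F : NoDup l -> NoDup l' -> (forall i, In i l <-> In i l') ->
  csum l F = csum l' F.
Proof.
intros H H' E.
pose proof (NoDup_Permutation H H' E) as P; clear H H' E.
induction P; simpl; [reflexivity|congruence| ring |congruence].
Qed.

Lemma split_list l l0 : NoDup l -> NoDup l0 -> incl l0 l -> exists l1,
  NoDup l1 /\ (forall i, In i l1 -> ~ In i l0) /\ NoDup (l0 ++ l1) /\
  (forall i, In i l <-> In i (l0 ++ l1)).
Proof.
intros H H0 E.
set (d := fun i => if excluded_middle_informative (In i l0) then false else true).
exists (filter d l).
assert (Hd : forall i, In i (filter d l) <-> In i l /\ ~ In i l0).
{ intros i; rewrite filter_In; unfold d.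
  destruct (excluded_middle_informative (In i l0)); intuition congruence. }
split; [now apply NoDup_filter|].
split; [intros i Hi; apply Hd in Hi; tauto|].
split.
- apply NoDup_app; [assumption|now apply NoDup_filter|].
  intros i Hi Hi'; apply Hd in Hi'; tauto.
- intros i; rewrite in_app_iff, Hd.
  destruct (classic (In i l0)); intuition.
Qed.

Lemma rsum_incl l l0 f : (forall i, 0 <= f i) -> NoDup l -> NoDup l0 -> incl l0 l ->
  rsum l0 f <= rsum l f.
Proof.
intros Hf H H0 E.
destruct (split_list l l0 H H0 E) as (l1 & H1 & _ & H2 & H3).
rewrite (rsum_perm l (l0 ++ l1)), rsum_app by assumption.
pose proof (rsum_ge0 l1 f Hf); lra.
Qed.

End Finite.

Section Sums.
Context {I : Type}.
Implicit Types (l : list I) (f g : I -> R) (F G : I -> C) (P : I -> Prop).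

(** For nonnegative terms the net of finite sums is increasing, so its supremum is also its
    limit. *)
Lemma rsum_sup f M : (forall i, 0 <= f i) ->
  (forall l, NoDup l -> rsum l f <= M) ->
  exists S, (forall l, NoDup l -> rsum l f <= S) /\
    forall eps, 0 < eps -> exists l0, NoDup l0 /\
      forall l, NoDup l -> incl l0 l -> S - eps <= rsum l f.
Proof.
intros Hf HM.
destruct (completeness (fun r => exists l, NoDup l /\ r = rsum l f)) as [S [HS1 HS2]].
- exists M; intros r [l [Hl ->]]; auto.
- exists 0, nil; split; [constructor|reflexivity].
- exists S; split; [intros l Hl; apply HS1; eauto|].
  intros eps He.
  destruct (classic (exists l0, NoDup l0 /\ S - eps <= rsum l0 f)) as [[l0 [H0 H1]]|N].
  + exists l0; split; [assumption|]; intros l Hl Hi.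
    eapply Rle_trans; [exact H1|]; now apply rsum_incl.
  + exfalso. assert (S <= S - eps); [|lra].
    apply HS2; intros r [l [Hl ->]].
    destruct (Rle_lt_dec (rsum l f) (S - eps)); [assumption|].
    exfalso; apply N; exists l; split; [assumption|lra].
Qed.

Lemma has_sum_unique F s t : has_sum F s -> has_sum F t -> s = t.
Proof.
intros Hs Ht.
assert (E : Cmod (s - t) = 0).
{ apply Rle_antisym; [|apply Cmod_ge_0].
  apply Rnot_lt_le; intros Hlt.
  destruct (Hs (Cmod (s - t) / 4) ltac:(lra)) as [l1 H1].
  destruct (Ht (Cmod (s - t) / 4) ltac:(lra)) as [l2 H2].
  destruct (nodup_same (l1 ++ l2)) as [l [Hl Hl']].
  assert (I1 : incl l1 l) by (intros i Hi; apply Hl', in_or_app; auto).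
  assert (I2 : incl l2 l) by (intros i Hi; apply Hl', in_or_app; auto).
  specialize (H1 l Hl I1); specialize (H2 l Hl I2).
  assert (Cmod (s - t) <= Cmod (csum l F - t) + Cmod (csum l F - s)).
  { replace (s - t)%C with ((csum l F - t) + - (csum l F - s))%C by ring.
    eapply Rle_trans; [apply Cmod_triangle|]. rewrite Cmod_opp; lra. }
  lra. }
apply Cmod_eq_0 in E.
replace s with (s - t + t)%C by ring; rewrite E; ring.
Qed.

Lemma Cmod_le_parts (a b : R) : Cmod (a, b) <= Rabs a + Rabs b.
Proof.
replace (a, b) with (RtoC a + Ci * RtoC b)%C.
- eapply Rle_trans; [apply Cmod_triangle|].
  rewrite Cmod_mult, Cmod_Ci, !Cmod_R; lra.
- unfold RtoC, Ci, Cplus, Cmult; simpl; f_equal; ring.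
Qed.

Lemma summable_has_sum F : summable F -> has_sum F (tsum F).
Proof.
intros [M HM].
unfold tsum; apply epsilon_spec.
assert (Hm : forall i, 0 <= Cmod (F i)) by (intros; apply Cmod_ge_0).
(* Adding |F i| to the real and to the imaginary part gives nonnegative families, to which
   [rsum_sup] applies; the sum of the moduli is subtracted again in the limit. *)
assert (Hre : forall i, 0 <= Re (F i) + Cmod (F i) <= 2 * Cmod (F i)).
{ intros i; pose proof (re_le_Cmod (F i)) as H; apply Rabs_le_between in H; lra. }
assert (Him : forall i, 0 <= Im (F i) + Cmod (F i) <= 2 * Cmod (F i)).
{ intros i; pose proof (Rmax_Cmod (F i)) as H.
  assert (H2 : Rabs (Im (F i)) <= Cmod (F i)) by (eapply Rle_trans; [apply Rmax_r|exact H]).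
  apply Rabs_le_between in H2; lra. }
destruct (rsum_sup (fun i => Cmod (F i)) M Hm HM) as (S0 & A0 & B0).
destruct (rsum_sup (fun i => Re (F i) + Cmod (F i)) (2 * M)) as (S1 & A1 & B1).
{ apply Hre. }
{ intros l Hl; eapply Rle_trans; [apply rsum_le; intros i _; apply Hre|].
  rewrite rsum_scal; specialize (HM l Hl); lra. }
destruct (rsum_sup (fun i => Im (F i) + Cmod (F i)) (2 * M)) as (S2 & A2 & B2).
{ apply Him. }
{ intros l Hl; eapply Rle_trans; [apply rsum_le; intros i _; apply Him|].
  rewrite rsum_scal; specialize (HM l Hl); lra. }
exists (S1 - S0, S2 - S0); intros eps He.
destruct (B0 (eps / 4) ltac:(lra)) as (l0 & N0 & C0).
destruct (B1 (eps / 4) ltac:(lra)) as (l1 & N1 & C1).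
destruct (B2 (eps / 4) ltac:(lra)) as (l2 & N2 & C2).
exists (l0 ++ l1 ++ l2); intros l Hl Hi.
assert (I0 : incl l0 l) by (intros i Hin; apply Hi; rewrite !in_app_iff; auto).
assert (I1 : incl l1 l) by (intros i Hin; apply Hi; rewrite !in_app_iff; auto).
assert (I2 : incl l2 l) by (intros i Hin; apply Hi; rewrite !in_app_iff; auto).
specialize (C0 l Hl I0); specialize (C1 l Hl I1); specialize (C2 l Hl I2).
specialize (A0 l Hl); specialize (A1 l Hl); specialize (A2 l Hl).
rewrite rsum_plus in A1, C1, A2, C2.
rewrite csum_Re_Im.
eapply Rle_trans; [apply (Cmod_le_parts
  (rsum l (fun i => Re (F i)) - (S1 - S0)) (rsum l (fun i => Im (F i)) - (S2 - S0)))|].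
assert (Rabs (rsum l (fun i => Re (F i)) - (S1 - S0)) <= eps / 4) by (apply Rabs_le; lra).
assert (Rabs (rsum l (fun i => Im (F i)) - (S2 - S0)) <= eps / 4) by (apply Rabs_le; lra).
lra.
Qed.

Lemma tsum_eq F s : has_sum F s -> tsum F = s.
Proof.
intros H; apply (has_sum_unique F); [|assumption].
unfold tsum; apply epsilon_spec; eauto.
Qed.

Lemma summable_tail F : summable F -> forall eps, 0 < eps -> exists l0, NoDup l0 /\
  forall l, NoDup l -> (forall i, In i l -> ~ In i l0) ->
    rsum l (fun i => Cmod (F i)) <= eps.
Proof.
intros [M HM] eps He.
destruct (rsum_sup (fun i => Cmod (F i)) M (fun i => Cmod_ge_0 _) HM) as (S & A & B).
destruct (B eps He) as (l0 & N0 & H0).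
exists l0; split; [assumption|]; intros l Hl Hd.
assert (N : NoDup (l0 ++ l)) by (apply NoDup_app; auto; intros i Hi Hi'; exact (Hd i Hi' Hi)).
specialize (H0 l0 N0 (incl_refl _)); specialize (A _ N); rewrite rsum_app in A; lra.
Qed.

Lemma Cmod_has_sum_le F s M : has_sum F s ->
  (forall l, NoDup l -> rsum l (fun i => Cmod (F i)) <= M) -> Cmod s <= M.
Proof.
intros Hs HM; apply le_epsilon; intros eps He.
destruct (Hs eps He) as [l0 H0].
destruct (nodup_same l0) as [l [Hl Hl']].
assert (Hi : incl l0 l) by (intros i Hin; apply Hl'; assumption).
specialize (H0 l Hl Hi).
replace s with (csum l F - (csum l F - s))%C by ring.
eapply Rle_trans; [apply Cmod_triangle|]; rewrite Cmod_opp.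
pose proof (Cmod_csum l F); specialize (HM l Hl); lra.
Qed.

Lemma Cmod_tsum_le F M : (forall l, NoDup l -> rsum l (fun i => Cmod (F i)) <= M) ->
  Cmod (tsum F) <= M.
Proof. intros H; apply (Cmod_has_sum_le F); [apply summable_has_sum; eauto; exists M; assumption|assumption]. Qed.

Lemma has_sum_ext F G s : (forall i, F i = G i) -> has_sum F s -> has_sum G s.
Proof. intros H; replace G with F; [auto|]; extensionality i; auto. Qed.

Lemma summable_ext F G : (forall i, F i = G i) -> summable F -> summable G.
Proof. intros H; replace G with F; [auto|]; extensionality i; auto. Qed.

Lemma tsum_ext F G : (forall i, F i = G i) -> tsum F = tsum G.
Proof. intros H; replace G with F; [auto|]; extensionality i; auto. Qed.

Lemma has_sum_plus F G s t : has_sum F s -> has_sum G t ->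
  has_sum (fun i => (F i + G i)%C) (s + t)%C.
Proof.
intros Hs Ht eps He.
destruct (Hs (eps / 2) ltac:(lra)) as [l1 H1].
destruct (Ht (eps / 2) ltac:(lra)) as [l2 H2].
exists (l1 ++ l2); intros l Hl Hi.
specialize (H1 l Hl (fun i h => Hi i (in_or_app _ _ _ (or_introl h)))).
specialize (H2 l Hl (fun i h => Hi i (in_or_app _ _ _ (or_intror h)))).
rewrite csum_plus.
replace (csum l F + csum l G - (s + t))%C with ((csum l F - s) + (csum l G - t))%C by ring.
eapply Rle_trans; [apply Cmod_triangle|]; lra.
Qed.

Lemma has_sum_scal c F s : has_sum F s -> has_sum (fun i => (c * F i)%C) (c * s)%C.
Proof.
intros Hs eps He.
assert (Hc : 0 < Cmod c + 1) by (pose proof (Cmod_ge_0 c); lra).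
destruct (Hs (eps / (Cmod c + 1))) as [l1 H1].
{ apply Rdiv_lt_0_compat; assumption. }
exists l1; intros l Hl Hi; specialize (H1 l Hl Hi).
rewrite csum_scal.
replace (c * csum l F - c * s)%C with (c * (csum l F - s))%C by ring.
rewrite Cmod_mult.
apply Rle_trans with ((Cmod c + 1) * (eps / (Cmod c + 1))).
- apply Rmult_le_compat; try apply Cmod_ge_0; lra.
- right; field; lra.
Qed.

Lemma summable_le F G : (forall i, Cmod (F i) <= Cmod (G i)) -> summable G -> summable F.
Proof.
intros H [M HM]; exists M; intros l Hl.
eapply Rle_trans; [apply rsum_le; intros i _; apply H|auto].
Qed.

Lemma summable_scal c F : summable F -> summable (fun i => (c * F i)%C).
Proof.
intros [M HM]; exists (Cmod c * M); intros l Hl.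
replace (fun i => Cmod (c * F i)) with (fun i => Cmod c * Cmod (F i))
  by (extensionality i; symmetry; apply Cmod_mult).
rewrite rsum_scal; apply Rmult_le_compat_l; [apply Cmod_ge_0|auto].
Qed.

Lemma summable_le_scal K F G : (forall i, Cmod (F i) <= K * Cmod (G i)) ->
  summable G -> summable F.
Proof.
intros H HG; apply (summable_le F (fun i => (RtoC K * G i)%C)); [|now apply summable_scal].
intros i; rewrite Cmod_mult, Cmod_R.
eapply Rle_trans; [apply H|]; apply Rmult_le_compat_r; [apply Cmod_ge_0|apply Rle_abs].
Qed.

Lemma summable_plus F G : summable F -> summable G -> summable (fun i => (F i + G i)%C).
Proof.
intros [M HM] [M' HM']; exists (M + M'); intros l Hl.
eapply Rle_trans; [apply rsum_le; intros i _; apply Cmod_triangle|].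
rewrite rsum_plus; specialize (HM l Hl); specialize (HM' l Hl); lra.
Qed.

Lemma summable_minus F G : summable F -> summable G -> summable (fun i => (F i - G i)%C).
Proof.
intros HF HG; apply (summable_ext (fun i => (F i + (- RtoC 1) * G i)%C)).
- intros i; ring.
- apply summable_plus; [assumption|now apply summable_scal].
Qed.

Lemma tsum_plus F G : summable F -> summable G ->
  tsum (fun i => (F i + G i)%C) = (tsum F + tsum G)%C.
Proof. intros HF HG; apply tsum_eq, has_sum_plus; now apply summable_has_sum. Qed.

Lemma tsum_scal c F : summable F -> tsum (fun i => (c * F i)%C) = (c * tsum F)%C.
Proof. intros HF; apply tsum_eq, has_sum_scal; now apply summable_has_sum. Qed.

Lemma tsum_minus F G : summable F -> summable G ->
  tsum (fun i => (F i - G i)%C) = (tsum F - tsum G)%C.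
Proof.
intros HF HG.
rewrite (tsum_ext _ (fun i => (F i + (- RtoC 1) * G i)%C)) by (intros; ring).
rewrite tsum_plus, tsum_scal by (try apply summable_scal; assumption); ring.
Qed.

Lemma summable_mask P F : summable F -> summable (mask P F).
Proof.
apply summable_le; intros i; unfold mask; destruct excluded_middle_informative; [lra|].
rewrite Cmod_0; apply Cmod_ge_0.
Qed.

Lemma csum_zero l F : (forall i, In i l -> F i = RtoC 0) -> csum l F = RtoC 0.
Proof.
induction l as [|i l IH]; simpl; intros H; [reflexivity|].
rewrite (H i (or_introl eq_refl)), IH by auto; ring.
Qed.

Lemma has_sum_finite l F : NoDup l -> (forall i, ~ In i l -> F i = RtoC 0) ->
  has_sum F (csum l F).
Proof.
intros Hl H eps He; exists l; intros l' Hl' Hi.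
destruct (split_list l' l Hl' Hl Hi) as (l1 & N1 & D1 & N2 & E).
rewrite (csum_perm l' (l ++ l1)), csum_app by assumption.
rewrite (csum_zero l1) by auto.
replace (csum l F + 0 - csum l F)%C with (RtoC 0) by ring.
rewrite Cmod_0; lra.
Qed.

Lemma summable_finite l F : (forall i, ~ In i l -> F i = RtoC 0) -> summable F.
Proof.
intros H; destruct (nodup_same l) as [l1 [N1 E1]].
exists (rsum l1 (fun i => Cmod (F i))); intros l' Hl'.
set (d := fun i => if excluded_middle_informative (In i l1) then true else false).
assert (E : forall m, rsum m (fun i => Cmod (F i)) = rsum (filter d m) (fun i => Cmod (F i))).
{ induction m as [|i m IH]; simpl; [reflexivity|].
  unfold d at 1; destruct (excluded_middle_informative (In i l1)) as [h|h]; simpl; rewrite IH; [reflexivity|].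
  rewrite H, Cmod_0; [ring|]; intros h'; apply h, E1, h'. }
rewrite E; apply rsum_incl; [intros; apply Cmod_ge_0|assumption|now apply NoDup_filter|].
intros i Hi; apply filter_In in Hi; destruct Hi as [_ Hi]; unfold d in Hi.
destruct (excluded_middle_informative (In i l1)); [assumption|discriminate].
Qed.

End Sums.

Lemma csum_map {I J : Type} (g : J -> I) (l : list J) (F : I -> C) :
  csum (map g l) F = csum l (fun j => F (g j)).
Proof. induction l as [|j l IH]; simpl; [reflexivity|]. now rewrite IH. Qed.

Lemma rsum_map {I J : Type} (g : J -> I) (l : list J) (f : I -> R) :
  rsum (map g l) f = rsum l (fun j => f (g j)).
Proof. induction l as [|j l IH]; simpl; [reflexivity|]. now rewrite IH. Qed.

(** * Reindexing along an injection *)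

Section Reindex.
Context {I J : Type} (g : J -> I) (g_inj : forall j j', g j = g j' -> j = j').

Lemma NoDup_map_inj (l : list J) : NoDup l -> NoDup (map g l).
Proof.
intros H; induction H as [|j l Hj Hl IH]; simpl; constructor; auto.
rewrite in_map_iff; intros (j' & E & Hj'); apply g_inj in E; subst; auto.
Qed.

Lemma summable_inj (F : I -> C) : summable F -> summable (fun j => F (g j)).
Proof.
intros [M HM]; exists M; intros l Hl.
rewrite <- (rsum_map g l (fun i => Cmod (F i))); apply HM, NoDup_map_inj, Hl.
Qed.

(** A finite list of indices is traded for the list of its preimages, since indices outside the
    range of [g] contribute zero. Summability and sums are both transferred along [g] in this
    way. *)
Lemma image_part (F : I -> C) (l : list I) :
  NoDup l -> (forall i, (forall j, g j <> i) -> F i = RtoC 0) ->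
  exists l', NoDup l' /\ (forall j, In j l' <-> In (g j) l) /\
    csum l F = csum l' (fun j => F (g j)) /\
    rsum l (fun i => Cmod (F i)) = rsum l' (fun j => Cmod (F (g j))).
Proof.
intros Hl H0; induction Hl as [|i l Hi Hl (l' & N' & E' & S' & S2)].
- exists nil; repeat split; auto; constructor.
- destruct (classic (exists j, g j = i)) as [[j <-]|N].
  + exists (j :: l'); split; [|split; [|split]].
    * constructor; [rewrite E'|]; assumption.
    * intros j'; simpl; rewrite E'; split; (intros [h|h]; [left; first [congruence|now apply g_inj]|now right]).
    * simpl; rewrite S'; reflexivity.
    * simpl; rewrite S2; reflexivity.
  + exists l'; split; [assumption|split; [|split]].
    * intros j; simpl; rewrite E'; split; [auto|]; intros [h|h]; [|assumption].
      exfalso; apply N; exists j; congruence.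
    * simpl; rewrite S', (H0 i); [ring|]; intros j h; apply N; exists j; exact h.
    * simpl; rewrite S2, (H0 i), Cmod_0; [ring|]; intros j h; apply N; exists j; exact h.
Qed.

Lemma summable_inj_inv (F : I -> C) : (forall i, (forall j, g j <> i) -> F i = RtoC 0) ->
  summable (fun j => F (g j)) -> summable F.
Proof.
intros H0 [M HM]; exists M; intros l Hl.
destruct (image_part F l Hl H0) as (l' & N' & _ & _ & ->); auto.
Qed.

Lemma has_sum_inj (F : I -> C) s : (forall i, (forall j, g j <> i) -> F i = RtoC 0) ->
  has_sum (fun j => F (g j)) s -> has_sum F s.
Proof.
intros H0 H eps He; destruct (H eps He) as [l0 Hl0].
exists (map g l0); intros l Hl Hi.
destruct (image_part F l Hl H0) as (l' & N' & E' & -> & _).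
apply Hl0; [assumption|]; intros j Hj; apply E', Hi, in_map, Hj.
Qed.

Lemma tsum_inj (F : I -> C) : (forall i, (forall j, g j <> i) -> F i = RtoC 0) ->
  summable F -> tsum F = tsum (fun j => F (g j)).
Proof.
intros H0 HF; apply tsum_eq, has_sum_inj; [assumption|].
now apply summable_has_sum, summable_inj.
Qed.

End Reindex.

Lemma tsum_bij {I J : Type} (g : J -> I) (h : I -> J) (F : I -> C) :
  (forall j, h (g j) = j) -> (forall i, g (h i) = i) ->
  summable F -> tsum F = tsum (fun j => F (g j)).
Proof.
intros H1 H2; apply tsum_inj.
- intros j j' E; rewrite <- (H1 j), <- (H1 j'), E; reflexivity.
- intros i N; exfalso; apply (N (h i)), H2.
Qed.

(** * Summation over the fibres of a map *)

Section Fibers.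
Context {I J : Type} (phi : I -> J).

Lemma csum_masks (F : I -> C) (l : list J) : summable F -> NoDup l ->
  csum l (fun j => tsum (mask (fun i => phi i = j) F)) = tsum (mask (fun i => In (phi i) l) F).
Proof.
intros HF Hl; induction Hl as [|j l Hj Hl IH]; simpl.
- symmetry; rewrite (tsum_eq _ (RtoC 0)); [reflexivity|].
  apply (has_sum_finite nil); [constructor|]; intros i _; unfold mask.
  destruct excluded_middle_informative; [contradiction|reflexivity].
- rewrite IH, <- tsum_plus by now apply summable_mask.
  apply tsum_ext; intros i; unfold mask.
  destruct (excluded_middle_informative (phi i = j)) as [e|n];
  destruct (excluded_middle_informative (In (phi i) l)) as [e'|n'];
  destruct (excluded_middle_informative (j = phi i \/ In (phi i) l)) as [e''|n''];
  try ring; exfalso; subst; try tauto.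
  destruct e'' as [e''|e'']; [symmetry in e''|]; tauto.
Qed.

Lemma tsum_fiber_tail (F : I -> C) : summable F -> forall eps, 0 < eps ->
  exists l0, forall l, NoDup l -> incl l0 l ->
    Cmod (tsum (mask (fun i => In (phi i) l) F) - tsum F) <= eps.
Proof.
intros HF eps He; destruct (summable_tail F HF eps He) as (l0 & N0 & H0).
exists (map phi l0); intros l Hl Hi.
rewrite <- tsum_minus by (try apply summable_mask; assumption).
apply Cmod_tsum_le; intros m Hm.
set (d := fun i => if excluded_middle_informative (In (phi i) l) then false else true).
apply Rle_trans with (rsum (filter d m) (fun i => Cmod (F i))).
- right; clear Hm; induction m as [|i m IH]; simpl; [reflexivity|].
  rewrite IH; unfold mask, d at 2; destruct (excluded_middle_informative (In (phi i) l)); simpl.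
  + replace (F i - F i)%C with (RtoC 0) by ring; rewrite Cmod_0; ring.
  + replace (RtoC 0 - F i)%C with (- F i)%C by ring; rewrite Cmod_opp; reflexivity.
- apply H0; [now apply NoDup_filter|].
  intros i Hin Hin0; apply filter_In in Hin; unfold d in Hin.
  destruct (excluded_middle_informative (In (phi i) l)) as [e|n]; [destruct Hin; discriminate|].
  apply n, Hi, in_map, Hin0.
Qed.

Lemma has_sum_fiber (F : I -> C) : summable F ->
  has_sum (fun j => tsum (mask (fun i => phi i = j) F)) (tsum F).
Proof.
intros HF eps He; destruct (tsum_fiber_tail F HF eps He) as [l0 H0].
exists l0; intros l Hl Hi; rewrite csum_masks by assumption; auto.
Qed.

(** Distinct fibres are disjoint, so finite parts that exhaust each of them up to [eps] concatenate
    to a duplicate-free list. Sums of fibre sums are thereby bounded by finite sums of the original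
    family. *)
Lemma rsum_fiber_approx (F : I -> C) (l : list J) eps : summable F -> 0 < eps -> NoDup l ->
  exists m, NoDup m /\ (forall i, In i m -> In (phi i) l) /\
    rsum l (fun j => Cmod (tsum (mask (fun i => phi i = j) F)))
      <= rsum m (fun i => Cmod (F i)) + INR (length l) * eps.
Proof.
intros HF He Hl; induction Hl as [|j l Hj Hl (m & Nm & Im & Bm)].
- exists nil; split; [constructor|]; split; [tauto|]; simpl; lra.
- assert (HT : has_sum (mask (fun i => phi i = j) F) (tsum (mask (fun i => phi i = j) F)))
    by now apply summable_has_sum, summable_mask.
  destruct (HT eps He) as [l0 H0]; destruct (nodup_same l0) as (m0 & N0 & E0).
  specialize (H0 m0 N0 (fun i h => proj2 (E0 i) h)).
  set (d := fun i => if excluded_middle_informative (phi i = j) then true else false).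
  assert (Hd : forall i, In i (filter d m0) -> phi i = j).
  { intros i Hi; apply filter_In in Hi; destruct Hi as [_ Hi]; unfold d in Hi.
    destruct (excluded_middle_informative (phi i = j)); [assumption|discriminate]. }
  assert (Ed : rsum m0 (fun i => Cmod (mask (fun i => phi i = j) F i))
      = rsum (filter d m0) (fun i => Cmod (F i))).
  { clear; induction m0 as [|i m0 IH]; simpl; [reflexivity|].
    rewrite IH; unfold mask, d at 2; destruct excluded_middle_informative; simpl; [reflexivity|].
    rewrite Cmod_0; ring. }
  exists (filter d m0 ++ m); split; [|split].
  + apply NoDup_app; [now apply NoDup_filter|assumption|].
    intros i Hi Hi'; apply Hj; rewrite <- (Hd i Hi); auto.
  + intros i Hi; apply in_app_iff in Hi; destruct Hi as [Hi|Hi]; simpl; [|auto].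
    left; symmetry; auto.
  + rewrite rsum_app, <- Ed.
    change (rsum (j :: l) ?f) with (f j + rsum l f); cbv beta.
    change (length (j :: l)) with (S (length l)); rewrite S_INR.
    pose proof (Cmod_csum m0 (mask (fun i => phi i = j) F)) as H1.
    set (S := tsum (mask (fun i => phi i = j) F)) in *.
    assert (Cmod S <= Cmod (csum m0 (mask (fun i => phi i = j) F)) + eps); [|lra].
    replace S with (csum m0 (mask (fun i => phi i = j) F)
      - (csum m0 (mask (fun i => phi i = j) F) - S))%C by ring.
    eapply Rle_trans; [apply Cmod_triangle|]; rewrite Cmod_opp; lra.
Qed.

Lemma rsum_fiber_le (F : I -> C) M (l : list J) : NoDup l ->
  (forall m, NoDup m -> rsum m (fun i => Cmod (F i)) <= M) ->
  rsum l (fun j => Cmod (tsum (mask (fun i => phi i = j) F))) <= M.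
Proof.
intros Hl HM; apply le_epsilon; intros eps He.
pose proof (pos_INR (length l)) as Hn.
destruct (rsum_fiber_approx F l (eps / (INR (length l) + 1))) as (m & Nm & _ & Bm); auto.
- exists M; assumption.
- apply Rdiv_lt_0_compat; lra.
- eapply Rle_trans; [exact Bm|]; apply Rplus_le_compat; [auto|].
  apply Rle_trans with ((INR (length l) + 1) * (eps / (INR (length l) + 1))); [|right; field; lra].
  apply Rmult_le_compat_r; [|lra]; left; apply Rdiv_lt_0_compat; lra.
Qed.

Lemma summable_fiber (F : I -> C) : summable F ->
  summable (fun j => tsum (mask (fun i => phi i = j) F)).
Proof. intros [M HM]; exists M; intros l Hl; now apply rsum_fiber_le. Qed.

Lemma tsum_fiber (F : I -> C) : summable F ->
  tsum F = tsum (fun j => tsum (mask (fun i => phi i = j) F)).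
Proof. intros HF; symmetry; apply tsum_eq, has_sum_fiber, HF. Qed.

End Fibers.

(** * Double sums *)

Lemma NoDup_list_prod {I J : Type} (l1 : list I) (l2 : list J) :
  NoDup l1 -> NoDup l2 -> NoDup (list_prod l1 l2).
Proof.
intros N1 N2; induction N1 as [|i l1 Hi N1 IH]; simpl; [constructor|].
apply NoDup_app; [|assumption|].
- apply (NoDup_map_inj (fun j => (i, j))); [intros; congruence|assumption].
- intros [i' j] H H'; apply in_map_iff in H; destruct H as (j' & E & _).
  apply in_prod_iff in H'; destruct H' as [H' _]; congruence.
Qed.

Section Products.
Context {I J : Type}.

Lemma fiber_fst (F : I * J -> C) i : summable F ->
  tsum (mask (fun p => fst p = i) F) = tsum (fun j => F (i, j)).
Proof.
intros HF; rewrite (tsum_inj (fun j => (i, j))).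
- apply tsum_ext; intros j; unfold mask; destruct excluded_middle_informative as [e|n]; [reflexivity|].
  exfalso; apply n; reflexivity.
- intros j j' E; congruence.
- intros [i' j] N; unfold mask; destruct excluded_middle_informative as [e|n]; [|reflexivity].
  simpl in e; subst; exfalso; apply (N j); reflexivity.
- now apply summable_mask.
Qed.

Lemma summable_rows (F : I * J -> C) : summable F -> summable (fun i => tsum (fun j => F (i, j))).
Proof.
intros HF; apply (summable_ext (fun i => tsum (mask (fun p => fst p = i) F))).
- intros i; now apply fiber_fst.
- now apply summable_fiber.
Qed.

Lemma tsum_rows (F : I * J -> C) : summable F ->
  tsum F = tsum (fun i => tsum (fun j => F (i, j))).
Proof.
intros HF; rewrite (tsum_fiber fst) by assumption.
apply tsum_ext; intros i; now apply fiber_fst.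
Qed.

(** A finite set of pairs lies in the product of its two projections, where the double sum
    factors. *)
Lemma rsum_prod_le (f : I -> R) (g : J -> R) (A B : R) (l : list (I * J)) :
  (forall i, 0 <= f i) -> (forall j, 0 <= g j) ->
  (forall m, NoDup m -> rsum m f <= A) -> (forall m, NoDup m -> rsum m g <= B) ->
  NoDup l -> rsum l (fun p => f (fst p) * g (snd p)) <= A * B.
Proof.
intros Hf Hg HA HB Hl.
destruct (nodup_same (map fst l)) as (l1 & N1 & E1).
destruct (nodup_same (map snd l)) as (l2 & N2 & E2).
apply Rle_trans with (rsum (list_prod l1 l2) (fun p => f (fst p) * g (snd p))).
- apply rsum_incl; try assumption.
  + intros p; apply Rmult_le_pos; auto.
  + now apply NoDup_list_prod.
  + intros [i j] Hp; apply in_prod_iff; split; [apply E1|apply E2]; apply in_map_iff; exists (i, j); auto.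
- assert (E : rsum (list_prod l1 l2) (fun p => f (fst p) * g (snd p)) = rsum l1 f * rsum l2 g).
  { clear. induction l1 as [|i l1 IH]; simpl; [ring|].
    rewrite rsum_app, IH, rsum_map; simpl; rewrite rsum_scal; ring. }
  rewrite E; apply Rmult_le_compat; auto using rsum_ge0.
Qed.

Lemma summable_prod (F : I -> C) (G : J -> C) : summable F -> summable G ->
  summable (fun p => (F (fst p) * G (snd p))%C).
Proof.
intros [A HA] [B HB]; exists (A * B); intros l Hl.
replace (fun i : I * J => Cmod (F (fst i) * G (snd i)))
  with (fun p : I * J => Cmod (F (fst p)) * Cmod (G (snd p)))
  by (extensionality p; symmetry; apply Cmod_mult).
apply (rsum_prod_le (fun i => Cmod (F i)) (fun j => Cmod (G j))); auto using Cmod_ge_0.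
Qed.

Lemma tsum_prod (F : I -> C) (G : J -> C) : summable F -> summable G ->
  tsum (fun p => (F (fst p) * G (snd p))%C) = (tsum F * tsum G)%C.
Proof.
intros HF HG; rewrite tsum_rows by now apply summable_prod.
simpl; rewrite (tsum_ext _ (fun i => (tsum G * F i)%C)).
- rewrite tsum_scal by assumption; ring.
- intros i; rewrite tsum_scal by assumption; ring.
Qed.

End Products.

Lemma summable_swap {I J : Type} (F : I * J -> C) :
  summable F -> summable (fun p : J * I => F (snd p, fst p)).
Proof.
apply (summable_inj (fun p : J * I => (snd p, fst p))).
intros [j i] [j' i'] E; simpl in E; congruence.
Qed.

Lemma tsum_swap {I J : Type} (F : I * J -> C) : summable F ->
  tsum (fun i => tsum (fun j => F (i, j))) = tsum (fun j => tsum (fun i => F (i, j))).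
Proof.
intros HF; rewrite <- tsum_rows by assumption.
rewrite (tsum_bij (fun p : J * I => (snd p, fst p)) (fun p => (snd p, fst p)))
  by (try assumption; intros []; reflexivity).
rewrite tsum_rows by now apply summable_swap.
reflexivity.
Qed.

Lemma csum_seq (F : nat -> C) n : csum (seq 0 (S n)) F = sum_n F n.
Proof.
induction n as [|n IH].
- simpl; rewrite sum_O; ring.
- rewrite seq_S, csum_app, IH, sum_Sn; simpl.
  change (plus (sum_n F n) (F (S n))) with (sum_n F n + F (S n))%C; ring.
Qed.

Lemma has_sum_is_series (F : nat -> C) s : has_sum F s ->
  is_series (K := C_AbsRing) (V := C_NormedModule) F s.
Proof.
intros H; apply filterlim_locally_ball_norm; intros eps.
destruct (H (eps / 2)) as [l0 H0]; [destruct eps; simpl; lra|].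
exists (list_max l0); intros n Hn.
unfold ball_norm; rewrite <- csum_seq.
change (Cmod (csum (seq 0 (S n)) F - s) < eps).
specialize (H0 (seq 0 (S n)) (seq_NoDup _ _)).
assert (Hi : incl l0 (seq 0 (S n))).
{ intros i Hi; apply in_seq; split; [lia|].
  pose proof (proj1 (list_max_le l0 _) (Nat.le_refl _)) as Hm.
  rewrite Forall_forall in Hm; specialize (Hm i Hi); lia. }
specialize (H0 Hi); destruct eps; simpl in *; lra.
Qed.

(** * Lambert series *)

(** Write r = s s with s = sqrt r: one copy of s^n absorbs a factor 1 + n by Bernoulli's inequality,
    the other carries the induction on [k]. *)
Lemma poly_times_geometric_bounded (k : nat) (r : R) : 0 <= r < 1 ->
  exists M, forall n, (1 + INR n) ^ k * r ^ n <= M.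
Proof.
revert r; induction k as [|k IH]; intros r Hr.
- exists 1; intros n; simpl; rewrite Rmult_1_l.
  apply Rle_trans with (1 ^ n); [apply pow_incr; lra|rewrite pow1; lra].
- destruct (Req_dec r 0) as [->|Hr0].
  { exists 1; intros [|n]; [simpl; rewrite Rplus_0_r, Rmult_1_l, pow1; lra|].
    rewrite (pow_i (S n)) by lia; lra. }
  set (s := sqrt r).
  assert (Hs : 0 < s) by (apply sqrt_lt_R0; lra).
  assert (Hss : s * s = r) by (apply sqrt_sqrt; lra).
  assert (Hs1 : s < 1) by nra.
  destruct (IH s ltac:(lra)) as [M HM].
  set (c := / s - 1).
  assert (Hc : 0 < c).
  { unfold c. assert (1 < / s); [rewrite <- Rinv_1 at 1; apply Rinv_lt_contravar; lra|lra]. }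
  assert (HM0 : 0 <= M).
  { specialize (HM 0%nat); simpl in HM; rewrite Rplus_0_r, pow1 in HM; lra. }
  exists (M * (1 + / c)); intros n.
  replace r with (s * s) by assumption; rewrite Rpow_mult_distr.
  replace ((1 + INR n) ^ S k * (s ^ n * s ^ n))
    with (((1 + INR n) ^ k * s ^ n) * ((1 + INR n) * s ^ n)) by (simpl; ring).
  pose proof (pos_INR n) as Hn.
  apply Rmult_le_compat.
  + apply Rmult_le_pos; apply pow_le; lra.
  + apply Rmult_le_pos; [lra|apply pow_le; lra].
  + apply HM.
  + assert (H1 : (1 + c) ^ n * s ^ n = 1).
    { rewrite <- Rpow_mult_distr; replace ((1 + c) * s) with 1 by (unfold c; field; lra).
      apply pow1. }
    pose proof (poly n c Hc) as H2.
    assert (H3 : 0 < s ^ n) by (apply pow_lt; lra).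
    assert (H4 : (1 + INR n * c) * s ^ n <= 1) by (rewrite <- H1; apply Rmult_le_compat_r; lra).
    assert (H5 : s ^ n <= 1).
    { apply Rle_trans with (1 ^ n); [apply pow_incr; lra|rewrite pow1; lra]. }
    assert (H6 : INR n * s ^ n <= / c).
    { apply Rmult_le_reg_r with c; [lra|]. rewrite Rinv_l by lra. nra. }
    lra.
Qed.

Lemma rsum_geometric_le (r : R) (l : list nat) : 0 <= r < 1 -> NoDup l ->
  rsum l (fun n => r ^ n) <= / (1 - r).
Proof.
intros Hr Hl.
apply Rle_trans with (rsum (seq 0 (S (list_max l))) (fun n => r ^ n)).
- apply rsum_incl; [intros; apply pow_le; lra|apply seq_NoDup|assumption|].
  intros i Hi; apply in_seq; split; [lia|].
  pose proof (proj1 (list_max_le l _) (Nat.le_refl _)) as Hm.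
  rewrite Forall_forall in Hm; specialize (Hm i Hi); lia.
- generalize (S (list_max l)); intros n.
  assert (E : rsum (seq 0 n) (fun n => r ^ n) * (1 - r) = 1 - r ^ n).
  { induction n as [|n IH]; [simpl; ring|].
    rewrite seq_S, rsum_app, Rmult_plus_distr_r, IH; simpl; ring. }
  apply Rmult_le_reg_r with (1 - r); [lra|].
  rewrite E, Rinv_l by lra.
  pose proof (pow_le r n ltac:(lra)); lra.
Qed.

Lemma summable_poly_geometric (k : nat) (r M : R) (F : nat -> C) : 0 <= r < 1 ->
  (forall n, Cmod (F n) <= M * ((1 + INR n) ^ k * r ^ n)) -> summable F.
Proof.
intros Hr HF.
destruct (Req_dec r 0) as [->|Hr0].
{ apply (summable_finite (0%nat :: nil)); intros [|n] Hn; [simpl in Hn; tauto|].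
  apply Cmod_eq_0, Rle_antisym; [|apply Cmod_ge_0].
  eapply Rle_trans; [apply HF|]; rewrite (pow_i (S n)) by lia; lra. }
set (s := sqrt r).
assert (Hs : 0 < s) by (apply sqrt_lt_R0; lra).
assert (Hss : s * s = r) by (apply sqrt_sqrt; lra).
assert (Hs1 : s < 1) by nra.
destruct (poly_times_geometric_bounded k s ltac:(lra)) as [B HB].
apply (summable_le_scal (Rabs M * B) F (fun n => RtoC (s ^ n))).
- intros n; eapply Rle_trans; [apply HF|].
  rewrite Cmod_R, (Rabs_pos_eq (s ^ n)) by (apply pow_le; lra).
  replace (r ^ n) with (s ^ n * s ^ n) by (rewrite <- Rpow_mult_distr, Hss; reflexivity).
  rewrite Rmult_assoc.
  apply Rle_trans with (Rabs M * ((1 + INR n) ^ k * (s ^ n * s ^ n))).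
  + apply Rmult_le_compat_r; [|apply Rle_abs].
    pose proof (pos_INR n); repeat apply Rmult_le_pos; apply pow_le; lra.
  + apply Rmult_le_compat_l; [apply Rabs_pos|]; rewrite <- Rmult_assoc.
    apply Rmult_le_compat_r; [apply pow_le; lra|apply HB].
- exists (/ (1 - s)); intros l Hl.
  eapply Rle_trans; [|apply (rsum_geometric_le s l); [lra|assumption]].
  apply rsum_le; intros n _; rewrite Cmod_R, Rabs_pos_eq; [lra|apply pow_le; lra].
Qed.

Lemma summable_Z (F : Z -> C) : summable (fun n : nat => F (Z.of_nat n)) ->
  summable (fun n : nat => F (- Z.of_nat n)%Z) -> summable F.
Proof.
intros H1 H2.
apply (summable_ext (fun n => (mask (fun n => 0 <= n)%Z F n + mask (fun n => n < 0)%Z F n)%C)).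
{ intros n; unfold mask.
  destruct (excluded_middle_informative (0 <= n)%Z); destruct (excluded_middle_informative (n < 0)%Z);
    try lia; ring. }
apply summable_plus.
- apply (summable_inj_inv Z.of_nat).
  + intros; lia.
  + intros n N; unfold mask; destruct excluded_middle_informative as [e|e]; [|reflexivity].
    exfalso; apply (N (Z.to_nat n)); lia.
  + apply (summable_le _ (fun n => F (Z.of_nat n))); [|exact H1].
    intros n; unfold mask; destruct excluded_middle_informative; [lra|rewrite Cmod_0; apply Cmod_ge_0].
- apply (summable_inj_inv (fun n => - Z.of_nat n)%Z).
  + intros; lia.
  + intros n N; unfold mask; destruct excluded_middle_informative as [e|e]; [|reflexivity].
    exfalso; apply (N (Z.to_nat (- n))); lia.
  + apply (summable_le _ (fun n => F (- Z.of_nat n)%Z)); [|exact H2].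
    intros n; unfold mask; destruct excluded_middle_informative; [lra|rewrite Cmod_0; apply Cmod_ge_0].
Qed.

Lemma tsum_Z (F : Z -> C) : summable F ->
  tsum F = (F 0%Z + tsum (fun n : nat => F (Z.of_nat (S n))) + tsum (fun n : nat => F (- Z.of_nat (S n))%Z))%C.
Proof.
intros HF.
rewrite (tsum_ext F (fun n => (mask (fun n => n = 0)%Z F n + mask (fun n => 0 < n)%Z F n + mask (fun n => n < 0)%Z F n)%C)).
2:{ intros n; unfold mask.
  destruct (excluded_middle_informative (n = 0)%Z); destruct (excluded_middle_informative (0 < n)%Z);
  destruct (excluded_middle_informative (n < 0)%Z); try lia; ring. }
rewrite !tsum_plus by (repeat apply summable_plus; now apply summable_mask).
f_equal; [f_equal|].
- rewrite (tsum_eq _ (csum (0%Z :: nil) (mask (fun n => n = 0)%Z F))).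
  + unfold mask; simpl; destruct excluded_middle_informative; [ring|lia].
  + apply has_sum_finite; [repeat constructor; auto|].
    intros n Hn; unfold mask; destruct excluded_middle_informative; [subst; simpl in Hn; tauto|reflexivity].
- rewrite (tsum_inj (fun n => Z.of_nat (S n))).
  + apply tsum_ext; intros n; unfold mask; destruct excluded_middle_informative; [reflexivity|lia].
  + intros; lia.
  + intros n N; unfold mask; destruct excluded_middle_informative; [|reflexivity].
    exfalso; apply (N (Z.to_nat (n - 1))); lia.
  + now apply summable_mask.
- rewrite (tsum_inj (fun n => - Z.of_nat (S n))%Z).
  + apply tsum_ext; intros n; unfold mask; destruct excluded_middle_informative; [reflexivity|lia].
  + intros; lia.
  + intros n N; unfold mask; destruct excluded_middle_informative; [|reflexivity].
    exfalso; apply (N (Z.to_nat (- n - 1))); lia.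
  + now apply summable_mask.
Qed.

(** * Integer powers and the weights 1/(1 - q^n) *)

Definition zpow (u : C) (n : Z) : C :=
  if (0 <=? n)%Z then (u ^ Z.to_nat n)%C else ((/ u) ^ Z.to_nat (- n))%C.

Lemma zpow_nat (u : C) (n : nat) : zpow u (Z.of_nat n) = (u ^ n)%C.
Proof. unfold zpow; destruct (Z.leb_spec 0 (Z.of_nat n)); [|lia]. now rewrite Nat2Z.id. Qed.

Lemma zpow_neg_nat (u : C) (n : nat) : zpow u (- Z.of_nat n) = ((/ u) ^ n)%C.
Proof.
destruct n; [reflexivity|].
unfold zpow; destruct (Z.leb_spec 0 (- Z.of_nat (S n))); [lia|].
now rewrite Z.opp_involutive, Nat2Z.id.
Qed.

Lemma zpow_0 (u : C) : zpow u 0 = 1.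
Proof. reflexivity. Qed.

Lemma Z_cases (n : Z) : (exists k, n = Z.of_nat k) \/ (exists k, n = - Z.of_nat (S k))%Z.
Proof.
destruct (Z.leb_spec 0 n); [left; exists (Z.to_nat n)|right; exists (Z.to_nat (- n - 1))]; lia.
Qed.

Lemma zpow_succ (u : C) n : u <> 0 -> zpow u (n + 1) = (u * zpow u n)%C.
Proof.
intros Hu; destruct (Z_cases n) as [[k ->]|[k ->]].
- replace (Z.of_nat k + 1)%Z with (Z.of_nat (S k)) by lia; rewrite !zpow_nat; reflexivity.
- replace (- Z.of_nat (S k) + 1)%Z with (- Z.of_nat k)%Z by lia; rewrite !zpow_neg_nat.
  rewrite Cpow_S; field; assumption.
Qed.

Lemma zpow_add (u : C) m n : u <> 0 -> zpow u (m + n) = (zpow u m * zpow u n)%C.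
Proof.
intros Hu; revert m; apply Z.bi_induction.
- intros x y ->; tauto.
- rewrite Z.add_0_l, zpow_0; ring.
- intros m; replace (Z.succ m + n)%Z with (m + n + 1)%Z by lia.
  replace (Z.succ m) with (m + 1)%Z by lia.
  rewrite !zpow_succ by assumption; split; intros H; [rewrite H; ring|].
  assert (E : (u * zpow u (m + n) = u * (zpow u m * zpow u n))%C) by (rewrite H; ring).
  apply (f_equal (fun z => / u * z)%C) in E.
  replace (/ u * (u * zpow u (m + n)))%C with (zpow u (m + n)) in E by (field; assumption).
  rewrite E; field; assumption.
Qed.

Lemma Cinv_neq_0 (u : C) : u <> 0 -> (/ u)%C <> 0.
Proof.
intros Hu H; apply (f_equal (fun z => u * z)%C) in H; rewrite Cinv_r in H by assumption.
replace (u * 0)%C with (RtoC 0) in H by ring; apply RtoC_inj in H; lra.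
Qed.

Lemma zpow_neq_0 (u : C) n : u <> 0 -> zpow u n <> 0.
Proof.
intros Hu; unfold zpow; destruct (0 <=? n)%Z; apply Cpow_nz; [assumption|now apply Cinv_neq_0].
Qed.

Lemma zpow_neg (u : C) n : u <> 0 -> zpow u (- n) = (/ zpow u n)%C.
Proof.
intros Hu; pose proof (zpow_add u (- n) n Hu) as E.
replace (- n + n)%Z with 0%Z in E by lia; rewrite zpow_0 in E.
pose proof (zpow_neq_0 u n Hu).
replace (/ zpow u n)%C with (1 * / zpow u n)%C by ring; rewrite E; field; assumption.
Qed.

Lemma zpow_mult (u v : C) n : u <> 0 -> v <> 0 -> zpow (u * v) n = (zpow u n * zpow v n)%C.
Proof.
intros Hu Hv; unfold zpow; destruct (0 <=? n)%Z; [apply Cpow_mult_l|].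
rewrite <- Cpow_mult_l; f_equal; field; auto.
Qed.

(** The coefficient of a two-sided Lambert series. The value 0 at n = 0 stands in for a pole; it is
    harmless because the series formed below carry a positive power of n. *)
Definition lam (q : C) (n : Z) : C := if (n =? 0)%Z then RtoC 0 else (/ (1 - zpow q n))%C.
(** The geometrically small part of [lam], which is 1 + [bet] at positive and - [bet] at negative
    integers. The index is shifted: [bet q n] belongs to the integer n + 1. *)
Definition bet (q : C) (n : nat) : C := (q ^ S n / (1 - q ^ S n))%C.

Lemma Cmod_neq_0 (z : C) : 0 < Cmod z -> z <> 0.
Proof. apply Cmod_gt_0. Qed.

Lemma Cmod_triangle_rev (a b : C) : Cmod a - Cmod b <= Cmod (a - b).
Proof.
pose proof (Cmod_triangle (a - b) b) as H.
replace (a - b + b)%C with a in H by ring; lra.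
Qed.

Lemma pow_le_base (r : R) n : 0 <= r <= 1 -> r ^ S n <= r.
Proof.
intros Hr; simpl; apply Rle_trans with (r * 1); [apply Rmult_le_compat_l; [lra|]|lra].
apply Rle_trans with (1 ^ n); [apply pow_incr; lra|rewrite pow1; lra].
Qed.

Section Nome.
Variable q : C.
Hypothesis Hq : 0 < Cmod q < 1.

Lemma q_neq_0 : q <> 0.
Proof. apply Cmod_neq_0; lra. Qed.

Lemma one_minus_qpow n : 1 - Cmod q <= Cmod (1 - q ^ S n).
Proof.
pose proof (Cmod_triangle_rev 1 (q ^ S n)) as H; rewrite Cmod_1, Cmod_pow in H.
pose proof (pow_le_base (Cmod q) n ltac:(lra)); lra.
Qed.

Lemma one_minus_qpow_neq_0 n : (1 - q ^ S n)%C <> 0.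
Proof. apply Cmod_neq_0; pose proof (one_minus_qpow n); lra. Qed.

Lemma lam_pos n : lam q (Z.of_nat (S n)) = (1 + bet q n)%C.
Proof.
unfold lam; replace (Z.of_nat (S n) =? 0)%Z with false by (symmetry; apply Z.eqb_neq; lia).
rewrite zpow_nat; unfold bet; field; apply one_minus_qpow_neq_0.
Qed.

Lemma lam_neg n : lam q (- Z.of_nat (S n)) = (- bet q n)%C.
Proof.
unfold lam; replace (- Z.of_nat (S n) =? 0)%Z with false by (symmetry; apply Z.eqb_neq; lia).
rewrite zpow_neg, zpow_nat by apply q_neq_0; unfold bet.
pose proof (one_minus_qpow_neq_0 n) as H.
pose proof (Cpow_nz q (S n) q_neq_0) as H2.
field; repeat split; try assumption.
intros E; apply H. replace (1 - q ^ S n)%C with (- (q ^ S n - 1))%C by ring; rewrite E; ring.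
Qed.

Lemma bet_le n : Cmod (bet q n) <= / (1 - Cmod q) * Cmod q ^ S n.
Proof.
unfold bet; rewrite Cmod_div by apply one_minus_qpow_neq_0; rewrite Cmod_pow.
unfold Rdiv; rewrite Rmult_comm.
apply Rmult_le_compat_r; [apply pow_le; lra|].
apply Rinv_le_contravar; [lra|apply one_minus_qpow].
Qed.

(** With x = q^m and y = q^n this is 1/((1 - x)(1 - y)) = (1/(1 - x) + y/(1 - y))/(1 - xy). In a
    Cauchy product it pulls the weight of N = m + n out of the inner sum and leaves differences
    [lam q m - lam q (m - N)], whose polynomially weighted sums are elementary. *)
Lemma lam_mult m n : m <> 0%Z -> n <> 0%Z -> (m + n)%Z <> 0%Z ->
  (lam q m * lam q n = lam q (m + n) * (lam q m - lam q (- n)))%C.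
Proof.
intros Hm Hn Hmn.
assert (Hl : forall k, k <> 0%Z -> (1 - zpow q k)%C <> 0).
{ intros k Hk; destruct (Z_cases k) as [[[|j] ->]|[j ->]]; [lia| |].
  - rewrite zpow_nat; apply one_minus_qpow_neq_0.
  - rewrite zpow_neg, zpow_nat by apply q_neq_0.
    pose proof (one_minus_qpow_neq_0 j) as H1; pose proof (Cpow_nz q (S j) q_neq_0) as H2.
    intros E; apply H1.
    replace (1 - q ^ S j)%C with (- (q ^ S j * (1 - / q ^ S j)))%C by (field; assumption).
    rewrite E; ring. }
unfold lam.
replace (m =? 0)%Z with false by (symmetry; now apply Z.eqb_neq).
replace (n =? 0)%Z with false by (symmetry; now apply Z.eqb_neq).
replace (m + n =? 0)%Z with false by (symmetry; now apply Z.eqb_neq).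
replace (- n =? 0)%Z with false by (symmetry; apply Z.eqb_neq; lia).
pose proof (Hl m Hm) as A; pose proof (Hl n Hn) as B; pose proof (Hl _ Hmn) as D.
assert (E : (1 - zpow q (- n))%C <> 0) by (apply Hl; lia).
rewrite zpow_add in * by apply q_neq_0; rewrite zpow_neg in * by apply q_neq_0.
pose proof (zpow_neq_0 q n q_neq_0) as Z0.
field; repeat split; try assumption.
intros E2; apply B. replace (1 - zpow q n)%C with (- (zpow q n - 1))%C by ring; rewrite E2; ring.
Qed.

End Nome.

(** * Products of Lambert series *)

Lemma abs_nat_opp (n : Z) : Z.abs_nat (- n) = Z.abs_nat n.
Proof. lia. Qed.

Definition pgrow (G : Z -> C) : Prop :=
  exists (M : R) (k : nat), 0 <= M /\ forall n, Cmod (G n) <= M * (1 + INR (Z.abs_nat n)) ^ k.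

Lemma one_le_growth (n : Z) k : 1 <= (1 + INR (Z.abs_nat n)) ^ k.
Proof. pose proof (pos_INR (Z.abs_nat n)); apply pow_R1_Rle; lra. Qed.

Lemma growth_mono (n : Z) k l : (k <= l)%nat ->
  (1 + INR (Z.abs_nat n)) ^ k <= (1 + INR (Z.abs_nat n)) ^ l.
Proof. intros H; pose proof (pos_INR (Z.abs_nat n)); apply Rle_pow; [lra|assumption]. Qed.

Lemma pgrow_const c : pgrow (fun _ => c).
Proof.
exists (Cmod c), 0%nat; split; [apply Cmod_ge_0|]; intros n; simpl; lra.
Qed.

Lemma pgrow_id : pgrow ZtoC.
Proof.
exists 1, 1%nat; split; [lra|]; intros n; unfold ZtoC.
rewrite Cmod_R, pow_1, Rmult_1_l, <- abs_IZR, INR_IZR_INZ.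
rewrite <- plus_IZR; apply IZR_le; lia.
Qed.

Lemma pgrow_plus G H : pgrow G -> pgrow H -> pgrow (fun n => (G n + H n)%C).
Proof.
intros (M & k & HM & HG) (M' & k' & HM' & HH).
exists (M + M'), (Nat.max k k'); split; [lra|]; intros n.
eapply Rle_trans; [apply Cmod_triangle|]; specialize (HG n); specialize (HH n).
pose proof (growth_mono n k (Nat.max k k') ltac:(lia)).
pose proof (growth_mono n k' (Nat.max k k') ltac:(lia)).
rewrite Rmult_plus_distr_r; apply Rplus_le_compat.
- eapply Rle_trans; [exact HG|]; now apply Rmult_le_compat_l.
- eapply Rle_trans; [exact HH|]; now apply Rmult_le_compat_l.
Qed.

Lemma pgrow_mult G H : pgrow G -> pgrow H -> pgrow (fun n => (G n * H n)%C).
Proof.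
intros (M & k & HM & HG) (M' & k' & HM' & HH).
exists (M * M'), (k + k')%nat; split; [now apply Rmult_le_pos|]; intros n.
rewrite Cmod_mult, pow_add.
replace (M * M' * ((1 + INR (Z.abs_nat n)) ^ k * (1 + INR (Z.abs_nat n)) ^ k'))
  with ((M * (1 + INR (Z.abs_nat n)) ^ k) * (M' * (1 + INR (Z.abs_nat n)) ^ k')) by ring.
apply Rmult_le_compat; auto using Cmod_ge_0.
Qed.

Lemma pgrow_minus G H : pgrow G -> pgrow H -> pgrow (fun n => (G n - H n)%C).
Proof.
intros HG HH; apply pgrow_plus; [assumption|].
replace (fun n => (- H n)%C) with (fun n => (- RtoC 1 * H n)%C) by (extensionality n; ring).
apply pgrow_mult; [apply pgrow_const|assumption].
Qed.

Lemma pgrow_pow G k : pgrow G -> pgrow (fun n => (G n ^ k)%C).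
Proof.
intros HG; induction k as [|k IH]; [apply (pgrow_const (RtoC 1))|].
apply (pgrow_mult G (fun n => (G n ^ k)%C)); assumption.
Qed.

Lemma pgrow_shift G N : pgrow G -> pgrow (fun n => G (n + N)%Z).
Proof.
intros (M & k & HM & HG).
exists (M * (1 + INR (Z.abs_nat N)) ^ k), k; split.
- apply Rmult_le_pos; [assumption|]; pose proof (one_le_growth N k); lra.
- intros n; eapply Rle_trans; [apply HG|].
  rewrite Rmult_assoc, <- Rpow_mult_distr; apply Rmult_le_compat_l; [assumption|].
  pose proof (pos_INR (Z.abs_nat n)); pose proof (pos_INR (Z.abs_nat N)).
  apply pow_incr; split; [pose proof (pos_INR (Z.abs_nat (n + N))); lra|].
  assert (INR (Z.abs_nat (n + N)) <= INR (Z.abs_nat n) + INR (Z.abs_nat N)).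
  { rewrite <- plus_INR; apply le_INR; lia. }
  nra.
Qed.

Lemma summable_growth_geometric (G g : Z -> C) (M r : R) : pgrow G -> 0 <= r < 1 ->
  (forall n, Cmod (g n) <= M * r ^ Z.abs_nat n) -> summable (fun n => (G n * g n)%C).
Proof.
intros (B & k & HB & HG) Hr Hg.
assert (H : forall n, Cmod (G n * g n) <= B * M * ((1 + INR (Z.abs_nat n)) ^ k * r ^ Z.abs_nat n)).
{ intros n; rewrite Cmod_mult.
  replace (B * M * ((1 + INR (Z.abs_nat n)) ^ k * r ^ Z.abs_nat n))
    with ((B * (1 + INR (Z.abs_nat n)) ^ k) * (M * r ^ Z.abs_nat n)) by ring.
  apply Rmult_le_compat; auto using Cmod_ge_0. }
apply summable_Z; apply (summable_poly_geometric k r (B * M)); try assumption; intros n.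
- specialize (H (Z.of_nat n)); rewrite Zabs2Nat.id in H; exact H.
- specialize (H (- Z.of_nat n)%Z); rewrite abs_nat_opp, Zabs2Nat.id in H; exact H.
Qed.

(** [lp q k u] is the sum of n^k u^n/(1 - q^n) over nonzero n, for |q| < |u| < 1. Since u d/du
    raises [k] by one, [lp q 1], [lp q 2] and [lp q 3] are the Weierstrass function, up to an
    additive constant and scaling, and its first two derivatives. *)
Definition lterm (q : C) (k : nat) (u : C) (n : Z) : C := (ZtoC n ^ k * (lam q n * zpow u n))%C.
Definition lp (q : C) (k : nat) (u : C) : C := tsum (lterm q k u).
(** The limit of [lam] at the two ends of Z: 1 at plus infinity, 0 at minus infinity. *)
Definition step (n : Z) : C := if (0 <? n)%Z then RtoC 1 else RtoC 0.

(** The difference of steps is the indicator of the integers in (0, N] or, for negative N, minus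
    that of (N, 0], so the sum telescopes along a discrete primitive [Phi]. *)
Lemma tsum_step_diff (G Phi : Z -> C) (N : Z) :
  (forall m, (Phi m - Phi (m - 1)%Z)%C = G m) ->
  has_sum (fun m => (G m * (step m - step (m - N)))%C) (Phi N - Phi 0%Z)%C.
Proof.
intros HPhi.
assert (Hs : forall N, has_sum (fun m => if (m =? N + 1)%Z then G m else RtoC 0) (Phi (N + 1)%Z - Phi N)%C).
{ intros N'; assert (E := has_sum_finite ((N' + 1)%Z :: nil) (fun m => if (m =? N' + 1)%Z then G m else RtoC 0)).
  simpl in E; rewrite Z.eqb_refl in E.
  specialize (HPhi (N' + 1)%Z); replace (N' + 1 - 1)%Z with N' in HPhi by lia; rewrite HPhi.
  replace (G (N' + 1)%Z) with (G (N' + 1)%Z + 0)%C by ring; apply E.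
  - repeat constructor; auto.
  - intros i Hi; destruct (Z.eqb_spec i (N' + 1)); [exfalso; apply Hi; auto|reflexivity]. }
assert (Hg : forall N m, (G m * (step m - step (m - (N + 1))) =
   G m * (step m - step (m - N)) + (if (m =? N + 1)%Z then G m else RtoC 0))%C).
{ intros N' m; unfold step.
  destruct (Z.ltb_spec 0 m); destruct (Z.ltb_spec 0 (m - (N' + 1)));
  destruct (Z.ltb_spec 0 (m - N')); destruct (Z.eqb_spec m (N' + 1)); try lia; ring. }
revert N; apply Z.bi_induction.
- intros x y E; unfold Z.eq in E; subst y; apply iff_refl.
- apply (has_sum_ext (fun _ => RtoC 0)).
  + intros m; replace (m - 0)%Z with m by lia; ring.
  + replace (Phi 0%Z - Phi 0%Z)%C with (csum (@nil Z) (fun _ => RtoC 0)) by (simpl; ring).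
    apply has_sum_finite; [constructor|auto].
- intros N; unfold Z.succ; split; intros H.
  + pose proof (has_sum_plus _ _ _ _ H (Hs N)) as H1.
    apply (has_sum_ext _ _ _ (fun m => eq_sym (Hg N m))).
    replace (Phi (N + 1)%Z - Phi 0%Z)%C with (Phi N - Phi 0%Z + (Phi (N + 1)%Z - Phi N))%C by ring.
    exact H1.
  + pose proof (has_sum_plus _ _ _ _ H (has_sum_scal (- RtoC 1) _ _ (Hs N))) as H1.
    replace (Phi N - Phi 0%Z)%C
      with (Phi (N + 1)%Z - Phi 0%Z + - (1) * (Phi (N + 1)%Z - Phi N))%C by ring.
    eapply has_sum_ext; [|exact H1]; intros m; cbv beta; rewrite Hg; ring.
Qed.

Lemma summable_step_diff (G : Z -> C) (N : Z) :
  summable (fun m => (G m * (step m - step (m - N)))%C).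
Proof.
set (K := (Z.to_nat (Z.abs N) + 1)%nat).
apply (summable_finite (map (fun i => Z.of_nat i - Z.of_nat K)%Z (seq 0 (2 * K + 1)))).
intros m Hm; assert (Hk : (m < - Z.of_nat K \/ m > Z.of_nat K)%Z).
{ destruct (Z_lt_le_dec m (- Z.of_nat K)); [auto|]; destruct (Z_lt_le_dec (Z.of_nat K) m); [lia|].
  exfalso; apply Hm, in_map_iff; exists (Z.to_nat (m + Z.of_nat K)); split; [lia|].
  apply in_seq; lia. }
unfold step; destruct (Z.ltb_spec 0 m); destruct (Z.ltb_spec 0 (m - N)); try ring; unfold K in *; lia.
Qed.

Section Nome.
Variable q : C.
Hypothesis Hq : 0 < Cmod q < 1.

Definition betZ (n : Z) : C := (lam q n - step n)%C.

Lemma betZ_le n : Cmod (betZ n) <= / (1 - Cmod q) * Cmod q ^ Z.abs_nat n.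
Proof.
unfold betZ; destruct (Z_cases n) as [[[|k] ->]|[k ->]].
- simpl; unfold lam, step; simpl; replace (0 - 0)%C with (RtoC 0) by ring; rewrite Cmod_0.
  rewrite Rmult_1_r; left; apply Rinv_0_lt_compat; lra.
- rewrite lam_pos by assumption; unfold step.
  replace (0 <? Z.of_nat (S k))%Z with true by (symmetry; apply Z.ltb_lt; lia).
  replace (1 + bet q k - 1)%C with (bet q k) by ring.
  rewrite Zabs2Nat.id; now apply bet_le.
- rewrite lam_neg by assumption; unfold step.
  replace (0 <? - Z.of_nat (S k))%Z with false by (symmetry; apply Z.ltb_ge; lia).
  replace (- bet q k - 0)%C with (- bet q k)%C by ring; rewrite Cmod_opp.
  rewrite abs_nat_opp, Zabs2Nat.id; now apply bet_le.
Qed.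

(** The annulus makes both tails geometric: the ratio is |u| for positive n, and |q|/|u| for
    negative n, where [lam] itself contributes |q|^|n|. *)
Lemma lam_zpow_le u : Cmod q < Cmod u < 1 -> exists M r, 0 <= r < 1 /\
  forall n, Cmod (lam q n * zpow u n) <= M * r ^ Z.abs_nat n.
Proof.
intros Hu.
assert (Hi : 0 < / (1 - Cmod q)) by (apply Rinv_0_lt_compat; lra).
assert (Hqu : 0 <= Cmod q / Cmod u < 1).
{ split; [apply Rle_div_r; lra|apply Rlt_div_l; lra]. }
set (r := Rmax (Cmod u) (Cmod q / Cmod u)).
assert (Hr : 0 <= r < 1).
{ split; [apply Rle_trans with (Cmod u); [lra|apply Rmax_l]|apply Rmax_lub_lt; lra]. }
exists (1 + / (1 - Cmod q)), r; split; [assumption|].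
intros n; destruct (Z_cases n) as [[[|k] ->]|[k ->]].
- unfold lam; simpl; rewrite Cmult_0_l, Cmod_0; lra.
- rewrite lam_pos, zpow_nat, Zabs2Nat.id, Cmod_mult, Cmod_pow by assumption.
  apply Rmult_le_compat; try apply Cmod_ge_0; [apply pow_le; lra| |].
  + eapply Rle_trans; [apply Cmod_triangle|]; rewrite Cmod_1; apply Rplus_le_compat_l.
    eapply Rle_trans; [apply bet_le; assumption|].
    rewrite <- (Rmult_1_r (/ (1 - Cmod q))) at 2; apply Rmult_le_compat_l; [lra|].
    pose proof (pow_le_base (Cmod q) k ltac:(lra)); lra.
  + apply pow_incr; split; [lra|apply Rmax_l].
- rewrite lam_neg, zpow_neg_nat, abs_nat_opp, Zabs2Nat.id, Cmod_mult, Cmod_opp, Cmod_pow by assumption.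
  assert (Hu0 : u <> 0) by (apply Cmod_neq_0; lra).
  rewrite Cmod_inv by assumption.
  apply Rle_trans with (/ (1 - Cmod q) * Cmod q ^ S k * (/ Cmod u) ^ S k).
  + apply Rmult_le_compat_r; [apply pow_le; left; apply Rinv_0_lt_compat; lra|now apply bet_le].
  + rewrite Rmult_assoc, <- Rpow_mult_distr.
    apply Rmult_le_compat; [lra|apply pow_le, Hqu|lra|].
    apply pow_incr; split; [apply Hqu|apply Rmax_r].
Qed.

Lemma summable_growth_lam G u : pgrow G -> Cmod q < Cmod u < 1 ->
  summable (fun n => (G n * (lam q n * zpow u n))%C).
Proof.
intros HG Hu; destruct (lam_zpow_le u Hu) as (M & r & Hr & H).
now apply (summable_growth_geometric G _ M r).
Qed.

Lemma summable_lterm k u : Cmod q < Cmod u < 1 -> summable (lterm q k u).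
Proof. intros Hu; apply summable_growth_lam; [apply pgrow_pow, pgrow_id|assumption]. Qed.

Lemma summable_growth_bet G : pgrow G -> summable (fun n : nat => (G (Z.of_nat (S n)) * bet q n)%C).
Proof.
intros HG; apply (summable_ext (fun n : nat => (G (Z.of_nat (S n)) * betZ (Z.of_nat (S n)))%C)).
- intros n; unfold betZ; rewrite lam_pos by assumption; unfold step.
  replace (0 <? Z.of_nat (S n))%Z with true by (symmetry; apply Z.ltb_lt; lia); f_equal; ring.
- apply (summable_inj (fun n => Z.of_nat (S n)) ltac:(cbv beta; intros; lia) (fun n => (G n * betZ n)%C)).
  apply (summable_growth_geometric _ _ (/ (1 - Cmod q)) (Cmod q)); [assumption|lra|apply betZ_le].
Qed.

(** Neither half of the difference is summable against a polynomial, because [lam] tends to 1 at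
    plus infinity. Splitting [lam] into [step] and [betZ] leaves a finite telescoping sum and two
    geometrically convergent ones; a shift by N and folding m onto -m turn the latter into a single
    series in [bet]. *)
Lemma tsum_lam_diff (G Phi : Z -> C) (N : Z) : pgrow G ->
  (forall m, (Phi m - Phi (m - 1)%Z)%C = G m) ->
  summable (fun m => (G m * (lam q m - lam q (m - N)))%C) /\
  tsum (fun m => (G m * (lam q m - lam q (m - N)))%C) =
  (Phi N - Phi 0%Z + tsum (fun k : nat => (G (Z.of_nat (S k)) - G (Z.of_nat (S k) + N)%Z
     - G (- Z.of_nat (S k))%Z + G (N - Z.of_nat (S k))%Z) * bet q k))%C.
Proof.
intros HG HPhi.
assert (S1 : summable (fun m => (G m * betZ m)%C)).
{ apply (summable_growth_geometric _ _ (/ (1 - Cmod q)) (Cmod q)); [assumption|lra|apply betZ_le]. }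
assert (S2 : summable (fun m => (G (m + N)%Z * betZ m)%C)).
{ apply (summable_growth_geometric (fun m => G (m + N)%Z) _ (/ (1 - Cmod q)) (Cmod q)); [now apply pgrow_shift|lra|apply betZ_le]. }
assert (S3 : summable (fun m => (G m * betZ (m - N))%C)).
{ apply (summable_ext (fun m => (G (m - N + N)%Z * betZ (m - N))%C)).
  - intros m; do 2 f_equal; lia.
  - apply (summable_inj (fun m => m - N)%Z ltac:(cbv beta; intros; lia) (fun m => (G (m + N)%Z * betZ m)%C)), S2. }
assert (E3 : tsum (fun m => (G m * betZ (m - N))%C) = tsum (fun m => (G (m + N)%Z * betZ m)%C)).
{ rewrite (tsum_bij (fun m => m + N)%Z (fun m => m - N)%Z) by (try assumption; intros; lia).
  apply tsum_ext; intros m; do 2 f_equal; lia. }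
assert (S0 := summable_step_diff G N).
assert (E : forall m, (G m * (lam q m - lam q (m - N)))%C =
  (G m * (step m - step (m - N)) + (G m * betZ m - G m * betZ (m - N)))%C).
{ intros m; unfold betZ; ring. }
split.
- apply (summable_ext _ _ (fun m => eq_sym (E m))).
  apply summable_plus; [assumption|now apply summable_minus].
- rewrite (tsum_ext _ _ E), tsum_plus, tsum_minus, E3
    by (try assumption; now apply summable_minus).
  f_equal; [apply tsum_eq, tsum_step_diff, HPhi|].
  rewrite <- tsum_minus by assumption.
  rewrite tsum_Z by now apply summable_minus.
  assert (Hb0 : betZ 0 = 0) by (unfold betZ, lam, step; simpl; ring).
  assert (Hbp : forall k, betZ (Z.of_nat (S k)) = bet q k).
  { intros k; unfold betZ, step; rewrite lam_pos by assumption.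
    replace (0 <? Z.of_nat (S k))%Z with true by (symmetry; apply Z.ltb_lt; lia); ring. }
  assert (Hbn : forall k, betZ (- Z.of_nat (S k)) = (- bet q k)%C).
  { intros k; unfold betZ, step; rewrite lam_neg by assumption.
    replace (0 <? - Z.of_nat (S k))%Z with false by (symmetry; apply Z.ltb_ge; lia); ring. }
  rewrite Hb0, !Cmult_0_r.
  assert (Hsum : summable (fun m => (G m * betZ m - G (m + N)%Z * betZ m)%C)) by now apply summable_minus.
  rewrite <- Cplus_assoc, <- tsum_plus.
  + replace (0 - 0)%C with (RtoC 0) by ring; rewrite Cplus_0_l.
    apply tsum_ext; intros k; rewrite Hbp, Hbn.
    replace (- Z.of_nat (S k) + N)%Z with (N - Z.of_nat (S k))%Z by lia; ring.
  + exact (summable_inj (fun n => Z.of_nat (S n)) ltac:(cbv beta; intros; lia) _ Hsum).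
  + exact (summable_inj (fun n => - Z.of_nat (S n))%Z ltac:(cbv beta; intros; lia) _ Hsum).
Qed.

End Nome.

Lemma ZtoC_plus m n : ZtoC (m + n) = (ZtoC m + ZtoC n)%C.
Proof. unfold ZtoC; now rewrite plus_IZR, RtoC_plus. Qed.

Lemma ZtoC_minus m n : ZtoC (m - n) = (ZtoC m - ZtoC n)%C.
Proof. unfold ZtoC; now rewrite minus_IZR, RtoC_minus. Qed.

Lemma ZtoC_opp n : ZtoC (- n) = (- ZtoC n)%C.
Proof. unfold ZtoC; now rewrite opp_IZR, RtoC_opp. Qed.

Lemma ZtoC_mult m n : ZtoC (m * n) = (ZtoC m * ZtoC n)%C.
Proof. unfold ZtoC; now rewrite mult_IZR, RtoC_mult. Qed.

Definition ntoC (n : nat) : C := RtoC (INR n).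

Lemma ZtoC_nat n : ZtoC (Z.of_nat n) = ntoC n.
Proof. unfold ZtoC, ntoC; now rewrite INR_IZR_INZ. Qed.

(* [dsum q (S k)] is q d/dq of [bsum q k]. *)
Definition bsum (q : C) (k : nat) : C := tsum (fun n : nat => (ntoC (S n) ^ k * bet q n)%C).

Definition dsum (q : C) (k : nat) : C :=
  tsum (fun n : nat => (ntoC (S n) ^ k * (bet q n * (1 + bet q n)))%C).

Lemma Cpow_0_l k : (1 <= k)%nat -> (RtoC 0 ^ k)%C = 0.
Proof. destruct k; [lia|]; rewrite Cpow_S; intros _; ring. Qed.

Lemma Cmod_sign (e : C) : (e * e)%C = 1 -> Cmod e = 1.
Proof.
intros He; apply (f_equal Cmod) in He; rewrite Cmod_mult, Cmod_1 in He.
pose proof (Cmod_ge_0 e); nra.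
Qed.

Lemma sign_neq_0 (e : C) : (e * e)%C = 1 -> e <> 0.
Proof. intros He; apply Cmod_neq_0; rewrite Cmod_sign by assumption; lra. Qed.

Lemma zpow_sign_sq (e : C) n : (e * e)%C = 1 -> (zpow e n * zpow e n)%C = 1.
Proof.
intros He; pose proof (sign_neq_0 e He) as H0.
rewrite <- zpow_mult, He by assumption.
unfold zpow; replace (/ 1)%C with (RtoC 1) by (field; apply C1_nz).
destruct (0 <=? n)%Z; apply Cpow_1_l.
Qed.

Lemma pgrow_zpow_sign (e : C) : (e * e)%C = 1 -> pgrow (zpow e).
Proof.
intros He; exists 1, 0%nat; split; [lra|]; intros n; simpl.
rewrite Cmod_sign; [lra|now apply zpow_sign_sq].
Qed.

Section Nome.
Variable q : C.
Hypothesis Hq : 0 < Cmod q < 1.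

(** Weight of the index m in the N-th Cauchy coefficient of [lp q i u] times [lp q j (e * u)]. The
    sign e = 1 gives products at one point, e = -1 products at two points differing by the half
    period 1/2. *)
Definition weight (e : C) (i j : nat) (N m : Z) : C := (zpow e m * (ZtoC m ^ i * ZtoC (N - m) ^ j))%C.

Lemma pgrow_weight e i j N : (e * e)%C = 1 -> pgrow (weight e i j N).
Proof.
intros He; apply pgrow_mult; [now apply pgrow_zpow_sign|].
apply pgrow_mult; apply (pgrow_pow _ _); [apply pgrow_id|].
replace (fun n => ZtoC (N - n)) with (fun n => (ZtoC N - ZtoC n)%C)
  by (extensionality n; symmetry; apply ZtoC_minus).
apply pgrow_minus; [apply pgrow_const|apply pgrow_id].
Qed.

(* Cauchy product, reduced by [lam_mult] to one-variable sums. *)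
Lemma lp_product (i j : nat) (e u : C) (R : Z -> C) (kappa : C) :
  (1 <= i)%nat -> (1 <= j)%nat -> (e * e)%C = 1 -> Cmod q < Cmod u < 1 ->
  tsum (fun m => (weight e i j 0 m * (lam q m * lam q (- m)))%C) = kappa ->
  (forall N, N <> 0%Z ->
    summable (fun m => (weight e i j N m * (lam q m - lam q (m - N)))%C) /\
    tsum (fun m => (weight e i j N m * (lam q m - lam q (m - N)))%C) = R N) ->
  summable (fun N => lam q N * zpow (e * u) N * R N)%C /\
  (lp q i u * lp q j (e * u))%C =
    (kappa + tsum (fun N => lam q N * zpow (e * u) N * R N))%C.
Proof.
intros Hi Hj He Hu Hk HR.
pose proof (sign_neq_0 e He) as He0.
assert (Hu0 : u <> 0) by (apply Cmod_neq_0; lra).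
assert (Heu : Cmod q < Cmod (e * u) < 1) by (rewrite Cmod_mult, (Cmod_sign e) by assumption; lra).
assert (Heu0 : (e * u)%C <> 0) by (apply Cmod_neq_0; lra).
assert (S1 := summable_lterm q Hq i u Hu).
assert (S2 := summable_lterm q Hq j (e * u) Heu).
assert (SP := summable_prod _ _ S1 S2).
unfold lp; rewrite <- tsum_prod by assumption.
rewrite (tsum_fiber (fun p => fst p + snd p)%Z) by assumption.
assert (EN : forall N, tsum (mask (fun p => fst p + snd p = N)%Z
    (fun p => lterm q i u (fst p) * lterm q j (e * u) (snd p))%C) =
  ((if (N =? 0)%Z then kappa else RtoC 0) + lam q N * zpow (e * u) N * R N)%C).
{ intros N; rewrite (tsum_inj (fun m => (m, N - m)%Z)).
  2:{ intros m m' E; congruence. }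
  2:{ intros [m n] H; unfold mask; destruct excluded_middle_informative as [E|E]; [|reflexivity].
      simpl in E; exfalso; apply (H m); f_equal; lia. }
  2:{ now apply summable_mask. }
  assert (E1 : forall m, mask (fun p => fst p + snd p = N)%Z
    (fun p => lterm q i u (fst p) * lterm q j (e * u) (snd p))%C (m, (N - m)%Z) =
    (zpow (e * u) N * (weight e i j N m * (lam q m * lam q (N - m))))%C).
  { intros m; unfold mask; destruct excluded_middle_informative as [E|E]; [|simpl in E; lia].
    simpl; unfold lterm, weight; rewrite !zpow_mult by assumption.
    replace (N - m)%Z with (N + - m)%Z by lia.
    rewrite !zpow_add, !zpow_neg by assumption.
    assert (Ei : (/ zpow e m)%C = zpow e m).
    { pose proof (zpow_neq_0 e m He0).
      replace (/ zpow e m)%C with (1 * / zpow e m)%C by ring.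
      rewrite <- (zpow_sign_sq e m He); field; assumption. }
    rewrite Ei; pose proof (zpow_neq_0 u m Hu0); field; assumption. }
  rewrite (tsum_ext _ _ E1).
  destruct (Z.eqb_spec N 0) as [->|HN].
  - rewrite zpow_0.
    rewrite (tsum_ext _ (fun m => (weight e i j 0 m * (lam q m * lam q (- m)))%C)).
    + rewrite Hk; unfold lam; simpl; ring.
    + intros m; replace (0 - m)%Z with (- m)%Z by lia; ring.
  - rewrite (tsum_ext _ (fun m => (zpow (e * u) N * lam q N * (weight e i j N m * (lam q m - lam q (m - N))))%C)).
    + destruct (HR N HN) as [HR1 HR2]; rewrite tsum_scal, HR2 by assumption; ring.
    (* [lam_mult] does not apply at m = 0 and m = N, but there the weight vanishes because i and j
       are positive. *)
    + intros m; destruct (Z.eqb_spec m 0) as [->|Hm].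
      { unfold weight; unfold ZtoC at 1 3; rewrite !Cpow_0_l by assumption; ring. }
      destruct (Z.eqb_spec m N) as [->|HmN].
      { unfold weight; replace (N - N)%Z with 0%Z by lia; unfold ZtoC at 2 4.
        rewrite !(Cpow_0_l j) by assumption; ring. }
      rewrite (lam_mult q Hq m (N - m)) by lia.
      replace (m + (N - m))%Z with N by lia; replace (- (N - m))%Z with (m - N)%Z by lia; ring. }
assert (SW := summable_fiber (fun p => fst p + snd p)%Z _ SP).
apply (summable_ext _ _ EN) in SW.
set (one := fun N => if (N =? 0)%Z then kappa else RtoC 0).
assert (H1 : forall N, ~ In N (0%Z :: nil) -> one N = RtoC 0).
{ intros N HN; unfold one; destruct (Z.eqb_spec N 0); [subst; simpl in HN; tauto|reflexivity]. }
assert (SR : summable (fun N => lam q N * zpow (e * u) N * R N)%C).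
{ apply (summable_ext (fun N => (one N + lam q N * zpow (e * u) N * R N) - one N)%C).
  - intros N; ring.
  - apply summable_minus; [exact SW|]; exact (summable_finite (0%Z :: nil) _ H1). }
split; [exact SR|].
rewrite (tsum_ext _ _ EN), (tsum_plus one) by
  (try assumption; exact (summable_finite (0%Z :: nil) _ H1)).
f_equal; apply tsum_eq.
replace kappa with (csum (0%Z :: nil) one) by (unfold one; simpl; ring).
apply has_sum_finite; [repeat constructor; auto|assumption].
Qed.

(** The term N = 0 of a Cauchy product lies outside the range of [lam_mult]. There [lam] at m times
    [lam] at -m is - [bet] (1 + [bet]), and the contributions of m and -m are combined; the last
    hypothesis records the resulting factor [s] and power [n]. *)
Lemma dsum_kappa (e : C) (i j n : nat) (s : C) : (1 <= i)%nat -> (1 <= j)%nat -> (e * e)%C = 1 ->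
  (forall m b : C, (m ^ i * (- m) ^ j * ((1 + b) * - b) + (- m) ^ i * m ^ j * (- b * (1 + b)) =
     s * (m ^ n * (b * (1 + b))))%C) ->
  tsum (fun m => (weight e i j 0 m * (lam q m * lam q (- m)))%C) =
  (s * tsum (fun k : nat => (e ^ S k * (ntoC (S k) ^ n * (bet q k * (1 + bet q k)))))%C)%C.
Proof.
intros Hi Hj He Hs.
assert (Hsum : summable (fun m => (weight e i j 0 m * (lam q m * lam q (- m)))%C)).
{ assert (Hl : forall m, Cmod (lam q m * lam q (- m)) <=
    (1 + / (1 - Cmod q)) * / (1 - Cmod q) * Cmod q ^ Z.abs_nat m).
  { assert (Hb : forall k, Cmod ((1 + bet q k) * - bet q k) <=
      (1 + / (1 - Cmod q)) * / (1 - Cmod q) * Cmod q ^ S k).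
    { intros k; rewrite Cmod_mult, Cmod_opp, Rmult_assoc.
      assert (Hi0 : 0 < / (1 - Cmod q)) by (apply Rinv_0_lt_compat; lra).
      apply Rmult_le_compat; try apply Cmod_ge_0; [|now apply bet_le].
      eapply Rle_trans; [apply Cmod_triangle|]; rewrite Cmod_1; apply Rplus_le_compat_l.
      eapply Rle_trans; [apply bet_le; assumption|].
      rewrite <- (Rmult_1_r (/ (1 - Cmod q))) at 2; apply Rmult_le_compat_l; [lra|].
      pose proof (pow_le_base (Cmod q) k ltac:(lra)); lra. }
    intros m; destruct (Z_cases m) as [[[|k] ->]|[k ->]].
    - unfold lam; simpl; rewrite Cmult_0_l, Cmod_0, Rmult_1_r.
      assert (Hi0 : 0 < / (1 - Cmod q)) by (apply Rinv_0_lt_compat; lra); nra.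
    - rewrite lam_pos, lam_neg, Zabs2Nat.id by assumption; apply Hb.
    - rewrite Z.opp_involutive, lam_pos, lam_neg, abs_nat_opp, Zabs2Nat.id, Cmult_comm by assumption; apply Hb. }
  eapply (summable_growth_geometric (weight e i j 0) _ _ (Cmod q)); [now apply pgrow_weight|lra|exact Hl]. }
rewrite tsum_Z by assumption.
assert (H0 : weight e i j 0 0 = 0).
{ unfold weight; unfold ZtoC at 1; rewrite Cpow_0_l by assumption; ring. }
rewrite H0, Cmult_0_l, Cplus_0_l, <- tsum_plus, <- tsum_scal.
- apply tsum_ext; intros k; rewrite Z.opp_involutive, lam_pos, lam_neg by assumption; unfold weight.
  rewrite zpow_neg, zpow_nat by now apply sign_neq_0.
  assert (Ei : (/ e ^ S k)%C = (e ^ S k)%C).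
  { rewrite <- zpow_nat; pose proof (zpow_neq_0 e (Z.of_nat (S k)) (sign_neq_0 e He)).
    replace (/ zpow e (Z.of_nat (S k)))%C with (1 * / zpow e (Z.of_nat (S k)))%C by ring.
    rewrite <- (zpow_sign_sq e (Z.of_nat (S k)) He); field; assumption. }
  rewrite Ei.
  replace (0 - Z.of_nat (S k))%Z with (- Z.of_nat (S k))%Z by lia.
  replace (0 - - Z.of_nat (S k))%Z with (Z.of_nat (S k)) by lia.
  rewrite !ZtoC_opp, !ZtoC_nat.
  specialize (Hs (ntoC (S k)) (bet q k)).
  transitivity (e ^ S k * (s * (ntoC (S k) ^ n * (bet q k * (1 + bet q k)))))%C; [|ring].
  rewrite <- Hs; ring.
- apply (summable_ext (fun k : nat => (zpow e (Z.of_nat (S k)) * (ZtoC (Z.of_nat (S k)) ^ n * (1 + bet q k)) * bet q k)%C)).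
  + intros k; rewrite zpow_nat, ZtoC_nat; ring.
  + apply (summable_le_scal (1 + / (1 - Cmod q)) _ (fun k : nat => (zpow e (Z.of_nat (S k)) * (ZtoC (Z.of_nat (S k)) ^ n) * bet q k)%C)).
    * intros k; replace (zpow e (Z.of_nat (S k)) * (ZtoC (Z.of_nat (S k)) ^ n * (1 + bet q k)) * bet q k)%C
        with ((1 + bet q k) * (zpow e (Z.of_nat (S k)) * (ZtoC (Z.of_nat (S k)) ^ n) * bet q k))%C by ring.
      rewrite Cmod_mult; apply Rmult_le_compat_r; [apply Cmod_ge_0|].
      eapply Rle_trans; [apply Cmod_triangle|]; rewrite Cmod_1; apply Rplus_le_compat_l.
      eapply Rle_trans; [apply bet_le; assumption|].
      assert (Hi0 : 0 < / (1 - Cmod q)) by (apply Rinv_0_lt_compat; lra).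
      rewrite <- (Rmult_1_r (/ (1 - Cmod q))) at 2; apply Rmult_le_compat_l; [lra|].
      pose proof (pow_le_base (Cmod q) k ltac:(lra)); lra.
    * apply (summable_growth_bet q Hq (fun n0 => (zpow e n0 * ZtoC n0 ^ n)%C)).
      apply pgrow_mult; [now apply pgrow_zpow_sign|apply pgrow_pow, pgrow_id].
- exact (summable_inj (fun n => Z.of_nat (S n)) ltac:(cbv beta; intros; lia) _ Hsum).
- exact (summable_inj (fun n => - Z.of_nat (S n))%Z ltac:(cbv beta; intros; lia) _ Hsum).
Qed.

End Nome.

(** * The Weierstrass equation and the Ramanujan relations *)

Section Nome.
Variable q : C.
Hypothesis Hq : 0 < Cmod q < 1.

Lemma summable_bsum k : summable (fun n : nat => (ntoC (S n) ^ k * bet q n)%C).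
Proof.
apply (summable_ext (fun n : nat => (ZtoC (Z.of_nat (S n)) ^ k * bet q n)%C)).
- intros n; now rewrite ZtoC_nat.
- apply (summable_growth_bet q Hq (fun n => (ZtoC n ^ k)%C)), pgrow_pow, pgrow_id.
Qed.

(** Reduces each product formula to polynomial identities that [field] decides. [Phi] is a discrete
    primitive of m^i (N - m)^j; [d1], [d3], [d5] expand the reflected combination of [tsum_lam_diff]
    in odd powers of m; [c1] to [c7] expand the resulting coefficient in powers of N, and each N^k
    then produces [lp q k u]. *)
Lemma lp_product_same (i j n : nat) (Phi : C -> C -> C) (d1 d3 d5 : C -> C) (s c1 c3 c5 c7 u : C) :
  (1 <= i)%nat -> (1 <= j)%nat -> Cmod q < Cmod u < 1 ->
  (forall N m, Phi N m - Phi N (m - 1) = m ^ i * (N - m) ^ j)%C ->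
  (forall N m, m ^ i * (N - m) ^ j - (m + N) ^ i * (- m) ^ j - (- m) ^ i * (N + m) ^ j
     + (N - m) ^ i * m ^ j = d1 N * m + d3 N * m ^ 3 + d5 N * m ^ 5)%C ->
  (forall N, Phi N N - Phi N 0 + d1 N * bsum q 1 + d3 N * bsum q 3 + d5 N * bsum q 5
     = c1 * N + c3 * N ^ 3 + c5 * N ^ 5 + c7 * N ^ 7)%C ->
  (forall m b, m ^ i * (- m) ^ j * ((1 + b) * - b) + (- m) ^ i * m ^ j * (- b * (1 + b)) =
     s * (m ^ n * (b * (1 + b))))%C ->
  (lp q i u * lp q j u = s * dsum q n + c1 * lp q 1 u + c3 * lp q 3 u + c5 * lp q 5 u + c7 * lp q 7 u)%C.
Proof.
intros Hi Hj Hu HPhi Hd Hc Hs.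
assert (H1 : (1 * 1)%C = 1) by ring.
assert (Ez : forall m, zpow 1 m = 1).
{ intros m; unfold zpow; replace (/ 1)%C with (RtoC 1) by (field; apply C1_nz).
  destruct (0 <=? m)%Z; apply Cpow_1_l. }
destruct (lp_product q Hq i j 1 u
  (fun N => c1 * ZtoC N + c3 * ZtoC N ^ 3 + c5 * ZtoC N ^ 5 + c7 * ZtoC N ^ 7)%C
  (s * dsum q n)%C Hi Hj H1 Hu) as [HS HP].
- rewrite (dsum_kappa q Hq 1 i j n s Hi Hj H1 Hs); unfold dsum; f_equal; apply tsum_ext.
  intros k; rewrite Cpow_1_l; ring.
- intros N HN.
  destruct (tsum_lam_diff q Hq (weight 1 i j N) (fun m => Phi (ZtoC N) (ZtoC m)) N) as [HS HT].
  + now apply pgrow_weight.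
  + intros m; unfold weight; rewrite Ez, ZtoC_minus; change (ZtoC 1) with (RtoC 1).
    rewrite HPhi, ZtoC_minus; ring.
  + split; [exact HS|]; rewrite HT, <- Hc.
    change (ZtoC 0) with (RtoC 0).
    rewrite <- !Cplus_assoc; do 2 f_equal.
    unfold bsum; rewrite <- !tsum_scal by apply summable_bsum.
    rewrite <- !tsum_plus by (repeat apply summable_plus; apply summable_scal, summable_bsum).
    apply tsum_ext; intros k; unfold weight; rewrite !Ez.
    rewrite !ZtoC_minus, !ZtoC_plus, !ZtoC_opp, !ZtoC_nat.
    specialize (Hd (ZtoC N) (ntoC (S k))).
    replace ((ZtoC N - (ZtoC N - ntoC (S k))))%C with (ntoC (S k)) by ring.
    replace ((ZtoC N - (ntoC (S k) + ZtoC N)))%C with (- ntoC (S k))%C by ring.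
    replace ((ZtoC N - - ntoC (S k)))%C with (ZtoC N + ntoC (S k))%C by ring.
    rewrite Cpow_1_r.
    transitivity ((d1 (ZtoC N) * ntoC (S k) + d3 (ZtoC N) * ntoC (S k) ^ 3 + d5 (ZtoC N) * ntoC (S k) ^ 5) * bet q k)%C; [|ring].
    rewrite <- Hd; ring.
- replace (1 * u)%C with u in * by ring.
  rewrite HP, <- !Cplus_assoc; f_equal.
  unfold lp; rewrite <- !tsum_scal by now apply summable_lterm.
  rewrite <- !tsum_plus by (repeat apply summable_plus; apply summable_scal; now apply summable_lterm).
  apply tsum_ext; intros N; unfold lterm; rewrite Cpow_1_r; ring.
Qed.

Definition E2q : C := (1 - 24 * bsum q 1)%C.
Definition E4q : C := (1 + 240 * bsum q 3)%C.
Definition E6q : C := (1 - 504 * bsum q 5)%C.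

Variable u : C.
Hypothesis Hu : Cmod q < Cmod u < 1.
Notation p k := (lp q k u).
Local Open Scope C_scope.

(** The five product formulas have weights 4, 6, 6, 8, 8. They express [lp q 3], [lp q 5] and
    [lp q 7] through [lp q 1], and the two formulas of weight 8 overdetermine [lp q 7]. The first
    argument of each instance is a power-sum polynomial in m, the later ones follow from it. *)
Lemma lp_11 : p 1 * p 1 = p 3 / 6 - E2q / 6 * p 1 + 2 * dsum q 2.
Proof.
rewrite (lp_product_same 1 1 2 (fun N m => N * (m * (m + 1)) / 2 - m * (m + 1) * (2 * m + 1) / 6)
  (fun N => 4 * N) (fun _ => 0) (fun _ => 0) 2 (- 1 / 6 + 4 * bsum q 1) (1 / 6) 0 0 u);
  try (unfold E2q; field); try lia; try assumption; intros; field.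
Qed.

Lemma lp_13 : p 1 * p 3 = p 5 / 20 - E2q / 12 * p 3 + E4q / 30 * p 1 + 2 * dsum q 4.
Proof.
rewrite (lp_product_same 1 3 4
  (fun N m => N ^ 3 * (m * (m + 1)) / 2 - 3 * N ^ 2 * (m * (m + 1) * (2 * m + 1) / 6)
    + 3 * N * (m ^ 2 * (m + 1) ^ 2 / 4) - m * (m + 1) * (2 * m + 1) * (3 * m ^ 2 + 3 * m - 1) / 30)
  (fun N => 2 * N ^ 3) (fun N => 8 * N) (fun _ => 0) 2
  (1 / 30 + 8 * bsum q 3) (- 1 / 12 + 2 * bsum q 1) (1 / 20) 0 u);
  try (unfold E2q, E4q; field); try lia; try assumption; intros; field.
Qed.

Lemma lp_22 : p 2 * p 2 = p 5 / 30 - E4q / 30 * p 1 - 2 * dsum q 4.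
Proof.
rewrite (lp_product_same 2 2 4
  (fun N m => N ^ 2 * (m * (m + 1) * (2 * m + 1) / 6)
    - 2 * N * (m ^ 2 * (m + 1) ^ 2 / 4) + m * (m + 1) * (2 * m + 1) * (3 * m ^ 2 + 3 * m - 1) / 30)
  (fun N => 0) (fun N => - 8 * N) (fun _ => 0) (- 2)
  (- 1 / 30 - 8 * bsum q 3) 0 (1 / 30) 0 u);
  try (unfold E2q, E4q; field); try lia; try assumption; intros; field.
Qed.

(** Faulhaber polynomials: [f2] to [f6] are the sums of the second to sixth powers of 1, ..., m. *)
Let f2 (m : C) := m * (m + 1) * (2 * m + 1) / 6.
Let f3 (m : C) := m ^ 2 * (m + 1) ^ 2 / 4.
Let f4 (m : C) := m * (m + 1) * (2 * m + 1) * (3 * m ^ 2 + 3 * m - 1) / 30.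
Let f5 (m : C) := m ^ 2 * (m + 1) ^ 2 * (2 * m ^ 2 + 2 * m - 1) / 12.
Let f6 (m : C) := m ^ 7 / 7 + m ^ 6 / 2 + m ^ 5 / 2 - m ^ 3 / 6 + m / 42.

Lemma lp_33 : p 3 * p 3 = p 7 / 140 + E4q / 60 * p 3 - E6q / 42 * p 1 + 2 * dsum q 6.
Proof.
rewrite (lp_product_same 3 3 6
  (fun N m => N ^ 3 * f3 m - 3 * N ^ 2 * f4 m + 3 * N * f5 m - f6 m)
  (fun N => 0) (fun N => 4 * N ^ 3) (fun N => 12 * N) 2
  (- 1 / 42 + 12 * bsum q 5) (1 / 60 + 4 * bsum q 3) 0 (1 / 140) u);
  try (unfold E6q, E4q; field); try lia; try assumption; intros; unfold f3, f4, f5, f6; field.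
Qed.

Lemma lp_15 : p 1 * p 5 = p 7 / 42 - E2q / 12 * p 5 + E4q / 12 * p 3 - E6q / 42 * p 1 + 2 * dsum q 6.
Proof.
rewrite (lp_product_same 1 5 6
  (fun N m => N ^ 5 * (m * (m + 1) / 2) - 5 * N ^ 4 * f2 m + 10 * N ^ 3 * f3 m
     - 10 * N ^ 2 * f4 m + 5 * N * f5 m - f6 m)
  (fun N => 2 * N ^ 5) (fun N => 20 * N ^ 3) (fun N => 12 * N) 2
  (- 1 / 42 + 12 * bsum q 5) (1 / 12 + 20 * bsum q 3) (- 1 / 12 + 2 * bsum q 1) (1 / 42) u);
  try (unfold E2q, E4q, E6q; field); try lia; try assumption; intros; unfold f2, f3, f4, f5, f6; field.
Qed.

End Nome.

(** * Geometric series and the pole at u = 1 *)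

Lemma tsum_nat_S (F : nat -> C) : summable F -> tsum F = (F 0%nat + tsum (fun n => F (S n)))%C.
Proof.
intros HF.
rewrite (tsum_ext F (fun n => (mask (fun n => n = 0%nat) F n + mask (fun n => n <> 0%nat) F n)%C)).
2:{ intros n; unfold mask; destruct (excluded_middle_informative (n = 0%nat));
    destruct (excluded_middle_informative (n <> 0%nat)); try tauto; ring. }
rewrite tsum_plus by now apply summable_mask.
f_equal.
- apply tsum_eq.
  replace (F 0%nat) with (csum (0%nat :: nil) (mask (fun n => n = 0%nat) F)).
  + apply has_sum_finite; [repeat constructor; auto|].
    intros n Hn; unfold mask; destruct excluded_middle_informative; [subst; simpl in Hn; tauto|reflexivity].
  + unfold mask; simpl; destruct excluded_middle_informative; [ring|tauto].
- rewrite (tsum_inj S).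
  + apply tsum_ext; intros n; unfold mask; destruct excluded_middle_informative; [reflexivity|lia].
  + intros; lia.
  + intros [|n] N; unfold mask; destruct excluded_middle_informative; try reflexivity; [lia|].
    exfalso; apply (N n); reflexivity.
  + now apply summable_mask.
Qed.

Lemma RtoC_neq_0 (r : R) : r <> 0 -> RtoC r <> 0.
Proof. intros H E; apply RtoC_inj in E; lra. Qed.

Lemma ntoC_S n : ntoC (S n) = (ntoC n + 1)%C.
Proof. unfold ntoC; rewrite S_INR, RtoC_plus; reflexivity. Qed.

Lemma Cmod_ntoC n : Cmod (ntoC n) = INR n.
Proof. unfold ntoC; rewrite Cmod_R, Rabs_pos_eq; [reflexivity|apply pos_INR]. Qed.

Lemma summable_geometric (k : nat) (u : C) : Cmod u < 1 ->
  summable (fun n : nat => (ntoC n ^ k * u ^ n)%C).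
Proof.
intros Hu; apply (summable_poly_geometric k (Cmod u) 1); [split; [apply Cmod_ge_0|assumption]|].
intros n; rewrite Rmult_1_l, Cmod_mult, !Cmod_pow, Cmod_ntoC.
pose proof (pos_INR n).
apply Rmult_le_compat_r; [apply pow_le, Cmod_ge_0|apply pow_incr; lra].
Qed.

Lemma one_minus_neq_0 (u : C) : Cmod u < 1 -> (1 - u)%C <> 0.
Proof.
intros Hu; apply Cmod_neq_0; pose proof (Cmod_triangle_rev 1 u); rewrite Cmod_1 in *; lra.
Qed.

Lemma tsum_geometric (u : C) : Cmod u < 1 -> tsum (fun n : nat => (u ^ n)%C) = (/ (1 - u))%C.
Proof.
intros Hu; pose proof (one_minus_neq_0 u Hu).
assert (HS : summable (fun n : nat => (u ^ n)%C)).
{ apply (summable_ext (fun n : nat => (ntoC n ^ 0 * u ^ n)%C)); [intros n; simpl; ring|].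
  now apply summable_geometric. }
assert (E : tsum (fun n : nat => (u ^ n)%C) = (1 + u * tsum (fun n : nat => (u ^ n)%C))%C).
{ rewrite tsum_nat_S at 1 by assumption; rewrite <- tsum_scal by assumption.
  f_equal; apply tsum_ext; intros n; now rewrite Cpow_S. }
set (T := tsum (fun n : nat => (u ^ n)%C)) in *.
replace T with ((T - u * T) / (1 - u))%C by (field; assumption).
rewrite E at 1; field; assumption.
Qed.

Lemma tsum_n_geometric (u : C) : Cmod u < 1 ->
  summable (fun n : nat => (ntoC (S n) * u ^ S n)%C) /\
  tsum (fun n : nat => (ntoC (S n) * u ^ S n)%C) = (u / (1 - u) ^ 2)%C.
Proof.
intros Hu; pose proof (one_minus_neq_0 u Hu).
assert (HS0 : summable (fun n : nat => (u ^ n)%C)).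
{ apply (summable_ext (fun n : nat => (ntoC n ^ 0 * u ^ n)%C)); [intros n; simpl; ring|].
  now apply summable_geometric. }
assert (HS1 : summable (fun n : nat => (ntoC n * u ^ n)%C)).
{ apply (summable_ext (fun n : nat => (ntoC n ^ 1 * u ^ n)%C)); [intros n; rewrite Cpow_1_r; ring|].
  now apply summable_geometric. }
assert (HS2 : summable (fun n : nat => (ntoC (S n) * u ^ S n)%C))
  by exact (summable_inj S ltac:(intros; lia) _ HS1).
split; [assumption|].
set (T := tsum (fun n : nat => (ntoC (S n) * u ^ S n)%C)).
assert (E1 : tsum (fun n : nat => (ntoC n * u ^ n)%C) = T).
{ rewrite tsum_nat_S by assumption; unfold ntoC at 1; simpl INR; fold T; ring. }
assert (E : T = (u * T + u * / (1 - u))%C).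
{ rewrite <- tsum_geometric by assumption.
  rewrite <- E1 at 2; rewrite <- !tsum_scal, <- tsum_plus by (try apply summable_scal; assumption).
  unfold T; apply tsum_ext; intros n; rewrite Cpow_S, ntoC_S; ring. }
replace T with ((T - u * T) / (1 - u))%C by (field; assumption).
rewrite E at 1; field; assumption.
Qed.

Section Nome.
Variable q : C.
Hypothesis Hq : 0 < Cmod q < 1.

Lemma lp_split (k : nat) (u : C) : (1 <= k)%nat -> Cmod q < Cmod u < 1 ->
  summable (fun n : nat => (bet q n * (ntoC (S n) ^ k * u ^ S n))%C) /\
  summable (fun n : nat => (bet q n * (ntoC (S n) ^ k * (/ u) ^ S n))%C) /\
  (lp q k u = tsum (fun n : nat => (ntoC (S n) ^ k * u ^ S n))
    + (tsum (fun n : nat => (bet q n * (ntoC (S n) ^ k * u ^ S n)))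
    - (- 1) ^ k * tsum (fun n : nat => (bet q n * (ntoC (S n) ^ k * (/ u) ^ S n)))))%C.
Proof.
intros Hk Hu.
assert (HL := summable_lterm q Hq k u Hu).
assert (HP := summable_inj (fun n => Z.of_nat (S n)) ltac:(cbv beta; intros; lia) _ HL).
assert (HN := summable_inj (fun n => - Z.of_nat (S n))%Z ltac:(cbv beta; intros; lia) _ HL).
assert (HG : summable (fun n : nat => (ntoC (S n) ^ k * u ^ S n)%C)).
{ exact (summable_inj S ltac:(intros; lia) _ (summable_geometric k u ltac:(lra))). }
assert (EP : forall n : nat, lterm q k u (Z.of_nat (S n)) =
  (ntoC (S n) ^ k * u ^ S n + bet q n * (ntoC (S n) ^ k * u ^ S n))%C).
{ intros n; unfold lterm; rewrite ZtoC_nat, lam_pos, zpow_nat by assumption; ring. }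
assert (Hm1 : ((- 1) ^ k * (- 1) ^ k)%C = 1).
{ rewrite <- Cpow_mult_l; replace (- 1 * - 1)%C with (RtoC 1) by ring; apply Cpow_1_l. }
assert (EN : forall n : nat, lterm q k u (- Z.of_nat (S n)) =
  ((- (- 1) ^ k) * (bet q n * (ntoC (S n) ^ k * (/ u) ^ S n)))%C).
{ intros n; unfold lterm; rewrite ZtoC_opp, ZtoC_nat, lam_neg, zpow_neg_nat by assumption.
  replace (- ntoC (S n))%C with (- 1 * ntoC (S n))%C by ring; rewrite Cpow_mult_l; ring. }
assert (HB1 : summable (fun n : nat => (bet q n * (ntoC (S n) ^ k * u ^ S n))%C)).
{ apply (summable_ext (fun n : nat => (lterm q k u (Z.of_nat (S n)) - ntoC (S n) ^ k * u ^ S n)%C)).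
  - intros n; rewrite EP; ring.
  - now apply summable_minus. }
assert (HB2 : summable (fun n : nat => (bet q n * (ntoC (S n) ^ k * (/ u) ^ S n))%C)).
{ apply (summable_ext (fun n : nat => (- (- 1) ^ k * lterm q k u (- Z.of_nat (S n)))%C)).
  - intros n; rewrite EN.
    transitivity (((- 1) ^ k * (- 1) ^ k) * (bet q n * (ntoC (S n) ^ k * (/ u) ^ S n)))%C; [ring|].
    rewrite Hm1; ring.
  - now apply summable_scal. }
split; [assumption|split; [assumption|]].
unfold lp; rewrite tsum_Z by assumption.
rewrite (tsum_ext _ _ EP), (tsum_ext _ _ EN), tsum_plus, tsum_scal by assumption.
unfold lterm; unfold ZtoC at 1; rewrite Cpow_0_l by assumption; ring.
Qed.

(** Near u = 1 the part with positive n contains the sum of n r^n, which is r/(1 - r)^2, while the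
    two series in [bet] stay bounded. This blow-up is what later forces polynomial relations to be
    trivial. *)
Lemma lp_1_unbounded (B r0 : R) : r0 < 1 -> exists r, r0 < r < 1 /\ Cmod q < r /\ 0 < r /\ B < Cmod (lp q 1 (RtoC r)).
Proof.
intros Hr0.
set (rho := Rmax ((1 + Cmod q) / 2) (Rmax r0 (1 / 2))).
assert (H1 : (1 + Cmod q) / 2 <= rho) by apply Rmax_l.
assert (H2 : r0 <= rho) by (eapply Rle_trans; [apply Rmax_l|apply Rmax_r]).
assert (H3 : 1 / 2 <= rho) by (eapply Rle_trans; [apply Rmax_r|apply Rmax_r]).
assert (H4 : rho < 1) by (repeat apply Rmax_lub_lt; lra).
assert (Hrho : Cmod q < Cmod (RtoC rho) < 1) by (rewrite Cmod_R, Rabs_pos_eq; lra).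
destruct (lp_split 1 (RtoC rho) (le_n _) Hrho) as (_ & [M HM] & _).
assert (HM0 : 0 <= M) by (apply (HM nil); constructor).
set (K := Rabs B + 2 * M).
assert (HK : 0 <= K) by (unfold K; pose proof (Rabs_pos B); lra).
set (d := Rmin (1 - rho) (/ (K + 1)) / 4).
assert (Hd0 : 0 < d).
{ unfold d; apply Rdiv_lt_0_compat; [|lra]; apply Rmin_glb_lt; [lra|apply Rinv_0_lt_compat; lra]. }
assert (Hd1 : d * 4 <= 1 - rho) by (unfold d; pose proof (Rmin_l (1 - rho) (/ (K + 1))); lra).
assert (Hd2 : d * 4 * (K + 1) <= 1).
{ pose proof (Rmin_r (1 - rho) (/ (K + 1))) as h. apply Rle_trans with (/ (K + 1) * (K + 1)); [|right; field; lra].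
  apply Rmult_le_compat_r; [lra|]; unfold d; lra. }
set (r := 1 - d).
exists r; split; [unfold r; lra|]; split; [unfold r; lra|]; split; [unfold r; lra|].
assert (Hr : rho < r < 1) by (unfold r; lra).
assert (Hu : Cmod q < Cmod (RtoC r) < 1) by (rewrite Cmod_R, Rabs_pos_eq; lra).
destruct (lp_split 1 (RtoC r) (le_n _) Hu) as (_ & _ & ->).
(* For rho < r < 1 both r and 1/r are at most 1/rho, so the series at 1/rho, whose finite sums are
   bounded by [M], dominates both. *)
assert (Hbd : forall n, Cmod (bet q n * (ntoC (S n) ^ 1 * RtoC r ^ S n)) <=
     Cmod (bet q n * (ntoC (S n) ^ 1 * (/ RtoC rho) ^ S n)) /\
   Cmod (bet q n * (ntoC (S n) ^ 1 * (/ RtoC r) ^ S n)) <=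
     Cmod (bet q n * (ntoC (S n) ^ 1 * (/ RtoC rho) ^ S n))).
{ intros n.
  assert (Hr1 : 1 <= / rho) by (rewrite <- Rinv_1; apply Rinv_le_contravar; lra).
  rewrite !Cmod_mult, !(Cmod_pow _ (S n)), !Cmod_inv, !Cmod_R, !(Rabs_pos_eq r), !Rabs_pos_eq
   by (try lra; apply RtoC_neq_0; lra).
  split; repeat (apply Rmult_le_compat_l; [apply Cmod_ge_0|]); apply pow_incr; split; try lra.
  - left; apply Rinv_0_lt_compat; lra.
  - apply Rinv_le_contravar; lra. }
assert (T1 : Cmod (tsum (fun n : nat => (bet q n * (ntoC (S n) ^ 1 * RtoC r ^ S n))%C)) <= M).
{ apply Cmod_tsum_le; intros l Hl; eapply Rle_trans; [|apply (HM l Hl)].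
  apply rsum_le; intros n _; apply Hbd. }
assert (T2 : Cmod (tsum (fun n : nat => (bet q n * (ntoC (S n) ^ 1 * (/ RtoC r) ^ S n))%C)) <= M).
{ apply Cmod_tsum_le; intros l Hl; eapply Rle_trans; [|apply (HM l Hl)].
  apply rsum_le; intros n _; apply Hbd. }
rewrite (tsum_ext _ (fun n : nat => (ntoC (S n) * RtoC r ^ S n)%C)) by (intros n; now rewrite Cpow_1_r).
rewrite (proj2 (tsum_n_geometric (RtoC r) (proj2 Hu))).
set (A := tsum _) in *; set (A' := tsum _) in T2 |- *.
rewrite Cpow_1_r.
assert (G : Cmod (RtoC r / (1 - RtoC r) ^ 2) > 2 * (K + 1)).
{ rewrite <- RtoC_minus, <- RtoC_pow, <- RtoC_div by (apply pow_nonzero; unfold r; lra).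
  replace (1 - r) with d by (unfold r; ring).
  rewrite Cmod_R, Rabs_pos_eq by (apply Rlt_le, Rdiv_lt_0_compat; [lra|apply pow_lt; lra]).
  apply Rlt_gt, Rmult_lt_reg_r with (d ^ 2); [apply pow_lt; lra|].
  replace (r / d ^ 2 * d ^ 2) with r by (field; lra).
  apply Rle_lt_trans with (1/4); [|lra]. nra. }
pose proof (Cmod_triangle_rev (RtoC r / (1 - RtoC r) ^ 2) (- (A - (-1) * A'))) as H.
replace (RtoC r / (1 - RtoC r) ^ 2 - - (A - (-1) * A'))%C
  with (RtoC r / (1 - RtoC r) ^ 2 + (A - (-1) * A'))%C in H by ring.
eapply Rlt_le_trans; [|exact H].
rewrite Cmod_opp.
assert (Cmod (A - (-1) * A') <= 2 * M).
{ replace (A - (-1) * A')%C with (A + A')%C by ring; eapply Rle_trans; [apply Cmod_triangle|]; lra. }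
pose proof (Rle_abs B); unfold K in *; lra.
Qed.

End Nome.

(** Plays the part of an identity theorem: relations valid throughout an annulus are tested at
    points where the Weierstrass function is arbitrarily large. *)
Lemma linear_unbounded_zero (c0 c1 : C) :
  (forall B, exists z : C, B < Cmod z /\ (c1 * z + c0)%C = 0) -> c1 = 0 /\ c0 = 0.
Proof.
intros H; assert (E1 : c1 = 0).
{ apply NNPP; intros N; apply Cmod_gt_0 in N.
  destruct (H (Cmod c0 / Cmod c1)) as (z & Hz & E).
  assert (E2 : (c1 * z)%C = (- c0)%C) by (replace (c1 * z)%C with (c1 * z + c0 - c0)%C by ring; rewrite E; ring).
  apply (f_equal Cmod) in E2; rewrite Cmod_mult, Cmod_opp in E2.
  rewrite <- E2 in Hz; unfold Rdiv in Hz.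
  replace (Cmod c1 * Cmod z * / Cmod c1) with (Cmod z) in Hz by (field; lra); lra. }
split; [assumption|]; destruct (H 0) as (z & _ & E); subst; rewrite <- E; ring.
Qed.

Lemma quadratic_unbounded_zero (c0 c1 c2 : C) :
  (forall B, exists z : C, B < Cmod z /\ (c2 * z ^ 2 + c1 * z + c0)%C = 0) ->
  c2 = 0 /\ c1 = 0 /\ c0 = 0.
Proof.
intros H; assert (E2 : c2 = 0).
{ apply NNPP; intros N; apply Cmod_gt_0 in N.
  destruct (H (1 + (Cmod c0 + Cmod c1) / Cmod c2)) as (z & Hz & E).
  pose proof (Cmod_ge_0 c0) as P0; pose proof (Cmod_ge_0 c1) as P1.
  assert (P2 : 0 <= (Cmod c0 + Cmod c1) / Cmod c2) by (apply Rle_div_r; lra).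
  assert (E3 : (c2 * z * z)%C = (- (c1 * z + c0))%C).
  { replace (c2 * z * z)%C with (c2 * z ^ 2 + c1 * z + c0 - (c1 * z + c0))%C by ring; rewrite E; ring. }
  apply (f_equal Cmod) in E3; rewrite Cmod_opp, !Cmod_mult in E3.
  pose proof (Cmod_triangle (c1 * z) c0) as T; rewrite Cmod_mult in T.
  assert (H4 : (Cmod c0 + Cmod c1) < Cmod c2 * Cmod z).
  { apply Rle_lt_trans with (Cmod c2 * ((Cmod c0 + Cmod c1) / Cmod c2)); [right; field; lra|].
    apply Rmult_lt_compat_l; lra. }
  nra. }
subst; split; [reflexivity|].
apply linear_unbounded_zero; intros B; destruct (H B) as (z & Hz & E); exists z; split; [assumption|].
rewrite <- E; ring.
Qed.

Section Weierstrass.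
Variable q : C.
Hypothesis Hq : 0 < Cmod q < 1.

(** The Weierstrass function of Z + tau Z divided by (2 pi i)^2, in terms of u = e^(2 pi i z) and q
    = e^(2 pi i tau). *)
Definition wp (u : C) : C := (lp q 1 u + E2q q / 12)%C.

Lemma wp_unbounded (B r0 : R) : r0 < 1 -> exists r, r0 < r < 1 /\ Cmod q < r /\ 0 < r /\ B < Cmod (wp (RtoC r)).
Proof.
intros Hr0; destruct (lp_1_unbounded q Hq (B + Cmod (E2q q / 12)) r0 Hr0) as (r & H1 & H2 & H3 & H4).
exists r; do 3 (split; [assumption|]).
pose proof (Cmod_triangle_rev (lp q 1 (RtoC r)) (- (E2q q / 12))) as H.
rewrite Cmod_opp in H; unfold wp.
replace (lp q 1 (RtoC r) + E2q q / 12)%C with (lp q 1 (RtoC r) - - (E2q q / 12))%C by ring; lra.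
Qed.

Local Open Scope C_scope.

(** [lp_11] and [lp_13] express [lp q 3] and [lp q 5] through [lp q 1]; the combination of [lp_15]
    and [lp_33] free of [lp q 7] then becomes a polynomial in [wp]. Its quartic and cubic terms
    cancel, and the vanishing of the three coefficients of the remaining quadratic gives Ramanujan's
    relations. *)
Lemma Ramanujan_relations :
  dsum q 2 = (E4q q - E2q q ^ 2) / 288 /\ dsum q 4 = (E2q q * E4q q - E6q q) / 720 /\
  dsum q 6 = (E4q q ^ 2 - E2q q * E6q q) / 1008.
Proof.
set (A := E2q q); set (B := E4q q); set (D := E6q q).
set (h := A ^ 2 / 24 + 12 * dsum q 2).
destruct (quadratic_unbounded_zero
  (- 140 * h ^ 2 + 7 / 6 * B * h + 7 / 36 * A * D + 196 * dsum q 6)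
  (42 * (B * A / 18 - 40 * dsum q 4) - 7 / 3 * D) (840 * h - 35 * B)) as (H2 & H1 & H0).
- intros M; destruct (wp_unbounded M 0 ltac:(lra)) as (r & Hr0 & Hr1 & Hr2 & Hr3).
  exists (wp (RtoC r)); split; [assumption|].
  assert (Hu : (Cmod q < Cmod (RtoC r) < 1)%R) by (rewrite Cmod_R, Rabs_pos_eq; lra).
  pose proof (lp_11 q Hq _ Hu) as E11; pose proof (lp_13 q Hq _ Hu) as E13.
  pose proof (lp_33 q Hq _ Hu) as E33; pose proof (lp_15 q Hq _ Hu) as E15.
  unfold wp, h, A, B, D; clear h A B D.
  set (A := E2q q) in *; set (B := E4q q) in *; set (D := E6q q) in *.
  set (p1 := lp q 1 (RtoC r)) in *; set (p3 := lp q 3 (RtoC r)) in *.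
  set (p5 := lp q 5 (RtoC r)) in *; set (p7 := lp q 7 (RtoC r)) in *.
  assert (F3 : p3 = 6 * p1 * p1 + A * p1 - 12 * dsum q 2) by (rewrite <- Cmult_assoc, E11; field).
  assert (F5 : p5 = 20 * (p1 * p3) + 5 / 3 * A * p3 - 2 / 3 * B * p1 - 40 * dsum q 4) by (rewrite E13; field).
  assert (F : 42 * (p1 * p5) - 140 * (p3 * p3) + 7 / 2 * A * p5 - 7 / 6 * B * p3 - 7 / 3 * D * p1 + 196 * dsum q 6 = 0)
    by (rewrite E15, E33; field).
  rewrite <- F, F5, F3; field.
- assert (Hh : h = B / 24).
  { replace h with ((840 * h - 35 * B) / 840 + B / 24) by field; rewrite H2; field. }
  split; [|split].
  + replace (dsum q 2) with ((h - A ^ 2 / 24) / 12) by (unfold h; field); rewrite Hh; field.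
  + replace (dsum q 4) with ((A * B - D) / 720 - (42 * (B * A / 18 - 40 * dsum q 4) - 7 / 3 * D) / 1680)
      by field; rewrite H1; field.
  + replace (dsum q 6) with ((B ^ 2 - A * D) / 1008 + (- 140 * (B / 24) ^ 2 + 7 / 6 * B * (B / 24) + 7 / 36 * A * D + 196 * dsum q 6) / 196)
      by field; rewrite <- Hh, H0; field.
Qed.

Lemma lp_3_wp u : (Cmod q < Cmod u < 1)%R -> lp q 3 u = 6 * wp u ^ 2 - E4q q / 24.
Proof.
intros Hu; pose proof (lp_11 q Hq u Hu) as E.
replace (lp q 3 u) with (6 * (lp q 1 u * lp q 1 u) + E2q q * lp q 1 u - 12 * dsum q 2) by (rewrite E; field).
rewrite (proj1 Ramanujan_relations); unfold wp; field.
Qed.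

(** Weierstrass's cubic equation: [lp_22] supplies the square of the derivative, [lp_13] eliminates
    [lp q 5]. *)
Lemma lp_2_wp u : (Cmod q < Cmod u < 1)%R ->
  lp q 2 u ^ 2 = 4 * wp u ^ 3 - E4q q / 12 * wp u + E6q q / 216.
Proof.
intros Hu; pose proof (lp_13 q Hq u Hu) as E; pose proof (lp_22 q Hq u Hu) as E2.
pose proof (lp_3_wp u Hu) as E3.
assert (F5 : lp q 5 u = 20 * wp u * lp q 3 u - 2 / 3 * E4q q * lp q 1 u - 40 * dsum q 4).
{ unfold wp; replace (20 * (lp q 1 u + E2q q / 12) * lp q 3 u)
    with (20 * (lp q 1 u * lp q 3 u) + 5 / 3 * E2q q * lp q 3 u) by field; rewrite E; field. }
replace (lp q 2 u ^ 2) with (lp q 2 u * lp q 2 u) by ring.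
rewrite E2, F5, E3, (proj1 (proj2 Ramanujan_relations)).
replace (lp q 1 u) with (wp u - E2q q / 12) by (unfold wp; ring); field.
Qed.

End Weierstrass.

Section Nome.
Variable q : C.
Hypothesis Hq : 0 < Cmod q < 1.

(* The value at u = -1 of the continuation of [lp q 1] to the unit circle. *)
Definition lp_half : C :=
  (- 1 / 4 + 2 * tsum (fun n : nat => (- RtoC 1) ^ S n * (ntoC (S n) * bet q n)))%C.

(** Translation by the half period 1/2 is u to -u. After subtracting [lp_half] from both factors the
    product is constant; [kappa] is left as a series here, since evaluation at one point determines
    it later. *)
Lemma lp_neg_product : exists kappa : C, forall u, Cmod q < Cmod u < 1 ->
  (lp q 1 u * lp q 1 (- u) = kappa + lp_half * (lp q 1 u + lp q 1 (- u)))%C.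
Proof.
set (e := (- RtoC 1)%C).
assert (He : (e * e)%C = 1) by (unfold e; ring).
assert (He0 : e <> 0) by now apply sign_neq_0.
exists (tsum (fun m => (weight e 1 1 0 m * (lam q m * lam q (- m)))%C)).
intros u Hu.
assert (Hu0 : u <> 0) by (apply Cmod_neq_0; lra).
assert (Hu' : Cmod q < Cmod (- u) < 1) by now rewrite Cmod_opp.
destruct (lp_product q Hq 1 1 e u (fun N => lp_half * (ZtoC N * (1 + zpow e N)))%C
  _ (le_n _) (le_n _) He Hu eq_refl) as [HS HP].
- intros N HN.
  (* A discrete primitive of (-1)^m m (N - m): because of the alternating sign, the polynomial P in
     the bracket has to satisfy P(m) + P(m - 1) = m (N - m). *)
  destruct (tsum_lam_diff q Hq (weight e 1 1 N)
    (fun m => zpow e m * (- (1 / 2) * ZtoC m ^ 2 + (ZtoC N - 1) / 2 * ZtoC m + ZtoC N / 4))%C N) as [HS HT].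
  + now apply pgrow_weight.
  + intros m; unfold weight.
    replace (zpow e m) with (- zpow e (m - 1))%C.
    * rewrite !ZtoC_minus; change (ZtoC 1) with (RtoC 1); field.
    * replace m with (m - 1 + 1)%Z at 2 by lia; rewrite zpow_succ by assumption; unfold e; ring.
  + split; [exact HS|]; rewrite HT; clear HT HS.
    assert (SB : summable (fun n : nat => (e ^ S n * (ntoC (S n) * bet q n))%C)).
    { apply (summable_ext (fun n : nat => (zpow e (Z.of_nat (S n)) * ZtoC (Z.of_nat (S n)) * bet q n)%C)).
      - intros n; rewrite zpow_nat, ZtoC_nat; ring.
      - apply (summable_growth_bet q Hq (fun n => (zpow e n * ZtoC n)%C)).
        apply pgrow_mult; [now apply pgrow_zpow_sign|apply pgrow_id]. }
    rewrite (tsum_ext _ (fun n : nat => (2 * ZtoC N * (1 + zpow e N)) * (e ^ S n * (ntoC (S n) * bet q n)))%C).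
    * rewrite tsum_scal by assumption; unfold lp_half; fold e.
      change (ZtoC 0) with (RtoC 0); rewrite zpow_0; field.
    * intros k; unfold weight.
      rewrite !ZtoC_minus, !ZtoC_plus, !ZtoC_opp, !ZtoC_nat.
      unfold Z.sub; rewrite !zpow_add, !zpow_neg, !zpow_nat by assumption.
      assert (Ei : (/ e ^ S k)%C = (e ^ S k)%C).
      { rewrite <- zpow_nat; pose proof (zpow_neq_0 e (Z.of_nat (S k)) He0).
        replace (/ zpow e (Z.of_nat (S k)))%C with (1 * / zpow e (Z.of_nat (S k)))%C by ring.
        rewrite <- (zpow_sign_sq e (Z.of_nat (S k)) He); field; assumption. }
      rewrite Ei; ring.
- replace (- u)%C with (e * u)%C in * by (unfold e; ring).
  rewrite HP; f_equal.
  unfold lp; rewrite <- tsum_plus, <- tsum_scal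
    by (try apply summable_plus; apply summable_lterm; assumption).
  apply tsum_ext; intros N; unfold lterm; rewrite !zpow_mult by assumption.
  transitivity (lp_half * ZtoC N * lam q N * zpow u N * (zpow e N + zpow e N * zpow e N))%C; [ring|].
  rewrite zpow_sign_sq by assumption; ring.
Qed.

End Nome.

(** * The complex exponential *)

Lemma Cexp_plus (z w : C) : Cexp (z + w) = (Cexp z * Cexp w)%C.
Proof.
unfold Cexp; destruct z as [a b], w as [c d]; simpl.
rewrite exp_plus, cos_plus, sin_plus; unfold Cmult, RtoC; simpl; f_equal; ring.
Qed.

Lemma Cexp_0 : Cexp 0 = 1.
Proof. unfold Cexp; simpl; rewrite exp_0, cos_0, sin_0; unfold Cmult, RtoC; simpl; f_equal; ring. Qed.

Lemma Cmod_Cexp (z : C) : Cmod (Cexp z) = exp (Re z).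
Proof.
unfold Cexp; rewrite Cmod_mult, Cmod_R, Rabs_pos_eq by (left; apply exp_pos).
unfold Cmod at 1; simpl.
replace (cos (Im z) * (cos (Im z) * 1) + sin (Im z) * (sin (Im z) * 1)) with 1
  by (pose proof (sin2_cos2 (Im z)) as H; unfold Rsqr in H; lra).
rewrite sqrt_1; ring.
Qed.

Lemma Cexp_neq_0 (z : C) : Cexp z <> 0.
Proof. apply Cmod_neq_0; rewrite Cmod_Cexp; apply exp_pos. Qed.

Lemma Cexp_opp (z : C) : Cexp (- z) = (/ Cexp z)%C.
Proof.
pose proof (Cexp_neq_0 z).
replace (Cexp (- z)) with (Cexp (- z) * Cexp z / Cexp z)%C by (field; assumption).
rewrite <- Cexp_plus; replace (- z + z)%C with (RtoC 0) by ring; rewrite Cexp_0; field; assumption.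
Qed.

Lemma Cexp_real (x : R) : Cexp (RtoC x) = RtoC (exp x).
Proof. unfold Cexp; simpl; rewrite cos_0, sin_0; unfold Cmult, RtoC; simpl; f_equal; ring. Qed.

Lemma Cexp_nat_mult (n : nat) (z : C) : Cexp (ntoC n * z) = (Cexp z ^ n)%C.
Proof.
induction n as [|n IH]; [unfold ntoC; simpl; rewrite Cmult_0_l; apply Cexp_0|].
rewrite ntoC_S, Cpow_S, <- IH, <- Cexp_plus; f_equal; ring.
Qed.

(** By the mean value theorem a bound of order |t|^n on the derivative gains one order. The Taylor
    remainders of exp, sin and cos follow by iteration. *)
Lemma derive_bound (h h' : R -> R) (K : R) (n : nat) (x : R) : 0 <= K -> h 0 = 0 ->
  (forall t, is_derive h t (h' t)) ->
  (forall t, Rabs t <= Rabs x -> Rabs (h' t) <= K * Rabs t ^ n) ->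
  Rabs (h x) <= K * Rabs x ^ S n.
Proof.
intros HK H0 Hd Hb.
destruct (MVT_gen h 0 x h') as (c & Hc & E).
- intros t _; apply Hd.
- intros t _. apply continuity_pt_filterlim.
  apply (ex_derive_continuous (K := R_AbsRing) (V := R_NormedModule)); eexists; apply Hd.
- rewrite H0, !Rminus_0_r in E; rewrite E, Rabs_mult.
  assert (Hcx : Rabs c <= Rabs x).
  { destruct (Rle_dec 0 x) as [h0|h0].
    - rewrite Rmin_left, Rmax_right in Hc by lra; rewrite !Rabs_pos_eq; lra.
    - rewrite Rmin_right, Rmax_left in Hc by lra; rewrite !Rabs_left1; lra. }
  simpl; rewrite (Rmult_comm (Rabs x)), <- Rmult_assoc.
  apply Rmult_le_compat_r; [apply Rabs_pos|].
  eapply Rle_trans; [apply Hb, Hcx|]; apply Rmult_le_compat_l; [assumption|].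
  apply pow_incr; split; [apply Rabs_pos|assumption].
Qed.

Lemma exp_rem1 (x : R) : Rabs (exp x - 1) <= exp (Rabs x) * Rabs x.
Proof.
rewrite <- (pow_1 (Rabs x)) at 2.
apply (derive_bound (fun t => exp t - 1) exp); [left; apply exp_pos|rewrite exp_0; ring| |].
- intros t; auto_derive; [trivial|ring].
- intros t Ht; rewrite pow_O, Rmult_1_r, Rabs_pos_eq by (left; apply exp_pos).
  destruct (Rle_lt_or_eq_dec t (Rabs x)) as [h|h]; [pose proof (Rle_abs t); lra| |];
  [left; now apply exp_increasing|rewrite h; lra].
Qed.

Lemma exp_Rabs_mono t x : Rabs t <= Rabs x -> exp (Rabs t) <= exp (Rabs x).
Proof.
intros H; destruct (Rle_lt_or_eq_dec _ _ H) as [h|h]; [left; now apply exp_increasing|rewrite h; lra].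
Qed.

Lemma exp_rem2 (x : R) : Rabs (exp x - 1 - x) <= exp (Rabs x) * Rabs x ^ 2.
Proof.
apply (derive_bound (fun t => exp t - 1 - t) (fun t => exp t - 1)); [left; apply exp_pos|rewrite exp_0; ring| |].
- intros t; auto_derive; [trivial|ring].
- intros t Ht; rewrite pow_1; eapply Rle_trans; [apply exp_rem1|].
  apply Rmult_le_compat_r; [apply Rabs_pos|now apply exp_Rabs_mono].
Qed.

Lemma exp_rem3 (x : R) : Rabs (exp x - 1 - x - x ^ 2 / 2) <= exp (Rabs x) * Rabs x ^ 3.
Proof.
apply (derive_bound (fun t => exp t - 1 - t - t ^ 2 / 2) (fun t => exp t - 1 - t)); [left; apply exp_pos|rewrite exp_0; field| |].
- intros t; auto_derive; [trivial|field].
- intros t Ht; eapply Rle_trans; [apply exp_rem2|].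
  apply Rmult_le_compat_r; [apply pow_le, Rabs_pos|now apply exp_Rabs_mono].
Qed.

Lemma sin_rem1 (x : R) : Rabs (sin x) <= Rabs x.
Proof.
replace (Rabs x) with (1 * Rabs x ^ 1) by ring.
apply (derive_bound sin cos); [lra|apply sin_0| |].
- intros t; auto_derive; [trivial|ring].
- intros t _; simpl; rewrite Rmult_1_r; apply Rabs_le; apply COS_bound.
Qed.

Lemma cos_rem2 (x : R) : Rabs (cos x - 1) <= Rabs x ^ 2.
Proof.
rewrite <- (Rmult_1_l (Rabs x ^ 2)).
apply (derive_bound (fun t => cos t - 1) (fun t => - sin t)); [lra|rewrite cos_0; ring| |].
- intros t; auto_derive; [trivial|ring].
- intros t _; rewrite Rabs_Ropp, pow_1, Rmult_1_l; apply sin_rem1.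
Qed.

Lemma sin_rem3 (x : R) : Rabs (sin x - x) <= Rabs x ^ 3.
Proof.
rewrite <- (Rmult_1_l (Rabs x ^ 3)).
apply (derive_bound (fun t => sin t - t) (fun t => cos t - 1)); [lra|rewrite sin_0; ring| |].
- intros t; auto_derive; [trivial|ring].
- intros t _; rewrite Rmult_1_l; apply cos_rem2.
Qed.

Lemma sin_rem2 (x : R) : Rabs (sin x - x) <= 2 * Rabs x ^ 2.
Proof.
apply (derive_bound (fun t => sin t - t) (fun t => cos t - 1)); [lra|rewrite sin_0; ring| |].
- intros t; auto_derive; [trivial|ring].
- intros t _; rewrite pow_1.
  destruct (Rle_dec (Rabs t) 1) as [h|h].
  + eapply Rle_trans; [apply cos_rem2|]; pose proof (Rabs_pos t); nra.
  + pose proof (COS_bound t); apply Rabs_le; lra.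
Qed.

Lemma cos_rem4 (x : R) : Rabs (cos x - 1 + x ^ 2 / 2) <= Rabs x ^ 4.
Proof.
rewrite <- (Rmult_1_l (Rabs x ^ 4)).
apply (derive_bound (fun t => cos t - 1 + t ^ 2 / 2) (fun t => - (sin t - t))); [lra|rewrite cos_0; field| |].
- intros t; auto_derive; [trivial|field].
- intros t _; rewrite Rabs_Ropp, Rmult_1_l; apply sin_rem3.
Qed.

Lemma Im_le_Cmod (z : C) : Rabs (Im z) <= Cmod z.
Proof. eapply Rle_trans; [apply Rmax_r|apply Rmax_Cmod]. Qed.

Lemma exp_Re_le (z : C) : exp (Re z) <= exp (Cmod z).
Proof.
pose proof (re_le_Cmod z) as H; pose proof (Rle_abs (Re z)).
destruct (Rle_lt_or_eq_dec (Re z) (Cmod z)) as [h|h]; [lra|left; now apply exp_increasing|rewrite h; lra].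
Qed.

Lemma exp_Rabs_Re_le (z : C) : exp (Rabs (Re z)) <= exp (Cmod z).
Proof.
pose proof (re_le_Cmod z) as H.
destruct (Rle_lt_or_eq_dec _ _ H) as [h|h]; [left; now apply exp_increasing|rewrite h; lra].
Qed.

Lemma Cexp_rem1 (z : C) : Cmod (Cexp z - 1) <= 3 * exp (Cmod z) * Cmod z.
Proof.
destruct z as [a b].
pose proof (exp_Re_le (a, b)) as E1; pose proof (exp_Rabs_Re_le (a, b)) as E2.
pose proof (re_le_Cmod (a, b)) as M1; pose proof (Im_le_Cmod (a, b)) as M2; simpl in E1, E2, M1, M2.
set (m := Cmod (a, b)) in *.
pose proof (Rabs_pos a) as P1; pose proof (Rabs_pos b) as P2; pose proof (exp_pos m) as P3.
replace (Cexp (a, b) - 1)%C with (RtoC (exp a - 1) + RtoC (exp a) * ((cos b - 1)%R, sin b))%C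
  by (apply injective_projections; simpl; ring).
eapply Rle_trans; [apply Cmod_triangle|].
rewrite Cmod_mult, !Cmod_R, (Rabs_pos_eq (exp a)) by (left; apply exp_pos).
pose proof (exp_rem1 a) as H1.
assert (H2 : Cmod (cos b - 1, sin b) <= 2 * Rabs b).
{ eapply Rle_trans; [apply Cmod_le_parts|].
  pose proof (sin_rem1 b).
  assert (Rabs (cos b - 1) <= 1 * Rabs b ^ 1); [|lra].
  apply (derive_bound (fun t => cos t - 1) (fun t => - sin t)); [lra|rewrite cos_0; ring| |].
  - intros t; auto_derive; [trivial|ring].
  - intros t _; rewrite Rabs_Ropp, pow_O, Rmult_1_r; apply Rabs_le; apply SIN_bound. }
assert (H3 : Rabs (exp a - 1) <= exp m * m).
{ eapply Rle_trans; [exact H1|]; apply Rmult_le_compat; try lra; left; apply exp_pos. }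
assert (H4 : exp a * Cmod (cos b - 1, sin b) <= exp m * (2 * m)).
{ apply Rmult_le_compat; try lra; [left; apply exp_pos|apply Cmod_ge_0]. }
lra.
Qed.

Lemma Cexp_rem2 (z : C) : Cmod (Cexp z - 1 - z) <= 5 * exp (Cmod z) * Cmod z ^ 2.
Proof.
destruct z as [a b].
pose proof (exp_Re_le (a, b)) as E1; pose proof (exp_Rabs_Re_le (a, b)) as E2.
pose proof (re_le_Cmod (a, b)) as M1; pose proof (Im_le_Cmod (a, b)) as M2; simpl in E1, E2, M1, M2.
set (m := Cmod (a, b)) in *.
pose proof (Rabs_pos a) as P1; pose proof (Rabs_pos b) as P2; pose proof (exp_pos m) as P3.
replace (Cexp (a, b) - 1 - (a, b))%C with (RtoC (exp a - 1 - a) +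
  (RtoC (exp a) * ((cos b - 1)%R, (sin b - b)%R) + Ci * (RtoC (exp a - 1) * RtoC b)))%C
  by (apply injective_projections; simpl; ring).
eapply Rle_trans; [apply Cmod_triangle|].
eapply Rle_trans; [apply Rplus_le_compat_l, Cmod_triangle|].
rewrite !Cmod_mult, Cmod_Ci, !Cmod_R, (Rabs_pos_eq (exp a)) by (left; apply exp_pos).
assert (Mb : Rabs b ^ 2 <= m ^ 2) by (apply pow_incr; lra).
assert (Ma : Rabs a ^ 2 <= m ^ 2) by (apply pow_incr; lra).
assert (H1 : Rabs (exp a - 1 - a) <= exp m * m ^ 2).
{ eapply Rle_trans; [apply exp_rem2|]; apply Rmult_le_compat; try lra; [left; apply exp_pos|apply pow_le; lra]. }
assert (H2 : Cmod (cos b - 1, sin b - b) <= 3 * m ^ 2).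
{ eapply Rle_trans; [apply Cmod_le_parts|].
  pose proof (cos_rem2 b); pose proof (sin_rem2 b); lra. }
assert (H3 : exp a * Cmod (cos b - 1, sin b - b) <= exp m * (3 * m ^ 2)).
{ apply Rmult_le_compat; try lra; [left; apply exp_pos|apply Cmod_ge_0]. }
assert (H4 : Rabs (exp a - 1) * Rabs b <= exp m * m * m).
{ apply Rmult_le_compat; try lra; [apply Rabs_pos|].
  eapply Rle_trans; [apply exp_rem1|]; apply Rmult_le_compat; try lra; left; apply exp_pos. }
nra.
Qed.

Lemma Cexp_rem3 (z : C) : Cmod z <= 2 ->
  Cmod (Cexp z - 1 - z - z ^ 2 / 2) <= 10 * exp 2 * Cmod z ^ 3.
Proof.
intros Hz; destruct z as [a b].
pose proof (exp_Re_le (a, b)) as E1; pose proof (exp_Rabs_Re_le (a, b)) as E2.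
pose proof (re_le_Cmod (a, b)) as M1; pose proof (Im_le_Cmod (a, b)) as M2; simpl in E1, E2, M1, M2.
set (m := Cmod (a, b)) in *.
pose proof (Rabs_pos a) as P1; pose proof (Rabs_pos b) as P2.
assert (Em : exp m <= exp 2).
{ destruct (Rle_lt_or_eq_dec _ _ Hz) as [h|h]; [left; now apply exp_increasing|rewrite h; lra]. }
assert (P3 : 1 <= exp 2) by (pose proof (exp_ineq1_le 2); lra).
replace (Cexp (a, b) - 1 - (a, b) - (a, b) ^ 2 / 2)%C with (RtoC (exp a - 1 - a - a ^ 2 / 2) +
  (RtoC (exp a) * ((cos b - 1 + b ^ 2 / 2)%R, (sin b - b)%R) +
  (Ci * (RtoC (exp a - 1 - a) * RtoC b) + - (RtoC (exp a - 1) * RtoC (b ^ 2 / 2)))))%C.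
2:{ unfold Cdiv; replace (/ 2)%C with (RtoC (/ 2)) by (rewrite RtoC_inv by lra; reflexivity).
    apply injective_projections; simpl; field. }
eapply Rle_trans; [apply Cmod_triangle|].
eapply Rle_trans; [apply Rplus_le_compat_l, Cmod_triangle|].
eapply Rle_trans; [apply Rplus_le_compat_l, Rplus_le_compat_l, Cmod_triangle|].
rewrite Cmod_opp, !Cmod_mult, Cmod_Ci, !Cmod_R, (Rabs_pos_eq (exp a)) by (left; apply exp_pos).
assert (Mb : Rabs b ^ 2 <= m ^ 2) by (apply pow_incr; lra).
assert (Mb3 : Rabs b ^ 3 <= m ^ 3) by (apply pow_incr; lra).
assert (Ma : Rabs a ^ 2 <= m ^ 2) by (apply pow_incr; lra).
assert (Ma3 : Rabs a ^ 3 <= m ^ 3) by (apply pow_incr; lra).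
assert (Pm : 0 <= m) by lra.
assert (Pm2 : 0 <= m ^ 2) by (apply pow_le; lra).
assert (Pm3 : 0 <= m ^ 3) by (apply pow_le; lra).
assert (Pe : 0 <= exp (Rabs a)) by (left; apply exp_pos).
assert (H1 : Rabs (exp a - 1 - a - a ^ 2 / 2) <= exp 2 * m ^ 3).
{ eapply Rle_trans; [apply exp_rem3|]; apply Rmult_le_compat; try lra; apply pow_le; lra. }
assert (H2 : Cmod (cos b - 1 + b ^ 2 / 2, sin b - b) <= 3 * m ^ 3).
{ eapply Rle_trans; [apply Cmod_le_parts|].
  pose proof (cos_rem4 b) as C4; pose proof (sin_rem3 b).
  assert (Rabs b ^ 4 <= 2 * m ^ 3); [|lra].
  replace (Rabs b ^ 4) with (Rabs b * Rabs b ^ 3) by ring.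
  apply Rmult_le_compat; try lra; apply pow_le; lra. }
assert (H3 : exp a * Cmod (cos b - 1 + b ^ 2 / 2, sin b - b) <= exp 2 * (3 * m ^ 3)).
{ apply Rmult_le_compat; try lra; [left; apply exp_pos|apply Cmod_ge_0]. }
assert (H4 : Rabs (exp a - 1 - a) * Rabs b <= exp 2 * m ^ 2 * m).
{ apply Rmult_le_compat; try lra; [apply Rabs_pos|].
  eapply Rle_trans; [apply exp_rem2|]; apply Rmult_le_compat; try lra; apply pow_le; lra. }
assert (H5 : Rabs (exp a - 1) * Rabs (b ^ 2 / 2) <= exp 2 * m * m ^ 2).
{ apply Rmult_le_compat; try apply Rabs_pos.
  - eapply Rle_trans; [apply exp_rem1|]; apply Rmult_le_compat; lra.
  - rewrite Rabs_pos_eq by (apply Rmult_le_pos; [apply pow2_ge_0|lra]).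
    rewrite <- pow2_abs; lra. }
nra.
Qed.

(** * Partial fractions of the squared cosecant *)

(** [phi] cuts the index set into finitely many classes and [g] parametrises each. It is applied to
    parity on Z and to residues modulo N on the lattice. *)
Lemma tsum_classes {I J K : Type} (phi : I -> J) (g : J -> K -> I) (L : list J) (F : I -> C) :
  NoDup L -> (forall i, In (phi i) L) ->
  (forall j, In j L -> forall k k', g j k = g j k' -> k = k') ->
  (forall j, In j L -> forall k, phi (g j k) = j) ->
  (forall i, exists k, g (phi i) k = i) -> summable F ->
  tsum F = csum L (fun j => tsum (fun k => F (g j k))).
Proof.
intros HL Hin Hinj Hphi Hsurj HF.
rewrite (tsum_fiber phi) by assumption.
transitivity (csum L (fun j => tsum (mask (fun i => phi i = j) F))).
- apply tsum_eq, has_sum_finite; [assumption|].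
  intros j Hj; apply tsum_eq, (has_sum_finite nil); [constructor|].
  intros i _; unfold mask; destruct excluded_middle_informative; [|reflexivity].
  subst; exfalso; apply Hj, Hin.
- apply csum_ext; intros j Hj.
  assert (H0 : forall i, (forall k, g j k <> i) -> mask (fun i => phi i = j) F i = RtoC 0).
  { intros i Hi; unfold mask; destruct excluded_middle_informative; [|reflexivity].
    destruct (Hsurj i) as [k Hk]; subst; exfalso; apply (Hi k), Hk. }
  rewrite (tsum_inj (g j) (Hinj j Hj) _ H0) by now apply summable_mask.
  apply tsum_ext; intros k; unfold mask; destruct excluded_middle_informative as [e|e]; [reflexivity|].
  exfalso; apply e; auto.
Qed.

Lemma tsum_Z_parity (F : Z -> C) : summable F ->
  tsum F = (tsum (fun m => F (2 * m)%Z) + tsum (fun m => F (2 * m + 1)%Z))%C.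
Proof.
intros HF.
rewrite (tsum_classes (fun n => (n mod 2)%Z) (fun r m => (2 * m + r)%Z) (0 :: 1 :: nil)%Z F).
- simpl; rewrite Cplus_0_r; f_equal; apply tsum_ext; intros m; f_equal; lia.
- repeat constructor; simpl; intuition lia.
- intros n; simpl; pose proof (Z.mod_pos_bound n 2 ltac:(lia)); lia.
- intros j _ k k' E; lia.
- intros j Hj k; simpl in Hj; rewrite Z.add_comm, Z.mul_comm, Z_mod_plus_full; apply Z.mod_small.
  destruct Hj as [<-|[<-|[]]]; lia.
- intros n; exists (n / 2)%Z; pose proof (Z.div_mod n 2 ltac:(lia)); lia.
- assumption.
Qed.

(* The exponent 5/4 leaves room on both sides: it exceeds 1, and products of
   two such weights dominate |lambda|^(-s) on a lattice for every s >= 5/2. *)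
Definition wt (n : Z) : R := Rpower (1 + Rabs (IZR n)) (- (5 / 4)).

Lemma wt_pos n : 0 < wt n.
Proof. apply exp_pos. Qed.

(** Integral comparison in algebraic form: with t = x^(-1/4) and s = (x + 1)^(-1/4) one has t^4 -
    s^4 = s^4 t^4, and factoring out t - s gives s^5 <= s^4 t <= 4 (t - s). *)
Lemma wt_nat_telescope (k : nat) : Rpower (INR (S (S k))) (- (5 / 4)) <=
  4 * (Rpower (INR (S k)) (- (1 / 4)) - Rpower (INR (S (S k))) (- (1 / 4))).
Proof.
set (x := INR (S k)); replace (INR (S (S k))) with (x + 1) by (unfold x; rewrite (S_INR (S k)); ring).
assert (Hx : 0 < x) by (apply lt_0_INR; lia).
set (t := Rpower x (- (1 / 4))); set (s := Rpower (x + 1) (- (1 / 4))).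
assert (Ht : 0 < t) by apply exp_pos.
assert (Hs : 0 < s) by apply exp_pos.
assert (Et : t ^ 4 * x = 1).
{ unfold t; rewrite <- Rpower_pow, Rpower_mult by apply exp_pos.
  replace (- (1 / 4) * INR 4) with (- (1)) by (simpl; field).
  rewrite Rpower_Ropp, Rpower_1 by assumption; field; lra. }
assert (Es : s ^ 4 * (x + 1) = 1).
{ unfold s; rewrite <- Rpower_pow, Rpower_mult by apply exp_pos.
  replace (- (1 / 4) * INR 4) with (- (1)) by (simpl; field).
  rewrite Rpower_Ropp, Rpower_1 by lra; field; lra. }
assert (E5 : Rpower (x + 1) (- (5 / 4)) = s ^ 5).
{ unfold s; rewrite <- Rpower_pow, Rpower_mult by apply exp_pos; f_equal; simpl; field. }
rewrite E5.
assert (Hst : s <= t).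
{ unfold s, t; rewrite !Rpower_Ropp; apply Rinv_le_contravar; [apply exp_pos|].
  apply Rle_Rpower_l; lra. }
assert (Ed : (t - s) * (t ^ 3 + t ^ 2 * s + t * s ^ 2 + s ^ 3) = s ^ 4 * t ^ 4).
{ transitivity (t ^ 4 - s ^ 4); [ring|].
  transitivity (t ^ 4 * (s ^ 4 * (x + 1)) - s ^ 4 * (t ^ 4 * x)); [rewrite Et, Es; ring|ring]. }
assert (T3 : 0 < t ^ 3) by (apply pow_lt; assumption).
assert (H4 : s ^ 4 * t ^ 4 <= (t - s) * (4 * t ^ 3)).
{ rewrite <- Ed; apply Rmult_le_compat_l; [lra|].
  assert (s ^ 2 <= t ^ 2) by (apply pow_incr; lra).
  assert (s ^ 3 <= t ^ 3) by (apply pow_incr; lra).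
  assert (0 <= t ^ 2) by (apply pow_le; lra).
  nra. }
assert (H5 : s ^ 4 * t <= 4 * (t - s)).
{ apply Rmult_le_reg_r with (t ^ 3); [assumption|]. nra. }
assert (0 < s ^ 4) by (apply pow_lt; assumption).
replace (s ^ 5) with (s ^ 4 * s) by ring.
nra.
Qed.

Lemma rsum_wt_nat_le (l : list nat) : NoDup l ->
  rsum l (fun n => Rpower (INR (S n)) (- (5 / 4))) <= 5.
Proof.
intros Hl.
apply Rle_trans with (rsum (seq 0 (S (list_max l))) (fun n => Rpower (INR (S n)) (- (5 / 4)))).
- apply rsum_incl; [intros; left; apply exp_pos|apply seq_NoDup|assumption|].
  intros i Hi; apply in_seq; split; [lia|].
  pose proof (proj1 (list_max_le l _) (Nat.le_refl _)) as Hm.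
  rewrite Forall_forall in Hm; specialize (Hm i Hi); lia.
- generalize (list_max l); intros N.
  assert (H : rsum (seq 0 (S N)) (fun n => Rpower (INR (S n)) (- (5 / 4))) <=
    5 - 4 * Rpower (INR (S N)) (- (1 / 4))).
  { induction N as [|N IH].
    - simpl; unfold Rpower; rewrite ln_1, !Rmult_0_r, exp_0; lra.
    - rewrite seq_S, rsum_app; unfold rsum at 2; cbn [fold_right Nat.add].
      pose proof (wt_nat_telescope N); lra. }
  pose proof (exp_pos (- (1 / 4) * ln (INR (S N)))); unfold Rpower in *; lra.
Qed.

Lemma summable_wt : summable (fun n : Z => RtoC (wt n)).
Proof.
assert (H : summable (fun n : nat => RtoC (Rpower (INR (S n)) (- (5 / 4))))).
{ exists 5; intros l Hl; eapply Rle_trans; [|apply (rsum_wt_nat_le l Hl)].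
  apply rsum_le; intros n _; rewrite Cmod_R, Rabs_pos_eq; [lra|left; apply exp_pos]. }
assert (E : forall n : nat, 1 + Rabs (IZR (Z.of_nat n)) = INR (S n)).
{ intros n; rewrite <- INR_IZR_INZ, Rabs_pos_eq by apply pos_INR; rewrite S_INR; ring. }
apply summable_Z; (apply (summable_ext (fun n : nat => RtoC (Rpower (INR (S n)) (- (5 / 4))))); [|assumption]);
  intros n; unfold wt; rewrite ?opp_IZR, ?Rabs_Ropp, E; reflexivity.
Qed.

Definition wt2 (p : Z * Z) : C := (RtoC (wt (fst p)) * RtoC (wt (snd p)))%C.

Lemma summable_wt2 : summable wt2.
Proof. apply (summable_prod (fun n => RtoC (wt n)) (fun n => RtoC (wt n))); apply summable_wt. Qed.

Lemma Cmod_wt2 p : Cmod (wt2 p) = wt (fst p) * wt (snd p).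
Proof.
unfold wt2; rewrite Cmod_mult, !Cmod_R, !Rabs_pos_eq by (left; apply wt_pos); reflexivity.
Qed.

Lemma Rpower_neg_antitone (x a b : R) : 1 <= x -> a <= b -> Rpower x (- b) <= Rpower x (- a).
Proof. intros Hx Hab; apply Rle_Rpower; lra. Qed.

Lemma inv_sq_le_wt (n : Z) : / (1 + Rabs (IZR n)) ^ 2 <= wt n.
Proof.
pose proof (Rabs_pos (IZR n)).
unfold wt; replace (/ (1 + Rabs (IZR n)) ^ 2) with (Rpower (1 + Rabs (IZR n)) (- (2))).
- apply Rpower_neg_antitone; lra.
- rewrite Rpower_Ropp; f_equal; apply (Rpower_pow 2); lra.
Qed.

Lemma dist_Z (x : R) : (forall m : Z, x + IZR m <> 0) ->
  exists eta, 0 < eta /\ forall m : Z, eta <= Rabs (x + IZR m).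
Proof.
intros Hx; destruct (archimed x) as [H1 H2]; set (n := up x) in *.
assert (A : 0 < IZR n - x) by lra.
assert (B : 0 < x - (IZR n - 1)).
{ destruct (Req_dec (x - (IZR n - 1)) 0) as [e|e]; [|lra].
  exfalso; apply (Hx (1 - n)%Z); rewrite minus_IZR; lra. }
exists (Rmin (IZR n - x) (x - (IZR n - 1))); split; [now apply Rmin_glb_lt|].
intros m; destruct (Z_le_gt_dec m (- n)) as [h|h].
- apply Rle_trans with (IZR n - x); [apply Rmin_l|].
  apply IZR_le in h; rewrite opp_IZR in h; rewrite Rabs_left1; lra.
- apply Rle_trans with (x - (IZR n - 1)); [apply Rmin_r|].
  assert (h' : (1 - n <= m)%Z) by lia; apply IZR_le in h'; rewrite minus_IZR in h'.
  rewrite Rabs_pos_eq; lra.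
Qed.

Definition not_integer (z : C) : Prop := forall m : Z, (z + ZtoC m)%C <> 0.

Lemma not_integer_lower (z : C) : not_integer z ->
  exists c, 0 < c /\ forall m : Z, c * (1 + Rabs (IZR m)) <= Cmod (z + ZtoC m).
Proof.
intros Hz.
assert (Heta : exists eta, 0 < eta /\ forall m : Z, eta <= Cmod (z + ZtoC m)).
{ destruct z as [x y]; destruct (Req_dec y 0) as [->|Hy].
  - destruct (dist_Z x) as (eta & H1 & H2).
    + intros m E; apply (Hz m); unfold ZtoC, RtoC, Cplus; simpl; rewrite E; f_equal; ring.
    + exists eta; split; [assumption|]; intros m; eapply Rle_trans; [apply H2|].
      apply (re_le_Cmod ((x, 0) + ZtoC m)%C).
  - exists (Rabs y); split; [now apply Rabs_pos_lt|]; intros m.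
    eapply Rle_trans; [|apply (Im_le_Cmod ((x, y) + ZtoC m)%C)]; simpl; rewrite Rplus_0_r; lra. }
destruct Heta as (eta & He & H).
pose proof (Cmod_ge_0 z) as P.
assert (K : 0 < (1 + Cmod z) / eta + 1) by (assert (0 < (1 + Cmod z) / eta) by (apply Rdiv_lt_0_compat; lra); lra).
exists (/ ((1 + Cmod z) / eta + 1)); split; [now apply Rinv_0_lt_compat|].
intros m; specialize (H m).
apply Rmult_le_reg_l with ((1 + Cmod z) / eta + 1); [assumption|].
rewrite <- Rmult_assoc, Rinv_r, Rmult_1_l by lra.
assert (H1 : Rabs (IZR m) <= Cmod (z + ZtoC m) + Cmod z).
{ rewrite <- Cmod_R; change (RtoC (IZR m)) with (ZtoC m).
  replace (ZtoC m) with (z + ZtoC m + - z)%C at 1 by ring.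
  eapply Rle_trans; [apply Cmod_triangle|]; rewrite Cmod_opp; lra. }
assert (H2 : 1 + Cmod z <= (1 + Cmod z) / eta * Cmod (z + ZtoC m)).
{ apply Rle_trans with ((1 + Cmod z) / eta * eta); [right; field; lra|].
  apply Rmult_le_compat_l; [apply Rlt_le, Rdiv_lt_0_compat|]; lra. }
lra.
Qed.

Definition row (z : C) : C := tsum (fun m : Z => (/ (z + ZtoC m) ^ 2)%C).

Lemma Cmod_inv_sq (z : C) : z <> 0 -> Cmod (/ z ^ 2) = / (Cmod z) ^ 2.
Proof. intros Hz; rewrite Cmod_inv by now apply Cpow_nz. now rewrite Cmod_pow. Qed.

Lemma summable_row_inv_sq (z : C) : not_integer z -> summable (fun m : Z => (/ (z + ZtoC m) ^ 2)%C).
Proof.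
intros Hz; destruct (not_integer_lower z Hz) as (c & Hc & H).
apply (summable_le_scal (/ c ^ 2) _ (fun m => RtoC (wt m))); [|apply summable_wt].
intros m; rewrite Cmod_inv_sq by apply Hz.
rewrite Cmod_R, Rabs_pos_eq by (left; apply wt_pos).
pose proof (Rabs_pos (IZR m)) as P.
eapply Rle_trans; [|apply Rmult_le_compat_l; [left; apply Rinv_0_lt_compat, pow_lt, Hc|apply inv_sq_le_wt]].
rewrite <- Rinv_mult, <- Rpow_mult_distr.
apply Rinv_le_contravar; [apply pow_lt, Rmult_lt_0_compat; lra|].
apply pow_incr; split; [apply Rmult_le_pos; lra|apply H].
Qed.

Lemma nome_plus (z w : C) : nome (z + w) = (nome z * nome w)%C.
Proof. unfold nome; rewrite <- Cexp_plus; f_equal; ring. Qed.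

Lemma nome_opp (z : C) : nome (- z) = (/ nome z)%C.
Proof. unfold nome; rewrite <- Cexp_opp; f_equal; ring. Qed.

Lemma nome_neq_0 (z : C) : nome z <> 0.
Proof. apply Cexp_neq_0. Qed.

Lemma nome_1 : nome 1 = 1.
Proof.
unfold nome, Cexp; simpl.
replace ((2 * PI * 0 - 0 * 1) * 1 - (2 * PI * 1 + 0 * 0) * 0) with 0 by ring.
replace ((2 * PI * 0 - 0 * 1) * 0 + (2 * PI * 1 + 0 * 0) * 1) with (2 * PI) by ring.
rewrite exp_0, cos_2PI, sin_2PI; apply injective_projections; simpl; ring.
Qed.

Lemma nome_half : nome (/ 2) = (- RtoC 1)%C.
Proof.
replace (/ 2)%C with (RtoC (/ 2)) by (rewrite RtoC_inv by lra; reflexivity).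
unfold nome, Cexp; simpl.
replace ((2 * PI * 0 - 0 * 1) * / 2 - (2 * PI * 1 + 0 * 0) * 0) with 0 by field.
replace ((2 * PI * 0 - 0 * 1) * 0 + (2 * PI * 1 + 0 * 0) * / 2) with PI by field.
rewrite exp_0, cos_PI, sin_PI; apply injective_projections; simpl; ring.
Qed.

Lemma nome_nat_mult (n : nat) (z : C) : nome (ntoC n * z) = (nome z ^ n)%C.
Proof.
unfold nome; rewrite <- Cexp_nat_mult; f_equal; ring.
Qed.

Lemma nome_ZtoC (m : Z) : nome (ZtoC m) = 1.
Proof.
destruct (Z_cases m) as [[k ->]|[k ->]].
- rewrite ZtoC_nat; replace (ntoC k) with (ntoC k * 1)%C by ring.
  rewrite nome_nat_mult, nome_1; apply Cpow_1_l.
- rewrite ZtoC_opp, ZtoC_nat, nome_opp; replace (ntoC (S k)) with (ntoC (S k) * 1)%C by ring.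
  rewrite nome_nat_mult, nome_1, Cpow_1_l; field; apply C1_nz.
Qed.

Lemma Cmod_nome (z : C) : Cmod (nome z) = exp (- (2 * PI * Im z)).
Proof.
unfold nome; rewrite Cmod_Cexp; f_equal; destruct z as [x y]; simpl; ring.
Qed.

Lemma nome_pair (x y : R) : nome (x, y) =
  (exp (- (2 * PI * y)) * cos (2 * PI * x), exp (- (2 * PI * y)) * sin (2 * PI * x)).
Proof.
unfold nome, Cexp; apply injective_projections; simpl.
- replace ((2 * PI * 0 - 0 * 1) * x - (2 * PI * 1 + 0 * 0) * y) with (- (2 * PI * y)) by ring.
  replace ((2 * PI * 0 - 0 * 1) * y + (2 * PI * 1 + 0 * 0) * x) with (2 * PI * x) by ring; ring.
- replace ((2 * PI * 0 - 0 * 1) * x - (2 * PI * 1 + 0 * 0) * y) with (- (2 * PI * y)) by ring.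
  replace ((2 * PI * 0 - 0 * 1) * y + (2 * PI * 1 + 0 * 0) * x) with (2 * PI * x) by ring; ring.
Qed.

Lemma Cmod_sq (z : C) : Cmod z ^ 2 = Re z ^ 2 + Im z ^ 2.
Proof. apply Cmod2_alt. Qed.

Lemma one_minus_nome_sq (x y : R) : Cmod (1 - nome (x, y)) ^ 2 =
  (1 - exp (- (2 * PI * y))) ^ 2 + 4 * exp (- (2 * PI * y)) * sin (PI * x) ^ 2.
Proof.
rewrite Cmod_sq, nome_pair; simpl.
set (e := exp (- (2 * PI * y))).
replace (2 * PI * x) with (2 * (PI * x)) by ring.
rewrite cos_2a_sin, sin_2a.
pose proof (sin2_cos2 (PI * x)) as H; unfold Rsqr in H.
set (s := sin (PI * x)) in *; set (c := cos (PI * x)) in *.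
replace ((1 + - (e * (1 - 2 * s * s))) * ((1 + - (e * (1 - 2 * s * s))) * 1) +
 (0 + - (e * (2 * s * c))) * ((0 + - (e * (2 * s * c))) * 1))
 with ((1 - e) ^ 2 + 4 * e * s ^ 2 * (1 - e) + 4 * e ^ 2 * s ^ 2 * (s * s + c * c)) by ring.
rewrite H; ring.
Qed.

Lemma sin_eq_0_integer (x : R) : sin (PI * x) = 0 -> exists k : Z, x = IZR k.
Proof.
intros H; destruct (sin_eq_0_0 _ H) as [k Hk]; exists k.
pose proof PI_RGT_0; apply Rmult_eq_reg_l with PI; [lra|lra].
Qed.

Lemma nome_neq_1 (z : C) : not_integer z -> (1 - nome z)%C <> 0.
Proof.
intros Hz E; destruct z as [x y].
assert (E2 : Cmod (1 - nome (x, y)) ^ 2 = 0) by (rewrite E, Cmod_0; ring).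
rewrite one_minus_nome_sq in E2.
pose proof (exp_pos (- (2 * PI * y))) as P.
pose proof (pow2_ge_0 (1 - exp (- (2 * PI * y)))) as P1.
pose proof (pow2_ge_0 (sin (PI * x))) as P2.
assert (E3 : (1 - exp (- (2 * PI * y))) ^ 2 = 0) by nra.
assert (E4 : sin (PI * x) ^ 2 = 0) by nra.
assert (E5 : sin (PI * x) = 0) by nra.
assert (E6 : exp (- (2 * PI * y)) = exp 0) by (rewrite exp_0; nra).
apply exp_inv in E6; pose proof PI_RGT_0.
assert (y = 0) by nra; subst y.
destruct (sin_eq_0_integer x E5) as [k ->].
apply (Hz (- k)%Z); unfold ZtoC, RtoC, Cplus; simpl; rewrite opp_IZR; f_equal; ring.
Qed.

(** This is pi^2/sin^2(pi z), written in u = e^(2 pi i z). *)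
Definition cot_sum (z : C) : C := (- (4 * RtoC PI ^ 2) * (nome z / (1 - nome z) ^ 2))%C.

Lemma sin_half_lower (a : R) : 0 <= a <= 2 -> a / 4 <= sin a.
Proof.
intros Ha; pose proof PI2_3_2 as H0; unfold PI2 in H0.
destruct (SIN a) as [H _]; [lra|lra|].
eapply Rle_trans; [|exact H].
unfold sin_lb, sin_approx, sin_term; simpl.
assert (0 <= a ^ 5) by (apply pow_le; lra).
assert (a ^ 3 <= 4 * a) by (simpl; nra).
assert (a ^ 2 <= 4) by (simpl; nra).
assert (a ^ 7 <= 4 * a ^ 5) by (replace (a ^ 7) with (a ^ 2 * a ^ 5) by ring; nra).
match goal with |- _ <= ?e => replace e with (a - a ^ 3 / 6 + a ^ 5 / 120 - a ^ 7 / 5040) by (simpl; field) end.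
lra.
Qed.

(** The right side is (2 sinh(t/2))^2 e^(-t), and 2 |sinh(t/2)| is at least |t/2|. *)
Lemma one_minus_exp_lower (t : R) : t ^ 2 / 4 * exp (- t) <= (1 - exp (- t)) ^ 2.
Proof.
pose proof (exp_pos (t / 2)) as P; pose proof (exp_pos (- (t / 2))) as Q.
assert (E1 : exp (- t) = exp (- (t / 2)) ^ 2) by (simpl; rewrite Rmult_1_r, <- exp_plus; f_equal; field).
assert (E2 : exp (t / 2) * exp (- (t / 2)) = 1) by (rewrite <- exp_plus, <- exp_0; f_equal; ring).
replace ((1 - exp (- t)) ^ 2) with ((exp (t / 2) - exp (- (t / 2))) ^ 2 * exp (- t)).
- apply Rmult_le_compat_r; [left; apply exp_pos|].
  replace (t ^ 2 / 4) with (Rabs (t / 2) ^ 2) by (rewrite pow2_abs; field).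
  rewrite <- (pow2_abs (exp (t / 2) - exp (- (t / 2)))).
  apply pow_incr; split; [apply Rabs_pos|].
  pose proof (exp_ineq1_le (t / 2)); pose proof (exp_ineq1_le (- (t / 2))).
  destruct (Rle_dec 0 t) as [h|h].
  + assert (exp (- (t / 2)) <= 1).
    { destruct (Rle_lt_or_eq_dec _ _ h) as [h'|h'].
      - rewrite <- exp_0; left; apply exp_increasing; lra.
      - replace (- (t / 2)) with 0 by lra; rewrite exp_0; lra. }
    rewrite !Rabs_pos_eq by lra; lra.
  + assert (exp (t / 2) <= 1) by (rewrite <- exp_0; left; apply exp_increasing; lra).
    rewrite !Rabs_left1 by lra; lra.
- rewrite E1; replace ((1 - exp (- (t / 2)) ^ 2)) with (exp (- (t / 2)) * (exp (t / 2) - exp (- (t / 2)))); [ring|].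
  replace (exp (- (t / 2)) * (exp (t / 2) - exp (- (t / 2)))) with (exp (t / 2) * exp (- (t / 2)) - exp (- (t / 2)) ^ 2) by ring.
  rewrite E2; ring.
Qed.

Lemma one_minus_nome_lower (z : C) : Rabs (Re z) <= 1 / 2 ->
  2 * Cmod z ^ 2 * Cmod (nome z) <= Cmod (1 - nome z) ^ 2.
Proof.
intros Hx; rewrite Cmod_nome; destruct z as [x y]; simpl in Hx; simpl Im.
rewrite one_minus_nome_sq, Cmod_sq; simpl Re; simpl Im.
set (e := exp (- (2 * PI * y))); assert (P : 0 < e) by apply exp_pos.
pose proof (one_minus_exp_lower (2 * PI * y)) as H1; fold e in H1.
assert (HPI : 3 < PI) by (pose proof PI2_3_2 as h; unfold PI2 in h; lra).
pose proof PI_4 as HPI4.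
assert (H2 : x ^ 2 / 2 <= sin (PI * x) ^ 2).
{ assert (Hs : 3 / 4 * Rabs x <= Rabs (sin (PI * x))).
  { destruct (Rle_dec 0 x) as [h|h].
    - rewrite (Rabs_pos_eq x) in * by lra.
      pose proof (sin_half_lower (PI * x) ltac:(split; nra)) as h1.
      pose proof (Rle_abs (sin (PI * x))); nra.
    - rewrite (Rabs_left1 x) in * by lra.
      pose proof (sin_half_lower (PI * - x) ltac:(split; nra)) as h1.
      replace (PI * x) with (- (PI * - x)) by ring; rewrite sin_neg, Rabs_Ropp.
      pose proof (Rle_abs (sin (PI * - x))); nra. }
  rewrite <- (pow2_abs x), <- (pow2_abs (sin (PI * x))).
  pose proof (Rabs_pos x).
  assert ((3 / 4 * Rabs x) ^ 2 <= Rabs (sin (PI * x)) ^ 2) by (apply pow_incr; lra).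
  pose proof (pow2_ge_0 (Rabs x)); nra. }
assert (H3 : 2 * y ^ 2 * e <= (2 * PI * y) ^ 2 / 4 * e).
{ apply Rmult_le_compat_r; [lra|].
  replace ((2 * PI * y) ^ 2 / 4) with (PI ^ 2 * y ^ 2) by field.
  apply Rmult_le_compat_r; [apply pow2_ge_0|simpl; nra]. }
nra.
Qed.

Lemma cot_sum_le (z : C) : not_integer z -> Rabs (Re z) <= 1 / 2 -> Cmod (cot_sum z) <= 32 / Cmod z ^ 2.
Proof.
intros Hz Hx.
assert (Hz0 : z <> 0) by (specialize (Hz 0%Z); unfold ZtoC in Hz; rewrite Cplus_0_r in Hz; assumption).
pose proof (one_minus_nome_lower z Hx) as H; pose proof (nome_neq_1 z Hz) as H1.
unfold cot_sum; rewrite Cmod_mult, Cmod_opp, Cmod_mult, Cmod_div, !Cmod_pow, !Cmod_R by now apply Cpow_nz.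
rewrite (Rabs_pos_eq 4), (Rabs_pos_eq PI) by (pose proof PI_RGT_0; lra).
apply Cmod_gt_0 in H1, Hz0.
assert (P2 : 0 < Cmod z ^ 2) by (apply pow_lt; assumption).
assert (P3 : 0 < Cmod (1 - nome z) ^ 2) by (apply pow_lt; assumption).
apply Rmult_le_reg_r with (Cmod z ^ 2 * Cmod (1 - nome z) ^ 2); [now apply Rmult_lt_0_compat|].
replace (4 * PI ^ 2 * (Cmod (nome z) / Cmod (1 - nome z) ^ 2) * (Cmod z ^ 2 * Cmod (1 - nome z) ^ 2))
  with (2 * PI ^ 2 * (2 * Cmod z ^ 2 * Cmod (nome z))) by (field; lra).
replace (32 / Cmod z ^ 2 * (Cmod z ^ 2 * Cmod (1 - nome z) ^ 2)) with (32 * Cmod (1 - nome z) ^ 2) by (field; lra).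
assert (2 * PI ^ 2 <= 32) by (pose proof PI_4; pose proof PI_RGT_0; simpl; nra).
pose proof (Cmod_ge_0 (nome z)).
apply Rmult_le_compat; try lra; [pose proof (pow2_ge_0 PI); lra|].
apply Rmult_le_pos; lra.
Qed.

(** With w = 2 pi i z the difference has the numerator w^2 e^w - (1 - e^w)^2, in which the terms of
    orders two and three cancel, over a denominator of order w^4. The radius 1/4 together with pi <=
    4 keeps |w| <= 2, the range of [Cexp_rem3]. *)
Lemma cot_sum_near_0 : exists M, 0 <= M /\
  forall z : C, z <> 0 -> Cmod z <= 1 / 4 -> not_integer z -> Cmod (cot_sum z - / z ^ 2) <= M.
Proof.
set (K := 10 * exp 2).
assert (PK : 0 < K) by (unfold K; pose proof (exp_pos 2); lra).
(* The bracket bounds the numerator divided by |w|^4, 4096 bounds 16 pi^4 through pi <= 4, and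
   e^(-2) is a lower bound for |e^w|. *)
exists ((1 / 4 + 4 * K ^ 2 + 2 * K) * 4096 / (2 * exp (- 2))).
split.
{ apply Rmult_le_pos; [|left; apply Rinv_0_lt_compat; pose proof (exp_pos (- 2)); lra].
  apply Rmult_le_pos; [|lra]. pose proof (pow2_ge_0 K); lra. }
intros z Hz0 Hz Hni.
set (w := (RtoC (2 * PI) * Ci * z)%C).
assert (HPI : 0 < PI) by apply PI_RGT_0.
pose proof PI_4 as HPI4.
assert (Hw : Cmod w = 2 * PI * Cmod z).
{ unfold w; rewrite !Cmod_mult, Cmod_Ci, Cmod_R, Rabs_pos_eq by lra; ring. }
assert (Hw2 : Cmod w <= 2) by (rewrite Hw; nra).
pose proof (nome_neq_1 z Hni) as Hu1.
assert (Hw0 : w <> 0).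
{ apply Cmod_neq_0; apply Cmod_gt_0 in Hz0; rewrite Hw; nra. }
pose proof (Cexp_rem3 w Hw2) as HR; fold K in HR.
set (R := (Cexp w - 1 - w - w ^ 2 / 2)%C) in HR.
change (nome z) with (Cexp w) in *.
assert (Eu : Cexp w = (1 + w + w ^ 2 / 2 + R)%C) by (unfold R; ring).
assert (EN : (w ^ 2 * Cexp w - (1 - Cexp w) ^ 2 = w ^ 4 / 4 - R ^ 2 - 2 * (w * R))%C)
  by (rewrite Eu; field).
assert (Ez : (z ^ 2)%C = (- (w ^ 2 / (4 * RtoC PI ^ 2)))%C).
{ unfold w; rewrite RtoC_mult.
  replace ((2 * RtoC PI * Ci * z) ^ 2)%C with (4 * RtoC PI ^ 2 * (Ci * Ci) * z ^ 2)%C by ring.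
  replace (Ci * Ci)%C with (- RtoC 1)%C by (apply injective_projections; simpl; ring).
  field; apply RtoC_neq_0; lra. }
assert (E : (cot_sum z - / z ^ 2)%C =
  (- (4 * RtoC PI ^ 2) * ((w ^ 4 / 4 - R ^ 2 - 2 * (w * R)) / (w ^ 2 * (1 - Cexp w) ^ 2)))%C).
{ rewrite <- EN, Ez; unfold cot_sum; change (nome z) with (Cexp w).
  field; repeat split; try assumption; try (apply RtoC_neq_0; lra). }
rewrite E.
pose proof (one_minus_nome_lower z ltac:(pose proof (re_le_Cmod z); lra)) as HL.
change (nome z) with (Cexp w) in HL.
set (m := Cmod w) in *; set (d := Cmod (1 - Cexp w)) in *.
assert (Hm : 0 < m) by now apply Cmod_gt_0.
assert (Hd : 0 < d) by now apply Cmod_gt_0.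
assert (Hu : exp (- 2) <= Cmod (Cexp w)).
{ rewrite Cmod_Cexp; pose proof (re_le_Cmod w) as h; fold m in h; apply Rabs_le_between in h.
  destruct (Rle_lt_or_eq_dec (- 2) (Re w)) as [h'|h']; [lra|left; now apply exp_increasing|rewrite h'; lra]. }
assert (Hnum : Cmod (w ^ 4 / 4 - R ^ 2 - 2 * (w * R)) <= (1 / 4 + 4 * K ^ 2 + 2 * K) * m ^ 4).
{ assert (HR0 := Cmod_ge_0 R).
  assert (H4 : Cmod (w ^ 4 / 4) = m ^ 4 / 4).
  { rewrite Cmod_div by (apply RtoC_neq_0; lra); rewrite Cmod_pow, Cmod_R, Rabs_pos_eq by lra; reflexivity. }
  assert (H5 : Cmod R ^ 2 <= 4 * K ^ 2 * m ^ 4).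
  { apply Rle_trans with ((K * m ^ 3) ^ 2); [apply pow_incr; lra|].
    replace ((K * m ^ 3) ^ 2) with (K ^ 2 * m ^ 4 * m ^ 2) by ring.
    replace (4 * K ^ 2 * m ^ 4) with (K ^ 2 * m ^ 4 * 4) by ring.
    apply Rmult_le_compat_l; [apply Rmult_le_pos; apply pow_le; lra|]. simpl; nra. }
  assert (H6 : Cmod (2 * (w * R)) <= 2 * K * m ^ 4).
  { rewrite !Cmod_mult, Cmod_R, Rabs_pos_eq by lra; fold m.
    replace (2 * K * m ^ 4) with (2 * (m * (K * m ^ 3))) by ring.
    apply Rmult_le_compat_l; [lra|]; apply Rmult_le_compat_l; lra. }
  unfold Cminus; eapply Rle_trans; [apply Cmod_triangle|]; rewrite Cmod_opp.
  assert (Cmod (w ^ 4 / 4 + - R ^ 2) <= m ^ 4 / 4 + Cmod R ^ 2); [|lra].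
  eapply Rle_trans; [apply Cmod_triangle|]; rewrite Cmod_opp, H4, Cmod_pow; lra. }
rewrite Cmod_mult, Cmod_opp, Cmod_mult, Cmod_div, Cmod_mult, !Cmod_pow, !Cmod_R
  by (apply Cmult_neq_0; now apply Cpow_nz).
rewrite (Rabs_pos_eq 4), (Rabs_pos_eq PI) by lra.
fold m d.
set (N := Cmod (w ^ 4 / 4 - R ^ 2 - 2 * (w * R))) in *.
assert (Hz2 : Cmod z ^ 2 = m ^ 2 / (4 * PI ^ 2)) by (rewrite Hw; field; lra).
assert (Hd2 : 2 * (m ^ 2 / (4 * PI ^ 2)) * exp (- 2) <= d ^ 2).
{ eapply Rle_trans; [|exact HL]; rewrite Hz2; apply Rmult_le_compat_l; [|assumption].
  apply Rmult_le_pos; [lra|]; left; apply Rdiv_lt_0_compat; [apply pow_lt; lra|].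
  apply Rmult_lt_0_compat; [lra|apply pow_lt; lra]. }
pose proof (exp_pos (- 2)) as Pe.
assert (Pd2 : 0 < d ^ 2) by (apply pow_lt; assumption).
assert (Pm2 : 0 < m ^ 2) by (apply pow_lt; assumption).
apply Rmult_le_reg_r with (m ^ 2 * d ^ 2); [now apply Rmult_lt_0_compat|].
replace (4 * PI ^ 2 * (N / (m ^ 2 * d ^ 2)) * (m ^ 2 * d ^ 2)) with (4 * PI ^ 2 * N) by (field; lra).
set (B := 1 / 4 + 4 * K ^ 2 + 2 * K) in *.
assert (PB : 0 < B) by (unfold B; pose proof (pow2_ge_0 K); lra).
apply Rle_trans with (4 * PI ^ 2 * (B * m ^ 4)).
{ apply Rmult_le_compat_l; [apply Rmult_le_pos; [lra|apply pow2_ge_0]|assumption]. }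
apply Rle_trans with (B * 4096 / (2 * exp (- 2)) * (m ^ 2 * (2 * (m ^ 2 / (4 * PI ^ 2)) * exp (- 2)))).
- replace (B * 4096 / (2 * exp (- 2)) * (m ^ 2 * (2 * (m ^ 2 / (4 * PI ^ 2)) * exp (- 2))))
    with (B * m ^ 4 * (1024 / PI ^ 2)) by (field; lra).
  replace (4 * PI ^ 2 * (B * m ^ 4)) with (B * m ^ 4 * (4 * PI ^ 2)) by ring.
  apply Rmult_le_compat_l; [apply Rmult_le_pos; [lra|apply pow_le; lra]|].
  apply Rmult_le_reg_r with (PI ^ 2); [apply pow_lt; lra|].
  replace (1024 / PI ^ 2 * PI ^ 2) with 1024 by (field; lra).
  assert (PI ^ 2 <= 16) by (simpl; nra).
  pose proof (pow2_ge_0 PI); nra.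
- apply Rmult_le_compat_l.
  + apply Rmult_le_pos; [lra|]; left; apply Rinv_0_lt_compat; lra.
  + apply Rmult_le_compat_l; lra.
Qed.

Lemma not_integer_shift (z : C) (k : Z) : not_integer z -> not_integer (z + ZtoC k).
Proof.
intros H m; specialize (H (k + m)%Z); rewrite ZtoC_plus in H.
now rewrite <- Cplus_assoc.
Qed.

Lemma cot_sum_shift (z : C) (k : Z) : cot_sum (z + ZtoC k) = cot_sum z.
Proof. unfold cot_sum; rewrite nome_plus, nome_ZtoC, Cmult_1_r; reflexivity. Qed.

Lemma row_shift (z : C) (k : Z) : not_integer z -> row (z + ZtoC k) = row z.
Proof.
intros Hz; unfold row.
rewrite (tsum_bij (fun m => m + k)%Z (fun m => m - k)%Z (fun m : Z => (/ (z + ZtoC m) ^ 2)%C))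
  by (try (intros; lia); now apply summable_row_inv_sq).
apply tsum_ext; intros m; rewrite ZtoC_plus; do 2 f_equal; ring.
Qed.

Lemma not_integer_halves (z : C) : not_integer z -> not_integer (z / 2) /\ not_integer ((z + 1) / 2).
Proof.
intros Hz; split; intros m E.
- apply (Hz (2 * m)%Z); rewrite ZtoC_mult; change (ZtoC 2) with (RtoC 2).
  replace (z + 2 * ZtoC m)%C with (2 * (z / 2 + ZtoC m))%C by (field; apply RtoC_neq_0; lra).
  rewrite E; ring.
- apply (Hz (2 * m + 1)%Z); rewrite ZtoC_plus, ZtoC_mult; change (ZtoC 2) with (RtoC 2); change (ZtoC 1) with (RtoC 1).
  replace (z + (2 * ZtoC m + 1))%C with (2 * ((z + 1) / 2 + ZtoC m))%C by (field; apply RtoC_neq_0; lra).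
  rewrite E; ring.
Qed.

Lemma cot_sum_dup (z : C) : not_integer z -> (cot_sum (z / 2) + cot_sum ((z + 1) / 2) = 4 * cot_sum z)%C.
Proof.
intros Hz; destruct (not_integer_halves z Hz) as [H1 H2].
pose proof (nome_neq_1 z Hz) as N0; pose proof (nome_neq_1 _ H1) as N1; pose proof (nome_neq_1 _ H2) as N2.
assert (E0 : nome z = (nome (z / 2) * nome (z / 2))%C) by (rewrite <- nome_plus; f_equal; field; apply RtoC_neq_0; lra).
assert (E2 : nome ((z + 1) / 2) = (- nome (z / 2))%C).
{ replace ((z + 1) / 2)%C with (z / 2 + / 2)%C by (field; apply RtoC_neq_0; lra).
  rewrite nome_plus, nome_half; ring. }
unfold cot_sum; rewrite E2, E0 in *; set (v := nome (z / 2)) in *.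
field; repeat split; assumption.
Qed.

Lemma row_dup (z : C) : not_integer z -> (row (z / 2) + row ((z + 1) / 2) = 4 * row z)%C.
Proof.
intros Hz; unfold row.
assert (HS := summable_row_inv_sq z Hz).
rewrite (tsum_Z_parity (fun m : Z => (/ (z + ZtoC m) ^ 2)%C)) by assumption.
rewrite Cmult_plus_distr_l, <- !tsum_scal.
- f_equal; apply tsum_ext; intros m.
  + rewrite ZtoC_mult; change (ZtoC 2) with (RtoC 2).
    pose proof (Hz (2 * m)%Z) as H; rewrite ZtoC_mult in H; change (ZtoC 2) with (RtoC 2) in H.
    replace (z / 2 + ZtoC m)%C with ((z + 2 * ZtoC m) / 2)%C by (field; apply RtoC_neq_0; lra).
    field; assumption.
  + rewrite ZtoC_plus, ZtoC_mult; change (ZtoC 2) with (RtoC 2); change (ZtoC 1) with (RtoC 1).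
    pose proof (Hz (2 * m + 1)%Z) as H; rewrite ZtoC_plus, ZtoC_mult in H; change (ZtoC 2) with (RtoC 2) in H; change (ZtoC 1) with (RtoC 1) in H.
    replace ((z + 1) / 2 + ZtoC m)%C with ((z + (2 * ZtoC m + 1)) / 2)%C by (field; apply RtoC_neq_0; lra).
    field; assumption.
- exact (summable_inj (fun m => 2 * m + 1)%Z ltac:(cbv beta; intros; lia) _ HS).
- exact (summable_inj (fun m => 2 * m)%Z ltac:(cbv beta; intros; lia) _ HS).
Qed.

(** In the strip |z + n| >= |n|/2 for n <> 0, so each of the two tails is at most 4 times the bound
    5 of [rsum_wt_nat_le]. *)
Lemma row_near_0 : forall z, not_integer z -> Rabs (Re z) <= 1 / 2 -> Cmod (row z - / z ^ 2) <= 40.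
Proof.
intros z Hz Hx.
assert (HS := summable_row_inv_sq z Hz).
assert (E : (row z - / z ^ 2)%C = (tsum (fun n : nat => (/ (z + ZtoC (Z.of_nat (S n))) ^ 2)%C)
  + tsum (fun n : nat => (/ (z + ZtoC (- Z.of_nat (S n))) ^ 2)%C))%C).
{ unfold row; rewrite tsum_Z by assumption; change (ZtoC 0) with (RtoC 0).
  replace (z + 0)%C with z by ring; ring. }
rewrite E.
assert (B : forall s : Z -> Z, (forall n, Rabs (IZR (s n)) = Rabs (IZR n)) ->
  Cmod (tsum (fun n : nat => (/ (z + ZtoC (s (Z.of_nat (S n)))) ^ 2)%C)) <= 20).
{ intros s Hs; apply Cmod_tsum_le; intros l Hl.
  apply Rle_trans with (rsum l (fun n => 4 * Rpower (INR (S n)) (- (5 / 4)))).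
  - apply rsum_le; intros n _; rewrite Cmod_inv_sq by apply Hz.
    assert (Hn : 1 <= INR (S n)) by (rewrite S_INR; pose proof (pos_INR n); lra).
    assert (H : INR (S n) / 2 <= Cmod (z + ZtoC (s (Z.of_nat (S n))))).
    { clear -Hx Hn Hs; eapply Rle_trans; [|apply re_le_Cmod].
      replace (Re (z + ZtoC (s (Z.of_nat (S n))))%C) with (Re z + IZR (s (Z.of_nat (S n)))) by reflexivity.
      set (x := Re z) in *.
      pose proof (Hs (Z.of_nat (S n))) as h; rewrite <- INR_IZR_INZ, (Rabs_pos_eq (INR (S n))) in h by lra.
      set (t := IZR (s (Z.of_nat (S n)))) in *.
      pose proof (Rabs_triang_inv t (- x)) as h1; rewrite Rabs_Ropp in h1.
      replace (t - - x) with (x + t) in h1 by ring; lra. }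
    apply Rle_trans with (/ (INR (S n) / 2) ^ 2).
    + apply Rinv_le_contravar; [apply pow_lt; lra|apply pow_incr; lra].
    + replace (/ (INR (S n) / 2) ^ 2) with (4 * Rpower (INR (S n)) (- (2))).
      * apply Rmult_le_compat_l; [lra|]; apply Rpower_neg_antitone; lra.
      * rewrite Rpower_Ropp; replace (Rpower (INR (S n)) 2) with (INR (S n) ^ 2)
          by (symmetry; apply (Rpower_pow 2); lra).
        field; lra.
  - rewrite rsum_scal; pose proof (rsum_wt_nat_le l Hl); lra. }
pose proof (B (fun n => n) (fun n => eq_refl)) as B1.
pose proof (B Z.opp (fun n => ltac:(rewrite opp_IZR; apply Rabs_Ropp))) as B2.
eapply Rle_trans; [apply Cmod_triangle|]; lra.
Qed.

(* Herglotz: the difference of both sides is bounded and is halved by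
   z -> z/2, (z+1)/2. *)
Lemma row_cot_sum (z : C) : not_integer z -> row z = cot_sum z.
Proof.
set (g := fun z => (cot_sum z - row z)%C).
assert (Hg : exists M, forall z, not_integer z -> Cmod (g z) <= M).
{ destruct cot_sum_near_0 as (M & HM & H0).
  exists (M + 512 + 16 + 40); intros w Hw.
  assert (Hk : exists k : Z, Rabs (Re (w + ZtoC k)) <= 1 / 2).
  { destruct w as [x y]; destruct (archimed (x - 1 / 2)) as [h1 h2].
    exists (- up (x - 1 / 2))%Z; simpl; rewrite opp_IZR; apply Rabs_le; lra. }
  destruct Hk as [k Hk].
  assert (Eg : g w = g (w + ZtoC k)%C) by (unfold g; now rewrite cot_sum_shift, row_shift).
  apply (not_integer_shift w k) in Hw.
  rewrite Eg; clear Eg; set (v := (w + ZtoC k)%C) in *.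
  assert (Hv0 : v <> 0) by (specialize (Hw 0%Z); unfold ZtoC in Hw; rewrite Cplus_0_r in Hw; assumption).
  replace (g v) with ((cot_sum v - / v ^ 2) - (row v - / v ^ 2))%C by (unfold g; ring).
  pose proof (row_near_0 v Hw Hk) as HR.
  assert (HC : Cmod (cot_sum v - / v ^ 2) <= M + 512 + 16).
  { destruct (Rle_dec (Cmod v) (1 / 4)) as [h|h]; [specialize (H0 v Hv0 h Hw); lra|].
    pose proof (cot_sum_le v Hw Hk) as H1.
    unfold Cminus; eapply Rle_trans; [apply Cmod_triangle|]; rewrite Cmod_opp, Cmod_inv_sq by assumption.
    assert (Hi : / Cmod v ^ 2 <= 16).
    { replace 16 with (/ ((1 / 4) ^ 2)) by field; apply Rinv_le_contravar; [lra|apply pow_incr; lra]. }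
    unfold Rdiv in H1; lra. }
  unfold Cminus at 1; eapply Rle_trans; [apply Cmod_triangle|]; rewrite Cmod_opp; lra. }
destruct Hg as [M HM]; intros Hz.
assert (Hn : forall n z, not_integer z -> Cmod (g z) <= M / 2 ^ n).
{ induction n as [|n IH]; intros w Hw; [simpl; specialize (HM w Hw); lra|].
  destruct (not_integer_halves w Hw) as [H1 H2].
  assert (E : (4 * g w)%C = (g (w / 2) + g ((w + 1) / 2))%C).
  { unfold g; transitivity (4 * cot_sum w - 4 * row w)%C; [ring|].
    rewrite <- cot_sum_dup, <- row_dup by assumption; ring. }
  apply (f_equal Cmod) in E; rewrite Cmod_mult, Cmod_R, Rabs_pos_eq in E by lra.
  pose proof (Cmod_triangle (g (w / 2)%C) (g ((w + 1) / 2)%C)) as T.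
  pose proof (IH _ H1); pose proof (IH _ H2).
  replace (M / 2 ^ S n) with (M / 2 ^ n / 2) by (simpl; field; apply pow_nonzero; lra); lra. }
assert (E0 : Cmod (g z) = 0).
{ apply Rle_antisym; [|apply Cmod_ge_0]; apply le_epsilon; intros eps He.
  assert (PM : 0 <= M) by (eapply Rle_trans; [apply Cmod_ge_0|apply (HM z Hz)]).
  destruct (pow_lt_1_zero (/ 2) ltac:(rewrite Rabs_pos_eq; lra) (eps / (M + 1))
    ltac:(apply Rdiv_lt_0_compat; lra)) as [n Hn'].
  specialize (Hn' n (le_n _)); rewrite Rabs_pos_eq in Hn' by (apply pow_le; lra).
  eapply Rle_trans; [apply (Hn n z Hz)|]; unfold Rdiv; rewrite <- pow_inv.
  apply Rle_trans with ((M + 1) * (eps / (M + 1))); [|right; field; lra].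
  apply Rmult_le_compat; try lra; apply pow_le; lra. }
apply Cmod_eq_0 in E0; unfold g in E0.
replace (cot_sum z) with (cot_sum z - row z + row z)%C by ring; rewrite E0; ring.
Qed.

(** * The Weierstrass function of Z[om] *)

Lemma sq_le_inv (a b : R) : 0 <= b -> a ^ 2 <= b ^ 2 -> a <= b.
Proof. intros Hb H; apply Rnot_lt_le; intros N; nra. Qed.

Definition om : C := (- (1 / 2), sqrt 3 / 2).
Definition lat (p : Z * Z) : C := (ZtoC (fst p) + ZtoC (snd p) * om)%C.

Lemma sqrt3_sq : sqrt 3 * sqrt 3 = 3.
Proof. apply sqrt_sqrt; lra. Qed.

Lemma sqrt3_pos : 0 < sqrt 3.
Proof. apply sqrt_lt_R0; lra. Qed.

Lemma om_eq : (om * om = - om - 1)%C.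
Proof.
pose proof sqrt3_sq as H; apply injective_projections; simpl.
- replace (- (1 / 2) * - (1 / 2) - sqrt 3 / 2 * (sqrt 3 / 2)) with (1 / 4 - sqrt 3 * sqrt 3 / 4) by field; lra.
- field.
Qed.

Lemma om_cube : (om * (om * om))%C = 1.
Proof.
rewrite om_eq; replace (om * (- om - 1))%C with (- (om * om) - om)%C by ring; rewrite om_eq; ring.
Qed.

Lemma om_neq_0 : om <> 0.
Proof.
intros E; pose proof om_cube as H; rewrite E in H.
replace (0 * (0 * 0))%C with (RtoC 0) in H by ring; apply RtoC_inj in H; lra.
Qed.

Definition off_lattice (z : C) : Prop := forall p, (z + lat p)%C <> 0.
Definition ladd (p r : Z * Z) : Z * Z := (fst p + fst r, snd p + snd r)%Z.
Definition lopp (p : Z * Z) : Z * Z := (- fst p, - snd p)%Z.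
(** Coordinates of multiplication by om^2; [lrot] below is multiplication by om, its inverse. *)
Definition lrot2 (p : Z * Z) : Z * Z := (snd p - fst p, - fst p)%Z.
Definition lrot (p : Z * Z) : Z * Z := (- snd p, fst p - snd p)%Z.

Lemma lat_add p r : lat (ladd p r) = (lat p + lat r)%C.
Proof. unfold lat; simpl; rewrite !ZtoC_plus; ring. Qed.

Lemma lat_opp p : lat (lopp p) = (- lat p)%C.
Proof. unfold lat; simpl; rewrite !ZtoC_opp; ring. Qed.

Lemma lat_rot p : lat (lrot p) = (om * lat p)%C.
Proof.
unfold lat; simpl; rewrite ZtoC_minus, ZtoC_opp.
replace (om * (ZtoC (fst p) + ZtoC (snd p) * om))%C
  with (ZtoC (fst p) * om + ZtoC (snd p) * (om * om))%C by ring.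
rewrite om_eq; ring.
Qed.

Lemma lrotK p : lrot (lrot2 p) = p.
Proof. destruct p; unfold lrot, lrot2; simpl; f_equal; lia. Qed.

Lemma lrot2K p : lrot2 (lrot p) = p.
Proof. destruct p; unfold lrot, lrot2; simpl; f_equal; lia. Qed.

Lemma lat_norm (al be : R) (p : Z * Z) :
  Cmod (RtoC al + RtoC be * om + lat p) ^ 2 =
  (al + IZR (fst p)) ^ 2 - (al + IZR (fst p)) * (be + IZR (snd p)) + (be + IZR (snd p)) ^ 2.
Proof.
rewrite Cmod_sq; unfold lat, om, ZtoC; simpl.
match goal with |- ?l = _ =>
  replace l with ((al + IZR (fst p) - (be + IZR (snd p)) / 2) ^ 2 + (sqrt 3 * sqrt 3) / 4 * (be + IZR (snd p)) ^ 2)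
    by field end.
rewrite sqrt3_sq; field.
Qed.

Lemma om_coordinates (z : C) : exists al be, z = (RtoC al + RtoC be * om)%C.
Proof.
destruct z as [x y]; exists (x + y / sqrt 3), (2 * y / sqrt 3).
pose proof sqrt3_pos; unfold om; apply injective_projections; simpl; field; lra.
Qed.

(** Up to a constant [rho p] is at most |z + [lat p]|^2 for z off the lattice. Unlike the norm it is
    a product over the two coordinates, so its powers factor and lattice sums are dominated by
    [wt2]. *)
Definition rho (p : Z * Z) : R := (1 + Rabs (IZR (fst p))) * (1 + Rabs (IZR (snd p))).

Lemma rho_ge_1 p : 1 <= rho p.
Proof.
unfold rho; pose proof (Rabs_pos (IZR (fst p))); pose proof (Rabs_pos (IZR (snd p))); nra.
Qed.

Lemma Rpower_rho p : Rpower (rho p) (- (5 / 4)) = wt (fst p) * wt (snd p).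
Proof.
unfold rho, wt; symmetry; apply Rpower_mult_distr;
  [pose proof (Rabs_pos (IZR (fst p)))|pose proof (Rabs_pos (IZR (snd p)))]; lra.
Qed.

Lemma off_lattice_lower (z : C) : off_lattice z ->
  exists c, 0 < c /\ forall p, c * sqrt (rho p) <= Cmod (z + lat p).
Proof.
intros Hz; destruct (om_coordinates z) as (al & be & ->).
assert (Heta : exists eta, 0 < eta /\ forall p, eta ^ 2 <= (al + IZR (fst p)) ^ 2 + (be + IZR (snd p)) ^ 2).
(* Either the first coordinate keeps away from the integers, or it is an integer and then the second
   one is not. *)
{ destruct (classic (forall m : Z, al + IZR m <> 0)) as [H|H].
  - destruct (dist_Z al H) as (eta & H1 & H2); exists eta; split; [assumption|].
    intros p; specialize (H2 (fst p)); pose proof (pow2_ge_0 (be + IZR (snd p))).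
    rewrite <- (pow2_abs (al + IZR (fst p))).
    assert (eta ^ 2 <= Rabs (al + IZR (fst p)) ^ 2) by (apply pow_incr; lra); lra.
  - apply not_all_ex_not in H; destruct H as [m Hm]; apply NNPP in Hm.
    destruct (dist_Z be) as (eta & H1 & H2).
    + intros n Hn; apply (Hz (m, n)); unfold lat, ZtoC; simpl.
      replace (RtoC al + RtoC be * om + (RtoC (IZR m) + RtoC (IZR n) * om))%C
        with (RtoC (al + IZR m) + RtoC (be + IZR n) * om)%C by (rewrite !RtoC_plus; ring).
      rewrite Hm, Hn; ring.
    + exists eta; split; [assumption|].
      intros p; specialize (H2 (snd p)); pose proof (pow2_ge_0 (al + IZR (fst p))).
      rewrite <- (pow2_abs (be + IZR (snd p))).
      assert (eta ^ 2 <= Rabs (be + IZR (snd p)) ^ 2) by (apply pow_incr; lra); lra. }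
destruct Heta as (eta & He & H).
pose proof (Rabs_pos al) as Pa; pose proof (Rabs_pos be) as Pb.
set (K := (1 + Rabs al + Rabs be) / eta + 1).
assert (PK : 0 < K).
{ unfold K; assert (0 < (1 + Rabs al + Rabs be) / eta) by (apply Rdiv_lt_0_compat; lra); lra. }
exists (/ (2 * K)); split; [apply Rinv_0_lt_compat; lra|].
intros p; specialize (H p).
set (s := al + IZR (fst p)) in *; set (t := be + IZR (snd p)) in *.
set (m := sqrt (s ^ 2 + t ^ 2)).
assert (Hm2 : m ^ 2 = s ^ 2 + t ^ 2) by (apply pow2_sqrt; pose proof (pow2_ge_0 s); pose proof (pow2_ge_0 t); lra).
assert (Pm : 0 <= m) by apply sqrt_pos.
assert (Hem : eta <= m) by (apply sq_le_inv; [assumption|rewrite Hm2; assumption]).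
assert (Hs : Rabs s <= m) by (apply sq_le_inv; [assumption|rewrite Hm2, pow2_abs; pose proof (pow2_ge_0 t); lra]).
assert (Ht : Rabs t <= m) by (apply sq_le_inv; [assumption|rewrite Hm2, pow2_abs; pose proof (pow2_ge_0 s); lra]).
assert (HK : 1 + Rabs al + Rabs be + m <= K * m).
{ unfold K; rewrite Rmult_plus_distr_r, Rmult_1_l; apply Rplus_le_compat_r.
  apply Rle_trans with ((1 + Rabs al + Rabs be) / eta * eta); [right; field; lra|].
  apply Rmult_le_compat_l; [left; apply Rdiv_lt_0_compat; lra|assumption]. }
assert (Ha : 1 + Rabs (IZR (fst p)) <= K * m).
{ replace (IZR (fst p)) with (s - al) by (unfold s; ring).
  pose proof (Rabs_triang s (- al)) as h; rewrite Rabs_Ropp in h; unfold Rminus; lra. }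
assert (Hb : 1 + Rabs (IZR (snd p)) <= K * m).
{ replace (IZR (snd p)) with (t - be) by (unfold t; ring).
  pose proof (Rabs_triang t (- be)) as h; rewrite Rabs_Ropp in h; unfold Rminus; lra. }
pose proof (Rabs_pos (IZR (fst p))); pose proof (Rabs_pos (IZR (snd p))).
assert (Hrho : rho p <= (K * m) ^ 2) by (unfold rho; simpl; rewrite Rmult_1_r; apply Rmult_le_compat; lra).
assert (Hsq : sqrt (rho p) <= K * m).
{ rewrite <- (sqrt_pow2 (K * m)) by (apply Rmult_le_pos; lra); now apply sqrt_le_1_alt. }
apply Rle_trans with (m / 2).
- apply Rmult_le_reg_l with (2 * K); [lra|].
  rewrite <- Rmult_assoc, Rinv_r, Rmult_1_l by lra; lra.
- apply sq_le_inv; [apply Cmod_ge_0|].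
  rewrite lat_norm; fold s t.
  replace ((m / 2) ^ 2) with (m ^ 2 / 4) by field; rewrite Hm2; nra.
Qed.

(** A single sum of (z + lambda)^(-2) is not absolutely convergent, but the difference of two such
    terms is O(|lambda|^(-3)). The Weierstrass function is therefore handled through its differences
    [L2 z w]. *)
Definition lat_diff (z w : C) (p : Z * Z) : C := (/ (z + lat p) ^ 2 - / (w + lat p) ^ 2)%C.
Definition L2 (z w : C) : C := tsum (lat_diff z w).

Lemma summable_lat_diff z w : off_lattice z -> off_lattice w -> summable (lat_diff z w).
Proof.
intros Hz Hw.
destruct (off_lattice_lower z Hz) as (c & Hc & H); destruct (off_lattice_lower w Hw) as (d & Hd & H').
set (K := Cmod (w - z) * (/ (c * d ^ 2) + / (c ^ 2 * d))).
apply (summable_le_scal K _ wt2); [|apply summable_wt2].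
intros p; rewrite Cmod_wt2, <- Rpower_rho; specialize (H p); specialize (H' p).
set (A := (z + lat p)%C) in *; set (B := (w + lat p)%C) in *.
assert (HA : A <> 0) by apply Hz; assert (HB : B <> 0) by apply Hw.
pose proof (rho_ge_1 p) as Hr; set (r := sqrt (rho p)) in *.
assert (Hr1 : 1 <= r) by (rewrite <- sqrt_1; now apply sqrt_le_1_alt).
assert (E : lat_diff z w p = ((w - z) * (/ (A * B ^ 2) + / (A ^ 2 * B)))%C).
{ unfold lat_diff; fold A B; replace (w - z)%C with (B - A)%C by (unfold A, B; ring); field; auto. }
rewrite E, Cmod_mult; unfold K; rewrite Rmult_assoc; apply Rmult_le_compat_l; [apply Cmod_ge_0|].
eapply Rle_trans; [apply Cmod_triangle|].
rewrite !Cmod_inv by (apply Cmult_neq_0; try apply Cpow_nz; assumption).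
rewrite !Cmod_mult, !Cmod_pow; set (a := Cmod A) in *; set (b := Cmod B) in *.
assert (E3 : Rpower (rho p) (- (3 / 2)) = / r ^ 3).
{ rewrite Rpower_Ropp; f_equal; unfold r; rewrite <- Rpower_sqrt by lra.
  rewrite <- Rpower_pow, Rpower_mult by apply exp_pos; f_equal; simpl; field. }
assert (Hle : / r ^ 3 <= Rpower (rho p) (- (5 / 4))) by (rewrite <- E3; apply Rpower_neg_antitone; lra).
assert (G : forall x y, 0 < x -> 0 < y -> x * r ^ 3 <= y -> / y <= / x * / r ^ 3).
{ intros x y Hx Hy Hxy; rewrite <- Rinv_mult; apply Rinv_le_contravar; [|assumption].
  apply Rmult_lt_0_compat; [assumption|apply pow_lt; lra]. }
assert (Ha : 0 < c * r) by nra; assert (Hb : 0 < d * r) by nra.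
assert (Ha2 : (c * r) ^ 2 <= a ^ 2) by (apply pow_incr; lra).
assert (Hb2 : (d * r) ^ 2 <= b ^ 2) by (apply pow_incr; lra).
assert (Pc : 0 < c ^ 2) by (apply pow_lt; lra); assert (Pd : 0 < d ^ 2) by (apply pow_lt; lra).
assert (Pa : 0 < a ^ 2) by (apply pow_lt; lra); assert (Pb : 0 < b ^ 2) by (apply pow_lt; lra).
assert (G1 : / (a * b ^ 2) <= / (c * d ^ 2) * / r ^ 3).
{ apply G; [nra|nra|]. replace (c * d ^ 2 * r ^ 3) with ((c * r) * (d * r) ^ 2) by ring.
  apply Rmult_le_compat; try lra; apply pow2_ge_0. }
assert (G2 : / (a ^ 2 * b) <= / (c ^ 2 * d) * / r ^ 3).
{ apply G; [nra|nra|]. replace (c ^ 2 * d * r ^ 3) with ((c * r) ^ 2 * (d * r)) by ring.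
  apply Rmult_le_compat; try lra; apply pow2_ge_0. }
assert (I1 : 0 < / (c * d ^ 2)) by (apply Rinv_0_lt_compat; nra).
assert (I2 : 0 < / (c ^ 2 * d)) by (apply Rinv_0_lt_compat; nra).
rewrite Rmult_plus_distr_r; apply Rplus_le_compat.
- eapply Rle_trans; [exact G1|]; apply Rmult_le_compat_l; lra.
- eapply Rle_trans; [exact G2|]; apply Rmult_le_compat_l; lra.
Qed.

Lemma L2_chain x y z : off_lattice x -> off_lattice y -> off_lattice z -> (L2 x y + L2 y z)%C = L2 x z.
Proof.
intros Hx Hy Hz; unfold L2; rewrite <- tsum_plus by now apply summable_lat_diff.
apply tsum_ext; intros p; unfold lat_diff; ring.
Qed.

Lemma L2_refl x : L2 x x = 0.
Proof.
apply tsum_eq, (has_sum_finite nil); [constructor|]; intros p _; unfold lat_diff; ring.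
Qed.

Lemma off_lattice_add z r : off_lattice z -> off_lattice (z + lat r).
Proof. intros H p; rewrite <- Cplus_assoc, <- lat_add; apply H. Qed.

Lemma off_lattice_opp z : off_lattice z -> off_lattice (- z).
Proof.
intros H p E; apply (H (lopp p)); rewrite lat_opp.
replace (z + - lat p)%C with (- (- z + lat p))%C by ring; rewrite E; ring.
Qed.

Lemma off_lattice_om z : off_lattice z -> off_lattice (om * z).
Proof.
intros H p E; apply (H (lrot2 p)).
replace (om * z + lat p)%C with (om * (z + lat (lrot2 p)))%C in E
  by (rewrite Cmult_plus_distr_l, <- lat_rot, lrotK; reflexivity).
destruct (classic ((z + lat (lrot2 p))%C = 0)) as [e|n]; [assumption|].
exfalso; revert E; apply Cmult_neq_0; [apply om_neq_0|assumption].
Qed.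

Lemma L2_shift z w r : off_lattice z -> off_lattice w -> L2 (z + lat r) (w + lat r) = L2 z w.
Proof.
intros Hz Hw; unfold L2; symmetry.
rewrite (tsum_bij (fun p => ladd p r) (fun p => ladd p (lopp r))).
- apply tsum_ext; intros p; unfold lat_diff; rewrite lat_add.
  replace (z + lat r + lat p)%C with (z + (lat p + lat r))%C by ring.
  replace (w + lat r + lat p)%C with (w + (lat p + lat r))%C by ring; reflexivity.
- intros []; unfold ladd, lopp; simpl; f_equal; lia.
- intros []; unfold ladd, lopp; simpl; f_equal; lia.
- now apply summable_lat_diff.
Qed.

Lemma L2_opp z w : off_lattice z -> off_lattice w -> L2 (- z) (- w) = L2 z w.
Proof.
intros Hz Hw; unfold L2; symmetry.
rewrite (tsum_bij lopp lopp).
- apply tsum_ext; intros p; unfold lat_diff; rewrite lat_opp.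
  replace (- z + lat p)%C with (- (z + - lat p))%C by ring.
  replace (- w + lat p)%C with (- (w + - lat p))%C by ring.
  replace ((- (z + - lat p)) ^ 2)%C with ((z + - lat p) ^ 2)%C by ring.
  replace ((- (w + - lat p)) ^ 2)%C with ((w + - lat p) ^ 2)%C by ring; reflexivity.
- intros []; unfold lopp; simpl; f_equal; lia.
- intros []; unfold lopp; simpl; f_equal; lia.
- now apply summable_lat_diff.
Qed.

Lemma L2_om z w : off_lattice z -> off_lattice w -> L2 (om * z) (om * w) = (om * L2 z w)%C.
Proof.
intros Hz Hw; unfold L2; rewrite <- tsum_scal by now apply summable_lat_diff.
rewrite (tsum_bij lrot lrot2).
- apply tsum_ext; intros p; unfold lat_diff; rewrite lat_rot, <- !Cmult_plus_distr_l.
  pose proof (Hz p) as A; pose proof (Hw p) as B; pose proof om_neq_0.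
  transitivity ((om * (om * om)) * (/ (om * (z + lat p)) ^ 2 - / (om * (w + lat p)) ^ 2))%C; [rewrite om_cube; ring|].
  field; auto.
- apply lrot2K.
- apply lrotK.
- apply summable_lat_diff; now apply off_lattice_om.
Qed.

(** By shifting and chaining, the increment under a period does not depend on the point; evenness
    reverses its sign, so it is zero. *)
Lemma L2_period z r : off_lattice z -> L2 (z + lat r) z = 0.
Proof.
intros Hz.
pose proof (off_lattice_add z r Hz) as Hzr; pose proof (off_lattice_opp z Hz) as Hoz.
pose proof (off_lattice_opp _ Hzr) as Hozr.
assert (E1 : L2 (z + lat r) z = L2 (- (z + lat r)) (- z)) by (symmetry; now apply L2_opp).
assert (E2 : L2 (- (z + lat r)) (- z) = L2 (- z) (- z + lat r)).
{ rewrite <- (L2_shift (- (z + lat r)) (- z) r) by assumption; f_equal; ring. }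
assert (E3 : forall w, off_lattice w -> L2 (w + lat r) w = L2 (z + lat r) z).
{ intros w Hw; pose proof (off_lattice_add w r Hw) as Hwr.
  rewrite <- (L2_chain (w + lat r) (z + lat r) w), L2_shift, <- (L2_chain (z + lat r) z w) by assumption.
  replace (L2 w z + (L2 (z + lat r) z + L2 z w))%C with (L2 (z + lat r) z + (L2 w z + L2 z w))%C by ring.
  rewrite (L2_chain w z w), L2_refl by assumption; ring. }
assert (E4 : (L2 (z + lat r) z + L2 (z + lat r) z)%C = 0).
{ rewrite E1 at 1; rewrite E2, <- (E3 (- z)%C) by assumption.
  rewrite L2_chain, L2_refl by (try assumption; now apply off_lattice_add); reflexivity. }
replace (L2 (z + lat r) z) with ((L2 (z + lat r) z + L2 (z + lat r) z) / 2)%C by (field; apply RtoC_neq_0; lra).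
rewrite E4; field; apply RtoC_neq_0; lra.
Qed.

Lemma half_off_lattice (al be : R) : (exists n : Z, al = IZR n + 1 / 2) \/ (exists n : Z, be = IZR n + 1 / 2) ->
  off_lattice (RtoC al + RtoC be * om).
Proof.
intros H p E.
assert (E2 : Cmod (RtoC al + RtoC be * om + lat p) ^ 2 = 0) by (rewrite E, Cmod_0; ring).
rewrite lat_norm in E2.
set (s := al + IZR (fst p)) in *; set (t := be + IZR (snd p)) in *.
assert (Hst : s = 0 /\ t = 0).
{ pose proof (pow2_ge_0 (s - t / 2)); pose proof (pow2_ge_0 (t - s / 2)).
  pose proof (pow2_ge_0 s); pose proof (pow2_ge_0 t).
  assert (Hs2 : s ^ 2 = 0) by lra; assert (Ht2 : t ^ 2 = 0) by lra.
  split; [destruct (Rmult_integral s s)|destruct (Rmult_integral t t)]; simpl in *; lra. }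
destruct Hst as [Hs Ht]; destruct H as [[n Hn]|[n Hn]].
- assert (Hi : IZR (2 * (n + fst p) + 1) = 0) by (rewrite plus_IZR, mult_IZR, plus_IZR; unfold s in Hs; simpl; lra).
  apply eq_IZR in Hi; lia.
- assert (Hi : IZR (2 * (n + snd p) + 1) = 0) by (rewrite plus_IZR, mult_IZR, plus_IZR; unfold t in Ht; simpl; lra).
  apply eq_IZR in Hi; lia.
Qed.

Lemma off_half : off_lattice (/ 2).
Proof.
replace (/ 2)%C with (RtoC (1 / 2) + RtoC 0 * om)%C.
- apply half_off_lattice; left; exists 0%Z; lra.
- rewrite RtoC_div by lra; field; apply RtoC_neq_0; lra.
Qed.

Definition Dz (z : C) : C := L2 z (/ 2).
(** Since [Dz] vanishes at 1/2, the requirement [RO (om / 2) = om * RO (/ 2)] on [Dz] plus a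
    constant has this quotient as its only solution. *)
Definition fO : C := (Dz (om / 2) / (om - 1))%C.

(* [RO] is the Weierstrass function of Z[om]: the normalising constant is the
   one for which [RO (om * z) = om * RO z]. *)
Definition RO (z : C) : C := (Dz z + fO)%C.

Lemma om_minus_1 : (om - 1)%C <> 0.
Proof.
intros E; apply (f_equal Re) in E; simpl in E; lra.
Qed.

Lemma off_om_half : off_lattice (om / 2).
Proof.
replace (om / 2)%C with (om * / 2)%C by (field; apply RtoC_neq_0; lra).
apply off_lattice_om, off_half.
Qed.

Lemma RO_om z : off_lattice z -> RO (om * z) = (om * RO z)%C.
Proof.
intros Hz; unfold RO.
assert (E : Dz (om * z) = (om * Dz z + Dz (om / 2))%C).
{ unfold Dz; rewrite <- (L2_chain (om * z) (om / 2) (/ 2)); try apply off_half; try apply off_om_half;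
    try (now apply off_lattice_om).
  f_equal; replace (om / 2)%C with (om * / 2)%C by (field; apply RtoC_neq_0; lra).
  apply L2_om; [assumption|apply off_half]. }
assert (Ef : Dz (om / 2) = ((om - 1) * fO)%C) by (unfold fO; field; apply om_minus_1).
rewrite E, Ef; ring.
Qed.

Lemma RO_diff z w : off_lattice z -> off_lattice w -> (RO z - RO w)%C = L2 z w.
Proof.
intros Hz Hw; unfold RO, Dz.
rewrite <- (L2_chain z w (/ 2)) by (try assumption; apply off_half); ring.
Qed.

Lemma RO_period z r : off_lattice z -> RO (z + lat r) = RO z.
Proof.
intros Hz; pose proof (RO_diff (z + lat r) z (off_lattice_add z r Hz) Hz) as E.
rewrite L2_period in E by assumption.
replace (RO (z + lat r)) with (RO (z + lat r) - RO z + RO z)%C by ring; rewrite E; ring.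
Qed.

Lemma RO_half : RO (/ 2) = fO.
Proof. unfold RO, Dz; rewrite L2_refl; ring. Qed.

Lemma RO_opp z : off_lattice z -> RO (- z) = RO z.
Proof.
intros Hz; pose proof (off_lattice_opp z Hz) as Hz'.
assert (E : (RO (- z) - RO (- / 2))%C = (RO z - RO (/ 2))%C).
{ rewrite !RO_diff by (try assumption; try apply off_half; apply off_lattice_opp, off_half).
  apply L2_opp; [assumption|apply off_half]. }
assert (E2 : RO (- / 2) = RO (/ 2)).
{ rewrite <- (RO_period (- / 2) (1, 0)%Z) by apply off_lattice_opp, off_half; f_equal.
  unfold lat, ZtoC; simpl; field; apply RtoC_neq_0; lra. }
rewrite E2 in E; replace (RO (- z)) with (RO (- z) - RO (/ 2) + RO (/ 2))%C by ring; rewrite E; ring.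
Qed.

(** * Residue classes and distribution relations *)

Definition residues (N : nat) : list (Z * Z) :=
  list_prod (map Z.of_nat (seq 0 N)) (map Z.of_nat (seq 0 N)).

Definition lmod (N : nat) (p : Z * Z) : Z * Z := (fst p mod Z.of_nat N, snd p mod Z.of_nat N)%Z.
Definition lscale (N : nat) (p : Z * Z) : Z * Z := (Z.of_nat N * fst p, Z.of_nat N * snd p)%Z.

Lemma in_residues N p : In p (residues N) <-> (0 <= fst p < Z.of_nat N /\ 0 <= snd p < Z.of_nat N)%Z.
Proof.
assert (H : forall a, In a (map Z.of_nat (seq 0 N)) <-> (0 <= a < Z.of_nat N)%Z).
{ intros a; rewrite in_map_iff; split.
  - intros (k & <- & Hk); apply in_seq in Hk; lia.
  - intros Ha; exists (Z.to_nat a); split; [lia|apply in_seq; lia]. }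
destruct p as [a b]; unfold residues; rewrite in_prod_iff, !H; reflexivity.
Qed.

Lemma NoDup_residues N : NoDup (residues N).
Proof.
apply NoDup_list_prod; apply (NoDup_map_inj Z.of_nat); try apply seq_NoDup; intros; lia.
Qed.

Lemma lmod_in N p : (0 < N)%nat -> In (lmod N p) (residues N).
Proof.
intros HN; apply in_residues; unfold lmod; simpl.
split; apply Z.mod_pos_bound; lia.
Qed.

Lemma lmod_decomp N p : (0 < N)%nat -> exists k, ladd (lmod N p) (lscale N k) = p.
Proof.
intros HN; destruct p as [a b].
exists (a / Z.of_nat N, b / Z.of_nat N)%Z; unfold ladd, lmod, lscale; simpl.
pose proof (Z.div_mod a (Z.of_nat N) ltac:(lia)); pose proof (Z.div_mod b (Z.of_nat N) ltac:(lia)).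
f_equal; lia.
Qed.

Lemma lat_scale N k : lat (lscale N k) = (ntoC N * lat k)%C.
Proof. unfold lat, lscale; simpl; rewrite !ZtoC_mult, ZtoC_nat; ring. Qed.

Lemma tsum_residues (N : nat) (F : Z * Z -> C) : (0 < N)%nat -> summable F ->
  tsum F = csum (residues N) (fun r => tsum (fun k => F (ladd r (lscale N k)))).
Proof.
intros HN HF; apply (tsum_classes (lmod N) (fun r k => ladd r (lscale N k))).
- apply NoDup_residues.
- intros p; now apply lmod_in.
- intros r _ [a b] [c d] E; unfold ladd, lscale in E; simpl in E; injection E; intros.
  f_equal; apply (Z.mul_reg_l _ _ (Z.of_nat N)); lia.
- intros r Hr k; apply in_residues in Hr; destruct r as [a b]; unfold ladd, lscale, lmod; simpl in *.
  rewrite !(Z.mul_comm (Z.of_nat N)), !Z_mod_plus_full, !Z.mod_small by lia; reflexivity.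
- intros p; now apply lmod_decomp.
- assumption.
Qed.

Lemma ntoC_neq_0 N : (0 < N)%nat -> ntoC N <> 0.
Proof. intros HN; apply RtoC_neq_0; apply not_0_INR; lia. Qed.

Lemma off_lattice_div N v r : (0 < N)%nat -> off_lattice (ntoC N * v) -> off_lattice (v + lat r / ntoC N).
Proof.
intros HN H p E; apply (H (ladd r (lscale N p))); rewrite lat_add, lat_scale.
pose proof (ntoC_neq_0 N HN).
replace (ntoC N * v + (lat r + ntoC N * lat p))%C with (ntoC N * (v + lat r / ntoC N + lat p))%C by (field; assumption).
rewrite E; ring.
Qed.

Lemma L2_distribution N v w : (0 < N)%nat -> off_lattice (ntoC N * v) -> off_lattice (ntoC N * w) ->
  csum (residues N) (fun r => L2 (v + lat r / ntoC N) (w + lat r / ntoC N)) =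
  (ntoC N ^ 2 * L2 (ntoC N * v) (ntoC N * w))%C.
Proof.
intros HN Hv Hw; unfold L2 at 2; rewrite (tsum_residues N) by (try assumption; now apply summable_lat_diff).
rewrite <- csum_scal; apply csum_ext; intros r _; unfold L2.
pose proof (ntoC_neq_0 N HN) as H0.
rewrite <- tsum_scal.
- apply tsum_ext; intros k; unfold lat_diff; rewrite lat_add, lat_scale.
  pose proof (off_lattice_div N v r HN Hv k) as A; pose proof (off_lattice_div N w r HN Hw k) as B.
  replace (ntoC N * v + (lat r + ntoC N * lat k))%C with (ntoC N * (v + lat r / ntoC N + lat k))%C by (field; assumption).
  replace (ntoC N * w + (lat r + ntoC N * lat k))%C with (ntoC N * (w + lat r / ntoC N + lat k))%C by (field; assumption).
  set (x := (v + lat r / ntoC N + lat k)%C) in *; set (y := (w + lat r / ntoC N + lat k)%C) in *.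
  field; auto.
- apply (summable_inj (fun k => ladd r (lscale N k))); [|now apply summable_lat_diff].
  intros [a b] [c d] E; unfold ladd, lscale in E; simpl in E; injection E; intros.
  f_equal; apply (Z.mul_reg_l _ _ (Z.of_nat N)); lia.
Qed.

Lemma csum_residues_rot N (h : Z * Z -> C) : (0 < N)%nat ->
  (forall p k, h (ladd p (lscale N k)) = h p) ->
  csum (residues N) (fun r => h (lrot2 r)) = csum (residues N) h.
Proof.
intros HN Hh.
assert (E : forall p, h (lmod N p) = h p).
{ intros p; destruct (lmod_decomp N p HN) as [k <-]. rewrite Hh.
  destruct (lmod_decomp N (ladd (lmod N p) (lscale N k)) HN) as [k' E'].
  rewrite <- (Hh (lmod N (ladd (lmod N p) (lscale N k))) k'), E', Hh; reflexivity. }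
rewrite (csum_ext _ _ (fun r => h (lmod N (lrot2 r)))) by (intros; now rewrite E).
rewrite <- (csum_map (fun r => lmod N (lrot2 r))).
(* Surjectivity suffices: a list of the same length that covers all residues has no repetition. *)
assert (I1 : incl (residues N) (map (fun r => lmod N (lrot2 r)) (residues N))).
{ intros p Hp; apply in_map_iff; exists (lmod N (lrot p)); split; [|now apply lmod_in].
  apply in_residues in Hp; destruct p as [a b]; unfold lmod, lrot2, lrot; simpl in *; f_equal.
  - rewrite <- Zminus_mod; replace (a - b - - b)%Z with a by lia; apply Z.mod_small; lia.
  - replace (- (- b mod Z.of_nat N))%Z with (0 - (- b mod Z.of_nat N))%Z by lia.
    rewrite Zminus_mod_idemp_r; replace (0 - - b)%Z with b by lia; apply Z.mod_small; lia. }
apply csum_perm.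
- apply (NoDup_incl_NoDup (NoDup_residues N)); [rewrite length_map; lia|assumption].
- apply NoDup_residues.
- intros p; split; [|apply I1].
  intros Hp; apply in_map_iff in Hp; destruct Hp as (r & <- & _); now apply lmod_in.
Qed.

Lemma csum_minus {I : Type} (l : list I) (F G : I -> C) :
  csum l (fun i => (F i - G i)%C) = (csum l F - csum l G)%C.
Proof. induction l as [|i l IH]; simpl; [ring|]. rewrite IH; ring. Qed.

(** The defect [Phi] does not depend on v, by the relation for differences, and it is multiplied by
    om when v is. A constant equal to om times itself is zero, so the additive constant takes care
    of itself. *)
Lemma RO_distribution N v : (0 < N)%nat -> off_lattice (ntoC N * v) ->
  csum (residues N) (fun r => RO (v + lat r / ntoC N)) = (ntoC N ^ 2 * RO (ntoC N * v))%C.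
Proof.
intros HN.
pose proof (ntoC_neq_0 N HN) as H0.
set (Phi := fun v => (csum (residues N) (fun r => RO (v + lat r / ntoC N)) - ntoC N ^ 2 * RO (ntoC N * v))%C).
assert (Hc : forall v w, off_lattice (ntoC N * v) -> off_lattice (ntoC N * w) -> Phi v = Phi w).
{ intros x y Hx Hy; pose proof (L2_distribution N x y HN Hx Hy) as E.
  rewrite <- RO_diff in E by assumption.
  rewrite (csum_ext _ _ (fun r => (RO (x + lat r / ntoC N) - RO (y + lat r / ntoC N))%C)) in E
    by (intros r _; symmetry; apply RO_diff; now apply off_lattice_div).
  rewrite csum_minus in E; unfold Phi.
  set (s := csum _ _) in *; set (t := csum (residues N) (fun r => RO (y + lat r / ntoC N))) in *.
  replace s with (s - t + t)%C by ring; rewrite E; ring. }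
intros Hv.
assert (Hov : off_lattice (ntoC N * (om * v))).
{ replace (ntoC N * (om * v))%C with (om * (ntoC N * v))%C by ring; now apply off_lattice_om. }
assert (Hr : Phi (om * v)%C = (om * Phi v)%C).
{ unfold Phi; replace (ntoC N * (om * v))%C with (om * (ntoC N * v))%C by ring.
  rewrite RO_om by assumption.
  rewrite (csum_ext _ _ (fun r => (om * (fun p => RO (v + lat p / ntoC N)) (lrot2 r))%C)).
  - rewrite csum_scal, (csum_residues_rot N (fun p => RO (v + lat p / ntoC N))); [ring|assumption|].
    intros p k; rewrite lat_add, lat_scale.
    replace (v + (lat p + ntoC N * lat k) / ntoC N)%C with (v + lat p / ntoC N + lat k)%C by (field; assumption).
    apply RO_period; now apply off_lattice_div.
  - intros r _; cbv beta; rewrite <- RO_om by now apply off_lattice_div.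
    f_equal; rewrite <- (lrotK r) at 1; rewrite lat_rot; field; assumption. }
rewrite <- (Hc v (om * v)%C) in Hr by assumption.
assert (E0 : Phi v = 0).
{ pose proof om_minus_1 as H1.
  replace (Phi v) with ((om * Phi v - Phi v) / (om - 1))%C by (field; assumption).
  rewrite <- Hr; field; assumption. }
unfold Phi in E0.
set (s := csum _ _) in *.
replace s with (s - ntoC N ^ 2 * RO (ntoC N * v) + ntoC N ^ 2 * RO (ntoC N * v))%C by ring.
rewrite E0; ring.
Qed.

(** * Expansion of the lattice function in the nome *)

Lemma summable_nat_S (G : nat -> C) : summable (fun n => G (S n)) -> summable G.
Proof.
intros H.
apply (summable_ext (fun n => (mask (fun n => n = 0%nat) G n + mask (fun n => n <> 0%nat) G n)%C)).
{ intros n; unfold mask; destruct (excluded_middle_informative (n = 0%nat));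
    destruct (excluded_middle_informative (n <> 0%nat)); try tauto; ring. }
apply summable_plus.
- apply (summable_finite (0%nat :: nil)); intros n Hn; unfold mask.
  destruct excluded_middle_informative; [subst; simpl in Hn; tauto|reflexivity].
- apply (summable_inj_inv S); [intros; lia| |].
  + intros [|n] N; unfold mask; destruct excluded_middle_informative; try reflexivity; [lia|].
    exfalso; apply (N n); reflexivity.
  + apply (summable_ext (fun n => G (S n))); [|assumption].
    intros n; unfold mask; destruct excluded_middle_informative; [reflexivity|lia].
Qed.

Section Nome.
Variable q : C.
Hypothesis Hq : 0 < Cmod q < 1.

(** Each row is v/(1 - v)^2, the sum of n v^n, with v replaced by v q^b; exchanging the two sums
    turns the geometric series in b into 1/(1 - q^n). *)
Lemma lambert_rows (v : C) : Cmod v < 1 ->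
  summable (fun b : nat => (v * q ^ b / (1 - v * q ^ b) ^ 2)%C) /\
  tsum (fun b : nat => (v * q ^ b / (1 - v * q ^ b) ^ 2)%C) =
  tsum (fun n : nat => (ntoC (S n) * v ^ S n * (1 + bet q n))%C).
Proof.
intros Hv.
set (G := fun p : nat * nat => (ntoC (S (snd p)) * (v * q ^ fst p) ^ S (snd p))%C).
assert (HvS := proj1 (tsum_n_geometric v Hv)).
assert (HqS : summable (fun b : nat => (q ^ b)%C)).
{ apply (summable_ext (fun n : nat => (ntoC n ^ 0 * q ^ n)%C)); [intros n; simpl; ring|].
  apply summable_geometric; lra. }
assert (HG : summable G).
{ apply (summable_le _ (fun p : nat * nat => (q ^ fst p * (ntoC (S (snd p)) * v ^ S (snd p)))%C)).
  - intros [b n]; unfold G; simpl fst; simpl snd.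
    rewrite Cpow_mult_l, !Cmod_mult, !Cmod_pow.
    pose proof (pow_le (Cmod q) b ltac:(lra)) as P1.
    pose proof (pow_le (Cmod v) (S n) (Cmod_ge_0 v)) as P2.
    assert (P3 : Cmod q ^ b <= 1) by (rewrite <- (pow1 b); apply pow_incr; lra).
    pose proof (pow_le_base (Cmod q ^ b) n ltac:(lra)) as P4.
    replace (Cmod q ^ b * (Cmod (ntoC (S n)) * Cmod v ^ S n))
      with (Cmod (ntoC (S n)) * (Cmod v ^ S n * Cmod q ^ b)) by ring.
    apply Rmult_le_compat_l; [apply Cmod_ge_0|]; apply Rmult_le_compat_l; assumption.
  - now apply (summable_prod (fun b : nat => (q ^ b)%C) (fun n : nat => (ntoC (S n) * v ^ S n)%C)). }
assert (Hvq : forall b : nat, Cmod (v * q ^ b) < 1).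
{ intros b; rewrite Cmod_mult, Cmod_pow.
  assert (P3 : Cmod q ^ b <= 1) by (rewrite <- (pow1 b); apply pow_incr; lra).
  pose proof (pow_le (Cmod q) b ltac:(lra)); pose proof (Cmod_ge_0 v); nra. }
assert (E : forall b : nat, tsum (fun n => G (b, n)) = (v * q ^ b / (1 - v * q ^ b) ^ 2)%C).
{ intros b; exact (proj2 (tsum_n_geometric _ (Hvq b))). }
split.
- apply (summable_ext _ _ E); now apply summable_rows.
- rewrite <- (tsum_ext _ _ E), tsum_swap by assumption.
  apply tsum_ext; intros n.
  assert (Hqn : Cmod (q ^ S n) < 1).
  { rewrite Cmod_pow; pose proof (pow_le_base (Cmod q) n ltac:(lra)); lra. }
  assert (HqnS : summable (fun b : nat => ((q ^ S n) ^ b)%C)).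
  { apply (summable_ext (fun b : nat => (ntoC b ^ 0 * (q ^ S n) ^ b)%C)); [intros b; simpl; ring|].
    now apply summable_geometric. }
  rewrite (tsum_ext _ (fun b : nat => (ntoC (S n) * v ^ S n * (q ^ S n) ^ b)%C)).
  + rewrite tsum_scal, tsum_geometric by assumption.
    f_equal; unfold bet; field; apply one_minus_qpow_neq_0; assumption.
  + intros b; unfold G; simpl fst; simpl snd; rewrite Cpow_mult_l, <- !Cpow_mult_r, Nat.mul_comm; ring.
Qed.

Lemma qpow_bet n : (q ^ S n * (1 + bet q n))%C = bet q n.
Proof. unfold bet; field; now apply one_minus_qpow_neq_0. Qed.

End Nome.

Definition qO : C := nome om.

Lemma Cmod_qO : Cmod qO = exp (- (PI * sqrt 3)).
Proof. unfold qO; rewrite Cmod_nome; f_equal; simpl; field. Qed.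

Lemma qO_lt : 0 < Cmod qO < 1.
Proof.
rewrite Cmod_qO; split; [apply exp_pos|].
rewrite <- exp_0; apply exp_increasing; pose proof PI_RGT_0; pose proof sqrt3_pos; nra.
Qed.

Lemma off_not_integer z (b : Z) : off_lattice z -> not_integer (z + ZtoC b * om).
Proof.
intros H m E; apply (H (m, b)); unfold lat; simpl; rewrite <- E; ring.
Qed.

Lemma cot_sum_opp z : not_integer z -> cot_sum (- z) = cot_sum z.
Proof.
intros Hz; pose proof (nome_neq_1 z Hz) as H; pose proof (nome_neq_0 z) as H0.
unfold cot_sum; rewrite nome_opp; f_equal; field; repeat split; try assumption.
intros E; apply H; replace (1 - nome z)%C with (- (nome z - 1))%C by ring; rewrite E; ring.
Qed.

Definition lattice_rows (z : C) : C :=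
  (cot_sum z - 4 * RtoC PI ^ 2 * (tsum (fun n : nat => bet qO n * (ntoC (S n) ^ 1 * nome z ^ S n))
     + tsum (fun n : nat => bet qO n * (ntoC (S n) ^ 1 * (/ nome z) ^ S n))))%C.

(** Rows with b < 0 are reflected by evenness, so both halves become Lambert series. The annulus |q|
    < |u| < 1/|q| is wider than that of [lp] because the base point 1/2 has |u| = 1. *)
Lemma lattice_rows_eq z : off_lattice z -> Cmod qO < Cmod (nome z) < / Cmod qO ->
  summable (fun b : Z => cot_sum (z + ZtoC b * om)) /\
  tsum (fun b : Z => cot_sum (z + ZtoC b * om)) = lattice_rows z.
Proof.
intros Hz Hu; pose proof qO_lt as Hq.
set (u := nome z) in *.
assert (Hu0 : u <> 0) by apply nome_neq_0.
assert (Hu1 : Cmod (u * qO) < 1).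
{ rewrite Cmod_mult. apply Rlt_le_trans with (/ Cmod qO * Cmod qO); [apply Rmult_lt_compat_r; lra|].
  right; field; lra. }
assert (Hu2 : Cmod (/ u * qO) < 1).
{ rewrite Cmod_mult, Cmod_inv by assumption; apply Cmod_gt_0 in Hu0.
  apply Rmult_lt_reg_l with (Cmod u); [assumption|].
  rewrite <- Rmult_assoc, Rinv_r, Rmult_1_l, Rmult_1_r by lra; lra. }
destruct (lambert_rows qO Hq _ Hu1) as [S1 T1]; destruct (lambert_rows qO Hq _ Hu2) as [S2 T2].
assert (Eb : forall b : nat, nome (ZtoC (Z.of_nat b) * om) = (qO ^ b)%C).
{ intros b; rewrite ZtoC_nat; apply nome_nat_mult. }
assert (E1 : forall b : nat, cot_sum (z + ZtoC (Z.of_nat (S b)) * om) =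
  (- (4 * RtoC PI ^ 2) * (u * qO * qO ^ b / (1 - u * qO * qO ^ b) ^ 2))%C).
{ intros b; unfold cot_sum; rewrite nome_plus, Eb; fold u.
  replace (u * qO ^ S b)%C with (u * qO * qO ^ b)%C by (rewrite Cpow_S; ring); reflexivity. }
assert (E2 : forall b : nat, cot_sum (z + ZtoC (- Z.of_nat (S b)) * om) =
  (- (4 * RtoC PI ^ 2) * (/ u * qO * qO ^ b / (1 - / u * qO * qO ^ b) ^ 2))%C).
{ intros b; rewrite <- cot_sum_opp by now apply off_not_integer.
  unfold cot_sum.
  replace (- (z + ZtoC (- Z.of_nat (S b)) * om))%C with (- z + ZtoC (Z.of_nat (S b)) * om)%C
    by (rewrite ZtoC_opp; ring).
  rewrite nome_plus, Eb, nome_opp; fold u.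
  replace (/ u * qO ^ S b)%C with (/ u * qO * qO ^ b)%C by (rewrite Cpow_S; ring); reflexivity. }
assert (HS : summable (fun b : Z => cot_sum (z + ZtoC b * om))).
{ apply summable_Z; apply summable_nat_S.
  - apply (summable_ext _ _ (fun b => eq_sym (E1 b))); now apply summable_scal.
  - apply (summable_ext _ _ (fun b => eq_sym (E2 b))); now apply summable_scal. }
split; [assumption|].
rewrite tsum_Z by assumption.
rewrite (tsum_ext _ _ E1), (tsum_ext _ _ E2), !tsum_scal, T1, T2 by assumption.
unfold lattice_rows; fold u.
replace (z + ZtoC 0 * om)%C with z by (unfold ZtoC; ring).
rewrite (tsum_ext (fun n : nat => (ntoC (S n) * (u * qO) ^ S n * (1 + bet qO n))%C)
  (fun n : nat => (bet qO n * (ntoC (S n) ^ 1 * u ^ S n))%C)).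
2:{ intros n; rewrite Cpow_mult_l, Cpow_1_r.
    transitivity (ntoC (S n) * u ^ S n * (qO ^ S n * (1 + bet qO n)))%C; [ring|rewrite qpow_bet by assumption; ring]. }
rewrite (tsum_ext (fun n : nat => (ntoC (S n) * (/ u * qO) ^ S n * (1 + bet qO n))%C)
  (fun n : nat => (bet qO n * (ntoC (S n) ^ 1 * (/ u) ^ S n))%C)).
2:{ intros n; rewrite Cpow_mult_l, Cpow_1_r.
    transitivity (ntoC (S n) * (/ u) ^ S n * (qO ^ S n * (1 + bet qO n)))%C; [ring|rewrite qpow_bet by assumption; ring]. }
ring.
Qed.

Lemma L2_rows z w : off_lattice z -> off_lattice w ->
  L2 z w = tsum (fun b : Z => (cot_sum (z + ZtoC b * om) - cot_sum (w + ZtoC b * om))%C).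
Proof.
intros Hz Hw; unfold L2; assert (HS := summable_lat_diff z w Hz Hw).
rewrite tsum_rows, tsum_swap by assumption.
apply tsum_ext; intros b.
rewrite <- !row_cot_sum by now apply off_not_integer.
unfold row; rewrite <- tsum_minus by (apply summable_row_inv_sq; now apply off_not_integer).
apply tsum_ext; intros a; unfold lat_diff, lat; simpl fst; simpl snd.
replace (z + (ZtoC a + ZtoC b * om))%C with (z + ZtoC b * om + ZtoC a)%C by ring.
replace (w + (ZtoC a + ZtoC b * om))%C with (w + ZtoC b * om + ZtoC a)%C by ring.
reflexivity.
Qed.

(** In terms of u this is the annulus |q| < |u| < 1 for q = [qO], on which [lp] converges. *)
Definition strip (z : C) : Prop := 0 < Im z < sqrt 3 / 2.

Lemma strip_off z : strip z -> off_lattice z.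
Proof.
intros [H1 H2] [a b] E; apply (f_equal Im) in E; destruct z as [x y]; simpl in *.
pose proof sqrt3_pos as H3.
assert (E' : y + IZR b * (sqrt 3 / 2) = 0) by lra.
destruct (Z_le_gt_dec 0 b) as [h|h].
- apply IZR_le in h; nra.
- assert (h' : (b <= -1)%Z) by lia; apply IZR_le in h'; nra.
Qed.

Lemma strip_nome z : strip z -> Cmod qO < Cmod (nome z) < 1.
Proof.
intros [H1 H2]; rewrite Cmod_qO, Cmod_nome; pose proof PI_RGT_0; split.
- apply exp_increasing; nra.
- rewrite <- exp_0; apply exp_increasing; nra.
Qed.

Lemma Dz_strip z : strip z -> Dz z = (- (4 * RtoC PI ^ 2) * (lp qO 1 (nome z) - lp_half qO))%C.
Proof.
intros Hz; pose proof (strip_off z Hz) as Ho; pose proof (strip_nome z Hz) as Hu; pose proof qO_lt as Hq.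
unfold Dz; rewrite L2_rows by (try assumption; apply off_half).
destruct (lattice_rows_eq z Ho) as [S1 T1].
{ split; [lra|]; apply Rlt_trans with 1; [lra|]. rewrite <- Rinv_1; apply Rinv_lt_contravar; lra. }
destruct (lattice_rows_eq (/ 2) off_half) as [S2 T2].
{ rewrite nome_half, Cmod_opp, Cmod_1; split; [lra|]; rewrite <- Rinv_1 at 1; apply Rinv_lt_contravar; lra. }
rewrite tsum_minus, T1, T2 by assumption.
destruct (lp_split qO Hq 1 (nome z) (le_n _) Hu) as (_ & _ & ->).
unfold lattice_rows, cot_sum.
rewrite (tsum_ext (fun n : nat => (ntoC (S n) ^ 1 * nome z ^ S n)%C) (fun n : nat => (ntoC (S n) * nome z ^ S n)%C))
  by (intros n; now rewrite Cpow_1_r).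
rewrite (proj2 (tsum_n_geometric (nome z) (proj2 Hu))).
rewrite nome_half.
replace (/ - RtoC 1)%C with (- RtoC 1)%C
  by (field; intros E; apply (f_equal Re) in E; simpl in E; lra).
unfold lp_half.
rewrite (tsum_ext (fun n : nat => (bet qO n * (ntoC (S n) ^ 1 * (- RtoC 1) ^ S n))%C)
  (fun n : nat => ((- RtoC 1) ^ S n * (ntoC (S n) * bet qO n))%C)) by (intros n; rewrite Cpow_1_r; ring).
set (A := tsum (fun n : nat => (bet qO n * (ntoC (S n) ^ 1 * nome z ^ S n))%C)).
set (B := tsum (fun n : nat => (bet qO n * (ntoC (S n) ^ 1 * (/ nome z) ^ S n))%C)).
set (D := tsum _).
set (X := (nome z / (1 - nome z) ^ 2)%C).
field; repeat split; try (apply RtoC_neq_0; lra).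
Qed.

Lemma strip_shift z : strip z -> strip (z + / 2).
Proof.
intros H; replace (/ 2)%C with (RtoC (/ 2)) by (rewrite RtoC_inv by lra; reflexivity).
unfold strip in *; destruct z; simpl in *; lra.
Qed.

Lemma strip_om_half : strip (om / 2).
Proof.
replace (om / 2)%C with (- (1 / 4), sqrt 3 / 4).
- unfold strip; simpl; pose proof sqrt3_pos; lra.
- unfold Cdiv; replace (/ 2)%C with (RtoC (/ 2)) by (rewrite RtoC_inv by lra; reflexivity).
  apply injective_projections; simpl; field.
Qed.

(** [lp_neg_product] makes the product constant on the strip. Its value is read off at om/2, where
    the factors are (om - 1) f and (om^2 - 1) f, and (om - 1)(om^2 - 1) = 3. *)
Lemma Dz_product z : strip z -> (Dz z * Dz (z + / 2))%C = (3 * fO ^ 2)%C.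
Proof.
intros Hz; pose proof qO_lt as Hq.
destruct (lp_neg_product qO Hq) as [kappa Hk].
assert (H : forall z, strip z -> (Dz z * Dz (z + / 2))%C = ((4 * RtoC PI ^ 2) ^ 2 * (kappa + lp_half qO ^ 2))%C).
{ intros w Hw; rewrite !Dz_strip by (try assumption; now apply strip_shift).
  rewrite nome_plus, nome_half; replace (nome w * - (1))%C with (- nome w)%C by ring.
  transitivity ((4 * RtoC PI ^ 2) ^ 2 * (lp qO 1 (nome w) * lp qO 1 (- nome w)
    - lp_half qO * (lp qO 1 (nome w) + lp qO 1 (- nome w)) + lp_half qO ^ 2))%C; [ring|].
  rewrite Hk by now apply strip_nome. ring. }
rewrite H, <- (H (om / 2)%C) by (try assumption; apply strip_om_half).
assert (E1 : Dz (om / 2) = ((om - 1) * fO)%C) by (unfold fO; field; apply om_minus_1).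
assert (E2 : Dz (om / 2 + / 2) = ((om * om - 1) * fO)%C).
{ replace (om / 2 + / 2)%C with (- (om * (om * / 2)))%C
    by (replace (om * (om * / 2))%C with (om * om / 2)%C by (field; apply RtoC_neq_0; lra);
        rewrite om_eq; field; apply RtoC_neq_0; lra).
  assert (H1 : off_lattice (om * / 2)) by apply off_lattice_om, off_half.
  assert (H2 : off_lattice (om * (om * / 2))) by now apply off_lattice_om.
  replace (Dz (- (om * (om * / 2)))) with (RO (- (om * (om * / 2))) - fO)%C by (unfold RO; ring).
  rewrite RO_opp, !RO_om, RO_half by (try assumption; apply off_half); ring. }
rewrite E1, E2.
transitivity ((om * (om * om) - om * om - om + 1) * fO ^ 2)%C; [ring|].
rewrite om_cube, om_eq; ring.
Qed.

(** Adding the same two values instead of multiplying them, with (om - 1) + (om^2 - 1) = -3, gives a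
    rapidly convergent expression for the numerical estimate of f. *)
Lemma fO_series : fO = (4 * RtoC PI ^ 2 / 3 * (lp qO 1 (nome (om / 2)) + lp qO 1 (- nome (om / 2)) - 2 * lp_half qO))%C.
Proof.
assert (E1 : Dz (om / 2) = ((om - 1) * fO)%C) by (unfold fO; field; apply om_minus_1).
assert (E2 : Dz (om / 2 + / 2) = ((om * om - 1) * fO)%C).
{ replace (om / 2 + / 2)%C with (- (om * (om * / 2)))%C
    by (replace (om * (om * / 2))%C with (om * om / 2)%C by (field; apply RtoC_neq_0; lra);
        rewrite om_eq; field; apply RtoC_neq_0; lra).
  assert (H1 : off_lattice (om * / 2)) by apply off_lattice_om, off_half.
  assert (H2 : off_lattice (om * (om * / 2))) by now apply off_lattice_om.
  replace (Dz (- (om * (om * / 2)))) with (RO (- (om * (om * / 2))) - fO)%C by (unfold RO; ring).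
  rewrite RO_opp, !RO_om, RO_half by (try assumption; apply off_half); ring. }
assert (E3 : (Dz (om / 2) + Dz (om / 2 + / 2))%C = (- 3 * fO)%C).
{ rewrite E1, E2, om_eq; ring. }
rewrite !Dz_strip, nome_plus, nome_half in E3 by (try apply strip_shift; apply strip_om_half).
replace (nome (om / 2) * - (1))%C with (- nome (om / 2))%C in E3 by ring.
replace fO with (- (- 3 * fO) / 3)%C by (field; apply RtoC_neq_0; lra).
rewrite <- E3; field; apply RtoC_neq_0; lra.
Qed.

(** * Reality and numerical bounds *)

Lemma csum_conj {I : Type} (l : list I) (F : I -> C) : csum l (fun i => Cconj (F i)) = Cconj (csum l F).
Proof.
induction l as [|i l IH]; simpl; [unfold Cconj, RtoC; simpl; f_equal; ring|].
rewrite IH, Cplus_conj; reflexivity.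
Qed.

Lemma tsum_conj {I : Type} (F : I -> C) : summable F -> tsum (fun i => Cconj (F i)) = Cconj (tsum F).
Proof.
intros HF; apply tsum_eq; intros eps He.
destruct (summable_has_sum F HF eps He) as [l0 H0]; exists l0; intros l Hl Hi.
rewrite csum_conj, <- Cminus_conj, Cmod_conj; auto.
Qed.

Lemma Cconj_RtoC (r : R) : Cconj (RtoC r) = RtoC r.
Proof. unfold Cconj, RtoC; simpl; f_equal; ring. Qed.

Lemma Cconj_real (z : C) : Cconj z = z -> z = RtoC (Re z).
Proof.
intros H; apply (f_equal Im) in H; rewrite im_conj in H.
destruct z as [a b]; simpl in *; unfold RtoC; f_equal; lra.
Qed.

Lemma Cconj_ntoC n : Cconj (ntoC n) = ntoC n.
Proof. apply Cconj_RtoC. Qed.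

Lemma tsum_nonneg_ge {I : Type} (f : I -> R) (l : list I) : (forall i, 0 <= f i) ->
  summable (fun i => RtoC (f i)) -> NoDup l -> rsum l f <= Re (tsum (fun i => RtoC (f i))).
Proof.
intros Hf HS Hl; apply le_epsilon; intros eps He.
destruct (summable_has_sum _ HS eps He) as [l0 H0].
destruct (nodup_same (l ++ l0)) as (m & Nm & Em).
specialize (H0 m Nm (fun i h => proj2 (Em i) (in_or_app _ _ _ (or_intror h)))).
assert (H1 : rsum l f <= rsum m f).
{ apply rsum_incl; try assumption; intros i Hi; apply Em, in_or_app; auto. }
assert (E : csum m (fun i => RtoC (f i)) = RtoC (rsum m f)).
{ clear; induction m as [|i m IH]; simpl; [reflexivity|]. now rewrite IH, RtoC_plus. }
rewrite E in H0.
set (T := tsum (fun i => RtoC (f i))) in *.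
pose proof (re_le_Cmod (RtoC (rsum m f) - T)) as H2.
apply Rabs_le_between in H2; replace (Re (RtoC (rsum m f) - T)) with (rsum m f - Re T) in H2 by reflexivity.
lra.
Qed.

Section Nome.
Variable q : C.
Hypothesis Hq : 0 < Cmod q < 1.

Lemma bet_tail_le (w : C) (y : R) : Cmod q * Cmod w <= y -> y < 1 ->
  Cmod (tsum (fun n : nat => (bet q n * (ntoC (S n) ^ 1 * w ^ S n))%C)) <= / (1 - Cmod q) * (y / (1 - y) ^ 2).
Proof.
intros Hw Hy.
assert (Hy0 : 0 <= y) by (pose proof (Cmod_ge_0 w); nra).
assert (Hyc : Cmod (RtoC y) < 1) by (rewrite Cmod_R, Rabs_pos_eq; lra).
destruct (tsum_n_geometric (RtoC y) Hyc) as [HS HT].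
assert (E : forall n : nat, (ntoC (S n) * RtoC y ^ S n)%C = RtoC (INR (S n) * y ^ S n)).
{ intros n; unfold ntoC; rewrite RtoC_mult, RtoC_pow; reflexivity. }
assert (Hi : 0 < / (1 - Cmod q)) by (apply Rinv_0_lt_compat; lra).
assert (H0 : forall n, 0 <= INR (S n) * y ^ S n).
{ intros n; apply Rmult_le_pos; [apply pos_INR|now apply pow_le]. }
assert (HSr : summable (fun n : nat => RtoC (INR (S n) * y ^ S n))) by exact (summable_ext _ _ E HS).
apply Cmod_tsum_le; intros l Hl.
apply Rle_trans with (rsum l (fun n => / (1 - Cmod q) * (INR (S n) * y ^ S n))).
- apply rsum_le; intros n _.
  rewrite !Cmod_mult, Cpow_1_r, Cmod_ntoC, Cmod_pow.
  pose proof (bet_le q Hq n) as HB; pose proof (pos_INR (S n)) as P.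
  apply Rle_trans with (/ (1 - Cmod q) * Cmod q ^ S n * (INR (S n) * Cmod w ^ S n)).
  + apply Rmult_le_compat_r; [apply Rmult_le_pos; [assumption|apply pow_le, Cmod_ge_0]|assumption].
  + replace (/ (1 - Cmod q) * Cmod q ^ S n * (INR (S n) * Cmod w ^ S n))
      with (/ (1 - Cmod q) * (INR (S n) * (Cmod q * Cmod w) ^ S n)) by (rewrite Rpow_mult_distr; ring).
    apply Rmult_le_compat_l; [lra|]; apply Rmult_le_compat_l; [assumption|].
    apply pow_incr; split; [apply Rmult_le_pos; [lra|apply Cmod_ge_0]|assumption].
- rewrite rsum_scal; apply Rmult_le_compat_l; [lra|].
  eapply Rle_trans; [apply tsum_nonneg_ge; assumption|].
  cbv beta; rewrite <- (tsum_ext _ _ E), HT.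
  rewrite <- RtoC_minus, <- RtoC_pow, <- RtoC_div by (apply pow_nonzero; lra); simpl; lra.
Qed.

Lemma lp_conj k u : Cmod q < Cmod u < 1 -> Cconj q = q -> Cconj (lp q k u) = lp q k (Cconj u).
Proof.
intros Hu Hc; assert (Hu0 : u <> 0) by (apply Cmod_neq_0; lra).
unfold lp; rewrite <- tsum_conj by now apply summable_lterm.
apply tsum_ext; intros n; unfold lterm.
assert (Hz : forall (v : C) m, v <> 0 -> Cconj (zpow v m) = zpow (Cconj v) m).
{ intros v m Hv; unfold zpow; destruct (0 <=? m)%Z; rewrite Cpow_conj; [reflexivity|].
  now rewrite Cinv_conj. }
rewrite !Cmult_conj, Cpow_conj, Hz by assumption.
unfold ZtoC; rewrite Cconj_RtoC; do 2 f_equal.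
unfold lam; destruct (Z.eqb_spec n 0) as [->|Hn]; [apply Cconj_RtoC|].
assert (Hl : (1 - zpow q n)%C <> 0).
{ destruct (Z_cases n) as [[[|j] ->]|[j ->]]; [lia| |].
  - rewrite zpow_nat; now apply one_minus_qpow_neq_0.
  - rewrite zpow_neg, zpow_nat by now apply q_neq_0.
    pose proof (one_minus_qpow_neq_0 q Hq j) as H1; pose proof (Cpow_nz q (S j) (q_neq_0 q Hq)) as H2.
    intros E; apply H1.
    replace (1 - q ^ S j)%C with (- (q ^ S j * (1 - / q ^ S j)))%C by (field; assumption).
    rewrite E; ring. }
rewrite Cinv_conj, Cminus_conj, Cconj_RtoC, Hz, Hc by (try assumption; now apply q_neq_0); reflexivity.
Qed.

Lemma bet_conj n : Cconj q = q -> Cconj (bet q n) = bet q n.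
Proof.
intros Hc; unfold bet; rewrite Cdiv_conj, Cminus_conj, Cpow_conj, Hc, Cconj_RtoC
  by (now apply one_minus_qpow_neq_0); reflexivity.
Qed.

Lemma summable_lp_half : summable (fun n : nat => ((- RtoC 1) ^ S n * (ntoC (S n) * bet q n))%C).
Proof.
apply (summable_le _ (fun n : nat => (ntoC (S n) ^ 1 * bet q n)%C)); [|now apply summable_bsum].
intros n; rewrite Cpow_1_r, Cmod_mult, Cmod_pow, Cmod_opp, Cmod_1, pow1; lra.
Qed.

Lemma lp_half_conj : Cconj q = q -> Cconj (lp_half q) = lp_half q.
Proof.
intros Hc; unfold lp_half; rewrite Cplus_conj, Cmult_conj, <- tsum_conj by apply summable_lp_half.
rewrite Cdiv_conj by (apply RtoC_neq_0; lra); rewrite !Cconj_RtoC.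
do 2 f_equal; apply tsum_ext; intros n.
rewrite !Cmult_conj, Cpow_conj, Cconj_ntoC, bet_conj, Copp_conj, Cconj_RtoC by assumption; reflexivity.
Qed.

Lemma lp_half_bound : Cmod (lp_half q + 1 / 4) <= 2 * (/ (1 - Cmod q) * (Cmod q / (1 - Cmod q) ^ 2)).
Proof.
replace (lp_half q + 1 / 4)%C with (2 * tsum (fun n : nat => (bet q n * (ntoC (S n) ^ 1 * (- RtoC 1) ^ S n))%C))%C.
- rewrite Cmod_mult, Cmod_R, Rabs_pos_eq by lra; apply Rmult_le_compat_l; [lra|].
  apply bet_tail_le; [|lra]. rewrite Cmod_opp, Cmod_1; lra.
- unfold lp_half; rewrite (tsum_ext _ (fun n : nat => ((- RtoC 1) ^ S n * (ntoC (S n) * bet q n))%C))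
    by (intros n; rewrite Cpow_1_r; ring).
  field; apply RtoC_neq_0; lra.
Qed.

End Nome.

Lemma qO_real : qO = RtoC (- exp (- (PI * sqrt 3))).
Proof.
unfold qO, om; rewrite nome_pair.
replace (2 * PI * - (1 / 2)) with (- PI) by field.
rewrite cos_neg, sin_neg, cos_PI, sin_PI.
replace (2 * PI * (sqrt 3 / 2)) with (PI * sqrt 3) by field.
unfold RtoC; f_equal; ring.
Qed.

Lemma qO_conj : Cconj qO = qO.
Proof. rewrite qO_real; apply Cconj_RtoC. Qed.

Lemma PI_bounds : 314 / 100 <= PI <= 315 / 100.
Proof.
destruct (PI_2_3_7_ineq 2) as [H1 _]; destruct (PI_2_3_7_ineq 2) as [_ H2].
unfold tg_alt, PI_2_3_7_tg, Ratan_seq in *; simpl in H1, H2; split; lra.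
Qed.

Lemma sqrt3_bounds : 1732 / 1000 <= sqrt 3 <= 1733 / 1000.
Proof. pose proof sqrt3_sq; pose proof sqrt3_pos; split; nra. Qed.

Lemma exp_cubic_lower (x : R) : 0 <= x -> 1 + x + x ^ 2 / 2 + x ^ 3 / 6 <= exp x.
Proof.
assert (D : forall (h h' : R -> R), h 0 = 0 -> (forall t, is_derive h t (h' t)) ->
  (forall t, 0 <= t -> 0 <= h' t) -> forall t, 0 <= t -> 0 <= h t).
{ intros h h' H0 Hd Hp t Ht.
  destruct (MVT_gen h 0 t h') as (c & Hc & E).
  - intros s _; apply Hd.
  - intros s _; apply continuity_pt_filterlim.
    apply (ex_derive_continuous (K := R_AbsRing) (V := R_NormedModule)); eexists; apply Hd.
  - rewrite Rmin_left, Rmax_right in Hc by lra; specialize (Hp c ltac:(lra)).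
    rewrite H0 in E; nra. }
assert (H1 : forall t, 0 <= t -> 0 <= exp t - 1).
{ intros t Ht; pose proof (exp_ineq1_le t); lra. }
assert (H2 : forall t, 0 <= t -> 0 <= exp t - 1 - t).
{ apply (D _ (fun t => exp t - 1)); [rewrite exp_0; ring|intros t; auto_derive; [trivial|ring]|assumption]. }
assert (H3 : forall t, 0 <= t -> 0 <= exp t - 1 - t - t ^ 2 / 2).
{ apply (D _ (fun t => exp t - 1 - t)); [rewrite exp_0; field|intros t; auto_derive; [trivial|field]|assumption]. }
assert (H4 : forall t, 0 <= t -> 0 <= exp t - 1 - t - t ^ 2 / 2 - t ^ 3 / 6).
{ apply (D _ (fun t => exp t - 1 - t - t ^ 2 / 2)); [rewrite exp_0; field|intros t; auto_derive; [trivial|field]|assumption]. }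
intros Hx; specialize (H4 x Hx); lra.
Qed.

Lemma exp_neg_cubic_lower (x : R) : 0 <= x -> 1 - x + x ^ 2 / 2 - x ^ 3 / 6 <= exp (- x).
Proof.
assert (D : forall (h h' : R -> R), h 0 = 0 -> (forall t, is_derive h t (h' t)) ->
  (forall t, 0 <= t -> 0 <= h' t) -> forall t, 0 <= t -> 0 <= h t).
{ intros h h' H0 Hd Hp t Ht.
  destruct (MVT_gen h 0 t h') as (c & Hc & E).
  - intros s _; apply Hd.
  - intros s _; apply continuity_pt_filterlim.
    apply (ex_derive_continuous (K := R_AbsRing) (V := R_NormedModule)); eexists; apply Hd.
  - rewrite Rmin_left, Rmax_right in Hc by lra; specialize (Hp c ltac:(lra)).
    rewrite H0 in E; nra. }
assert (E0 : exp (- 0) = 1) by (rewrite Ropp_0; apply exp_0).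
assert (H2 : forall t, 0 <= t -> 0 <= exp (- t) - 1 + t).
{ intros t Ht; pose proof (exp_ineq1_le (- t)); lra. }
assert (H3 : forall t, 0 <= t -> 0 <= 1 - t + t ^ 2 / 2 - exp (- t)).
{ apply (D _ (fun t => exp (- t) - 1 + t)); [rewrite E0; field|intros t; auto_derive; [trivial|field]|assumption]. }
assert (H4 : forall t, 0 <= t -> 0 <= exp (- t) - 1 + t - t ^ 2 / 2 + t ^ 3 / 6).
{ apply (D _ (fun t => 1 - t + t ^ 2 / 2 - exp (- t))); [rewrite E0; field|intros t; auto_derive; [trivial|field]|assumption]. }
intros Hx; specialize (H4 x Hx); lra.
Qed.

(** The value is about 0.0043. The cubic Taylor bound is applied to one tenth of the exponent, where
    it is sharp enough, and raised to the tenth power. *)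
Lemma nome_bound_1 : exp (- (PI * sqrt 3)) <= 1 / 200.
Proof.
pose proof PI_bounds; pose proof sqrt3_bounds.
set (t := PI * sqrt 3 / 10).
assert (Ht : 54 / 100 <= t) by (unfold t; nra).
assert (E : exp (- (PI * sqrt 3)) = / exp t ^ 10).
{ rewrite exp_Ropp; f_equal; rewrite <- Rpower_pow by apply exp_pos; unfold Rpower.
  rewrite ln_exp; f_equal; unfold t; simpl; field. }
pose proof (exp_cubic_lower (54 / 100) ltac:(lra)) as H1.
assert (H2 : exp (54 / 100) <= exp t).
{ destruct Ht as [Ht|Ht]; [left; now apply exp_increasing|rewrite <- Ht; lra]. }
assert (H3 : 171 / 100 <= exp t) by lra.
assert (H4 : (171 / 100) ^ 10 <= exp t ^ 10) by (apply pow_incr; lra).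
rewrite E; replace (1 / 200) with (/ 200) by field; apply Rinv_le_contravar; [lra|].
eapply Rle_trans; [|exact H4]; lra.
Qed.

Lemma nome_bound_2 : 1 / 10 <= exp (- (2 * PI * (sqrt 3 / 5))).
Proof.
pose proof PI_bounds; pose proof sqrt3_bounds.
set (t := PI * sqrt 3 / 10).
assert (Ht : t <= 55 / 100) by (unfold t; nra).
assert (E : exp (- (2 * PI * (sqrt 3 / 5))) = exp (- t) ^ 4).
{ rewrite <- Rpower_pow by apply exp_pos; unfold Rpower.
  rewrite ln_exp; f_equal; unfold t; simpl; field. }
pose proof (exp_neg_cubic_lower (55 / 100) ltac:(lra)) as H1.
assert (H2 : exp (- (55 / 100)) <= exp (- t)).
{ destruct Ht as [Ht|Ht]; [left; apply exp_increasing; lra|rewrite Ht; lra]. }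
assert (H4 : (57 / 100) ^ 4 <= exp (- t) ^ 4) by (apply pow_incr; lra).
rewrite E; eapply Rle_trans; [|exact H4]; lra.
Qed.

Lemma Cmod_qO_le : 0 < Cmod qO <= 1 / 200.
Proof. rewrite Cmod_qO; split; [apply exp_pos|apply nome_bound_1]. Qed.

Lemma half_term_le (y b : R) : 0 <= y <= b -> b < 1 -> y / (1 - y) ^ 2 <= b / (1 - b) ^ 2.
Proof.
intros Hy Hb; unfold Rdiv; apply Rmult_le_compat; try lra.
- left; apply Rinv_0_lt_compat, pow_lt; lra.
- apply Rinv_le_contravar; [apply pow_lt; lra|apply pow_incr; lra].
Qed.

Lemma lp_half_real : exists a : R, lp_half qO = RtoC a /\ - 265 / 1000 <= a <= - 235 / 1000.
Proof.
pose proof qO_lt as Hq; pose proof Cmod_qO_le as Hx.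
exists (Re (lp_half qO)); split; [apply Cconj_real, lp_half_conj; [assumption|apply qO_conj]|].
pose proof (lp_half_bound qO Hq) as H.
pose proof (re_le_Cmod (lp_half qO + 1 / 4)) as H2.
replace (Re (lp_half qO + 1 / 4)) with (Re (lp_half qO) + 1 / 4) in H2.
2:{ rewrite <- RtoC_div by lra; simpl; reflexivity. }
apply Rabs_le_between in H2.
set (x := Cmod qO) in *.
assert (E1 : / (1 - x) <= / (199 / 200)) by (apply Rinv_le_contravar; lra).
pose proof (half_term_le x (1 / 200) ltac:(lra) ltac:(lra)) as E2.
assert (E3 : / (1 - x) * (x / (1 - x) ^ 2) <= / (199 / 200) * (1 / 200 / (1 - 1 / 200) ^ 2)).
{ apply Rmult_le_compat; try lra; [left; apply Rinv_0_lt_compat; lra|].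
  apply Rmult_le_pos; [lra|left; apply Rinv_0_lt_compat, pow_lt; lra]. }
lra.
Qed.

(** The 5-torsion point sqrt(-3)/5. It lies on the imaginary axis, so its nome is real. *)
Definition v5 : C := (0, sqrt 3 / 5).

Lemma nome_v5 : nome v5 = RtoC (exp (- (2 * PI * (sqrt 3 / 5)))).
Proof.
unfold v5; rewrite nome_pair, Rmult_0_r, cos_0, sin_0; unfold RtoC; f_equal; ring.
Qed.

Lemma strip_v5 : strip v5.
Proof. unfold strip, v5; simpl; pose proof sqrt3_pos; lra. Qed.

Lemma lp_v5_real : exists a : R, lp qO 1 (nome v5) = RtoC a /\ 5 / 100 <= a.
Proof.
pose proof qO_lt as Hq; pose proof Cmod_qO_le as Hx; pose proof (strip_nome v5 strip_v5) as Hu.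
exists (Re (lp qO 1 (nome v5))); split.
- apply Cconj_real; rewrite lp_conj by (try assumption; apply qO_conj).
  rewrite nome_v5, Cconj_RtoC; reflexivity.
- destruct (lp_split qO Hq 1 (nome v5) (le_n _) Hu) as (_ & _ & E).
  rewrite (tsum_ext (fun n : nat => (ntoC (S n) ^ 1 * nome v5 ^ S n)%C) (fun n : nat => (ntoC (S n) * nome v5 ^ S n)%C)) in E
    by (intros n; now rewrite Cpow_1_r).
  rewrite (proj2 (tsum_n_geometric (nome v5) (proj2 Hu))) in E.
  pose proof nome_bound_2 as Hu1; rewrite nome_v5 in *.
  set (u := exp (- (2 * PI * (sqrt 3 / 5)))) in *.
  assert (Hu2 : Cmod (RtoC u) = u) by (rewrite Cmod_R, Rabs_pos_eq; lra).
  rewrite Hu2 in Hu.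
  pose proof (bet_tail_le qO Hq (RtoC u) (1 / 200) ltac:(rewrite Hu2; nra) ltac:(lra)) as T1.
  assert (Hi : Cmod (/ RtoC u) <= 10).
  { rewrite Cmod_inv, Hu2 by (apply RtoC_neq_0; lra).
    replace 10 with (/ (1 / 10)) by field; apply Rinv_le_contravar; lra. }
  pose proof (bet_tail_le qO Hq (/ RtoC u) (1 / 20) ltac:(pose proof (Cmod_ge_0 (/ RtoC u)); nra) ltac:(lra)) as T2.
  set (A := tsum (fun n : nat => (bet qO n * (ntoC (S n) ^ 1 * RtoC u ^ S n))%C)) in *.
  set (B := tsum (fun n : nat => (bet qO n * (ntoC (S n) ^ 1 * (/ RtoC u) ^ S n))%C)) in *.
  assert (E1 : (RtoC u / (1 - RtoC u) ^ 2)%C = RtoC (u / (1 - u) ^ 2)).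
  { rewrite RtoC_div, RtoC_pow, RtoC_minus by (apply pow_nonzero; lra); reflexivity. }
  rewrite E1, Cpow_1_r in E.
  replace (RtoC (u / (1 - u) ^ 2) + (A - -1 * B))%C with (RtoC (u / (1 - u) ^ 2) + (A + B))%C in E by ring.
  rewrite E; replace (Re (RtoC (u / (1 - u) ^ 2) + (A + B))) with (u / (1 - u) ^ 2 + (Re A + Re B)) by reflexivity.
  pose proof (re_le_Cmod A) as R1; pose proof (re_le_Cmod B) as R2.
  apply Rabs_le_between in R1; apply Rabs_le_between in R2.
  pose proof (half_term_le (1 / 10) u ltac:(lra) ltac:(lra)) as L1.
  set (x := Cmod qO) in *.
  assert (E2 : / (1 - x) <= / (199 / 200)) by (apply Rinv_le_contravar; lra).
  assert (T1' : Cmod A <= / (199 / 200) * (1 / 200 / (1 - 1 / 200) ^ 2)).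
  { eapply Rle_trans; [exact T1|]; apply Rmult_le_compat_r; [|assumption].
    apply Rmult_le_pos; [lra|left; apply Rinv_0_lt_compat, pow_lt; lra]. }
  assert (T2' : Cmod B <= / (199 / 200) * (1 / 20 / (1 - 1 / 20) ^ 2)).
  { eapply Rle_trans; [exact T2|]; apply Rmult_le_compat_r; [|assumption].
    apply Rmult_le_pos; [lra|left; apply Rinv_0_lt_compat, pow_lt; lra]. }
  lra.
Qed.

Lemma om_half_pair : (om / 2)%C = (- (1 / 4), sqrt 3 / 4).
Proof.
unfold Cdiv; replace (/ 2)%C with (RtoC (/ 2)) by (rewrite RtoC_inv by lra; reflexivity).
apply injective_projections; simpl; field.
Qed.

(** The nome of om/2 is purely imaginary, so conjugation exchanges the two terms and the sum is
    real. Its modulus is the square root of |[qO]|, hence below 0.071. *)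
Lemma lp_om_half_real : exists s : R,
  (lp qO 1 (nome (om / 2)) + lp qO 1 (- nome (om / 2)))%C = RtoC s /\ Rabs s <= 345 / 1000.
Proof.
pose proof qO_lt as Hq; pose proof Cmod_qO_le as Hx; pose proof (strip_nome _ strip_om_half) as Hu.
assert (Hc : Cconj (nome (om / 2)) = (- nome (om / 2))%C).
{ rewrite om_half_pair, nome_pair.
  replace (2 * PI * - (1 / 4)) with (- (PI / 2)) by field.
  rewrite cos_neg, sin_neg, cos_PI2, sin_PI2; unfold Cconj, Copp; simpl; f_equal; ring. }
assert (Hm : Cmod (nome (om / 2)) ^ 2 = Cmod qO).
{ rewrite om_half_pair, Cmod_nome, Cmod_qO; simpl Im; rewrite <- Rpower_pow by apply exp_pos.
  unfold Rpower; rewrite ln_exp; f_equal; simpl; field. }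
set (v := nome (om / 2)) in *.
assert (Hs : Cmod v <= 71 / 1000).
{ apply sq_le_inv; [lra|]; rewrite Hm; lra. }
assert (Hv' : Cmod qO < Cmod (- v) < 1) by now rewrite Cmod_opp.
assert (Hv0 : v <> 0) by apply nome_neq_0.
set (S := (lp qO 1 v + lp qO 1 (- v))%C).
exists (Re S); split.
- apply Cconj_real; unfold S; rewrite Cplus_conj, !lp_conj by (try assumption; apply qO_conj).
  rewrite Copp_conj, Hc, Copp_conj || rewrite Copp_conj, Hc.
  replace (- - v)%C with v by ring; ring.
- eapply Rle_trans; [apply re_le_Cmod|]; unfold S.
  assert (Hi : Cmod qO * Cmod (/ v) <= 71 / 1000).
  { rewrite Cmod_inv, <- Hm by assumption; apply Cmod_gt_0 in Hv0.
    replace (Cmod v ^ 2 * / Cmod v) with (Cmod v) by (field; lra); assumption. }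
  assert (B : forall w, Cmod qO < Cmod w < 1 -> Cmod w <= 71 / 1000 -> Cmod qO * Cmod (/ w) <= 71 / 1000 ->
    Cmod (lp qO 1 w) <= 1725 / 10000).
  { intros w Hw Hw1 Hw2.
    destruct (lp_split qO Hq 1 w (le_n _) Hw) as (_ & _ & ->).
    rewrite (tsum_ext (fun n : nat => (ntoC (Datatypes.S n) ^ 1 * w ^ Datatypes.S n)%C) (fun n : nat => (ntoC (Datatypes.S n) * w ^ Datatypes.S n)%C))
      by (intros n; now rewrite Cpow_1_r).
    rewrite (proj2 (tsum_n_geometric w (proj2 Hw))), Cpow_1_r.
    pose proof (bet_tail_le qO Hq w (1 / 2000) ltac:(pose proof (Cmod_ge_0 w); nra) ltac:(lra)) as T1.
    pose proof (bet_tail_le qO Hq (/ w) (71 / 1000) Hw2 ltac:(lra)) as T2.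
    set (A := tsum (fun n : nat => (bet qO n * (ntoC (Datatypes.S n) ^ 1 * w ^ Datatypes.S n))%C)) in *.
    set (A' := tsum (fun n : nat => (bet qO n * (ntoC (Datatypes.S n) ^ 1 * (/ w) ^ Datatypes.S n))%C)) in *.
    assert (E2 : / (1 - Cmod qO) <= / (199 / 200)) by (apply Rinv_le_contravar; lra).
    assert (T1' : Cmod A <= / (199 / 200) * (1 / 2000 / (1 - 1 / 2000) ^ 2)).
    { eapply Rle_trans; [exact T1|]; apply Rmult_le_compat_r; [|assumption].
      apply Rmult_le_pos; [lra|left; apply Rinv_0_lt_compat, pow_lt; lra]. }
    assert (T2' : Cmod A' <= / (199 / 200) * (71 / 1000 / (1 - 71 / 1000) ^ 2)).
    { eapply Rle_trans; [exact T2|]; apply Rmult_le_compat_r; [|assumption].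
      apply Rmult_le_pos; [lra|left; apply Rinv_0_lt_compat, pow_lt; lra]. }
    assert (T0 : Cmod (w / (1 - w) ^ 2) <= 71 / 1000 / (1 - 71 / 1000) ^ 2).
    { pose proof (one_minus_neq_0 w (proj2 Hw)) as N.
      rewrite Cmod_div, Cmod_pow by now apply Cpow_nz.
      pose proof (Cmod_triangle_rev 1 w) as H1; rewrite Cmod_1 in H1.
      pose proof (Cmod_ge_0 w) as P; unfold Rdiv; apply Rmult_le_compat; try lra.
      - left; apply Rinv_0_lt_compat, pow_lt; lra.
      - apply Rinv_le_contravar; [apply pow_lt; lra|apply pow_incr; lra]. }
    replace (w / (1 - w) ^ 2 + (A - -1 * A'))%C with (w / (1 - w) ^ 2 + (A + A'))%C by ring.
    eapply Rle_trans; [apply Cmod_triangle|].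
    eapply Rle_trans; [apply Rplus_le_compat_l, Cmod_triangle|]; lra. }
  eapply Rle_trans; [apply Cmod_triangle|].
  pose proof (B v Hu Hs Hi) as B1.
  assert (Ei : (/ - v)%C = (- / v)%C) by (field; assumption).
  pose proof (B (- v)%C Hv' ltac:(rewrite Cmod_opp; assumption) ltac:(rewrite Ei, Cmod_opp; assumption)) as B2.
  lra.
Qed.

(** The estimates decide three things. f > 0 fixes the branch of the square root of E4; d < 0 and d
    + f <> 0 say that R([v5]) is less than f and not zero, which selects the root in
    [quintic_root]. *)
Lemma fO_real : exists f d : R, fO = RtoC f /\ 0 < f /\ Dz v5 = RtoC d /\ d < 0 /\ d + f <> 0.
Proof.
destruct lp_half_real as (a & Ea & Ha); destruct lp_v5_real as (b & Eb & Hb).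
destruct lp_om_half_real as (s & Es & Hs); apply Rabs_le_between in Hs.
assert (HPI : 0 < 4 * PI ^ 2) by (pose proof PI_RGT_0; assert (0 < PI ^ 2) by (apply pow_lt; lra); lra).
exists (4 * PI ^ 2 / 3 * (s - 2 * a)), (- (4 * PI ^ 2) * (b - a)).
split; [|split; [|split; [|split]]].
- rewrite fO_series, Es, Ea; rewrite !RtoC_mult, RtoC_div, RtoC_minus, !RtoC_mult, RtoC_pow by lra; reflexivity.
- apply Rmult_lt_0_compat; lra.
- rewrite Dz_strip, Eb, Ea by apply strip_v5.
  rewrite RtoC_mult, RtoC_opp, RtoC_minus, RtoC_mult, RtoC_pow; reflexivity.
- nra.
(* This is the tightest use of the bounds: b - a/3 - s/3 is at least 0.05 + 0.078 - 0.115, which is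
   positive. *)
- replace (- (4 * PI ^ 2) * (b - a) + 4 * PI ^ 2 / 3 * (s - 2 * a))
    with (- (4 * PI ^ 2) * (b - a / 3 - s / 3)) by field.
  apply Rlt_not_eq; nra.
Qed.

(** * Two-torsion and five-torsion *)

Definition translates (y : C) : Prop := ((RO y - fO) * (RO (y + / 2) - fO))%C = (3 * fO ^ 2)%C.

Lemma translates_strip y : strip y -> translates y.
Proof.
intros Hy; unfold translates; rewrite <- (Dz_product y Hy); unfold RO; ring.
Qed.

Lemma translates_opp y : off_lattice y -> off_lattice (y + / 2) -> translates y -> translates (- y).
Proof.
intros Hy Hy2 H; unfold translates in *; rewrite RO_opp by assumption.
rewrite <- H; do 2 f_equal.
rewrite <- (RO_opp (y + / 2)), <- (RO_period (- (y + / 2)) (1, 0)%Z)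
  by (try assumption; now apply off_lattice_opp).
f_equal; unfold lat, ZtoC; simpl; field; apply RtoC_neq_0; lra.
Qed.

Lemma strip_opp_translates y : strip (- y) -> off_lattice y /\ translates y.
Proof.
intros H; pose proof (strip_off _ H) as H1; pose proof (strip_off _ (strip_shift _ H)) as H2.
replace y with (- - y)%C by ring; split; [now apply off_lattice_opp|].
apply translates_opp; [assumption|assumption|now apply translates_strip].
Qed.

(** The points om (0, t) and om^2 (0, t) lie below the real axis, but their negatives have imaginary
    part t/2 and lie in the strip, and [RO] is even. *)
Lemma imaginary_translates t : 0 < t < sqrt 3 / 2 ->
  translates (0, t) /\ translates (om * (0, t)) /\ translates (om * (om * (0, t))) /\ off_lattice (0, t).
Proof.
intros Ht; assert (Hs : strip (0, t)) by (unfold strip; simpl; lra).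
split; [now apply translates_strip|].
split; [|split; [|now apply strip_off]]; apply strip_opp_translates; unfold strip; simpl.
- match goal with |- 0 < ?a < _ => replace a with (t / 2) by field end; lra.
- match goal with |- 0 < ?a < _ => replace a with (t / 2) by (pose proof sqrt3_sq; nra) end; lra.
Qed.

Lemma csum_residues_2 (h : Z * Z -> C) :
  csum (residues 2) h = (h (0, 0)%Z + h (0, 1)%Z + h (1, 0)%Z + h (1, 1)%Z)%C.
Proof. simpl; ring. Qed.

Lemma ntoC_2 : ntoC 2 = RtoC 2.
Proof. unfold ntoC; f_equal; simpl; ring. Qed.

Lemma off_lattice_half v r : off_lattice (2 * v) -> off_lattice (v + lat r / 2).
Proof. rewrite <- ntoC_2; apply off_lattice_div; lia. Qed.

Lemma off_lattice_half1 v : off_lattice (2 * v) -> off_lattice (v + / 2).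
Proof.
intros H; replace (v + / 2)%C with (v + lat (1, 0)%Z / 2)%C; [now apply off_lattice_half|].
unfold lat, ZtoC; simpl; field; apply RtoC_neq_0; lra.
Qed.

(** The three translates by half periods are rotations of one: v + om/2 = om (om^2 v + 1/2), and
    likewise for (1 + om)/2 up to a period. The factor X^3 - f^3 = (X - f)(om X - f)(om^2 X - f)
    clears all denominators at once. *)
Lemma RO_two_torsion t : 0 < t < sqrt 3 / 2 -> off_lattice (2 * (0, t)) ->
  let X := RO (0, t) in let f := fO in
  ((X ^ 3 - f ^ 3) * (RO ((0, t) + lat (1, 0)%Z / 2) - f) = 3 * f ^ 2 * (X ^ 2 + f * X + f ^ 2))%C /\
  ((X ^ 3 - f ^ 3) * (RO ((0, t) + lat (0, 1)%Z / 2) - om * f) =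
     om * (3 * f ^ 2 * ((X - f) * (om * X - f))))%C /\
  ((X ^ 3 - f ^ 3) * (RO ((0, t) + lat (1, 1)%Z / 2) - om * om * f) =
     om * om * (3 * f ^ 2 * ((X - f) * (om * (om * X) - f))))%C.
Proof.
intros Ht H2; destruct (imaginary_translates t Ht) as (T0 & T1 & T2 & Ho).
intros X f; set (v := (0, t) : C) in *.
assert (Ho1 : off_lattice (om * v)) by now apply off_lattice_om.
assert (Ho2 : off_lattice (om * (om * v))) by now apply off_lattice_om.
assert (N2 : RtoC 2 <> 0) by (apply RtoC_neq_0; lra).
assert (Oo1 : off_lattice (om * v + / 2)).
{ apply off_lattice_half1; replace (2 * (om * v))%C with (om * (2 * v))%C by ring; now apply off_lattice_om. }
assert (Oo2 : off_lattice (om * (om * v) + / 2)).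
{ apply off_lattice_half1; replace (2 * (om * (om * v)))%C with (om * (om * (2 * v)))%C by ring.
  now do 2 apply off_lattice_om. }
assert (E1 : RO (v + lat (1, 0)%Z / 2) = RO (v + / 2)).
{ f_equal; unfold lat, ZtoC; simpl; field; assumption. }
assert (E2 : RO (v + lat (0, 1)%Z / 2) = (om * RO (om * (om * v) + / 2))%C).
{ rewrite <- RO_om by assumption; f_equal; unfold lat, ZtoC; simpl.
  transitivity (om * (om * om) * v + om / 2)%C; [rewrite om_cube|]; field; assumption. }
assert (E3 : RO (v + lat (1, 1)%Z / 2) = (om * (om * RO (om * v + / 2)))%C).
{ rewrite <- RO_om, <- RO_om by (try assumption; now apply off_lattice_om).
  rewrite <- (RO_period (v + lat (1, 1)%Z / 2) (-1, -1)%Z) by now apply off_lattice_half.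
  f_equal; unfold lat, ZtoC; simpl.
  transitivity (om * (om * om) * v + om * om / 2)%C; [rewrite om_cube, om_eq|]; field; assumption. }
rewrite E1, E2, E3.
unfold translates in T0, T1, T2.
rewrite !RO_om in T2 by assumption; rewrite RO_om in T1 by assumption.
fold X f in T0, T1, T2.
split; [rewrite <- T0; ring|split; [rewrite <- T2|rewrite <- T1]; ring [om_eq]].
Qed.

(** The duplication formula is the distribution relation for 2, whose four terms are X and the three
    translates just computed. *)
Lemma RO_dup t : 0 < t < sqrt 3 / 2 -> off_lattice (2 * (0, t)) ->
  (4 * RO (2 * (0, t)) * (RO (0, t) ^ 3 - fO ^ 3) = RO (0, t) * (RO (0, t) ^ 3 + 8 * fO ^ 3))%C.
Proof.
intros Ht H2; destruct (RO_two_torsion t Ht H2) as (FA & FB & FD).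
assert (E := RO_distribution 2 (0, t) ltac:(lia)); rewrite ntoC_2 in E.
specialize (E H2); rewrite csum_residues_2 in E.
assert (E0 : RO ((0, t) + lat (0, 0)%Z / 2) = RO (0, t)).
{ f_equal; unfold lat, ZtoC; simpl; field; apply RtoC_neq_0; lra. }
rewrite E0 in E; cbv zeta in FA, FB, FD.
set (X := RO (0, t)) in *; set (f := fO) in *.
transitivity ((X ^ 3 - f ^ 3) * (2 ^ 2 * RO (2 * (0, t))))%C; [ring|]; rewrite <- E.
set (A := RO ((0, t) + lat (1, 0)%Z / 2)) in *; set (B := RO ((0, t) + lat (0, 1)%Z / 2)) in *.
set (D := RO ((0, t) + lat (1, 1)%Z / 2)) in *.
transitivity ((X ^ 3 - f ^ 3) * X + (X ^ 3 - f ^ 3) * (A - f) + (X ^ 3 - f ^ 3) * (B - om * f)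
  + (X ^ 3 - f ^ 3) * (D - om * om * f))%C; [ring [om_eq]|].
rewrite FA, FB, FD; ring [om_eq].
Qed.

(** Second moment of the same four values. Squares enter the second derivative by [lp_3_wp], and
    comparing with its distribution relation [lp_four] is what evaluates E4 at om. *)
Lemma RO_sq_dup t : 0 < t < sqrt 3 / 2 -> off_lattice (2 * (0, t)) -> (RO (0, t) ^ 3 - fO ^ 3)%C <> 0 ->
  (RO (0, t) ^ 2 + RO ((0, t) + lat (1, 0)%Z / 2) ^ 2 + RO ((0, t) + lat (0, 1)%Z / 2) ^ 2
   + RO ((0, t) + lat (1, 1)%Z / 2) ^ 2 = 16 * RO (2 * (0, t)) ^ 2)%C.
Proof.
intros Ht H2 HK; destruct (RO_two_torsion t Ht H2) as (FA & FB & FD).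
pose proof (RO_dup t Ht H2) as E; cbv zeta in FA, FB, FD.
set (X := RO (0, t)) in *; set (f := fO) in *; set (Y := RO (2 * (0, t))) in *.
set (A := RO ((0, t) + lat (1, 0)%Z / 2)) in *; set (B := RO ((0, t) + lat (0, 1)%Z / 2)) in *.
set (D := RO ((0, t) + lat (1, 1)%Z / 2)) in *.
assert (HK2 : ((X ^ 3 - f ^ 3) ^ 2)%C <> 0) by now apply Cpow_nz.
assert (R : ((X ^ 3 - f ^ 3) ^ 2 * (X ^ 2 + A ^ 2 + B ^ 2 + D ^ 2) = (X ^ 3 - f ^ 3) ^ 2 * (16 * Y ^ 2))%C).
{ transitivity ((4 * Y * (X ^ 3 - f ^ 3)) ^ 2)%C; [|ring]; rewrite E.
  transitivity ((X ^ 3 - f ^ 3) ^ 2 * X ^ 2 + ((X ^ 3 - f ^ 3) * (A - f) + (X ^ 3 - f ^ 3) * f) ^ 2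
    + ((X ^ 3 - f ^ 3) * (B - om * f) + (X ^ 3 - f ^ 3) * (om * f)) ^ 2
    + ((X ^ 3 - f ^ 3) * (D - om * om * f) + (X ^ 3 - f ^ 3) * (om * om * f)) ^ 2)%C; [ring|].
  rewrite FA, FB, FD; ring [om_eq]. }
apply (f_equal (fun z => z / (X ^ 3 - f ^ 3) ^ 2)%C) in R.
transitivity ((X ^ 3 - f ^ 3) ^ 2 * (X ^ 2 + A ^ 2 + B ^ 2 + D ^ 2) / (X ^ 3 - f ^ 3) ^ 2)%C; [field; assumption|].
rewrite R; field; assumption.
Qed.

(** The polynomial is a - 4 times a quartic that is symmetric under a to 16/a, hence quadratic in s
    = a + 16/a with roots 2 + 6 sqrt 5 and 2 - 6 sqrt 5. The first would make a larger than 1, as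
    does a = 4. *)
Lemma quintic_root (a : R) : a < 1 -> a <> 0 ->
  (a + 8) * a ^ 3 * (16 - a) = 64 * (16 + 8 * a) * (a - 1) -> a + 16 / a = 2 - 6 * sqrt 5.
Proof.
intros H1 H0 E.
assert (F : (a - 4) * (a ^ 4 - 4 * a ^ 3 - 144 * a ^ 2 - 64 * a + 256) = 0) by nra.
apply Rmult_integral in F; destruct F as [F|F]; [lra|].
set (s := a + 16 / a).
assert (Q : s ^ 2 - 4 * s - 176 = 0).
{ apply Rmult_eq_reg_l with (a ^ 2); [|now apply pow_nonzero].
  rewrite Rmult_0_r, <- F; unfold s; field; assumption. }
assert (S5 : sqrt 5 * sqrt 5 = 5) by (apply sqrt_sqrt; lra).
assert (P5 : 0 < sqrt 5) by (apply sqrt_lt_R0; lra).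
assert (G : (s - 2 - 6 * sqrt 5) * (s - 2 + 6 * sqrt 5) = 0) by nra.
apply Rmult_integral in G; destruct G as [G|G]; [|lra].
exfalso; assert (U5 : sqrt 5 < 9 / 4) by nra.
assert (sa : s * a = a ^ 2 + 16) by (unfold s; field; assumption).
assert (Hs : s = 2 + 6 * sqrt 5) by lra.
nra.
Qed.

(* x and x' are normalised x-coordinates of P and 2P, with 5P = 0. *)
Lemma five_torsion_sum (x x' : R) : x < 1 -> x <> 0 ->
  4 * x' * (x ^ 3 - 1) = x * (x ^ 3 + 8) -> 4 * x * (x' ^ 3 - 1) = x' * (x' ^ 3 + 8) ->
  x ^ 3 <> 1 /\ x' ^ 3 <> 1 /\ / (x ^ 3 - 1) + / (x' ^ 3 - 1) = - (2 / 3) * sqrt 5.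
Proof.
intros H1 H0 E1 E2.
assert (Hx3 : x ^ 3 < 1).
{ destruct (Rle_dec x 0) as [h|h].
  - assert (x ^ 3 <= 0); [|lra]. replace (x ^ 3) with (x * x ^ 2) by ring; pose proof (pow2_ge_0 x); nra.
  - rewrite <- (pow1 3); apply pow_lt_compat_l || (simpl; nra). }
assert (Hx' : x' <> 0) by (intros ->; simpl in E2; lra).
assert (Hx'3 : x' ^ 3 <> 1).
{ intros h; rewrite h in E2; lra. }
(* Duplication gives a = (x^3 + 8)/(x^3 - 1) for P, and the same quantity for 2P is 4 x/x' = 16/a.
   Hence 1/(x^3 - 1) = (a - 1)/9, and the required sum is (a + 16/a - 2)/9. *)
set (a := 4 * x' / x).
assert (Ha0 : a <> 0) by (unfold a; intros h; apply Hx'; apply Rmult_eq_reg_l with (4 / x); [unfold Rdiv in *; lra|]; apply Rmult_integral_contrapositive_currified; [lra|now apply Rinv_neq_0_compat]).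
assert (Ea : a * (x ^ 3 - 1) = x ^ 3 + 8).
{ unfold a; apply Rmult_eq_reg_l with x; [|assumption]. rewrite <- E1; field; assumption. }
assert (Ha1 : a < 1) by nra.
assert (Eb : 16 / a * (x' ^ 3 - 1) = x' ^ 3 + 8).
{ unfold a; apply Rmult_eq_reg_l with x'; [|assumption]. rewrite <- E2; field; auto. }
assert (Ex' : x' ^ 3 = x ^ 3 * a ^ 3 / 64) by (unfold a; field; assumption).
assert (Q : (a + 8) * a ^ 3 * (16 - a) = 64 * (16 + 8 * a) * (a - 1)).
{ assert (F1 : x ^ 3 * (a - 1) = a + 8) by lra.
  assert (F2 : x' ^ 3 * (16 - a) = 16 + 8 * a).
  { assert (h : a * (16 / a * (x' ^ 3 - 1)) = a * (x' ^ 3 + 8)) by (rewrite Eb; reflexivity).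
    replace (a * (16 / a * (x' ^ 3 - 1))) with (16 * (x' ^ 3 - 1)) in h by (field; assumption); lra. }
  rewrite <- F2, Ex', <- F1; field. }
pose proof (quintic_root a Ha1 Ha0 Q) as S.
assert (D1 : / (x ^ 3 - 1) = (a - 1) / 9).
{ apply Rmult_eq_reg_l with (x ^ 3 - 1); [|lra]. rewrite Rinv_r by lra.
  replace ((x ^ 3 - 1) * ((a - 1) / 9)) with ((a * (x ^ 3 - 1) - (x ^ 3 - 1)) / 9) by field; rewrite Ea; field. }
assert (D2 : / (x' ^ 3 - 1) = (16 / a - 1) / 9).
{ apply Rmult_eq_reg_l with (x' ^ 3 - 1); [|lra]. rewrite Rinv_r by lra.
  replace ((x' ^ 3 - 1) * ((16 / a - 1) / 9)) with ((16 / a * (x' ^ 3 - 1) - (x' ^ 3 - 1)) / 9) by (field; assumption).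
  rewrite Eb; field. }
split; [lra|split; [assumption|]].
rewrite D1, D2; lra.
Qed.

Lemma RO_five_torsion : exists f x x' : R, fO = RtoC f /\ 0 < f /\
  RO v5 = RtoC (f * x) /\ RO (2 * v5) = RtoC (f * x') /\ x ^ 3 <> 1 /\ x' ^ 3 <> 1 /\
  / (x ^ 3 - 1) + / (x' ^ 3 - 1) = - (2 / 3) * sqrt 5 /\ off_lattice (2 * v5) /\ x < 1 /\ x <> 0 /\
  4 * x' * (x ^ 3 - 1) = x * (x ^ 3 + 8).
Proof.
destruct fO_real as (f & d & Ef & Hf & Ed & Hd & Hdf).
pose proof sqrt3_pos as H3.
assert (E2v : (2 * v5)%C = (0, 2 * (sqrt 3 / 5))).
{ unfold v5; apply injective_projections; simpl; ring. }
assert (O2 : off_lattice (2 * v5)) by (rewrite E2v; apply strip_off; unfold strip; simpl; lra).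
assert (O1 : off_lattice v5) by apply strip_off, strip_v5.
(* 5 [v5] is the period sqrt(-3), so doubling twice leads back to - [v5] modulo the lattice, where
   [RO] has the same value as at [v5]. *)
assert (E4 : (2 * (2 * v5))%C = (- v5 + lat (1, 2)%Z)%C).
{ unfold v5, lat, om, ZtoC; apply injective_projections; simpl; field. }
assert (O4 : off_lattice (2 * (2 * v5))) by (rewrite E4; now apply off_lattice_add, off_lattice_opp).
pose proof (RO_dup (sqrt 3 / 5) ltac:(lra) O2) as D1.
pose proof (RO_dup (2 * (sqrt 3 / 5)) ltac:(lra)) as D2.
rewrite <- E2v in D2; specialize (D2 O4).
fold v5 in D1; rewrite E4, RO_period, RO_opp in D2 by (try assumption; now apply off_lattice_opp).
set (x := (d + f) / f).
assert (Ex : RO v5 = RtoC (f * x)).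
{ unfold RO; rewrite Ed, Ef, <- RtoC_plus; f_equal; unfold x; field; lra. }
assert (Hx1 : x < 1) by (unfold x; apply Rlt_div_l; lra).
assert (Hx0 : x <> 0).
{ unfold x; intros h; apply Hdf; apply Rmult_eq_reg_r with (/ f); [unfold Rdiv in h; lra|].
  apply Rinv_neq_0_compat; lra. }
assert (Hx3 : x ^ 3 < 1).
{ destruct (Rle_dec x 0) as [h|h].
  - assert (x ^ 3 <= 0); [|lra]. replace (x ^ 3) with (x * x ^ 2) by ring; pose proof (pow2_ge_0 x); nra.
  - simpl; nra. }
set (x' := x * (x ^ 3 + 8) / (4 * (x ^ 3 - 1))).
assert (Ex' : RO (2 * v5) = RtoC (f * x')).
{ rewrite Ex, Ef in D1; rewrite <- !RtoC_pow, <- RtoC_minus, <- !RtoC_mult, <- RtoC_plus, <- RtoC_mult in D1.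
  assert (N : RtoC ((f * x) ^ 3 - f ^ 3) <> 0).
  { apply RtoC_neq_0; replace ((f * x) ^ 3 - f ^ 3) with (f ^ 3 * (x ^ 3 - 1)) by ring.
    apply Rmult_integral_contrapositive_currified; [apply pow_nonzero|]; lra. }
  set (w := (f * x) ^ 3 - f ^ 3) in *.
  assert (Nw : w <> 0) by (intros h; apply N; rewrite h; reflexivity).
  replace (RO (2 * v5)) with (4 * RO (2 * v5) * RtoC w / (4 * RtoC w))%C by (field; assumption).
  rewrite D1, <- RtoC_mult, <- RtoC_div by lra.
  f_equal; unfold x'; apply Rmult_eq_reg_r with (4 * w); [|lra].
  replace (f * (x * (x ^ 3 + 8) / (4 * (x ^ 3 - 1))) * (4 * w))
    with (f * (x * (x ^ 3 + 8)) * f ^ 3) by (unfold w; field; lra).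
  field; assumption. }
assert (R1 : 4 * x' * (x ^ 3 - 1) = x * (x ^ 3 + 8)) by (unfold x'; field; lra).
assert (R2 : 4 * x * (x' ^ 3 - 1) = x' * (x' ^ 3 + 8)).
{ rewrite Ex, Ex', Ef in D2; rewrite <- !RtoC_pow, <- RtoC_minus, <- !RtoC_mult, <- RtoC_plus, <- RtoC_mult in D2.
  apply RtoC_inj in D2; apply Rmult_eq_reg_l with (f ^ 4); [|apply pow_nonzero; lra].
  transitivity (4 * (f * x) * ((f * x') ^ 3 - f ^ 3)); [ring|]. rewrite D2; ring. }
destruct (five_torsion_sum x x' Hx1 Hx0 R1 R2) as (N1 & N2 & S).
exists f, x, x'; repeat split; assumption.
Qed.

(** * Eisenstein series at sqrt(-3) *)

Lemma sqr_nome_lt (q : C) : 0 < Cmod q < 1 -> 0 < Cmod (q * q) < 1.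
Proof. intros Hq; rewrite Cmod_mult; nra. Qed.

Lemma zpow_double (u : C) n : u <> 0 -> zpow u (2 * n) = zpow (u * u) n.
Proof.
intros Hu; replace (2 * n)%Z with (n + n)%Z by lia.
rewrite zpow_add, zpow_mult by assumption; reflexivity.
Qed.

Lemma zpow_neg_base_even (u : C) n : u <> 0 -> zpow (- u) (2 * n) = zpow u (2 * n).
Proof.
intros Hu; assert (Hu' : (- u)%C <> 0).
{ intros E; apply Hu; replace u with (- - u)%C by ring; rewrite E; ring. }
rewrite !zpow_double by assumption; f_equal; ring.
Qed.

Lemma zpow_neg_base_odd (u : C) n : u <> 0 -> zpow (- u) (2 * n + 1) = (- zpow u (2 * n + 1))%C.
Proof.
intros Hu; assert (Hu' : (- u)%C <> 0).
{ intros E; apply Hu; replace u with (- - u)%C by ring; rewrite E; ring. }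
rewrite !zpow_succ, zpow_neg_base_even by assumption; ring.
Qed.

Section Nome.
Variable q : C.
Hypothesis Hq : 0 < Cmod q < 1.

Lemma lterm_pm_even k (u : C) n : u <> 0 ->
  (lterm q k u (2 * n) + lterm q k (- u) (2 * n))%C = (2 ^ S k * lterm (q * q) k (u * u) n)%C.
Proof.
intros Hu; unfold lterm; rewrite zpow_neg_base_even, zpow_double, ZtoC_mult, Cpow_mult_l by assumption.
change (ZtoC 2) with (RtoC 2).
replace (lam q (2 * n)) with (lam (q * q) n); [rewrite Cpow_S; ring|].
unfold lam; destruct (Z.eqb_spec n 0) as [->|Hn]; [reflexivity|].
destruct (Z.eqb_spec (2 * n) 0) as [h|h]; [lia|].
rewrite zpow_double; [reflexivity|now apply q_neq_0].
Qed.

Lemma lterm_pm_odd k (u : C) n : u <> 0 ->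
  (lterm q k u (2 * n + 1) + lterm q k (- u) (2 * n + 1))%C = 0.
Proof. intros Hu; unfold lterm; rewrite zpow_neg_base_odd by assumption; ring. Qed.

Lemma sq_annulus u : Cmod q < Cmod u < 1 -> Cmod (q * q) < Cmod (u * u) < 1.
Proof. intros Hu; rewrite !Cmod_mult; nra. Qed.

(** Odd indices cancel, and for even ones 1/(1 - q^(2n)) is the weight belonging to the nome q^2. *)
Lemma lp_pm k u : Cmod q < Cmod u < 1 ->
  (lp q k u + lp q k (- u))%C = (2 ^ S k * lp (q * q) k (u * u))%C.
Proof.
intros Hu; assert (Hu0 : u <> 0) by (apply Cmod_neq_0; lra).
assert (Hu' : Cmod q < Cmod (- u) < 1) by now rewrite Cmod_opp.
pose proof (summable_lterm q Hq k u Hu) as S1; pose proof (summable_lterm q Hq k (- u) Hu') as S2.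
unfold lp; rewrite <- tsum_plus by assumption.
rewrite tsum_Z_parity by now apply summable_plus.
rewrite (tsum_ext (fun m => (lterm q k u (2 * m + 1) + lterm q k (- u) (2 * m + 1))%C) (fun _ => RtoC 0))
  by (intros; now apply lterm_pm_odd).
rewrite (tsum_eq (fun _ : Z => RtoC 0) 0).
2:{ apply (has_sum_finite nil); [constructor|auto]. }
rewrite Cplus_0_r, <- tsum_scal.
- apply tsum_ext; intros n; now apply lterm_pm_even.
- apply summable_lterm; [now apply sqr_nome_lt|now apply sq_annulus].
Qed.

(** Rests on (1 + q^n)/(1 - q^(2n)) = 1/(1 - q^n). *)
Lemma lp_half_shift k h U : (h * h)%C = q -> Cmod q < Cmod U < 1 ->
  (lp (q * q) k U + lp (q * q) k (q * U))%C = lp q k U.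
Proof.
intros Hh HU.
assert (Hq0 : q <> 0) by now apply q_neq_0.
assert (HU0 : U <> 0) by (apply Cmod_neq_0; lra).
pose proof (sqr_nome_lt q Hq) as Hqq.
assert (H1 : Cmod (q * q) < Cmod U < 1) by (rewrite Cmod_mult; nra).
assert (H2 : Cmod (q * q) < Cmod (q * U) < 1) by (rewrite !Cmod_mult; nra).
unfold lp; rewrite <- tsum_plus by now apply summable_lterm.
apply tsum_ext; intros n; unfold lterm.
rewrite (zpow_mult q U) by assumption.
unfold lam; destruct (Z.eqb_spec n 0) as [->|Hn]; [ring|].
assert (Hz : forall p, 0 < Cmod p < 1 -> (1 - zpow p n)%C <> 0).
{ intros p Hp; destruct (Z_cases n) as [[[|j] ->]|[j ->]]; [lia| |].
  - rewrite zpow_nat; now apply one_minus_qpow_neq_0.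
  - rewrite zpow_neg, zpow_nat by now apply q_neq_0.
    pose proof (one_minus_qpow_neq_0 p Hp j) as A; pose proof (Cpow_nz p (S j) (q_neq_0 p Hp)) as B.
    intros E; apply A.
    replace (1 - p ^ S j)%C with (- (p ^ S j * (1 - / p ^ S j)))%C by (field; assumption).
    rewrite E; ring. }
pose proof (Hz q Hq) as A; pose proof (Hz (q * q)%C Hqq) as B.
rewrite zpow_mult in * by assumption.
field; split; assumption.
Qed.

(** The distribution relation for multiplication by 2 on the derivatives: u, -u, h u and -h u are
    the four halves of the point u^2. *)
Lemma lp_four k h u : (h * h)%C = q -> Cmod q < Cmod (h * u) -> Cmod u < 1 ->
  (lp q k u + lp q k (- u) + (lp q k (h * u) + lp q k (- (h * u))))%C = (2 ^ S k * lp q k (u * u))%C.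
Proof.
intros Hh H1 H2.
assert (Hh1 : Cmod h * Cmod h = Cmod q) by (rewrite <- Cmod_mult, Hh; reflexivity).
pose proof (Cmod_ge_0 h) as P; pose proof (Cmod_ge_0 u) as P2; rewrite Cmod_mult in H1.
assert (Hh2 : Cmod h < 1) by nra.
assert (Hhu : Cmod h < Cmod u) by nra.
rewrite !lp_pm by (rewrite ?Cmod_mult; nra).
rewrite <- Cmult_plus_distr_l; f_equal.
replace (h * u * (h * u))%C with (q * (u * u))%C by (rewrite <- Hh; ring).
apply (lp_half_shift k h); [assumption|rewrite Cmod_mult; nra].
Qed.

(** In the nome q^2 the point u = q is a half period, where the derivative of an even elliptic
    function vanishes; termwise this is the substitution of -n for n. *)
Lemma lp_2_half : lp (q * q) 2 q = 0.
Proof.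
pose proof (sqr_nome_lt q Hq) as Hqq; pose proof (q_neq_0 q Hq) as Hq0.
assert (Hu : Cmod (q * q) < Cmod q < 1) by (rewrite Cmod_mult; nra).
pose proof (summable_lterm (q * q) Hqq 2 q Hu) as HS.
assert (E : lp (q * q) 2 q = (- RtoC 1 * lp (q * q) 2 q)%C).
{ unfold lp; rewrite (tsum_bij Z.opp Z.opp) at 1 by (try assumption; intros; lia).
  rewrite <- tsum_scal by assumption.
  apply tsum_ext; intros n; unfold lterm.
  destruct (Z_cases n) as [[[|j] ->]|[j ->]].
  - unfold lam; simpl; ring.
  - rewrite lam_neg, lam_pos, ZtoC_opp, zpow_neg_nat, zpow_nat by assumption.
    pose proof (one_minus_qpow_neq_0 (q * q) Hqq j) as A; pose proof (Cpow_nz q (S j) Hq0) as B.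
    rewrite Cpow_inv by assumption.
    unfold bet; rewrite Cpow_mult_l in *; field; split; assumption.
  - rewrite Z.opp_involutive, lam_neg, lam_pos, ZtoC_opp, zpow_neg_nat, zpow_nat by assumption.
    pose proof (one_minus_qpow_neq_0 (q * q) Hqq j) as A; pose proof (Cpow_nz q (S j) Hq0) as B.
    rewrite Cpow_inv by assumption.
    unfold bet; rewrite Cpow_mult_l in *; field; split; assumption. }
set (T := lp (q * q) 2 q) in *.
replace T with ((T - (- RtoC 1 * T)) / 2)%C by (field; apply RtoC_neq_0; lra).
rewrite <- E; field; apply RtoC_neq_0; lra.
Qed.

End Nome.

Lemma four_PI2_neq_0 : (4 * RtoC PI ^ 2)%C <> 0.
Proof.
rewrite <- RtoC_pow, <- RtoC_mult; apply RtoC_neq_0.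
pose proof PI_RGT_0; assert (0 < PI ^ 2) by (apply pow_lt; lra); lra.
Qed.

(** The value [fO] in the normalisation of [wp], that is, divided by (2 pi i)^2. *)
Definition eO : C := (- (fO / (4 * RtoC PI ^ 2)))%C.
(** The discrepancy between two choices of the additive constant: the one by E2 in [wp] and the one
    by rotation symmetry in [RO]. *)
Definition wp_shift : C := (E2q qO / 12 + lp_half qO - eO)%C.

Lemma RO_wp z : strip z -> RO z = (- (4 * RtoC PI ^ 2) * (wp qO (nome z) - wp_shift))%C.
Proof.
intros Hz; unfold RO; rewrite Dz_strip by assumption; unfold wp, wp_shift, eO.
assert (N : RtoC PI <> 0) by (apply RtoC_neq_0; pose proof PI_RGT_0; lra); field; assumption.
Qed.

(** The values at the four halves of a point satisfy a linear relation (distribution), a quadratic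
    one ([RO_sq_dup]) and one for the second derivative ([lp_four]). As the second derivative is 6
    wp^2 - E4/24, the three combine to a relation of degree one in wp, with coefficients -144 delta
    and 72 delta^2 + E4/2 for delta = [wp_shift]. Blow-up makes both vanish. *)
Lemma wp_shift_E4_zero : wp_shift = 0 /\ E4q qO = 0.
Proof.
pose proof qO_lt as Hq; pose proof sqrt3_pos as H3; pose proof PI_RGT_0 as HPI.
assert (H : (- 144 * wp_shift)%C = 0 /\ (72 * wp_shift ^ 2 + E4q qO / 2)%C = 0).
{ apply linear_unbounded_zero; intros B.
  destruct (wp_unbounded qO Hq B 0 ltac:(lra)) as (r & Hr0 & Hr1 & Hr2 & Hr3).
  exists (wp qO (RtoC r)); split; [assumption|].
  (* Chosen so that the nome of v = (0, t) has square r: the points supplied by [wp_unbounded] are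
     doubles of points on the imaginary axis. *)
  set (t := - ln r / (4 * PI)).
  assert (Hl0 : ln r < 0) by (rewrite <- ln_1; apply ln_increasing; lra).
  assert (Hl1 : - (PI * sqrt 3) < ln r).
  { rewrite Cmod_qO in Hr1; rewrite <- (ln_exp (- (PI * sqrt 3))); apply ln_increasing; [apply exp_pos|assumption]. }
  assert (Ht0 : 0 < t) by (unfold t; apply Rdiv_lt_0_compat; lra).
  assert (Ht1 : t < sqrt 3 / 4).
  { unfold t; apply Rmult_lt_reg_r with (4 * PI); [lra|].
    replace (- ln r / (4 * PI) * (4 * PI)) with (- ln r) by (field; lra).
    replace (sqrt 3 / 4 * (4 * PI)) with (PI * sqrt 3) by field; lra. }
  set (v := (0, t) : C).
  assert (E2v : (2 * v)%C = (0, 2 * t)) by (unfold v; apply injective_projections; simpl; ring).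
  assert (S2 : strip (2 * v)) by (rewrite E2v; unfold strip; simpl; lra).
  assert (S0 : strip v) by (unfold strip, v; simpl; lra).
  assert (Nh : RtoC 2 <> 0) by (apply RtoC_neq_0; lra).
  assert (L10 : (v + lat (1, 0)%Z / 2)%C = (v + / 2)%C) by (unfold lat, ZtoC; simpl; field; assumption).
  assert (L01 : (v + lat (0, 1)%Z / 2)%C = (v + om / 2)%C) by (unfold lat, ZtoC; simpl; field; assumption).
  assert (L11 : (v + lat (1, 1)%Z / 2)%C = (v + om / 2 + / 2)%C) by (unfold lat, ZtoC; simpl; field; assumption).
  assert (S1 : strip (v + / 2)) by now apply strip_shift.
  assert (S01 : strip (v + om / 2)) by (rewrite om_half_pair; unfold strip, v; simpl; lra).
  assert (S11 : strip (v + om / 2 + / 2)) by now apply strip_shift.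
  assert (O2 := strip_off _ S2).
  destruct (imaginary_translates t ltac:(lra)) as (T0 & T1 & T2 & Ho).
  assert (Hf : fO <> 0).
  { destruct fO_real as (f & d & Ef & Hf & _); rewrite Ef; apply RtoC_neq_0; lra. }
  assert (HK : (RO v ^ 3 - fO ^ 3)%C <> 0).
  { assert (Ho1 : off_lattice (om * v)) by now apply off_lattice_om.
    unfold translates in *; fold v in T0, T1, T2.
    rewrite RO_om in T1 by assumption; rewrite !RO_om in T2 by assumption.
    assert (N : (3 * fO ^ 2)%C <> 0) by (apply Cmult_neq_0; [apply RtoC_neq_0; lra|now apply Cpow_nz]).
    replace (RO v ^ 3 - fO ^ 3)%C with ((RO v - fO) * ((om * RO v - fO) * (om * (om * RO v) - fO)))%C by ring [om_eq].
    repeat apply Cmult_neq_0; intros E; apply N;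
      [rewrite <- T0|rewrite <- T1|rewrite <- T2]; rewrite E; ring. }
  pose proof (RO_sq_dup t ltac:(lra) O2 HK) as ESq.
  assert (EL := RO_distribution 2 v ltac:(lia)); rewrite ntoC_2 in EL.
  specialize (EL O2); rewrite csum_residues_2 in EL.
  replace (v + lat (0, 0)%Z / 2)%C with v in EL by (unfold lat, ZtoC; simpl; field; assumption).
  fold v in ESq; rewrite L10, L01, L11 in *.
  assert (Hr : (nome v * nome v)%C = RtoC r).
  { rewrite <- nome_plus; replace (v + v)%C with (0, 2 * t) by (unfold v; apply injective_projections; simpl; ring).
    rewrite nome_pair, Rmult_0_r, cos_0, sin_0.
    replace (- (2 * PI * (2 * t))) with (ln r) by (unfold t; field; lra).
    rewrite exp_ln by lra; unfold RtoC; f_equal; ring. }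
  set (h := nome (om / 2)).
  assert (Hh : (h * h)%C = qO) by (unfold h, qO; rewrite <- nome_plus; f_equal; field; assumption).
  pose proof (lp_four qO Hq 3 h (nome v) Hh) as L3.
  assert (Nhv : nome (v + om / 2) = (h * nome v)%C) by (rewrite nome_plus; unfold h; ring).
  assert (Nhv' : nome (v + om / 2 + / 2) = (- (h * nome v))%C) by (rewrite nome_plus, Nhv, nome_half; ring).
  assert (Nv' : nome (v + / 2) = (- nome v)%C) by (rewrite nome_plus, nome_half; ring).
  assert (N2v : nome (2 * v) = RtoC r) by (rewrite <- Hr, <- nome_plus; f_equal; ring).
  specialize (L3 ltac:(rewrite <- Nhv; apply (strip_nome _ S01)) ltac:(apply (strip_nome _ S0))).
  rewrite Hr in L3.
  assert (A1 := strip_nome _ S0); assert (A2 := strip_nome _ S1); rewrite Nv' in A2.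
  assert (A3 := strip_nome _ S01); rewrite Nhv in A3; assert (A4 := strip_nome _ S11); rewrite Nhv' in A4.
  assert (A5 : Cmod qO < Cmod (RtoC r) < 1) by (rewrite Cmod_R, Rabs_pos_eq; lra).
  rewrite !lp_3_wp in L3 by assumption.
  rewrite !RO_wp, Nhv', Nhv, Nv', N2v in ESq, EL by assumption.
  set (a := wp qO (nome v)) in *; set (b := wp qO (- nome v)) in *.
  set (c := wp qO (h * nome v)) in *; set (d := wp qO (- (h * nome v))) in *.
  set (s := wp qO (RtoC r)) in *; set (dl := wp_shift) in *; set (K := (4 * RtoC PI ^ 2)%C) in *.
  pose proof four_PI2_neq_0 as NK; fold K in NK.
  assert (G1 : (a + b + c + d = 4 * (s - dl) + 4 * dl)%C).
  { assert (Q : (- K * (a + b + c + d - 4 * dl) = - K * (4 * (s - dl)))%C).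
    { transitivity (- K * (a - dl) + - K * (c - dl) + - K * (b - dl) + - K * (d - dl))%C; [ring|].
      rewrite EL; ring. }
    apply (f_equal (fun z => z / - K + 4 * dl)%C) in Q.
    transitivity (- K * (a + b + c + d - 4 * dl) / - K + 4 * dl)%C; [field; assumption|].
    rewrite Q; field; assumption. }
  assert (G2 : ((a - dl) ^ 2 + (b - dl) ^ 2 + (c - dl) ^ 2 + (d - dl) ^ 2 = 16 * (s - dl) ^ 2)%C).
  { assert (Q : (K ^ 2 * ((a - dl) ^ 2 + (b - dl) ^ 2 + (c - dl) ^ 2 + (d - dl) ^ 2) = K ^ 2 * (16 * (s - dl) ^ 2))%C).
    { transitivity ((- K * (a - dl)) ^ 2 + (- K * (b - dl)) ^ 2 + (- K * (c - dl)) ^ 2 + (- K * (d - dl)) ^ 2)%C; [ring|].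
      rewrite ESq; ring. }
    apply (f_equal (fun z => z / K ^ 2)%C) in Q.
    transitivity (K ^ 2 * ((a - dl) ^ 2 + (b - dl) ^ 2 + (c - dl) ^ 2 + (d - dl) ^ 2) / K ^ 2)%C; [field; assumption|].
    rewrite Q; field; assumption. }
  set (E := E4q qO) in *.
  assert (G3 : (6 * ((a - dl) ^ 2 + (b - dl) ^ 2 + (c - dl) ^ 2 + (d - dl) ^ 2) + 12 * dl * (a + b + c + d) - 24 * dl ^ 2 - E / 6
     = 96 * s ^ 2 - 2 / 3 * E)%C).
  { transitivity (6 * a ^ 2 - E / 24 + (6 * b ^ 2 - E / 24) + (6 * c ^ 2 - E / 24 + (6 * d ^ 2 - E / 24)))%C;
      [field; try (apply RtoC_neq_0; lra)|].
    rewrite L3; field; try (apply RtoC_neq_0; lra). }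
  rewrite G1, G2 in G3.
  transitivity (6 * (16 * (s - dl) ^ 2) + 12 * dl * (4 * (s - dl) + 4 * dl) - 24 * dl ^ 2 - E / 6 - (96 * s ^ 2 - 2 / 3 * E))%C.
  - field; try (apply RtoC_neq_0; lra).
  - rewrite G3; ring. }
destruct H as [H1 H2].
assert (E : wp_shift = 0).
{ replace wp_shift with (- 144 * wp_shift / - 144)%C by (field; apply RtoC_neq_0; lra).
  rewrite H1; field; apply RtoC_neq_0; lra. }
split; [assumption|].
replace (E4q qO) with (2 * (72 * wp_shift ^ 2 + E4q qO / 2) - 144 * wp_shift ^ 2)%C by (field; apply RtoC_neq_0; lra).
rewrite H2, E; ring.
Qed.

Lemma RO_wp_0 z : strip z -> RO z = (- (4 * RtoC PI ^ 2) * wp qO (nome z))%C.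
Proof. intros Hz; rewrite RO_wp, (proj1 wp_shift_E4_zero) by assumption; ring. Qed.

Lemma fO_eO : fO = (- (4 * RtoC PI ^ 2) * eO)%C.
Proof.
unfold eO; assert (N : RtoC PI <> 0) by (apply RtoC_neq_0; pose proof PI_RGT_0; lra); field; assumption.
Qed.

Lemma wp_translates z : strip z ->
  (wp qO (nome z) * wp qO (- nome z))%C = (eO * (wp qO (nome z) + wp qO (- nome z)) + 2 * eO ^ 2)%C.
Proof.
intros Hz; pose proof (Dz_product z Hz) as E; pose proof (strip_shift z Hz) as Hz'.
replace (Dz z) with (RO z - fO)%C in E by (unfold RO; ring).
replace (Dz (z + / 2)) with (RO (z + / 2) - fO)%C in E by (unfold RO; ring).
rewrite !RO_wp_0, nome_plus, nome_half in E by assumption.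
replace (nome z * - (1))%C with (- nome z)%C in E by ring.
rewrite fO_eO in E; pose proof four_PI2_neq_0 as NK.
set (K := (4 * RtoC PI ^ 2)%C) in *; set (a := wp qO (nome z)) in *; set (b := wp qO (- nome z)) in *.
apply (f_equal (fun w => w / K ^ 2 + eO * (a + b) - eO ^ 2)%C) in E.
transitivity ((- K * a - - K * eO) * (- K * b - - K * eO) / K ^ 2 + eO * (a + b) - eO ^ 2)%C;
  [field; assumption|rewrite E; field; assumption].
Qed.

Lemma wp_pm u : Cmod qO < Cmod u < 1 ->
  (wp qO u + wp qO (- u) = 4 * wp (qO * qO) (u * u) - (E2q (qO * qO) / 3 - E2q qO / 6))%C.
Proof.
intros Hu; pose proof (lp_pm qO qO_lt 1 u Hu) as E; unfold wp.
replace (lp qO 1 u + E2q qO / 12 + (lp qO 1 (- u) + E2q qO / 12))%C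
  with (lp qO 1 u + lp qO 1 (- u) + E2q qO / 6)%C by field.
rewrite E; field.
Qed.

(** Let a and b be the values of wp at u and -u in the nome q, and s the value at u^2 in the nome
    q^2. [wp_pm] gives a + b = 4 s - g, translation by 1/2 gives ab, and the second derivatives give
    a^2 + b^2 because E4 vanishes at om. What remains has degree one in s, so both coefficients are
    zero. *)
Lemma E2_E4_eval : (E2q (qO * qO) / 3 - E2q qO / 6 + eO)%C = 0 /\ E4q (qO * qO) = (45 * eO ^ 2)%C.
Proof.
pose proof qO_lt as Hq; pose proof (sqr_nome_lt qO Hq) as Hqq.
set (g := (E2q (qO * qO) / 3 - E2q qO / 6)%C); set (E := E4q (qO * qO)).
assert (H : (- 48 * (g + eO))%C = 0 /\ (6 * (g ^ 2 + 2 * eO * g - 4 * eO ^ 2) + 2 / 3 * E)%C = 0).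
{ apply linear_unbounded_zero; intros B.
  destruct (wp_unbounded (qO * qO) Hqq B 0 ltac:(lra)) as (r & Hr0 & Hr1 & Hr2 & Hr3).
  exists (wp (qO * qO) (RtoC r)); split; [assumption|].
  set (t := - ln r / (4 * PI)); pose proof PI_RGT_0 as HPI; pose proof sqrt3_pos as H3.
  assert (Hl0 : ln r < 0) by (rewrite <- ln_1; apply ln_increasing; lra).
  assert (Hl1 : - (PI * sqrt 3) + - (PI * sqrt 3) < ln r).
  { rewrite Cmod_mult, Cmod_qO, <- exp_plus in Hr1.
    rewrite <- (ln_exp (- (PI * sqrt 3) + _)); apply ln_increasing; [apply exp_pos|assumption]. }
  assert (Ht0 : 0 < t) by (unfold t; apply Rdiv_lt_0_compat; lra).
  assert (Ht1 : t < sqrt 3 / 2).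
  { unfold t; apply Rmult_lt_reg_r with (4 * PI); [lra|].
    replace (- ln r / (4 * PI) * (4 * PI)) with (- ln r) by (field; lra).
    replace (sqrt 3 / 2 * (4 * PI)) with (PI * sqrt 3 + PI * sqrt 3) by field; lra. }
  set (v := (0, t) : C).
  assert (S0 : strip v) by (unfold strip, v; simpl; lra).
  assert (Hr : (nome v * nome v)%C = RtoC r).
  { rewrite <- nome_plus; replace (v + v)%C with (0, 2 * t) by (unfold v; apply injective_projections; simpl; ring).
    rewrite nome_pair, Rmult_0_r, cos_0, sin_0.
    replace (- (2 * PI * (2 * t))) with (ln r) by (unfold t; field; lra).
    rewrite exp_ln by lra; unfold RtoC; f_equal; ring. }
  assert (A1 := strip_nome _ S0).
  assert (A2 : Cmod qO < Cmod (- nome v) < 1) by now rewrite Cmod_opp.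
  assert (A5 : Cmod (qO * qO) < Cmod (RtoC r) < 1) by (rewrite Cmod_R, Rabs_pos_eq; lra).
  pose proof (wp_translates v S0) as T; pose proof (wp_pm (nome v) A1) as Q1.
  pose proof (lp_pm qO Hq 3 (nome v) A1) as Q3.
  rewrite Hr in Q1, Q3; rewrite !lp_3_wp in Q3 by assumption.
  rewrite (proj2 wp_shift_E4_zero) in Q3; fold g in Q1; fold E in Q3.
  set (a := wp qO (nome v)) in *; set (b := wp qO (- nome v)) in *; set (s := wp (qO * qO) (RtoC r)) in *.
  assert (G : (6 * ((a + b) ^ 2 - 2 * (a * b)))%C = (96 * s ^ 2 - 2 / 3 * E)%C).
  { transitivity (6 * a ^ 2 - 0 / 24 + (6 * b ^ 2 - 0 / 24))%C; [field|rewrite Q3; field]. }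
  rewrite T, Q1 in G.
  transitivity (6 * ((4 * s - g) ^ 2 - 2 * (eO * (4 * s - g) + 2 * eO ^ 2)) - (96 * s ^ 2 - 2 / 3 * E))%C; [field|].
  rewrite G; ring. }
destruct H as [H1 H2].
assert (G : (g + eO)%C = 0).
{ replace (g + eO)%C with (- 48 * (g + eO) / - 48)%C by (field; apply RtoC_neq_0; lra).
  rewrite H1; field; apply RtoC_neq_0; lra. }
split; [assumption|].
replace E with (3 / 2 * (6 * (g ^ 2 + 2 * eO * g - 4 * eO ^ 2) + 2 / 3 * E) - 9 * ((g + eO) ^ 2 - 5 * eO ^ 2))%C by field.
rewrite H2, G; ring.
Qed.

(** At u = q in the nome q^2 the derivative vanishes, so wp there is a root of the cubic of
    [lp_2_wp]. The root is -e/2, because the two values of wp in the nome q lying over it are om e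
    and om^2 e, with sum -e. With E4 known, the cubic yields E6. *)
Lemma E6_eval : E6q (qO * qO) = (- 297 * eO ^ 3)%C.
Proof.
pose proof qO_lt as Hq; pose proof (sqr_nome_lt qO Hq) as Hqq; pose proof strip_om_half as S0.
assert (Nh : RtoC 2 <> 0) by (apply RtoC_neq_0; lra).
destruct E2_E4_eval as [Hg H4].
assert (A1 := strip_nome _ S0).
assert (Hh : (nome (om / 2) * nome (om / 2))%C = qO)
  by (unfold qO; rewrite <- nome_plus; f_equal; field; assumption).
pose proof (wp_pm _ A1) as Q1; rewrite Hh in Q1.
assert (R1 : RO (om / 2) = (om * fO)%C).
{ replace (om / 2)%C with (om * / 2)%C by (field; assumption); rewrite RO_om, RO_half by apply off_half; reflexivity. }
assert (R2 : RO (om / 2 + / 2) = (om * (om * fO))%C).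
{ replace (om / 2 + / 2)%C with (- (om * (om * / 2)))%C
    by (replace (om * (om * / 2))%C with (om * om / 2)%C by (field; assumption);
        rewrite om_eq; field; assumption).
  rewrite RO_opp, !RO_om, RO_half; try reflexivity; try apply off_half; repeat apply off_lattice_om; apply off_half. }
rewrite RO_wp_0 in R1 by assumption; rewrite RO_wp_0, nome_plus, nome_half in R2 by now apply strip_shift.
replace (nome (om / 2) * - (1))%C with (- nome (om / 2))%C in R2 by ring.
rewrite fO_eO in R1, R2; pose proof four_PI2_neq_0 as NK; set (K := (4 * RtoC PI ^ 2)%C) in *.
set (a := wp qO (nome (om / 2))) in *; set (b := wp qO (- nome (om / 2))) in *.
assert (Sab : (a + b)%C = (- eO)%C).
{ transitivity ((- K * a + - K * b) / - K)%C; [field; assumption|].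
  rewrite R1, R2; transitivity ((om + om * om) * eO)%C; [field; assumption|rewrite om_eq; ring]. }
set (s := wp (qO * qO) qO) in *.
assert (Es : s = (- eO / 2)%C).
{ transitivity ((a + b + (E2q (qO * qO) / 3 - E2q qO / 6 + eO) - eO) / 4)%C.
  - rewrite Q1; field.
  - rewrite Sab, Hg; field. }
assert (Hu : Cmod (qO * qO) < Cmod qO < 1) by (rewrite Cmod_mult; nra).
pose proof (lp_2_wp (qO * qO) Hqq qO Hu) as E; fold s in E.
rewrite lp_2_half, H4, Es in E by assumption.
transitivity (216 * (4 * (- eO / 2) ^ 3 - 45 * eO ^ 2 / 12 * (- eO / 2) + E6q (qO * qO) / 216) - 297 * eO ^ 3)%C; [field|].
rewrite <- E; ring.
Qed.

(** * Ramanujan differential equations *)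

Lemma csum_list_sum (l : list nat) (h : nat -> nat) (c : C) :
  csum l (fun d => (ntoC (h d) * c)%C) = (ntoC (list_sum (map h l)) * c)%C.
Proof.
induction l as [|d l IH]; simpl.
- unfold ntoC; simpl; ring.
- unfold csum in *; rewrite IH; unfold ntoC; rewrite plus_INR, RtoC_plus; ring.
Qed.

Section DivisorSeries.
Variables (q : C) (k e : nat).
Hypothesis Hq : 0 < Cmod q < 1.

(** With d and j one more than the two coordinates, the term is d^k (d j)^e q^(d j). Summing over j
    first gives Lambert series, summing over the fibres d j = n gives divisor sums; e = 1 inserts
    the factor n of q d/dq. *)
Definition dterm (p : nat * nat) : C :=
  (ntoC (S (fst p)) ^ k * (ntoC (S (fst p) * S (snd p)) ^ e * q ^ (S (fst p) * S (snd p))))%C.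

Lemma summable_dterm : summable dterm.
Proof.
assert (G : forall j, summable (fun n : nat => (ntoC (S n) ^ j * q ^ n)%C)).
{ intros j; apply (summable_poly_geometric j (Cmod q) 1); [lra|].
  intros n; rewrite Rmult_1_l, Cmod_mult, !Cmod_pow, Cmod_ntoC, S_INR.
  apply Req_le; f_equal; f_equal; ring. }
apply (summable_le _ (fun p : nat * nat =>
  ((ntoC (S (fst p)) ^ (k + e) * q ^ fst p) * (ntoC (S (snd p)) ^ e * q ^ snd p))%C)).
- intros [m j]; unfold dterm; simpl fst; simpl snd.
  rewrite !Cmod_mult, !Cmod_pow, !Cmod_ntoC, mult_INR, Rpow_mult_distr, pow_add.
  replace (S m * S j)%nat with (m + (j + (m * j + 1)))%nat by lia; rewrite !(pow_add (Cmod q)).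
  set (a := INR (S m) ^ k); set (b := INR (S m) ^ e); set (c := INR (S j) ^ e).
  set (x := Cmod q ^ m); set (y := Cmod q ^ j).
  assert (Hz : Cmod q ^ (m * j) * Cmod q ^ 1 <= 1).
  { rewrite <- pow_add, <- (pow1 (m * j + 1)); apply pow_incr; lra. }
  assert (Ha : 0 <= a) by apply pow_le, pos_INR; assert (Hb : 0 <= b) by apply pow_le, pos_INR.
  assert (Hc : 0 <= c) by apply pow_le, pos_INR.
  assert (Hx : 0 <= x) by (apply pow_le; lra); assert (Hy : 0 <= y) by (apply pow_le; lra).
  replace (a * b * x * (c * y)) with (a * (b * c) * (x * y) * 1) by ring.
  match goal with |- ?l <= _ => replace l with (a * (b * c) * (x * y) * (Cmod q ^ (m * j) * Cmod q ^ 1)) by ring end.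
  apply Rmult_le_compat_l; [|assumption].
  repeat apply Rmult_le_pos; assumption.
- exact (summable_prod _ _ (G (k + e)%nat) (G e)).
Qed.

Lemma dterm_fiber n :
  tsum (mask (fun p => (S (fst p) * S (snd p) - 1)%nat = n) dterm) =
  (ntoC (S n) ^ e * ntoC (sigma k (S n)) * q ^ S n)%C.
Proof.
set (l := filter (fun d => Nat.eqb (Nat.modulo (S n) d) 0) (seq 1 (S n))).
assert (Hl : forall d, In d l -> (1 <= d <= S n)%nat /\ S n = (d * (S n / d))%nat).
{ intros d Hd; apply filter_In in Hd; destruct Hd as [H1 H2].
  apply in_seq in H1; apply Nat.eqb_eq in H2; split; [lia|].
  apply Nat.Div0.div_exact; assumption. }
set (g := fun d => (d - 1, S n / d - 1)%nat).
assert (Hg : forall d, In d l -> (S (fst (g d)) = d /\ S (fst (g d)) * S (snd (g d)) = S n)%nat).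
{ intros d Hd; destruct (Hl d Hd) as [H1 H2]; unfold g; simpl fst; simpl snd.
  assert (1 <= S n / d)%nat by (destruct (S n / d)%nat; lia).
  replace (S (d - 1)) with d by lia; replace (S (S n / d - 1)) with (S n / d)%nat by lia; lia. }
rewrite (tsum_eq _ (csum (map g l) (mask (fun p => (S (fst p) * S (snd p) - 1)%nat = n) dterm))).
- rewrite csum_map.
  transitivity (csum l (fun d => ntoC (Nat.pow d k) * (ntoC (S n) ^ e * q ^ S n))%C).
  + apply csum_ext; intros d Hd; destruct (Hg d Hd) as [H1 H2].
    unfold mask; destruct excluded_middle_informative as [h|h]; [|exfalso; apply h; rewrite H2; lia].
    unfold dterm; rewrite H2, H1; f_equal; unfold ntoC; rewrite pow_INR, RtoC_pow; reflexivity.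
  + rewrite csum_list_sum; fold l; unfold sigma; fold l; ring.
- apply has_sum_finite.
  + apply NoDup_map_NoDup_ForallPairs.
    * intros a b Ha Hb E; destruct (Hg a Ha) as [H1 _]; destruct (Hg b Hb) as [H2 _]; rewrite <- H1, E, H2; reflexivity.
    * apply NoDup_filter, seq_NoDup.
  + intros [m j] H; unfold mask; destruct excluded_middle_informative as [h|h]; [|reflexivity].
    exfalso; apply H; simpl in h; apply in_map_iff; exists (S m); 
    assert (En : S n = (S m * S j)%nat) by (simpl; lia).
    assert (Ed : (S n / S m)%nat = S j) by (rewrite En, Nat.mul_comm; apply Nat.div_mul; lia).
    split; [unfold g; rewrite Ed; f_equal; lia|].
    apply filter_In; split; [apply in_seq; nia|].
    apply Nat.eqb_eq; rewrite En, Nat.mul_comm; apply Nat.Div0.mod_mul.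
Qed.

Lemma has_sum_sigma :
  has_sum (fun n => (ntoC (S n) ^ e * ntoC (sigma k (S n)) * q ^ S n)%C)
    (tsum (fun m => tsum (fun j => dterm (m, j)))).
Proof.
rewrite <- (tsum_rows dterm summable_dterm).
apply (has_sum_ext _ _ _ dterm_fiber), (has_sum_fiber (fun p : nat * nat => (S (fst p) * S (snd p) - 1)%nat)).
exact summable_dterm.
Qed.

End DivisorSeries.

Lemma has_sum_sigma_0 q k : 0 < Cmod q < 1 ->
  has_sum (fun n => (ntoC (sigma k (S n)) * q ^ S n)%C) (bsum q k).
Proof.
intros Hq; pose proof (has_sum_sigma q k 0 Hq) as H.
replace (bsum q k) with (tsum (fun m => tsum (fun j => dterm q k 0 (m, j)))).
- revert H; apply has_sum_ext; intros n; change (ntoC (S n) ^ 0)%C with (RtoC 1); ring.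
- apply tsum_ext; intros m.
  pose proof (one_minus_qpow_neq_0 q Hq m) as N.
  assert (Hw : Cmod (q ^ S m) < 1) by (rewrite Cmod_pow; pose proof (pow_le_base (Cmod q) m ltac:(lra)); lra).
  rewrite (tsum_ext _ (fun j : nat => (ntoC (S m) ^ k * q ^ S m * (q ^ S m) ^ j)%C)).
  + rewrite tsum_scal, tsum_geometric by
      first [assumption | apply (summable_ext (fun n : nat => (ntoC n ^ 0 * (q ^ S m) ^ n)%C)); [intros n; simpl; ring|now apply summable_geometric]].
    unfold bet; field; assumption.
  + intros j; unfold dterm; simpl fst; simpl snd; rewrite (Cpow_mult_r q), Cpow_S.
    change (ntoC (S m * S j) ^ 0)%C with (RtoC 1); ring.
Qed.

Lemma has_sum_sigma_1 q k : 0 < Cmod q < 1 ->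
  has_sum (fun n => (ntoC (S n) * ntoC (sigma k (S n)) * q ^ S n)%C) (dsum q (S k)).
Proof.
intros Hq; pose proof (has_sum_sigma q k 1 Hq) as H.
replace (dsum q (S k)) with (tsum (fun m => tsum (fun j => dterm q k 1 (m, j)))).
- revert H; apply has_sum_ext; intros n; rewrite Cpow_1_r; reflexivity.
- apply tsum_ext; intros m.
  pose proof (one_minus_qpow_neq_0 q Hq m) as N.
  assert (Hw : Cmod (q ^ S m) < 1) by (rewrite Cmod_pow; pose proof (pow_le_base (Cmod q) m ltac:(lra)); lra).
  rewrite (tsum_ext _ (fun j : nat => (ntoC (S m) ^ S k * (ntoC (S j) * (q ^ S m) ^ S j))%C)).
  + destruct (tsum_n_geometric _ Hw) as [A B].
    rewrite tsum_scal, B by assumption; unfold bet; field; assumption.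
  + intros j; unfold dterm; simpl fst; simpl snd; rewrite (Cpow_mult_r q), Cpow_1_r, (Cpow_S (ntoC (S m)) k).
    replace (ntoC (S m * S j)) with (ntoC (S m) * ntoC (S j))%C by (unfold ntoC; rewrite mult_INR, RtoC_mult; reflexivity); ring.
Qed.

(** * Passage to real power series *)

Lemma is_series_Re (F : nat -> C) (s : C) :
  is_series (K := C_AbsRing) (V := C_NormedModule) F s -> is_series (fun n => Re (F n)) (Re s).
Proof.
intros H; unfold is_series in *.
apply (filterlim_ext (fun n => Re (sum_n F n))).
- induction x as [|n IH]; [rewrite !sum_O; reflexivity|rewrite !sum_Sn, <- IH; reflexivity].
- apply (filterlim_comp _ _ _ (sum_n F) Re _ _ _ H).
  exact (@continuous_fst R_UniformSpace R_UniformSpace (fst s) (snd s)).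
Qed.

Lemma is_series_Im (F : nat -> C) (s : C) :
  is_series (K := C_AbsRing) (V := C_NormedModule) F s -> is_series (fun n => Im (F n)) (Im s).
Proof.
intros H; unfold is_series in *.
apply (filterlim_ext (fun n => Im (sum_n F n))).
- induction x as [|n IH]; [rewrite !sum_O; reflexivity|rewrite !sum_Sn, <- IH; reflexivity].
- apply (filterlim_comp _ _ _ (sum_n F) Im _ _ _ H).
  exact (@continuous_snd R_UniformSpace R_UniformSpace (fst s) (snd s)).
Qed.

Lemma real_series (a : nat -> R) (s : C) :
  has_sum (fun n => RtoC (a n)) s -> is_series a (Re s) /\ s = RtoC (Re s).
Proof.
intros H; apply has_sum_is_series in H; split; [exact (is_series_Re _ _ H)|].
pose proof (is_series_unique _ _ (is_series_Im _ _ H)) as E; simpl in E.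
apply injective_projections; simpl; [reflexivity|].
change (Im s = 0); rewrite <- E.
transitivity (0 * Series (fun _ => 0)); [|ring].
rewrite <- Series_scal_l; apply Series_ext; intros n; ring.
Qed.

Definition unit_disk (a : nat -> R) : Prop := forall x, 0 < x < 1 -> ex_series (fun n => a n * x ^ n).

Lemma unit_disk_radius a x : unit_disk a -> Rabs x < 1 -> Rbar_lt (Rabs x) (CV_radius a).
Proof.
intros Ha Hx; set (y := (1 + Rabs x) / 2); pose proof (Rabs_pos x).
assert (Hy : Rbar_le (Rabs y) (CV_radius a)).
{ apply Rbar_not_lt_le; intros Hlt; apply (CV_disk_outside a y Hlt).
  apply ex_series_lim_0, Ha; unfold y; lra. }
apply Rbar_lt_le_trans with (Rabs y); [|assumption].
simpl; rewrite (Rabs_pos_eq y); unfold y; lra.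
Qed.

Lemma is_derive_unit_disk a x : unit_disk a -> Rabs x < 1 ->
  is_derive (PSeries a) x (PSeries (PS_derive a) x).
Proof. intros Ha Hx; apply is_derive_PSeries; now apply unit_disk_radius. Qed.

Lemma PSeries_theta a x : x * PSeries (PS_derive a) x = PSeries (fun n => INR n * a n) x.
Proof.
rewrite <- PSeries_incr_1; apply PSeries_ext; intros [|n]; [symmetry; apply Rmult_0_l|reflexivity].
Qed.

Definition sg (k : nat) (x : R) : R := PSeries (fun n => INR (sigma k n)) x.
Definition dsg (k : nat) (x : R) : R := PSeries (fun n => INR n * INR (sigma k n)) x.

Lemma sigma_series k x : 0 < x < 1 ->
  is_series (fun n => INR (sigma k n) * x ^ n) (sg k x) /\ bsum (RtoC x) k = RtoC (sg k x) /\
  is_series (fun n => INR n * INR (sigma k n) * x ^ n) (dsg k x) /\ dsum (RtoC x) (S k) = RtoC (dsg k x).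
Proof.
intros Hx; assert (Hq : 0 < Cmod (RtoC x) < 1) by (rewrite Cmod_R, Rabs_pos_eq; lra).
assert (A : is_series (fun n => INR (sigma k n) * x ^ n) (Re (bsum (RtoC x) k)) /\ bsum (RtoC x) k = RtoC (Re (bsum (RtoC x) k))).
{ destruct (real_series (fun n => INR (sigma k (S n)) * x ^ S n) (bsum (RtoC x) k)) as [B1 B2].
  - generalize (has_sum_sigma_0 (RtoC x) k Hq); apply has_sum_ext; intros n.
    unfold ntoC; rewrite RtoC_mult, RtoC_pow; reflexivity.
  - split; [|assumption].
    apply (is_series_decr_1 (fun n => INR (sigma k n) * x ^ n)); simpl.
    match goal with |- is_series _ ?l => replace l with (Re (bsum (RtoC x) k)) end; [exact B1|].
    unfold plus, opp; simpl; ring. }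
assert (A' : is_series (fun n => INR n * INR (sigma k n) * x ^ n) (Re (dsum (RtoC x) (S k))) /\
  dsum (RtoC x) (S k) = RtoC (Re (dsum (RtoC x) (S k)))).
{ destruct (real_series (fun n => INR (S n) * INR (sigma k (S n)) * x ^ S n) (dsum (RtoC x) (S k))) as [B1 B2].
  - generalize (has_sum_sigma_1 (RtoC x) k Hq); apply has_sum_ext; intros n.
    unfold ntoC; rewrite !RtoC_mult, RtoC_pow; reflexivity.
  - split; [|assumption].
    apply (is_series_decr_1 (fun n => INR n * INR (sigma k n) * x ^ n)).
    match goal with |- is_series _ ?l => replace l with (Re (dsum (RtoC x) (S k))) end; [exact B1|].
    unfold plus, opp; simpl; ring. }
destruct A as [A1 A2]; destruct A' as [A3 A4].
assert (E1 : sg k x = Re (bsum (RtoC x) k)) by exact (is_series_unique _ _ A1).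
assert (E2 : dsg k x = Re (dsum (RtoC x) (S k))) by exact (is_series_unique _ _ A3).
rewrite E1, E2; tauto.
Qed.

Lemma sigma_unit_disk k : unit_disk (fun n => INR (sigma k n)).
Proof. intros x Hx; exists (sg k x); apply (sigma_series k x Hx). Qed.

Definition E2r (x : R) : R := 1 - 24 * sg 1 x.
Definition E4r (x : R) : R := 1 + 240 * sg 3 x.
Definition E6r (x : R) : R := 1 - 504 * sg 5 x.

Lemma Er_Eq x : 0 < x < 1 ->
  E2q (RtoC x) = RtoC (E2r x) /\ E4q (RtoC x) = RtoC (E4r x) /\ E6q (RtoC x) = RtoC (E6r x).
Proof.
intros Hx; unfold E2q, E4q, E6q, E2r, E4r, E6r.
destruct (sigma_series 1 x Hx) as (_ & H1 & _); destruct (sigma_series 3 x Hx) as (_ & H3 & _).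
destruct (sigma_series 5 x Hx) as (_ & H5 & _); rewrite H1, H3, H5.
rewrite !RtoC_minus, RtoC_plus, !RtoC_mult; auto.
Qed.

Lemma sg_0 k : sg k 0 = 0.
Proof. unfold sg; rewrite PSeries_0; reflexivity. Qed.

Lemma is_derive_sg k x : 0 < x < 1 -> is_derive (sg k) x (dsg k x / x).
Proof.
intros Hx; unfold dsg; rewrite <- PSeries_theta.
match goal with |- is_derive _ _ ?l => replace l with (PSeries (PS_derive (fun n => INR (sigma k n))) x) by (field; lra) end.
apply is_derive_unit_disk; [apply sigma_unit_disk|rewrite Rabs_pos_eq; lra].
Qed.

Lemma Ramanujan_ODE x : 0 < x < 1 ->
  is_derive E2r x ((E2r x ^ 2 - E4r x) / 12 / x) /\
  is_derive E4r x ((E2r x * E4r x - E6r x) / 3 / x) /\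
  is_derive E6r x ((E2r x * E6r x - E4r x ^ 2) / 2 / x).
Proof.
intros Hx; assert (Hq : 0 < Cmod (RtoC x) < 1) by (rewrite Cmod_R, Rabs_pos_eq; lra).
destruct (Ramanujan_relations (RtoC x) Hq) as (R1 & R3 & R5).
destruct (Er_Eq x Hx) as (H2 & H4 & H6); rewrite H2, H4, H6 in *.
destruct (sigma_series 1 x Hx) as (_ & _ & _ & D1); destruct (sigma_series 3 x Hx) as (_ & _ & _ & D3).
destruct (sigma_series 5 x Hx) as (_ & _ & _ & D5); rewrite D1 in R1; rewrite D3 in R3; rewrite D5 in R5.
apply (f_equal Re) in R1; apply (f_equal Re) in R3; apply (f_equal Re) in R5.
rewrite <- ?RtoC_pow, <- ?RtoC_mult, <- ?RtoC_minus, <- ?RtoC_div in R1, R3, R5 by lra; simpl in R1, R3, R5.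
assert (Q1 : dsg 1 x = (E4r x - E2r x ^ 2) / 288) by (rewrite R1; field).
assert (Q3 : dsg 3 x = (E2r x * E4r x - E6r x) / 720) by (rewrite R3; field).
assert (Q5 : dsg 5 x = (E4r x ^ 2 - E2r x * E6r x) / 1008) by (rewrite R5; field).
pose proof (is_derive_sg 1 x Hx) as P1; pose proof (is_derive_sg 3 x Hx) as P3; pose proof (is_derive_sg 5 x Hx) as P5.
rewrite Q1 in P1; rewrite Q3 in P3; rewrite Q5 in P5.
split; [|split].
- unfold E2r at 1; evar_last; [auto_derive; [eexists; exact P1|reflexivity]|].
  rewrite (is_derive_unique (fun y : R => sg 1 y) x _ P1); field; lra.
- unfold E4r at 1; evar_last; [auto_derive; [eexists; exact P3|reflexivity]|].
  rewrite (is_derive_unique (fun y : R => sg 3 y) x _ P3); field; lra.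
- unfold E6r at 1; evar_last; [auto_derive; [eexists; exact P5|reflexivity]|].
  rewrite (is_derive_unique (fun y : R => sg 5 y) x _ P5); field; lra.
Qed.

Lemma sigma_growth k n : INR (sigma k n) <= INR n * INR n ^ k.
Proof.
unfold sigma; rewrite <- pow_INR, <- mult_INR; apply le_INR.
set (l := filter _ _).
assert (Hl : forall d, In d l -> (d <= n)%nat) by (intros d Hd; apply filter_In in Hd; destruct Hd as [Hd _]; apply in_seq in Hd; lia).
assert (Hlen : (length l <= n)%nat) by (unfold l; rewrite filter_length_le, length_seq; lia).
apply Nat.le_trans with (length l * n ^ k)%nat; [|now apply Nat.mul_le_mono_r].
clear Hlen; clearbody l; induction l as [|d l IH]; [simpl; lia|].
assert (Nat.pow d k <= Nat.pow n k)%nat by (apply Nat.pow_le_mono_l, Hl; now left).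
specialize (IH ltac:(intros; apply Hl; now right)).
change (list_sum (map (fun d0 => Nat.pow d0 k) (d :: l))) with (Nat.pow d k + list_sum (map (fun d0 => Nat.pow d0 k) l))%nat.
change (length (d :: l)) with (S (length l)); lia.
Qed.

Lemma sg_nonneg k x : 0 <= x < 1 -> 0 <= sg k x.
Proof.
intros [Hx Hx1]; destruct (Rle_lt_or_eq_dec _ _ Hx) as [h|h]; [|rewrite <- h, sg_0; lra].
destruct (sigma_series k x ltac:(lra)) as [H _].
assert (E : Series (fun n => INR (sigma k n) * x ^ n) = sg k x) by exact (is_series_unique _ _ H).
rewrite <- E, <- (Rmult_0_l (Series (fun n => INR (sigma k n) * x ^ n))) at 1; rewrite <- Series_scal_l.
apply Series_le; [|eexists; exact H].
intros n; pose proof (pos_INR (sigma k n)); pose proof (pow_le x n Hx).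
assert (0 <= INR (sigma k n) * x ^ n) by now apply Rmult_le_pos. lra.
Qed.

(** From sigma_5(n + 1) <= (n + 1)^6 <= 64^n the series is at most x/(1 - 64 x). The bound 1/40000
    is the square of 1/200, so the interval reaches the nome of sqrt(-3), and E6 stays positive on
    all of it. *)
Lemma sg_5_small x : 0 <= x <= / 40000 -> sg 5 x < / 504.
Proof.
intros [Hx Hx1]; destruct (Rle_lt_or_eq_dec _ _ Hx) as [h|h]; [|rewrite <- h, sg_0; lra].
destruct (sigma_series 5 x ltac:(lra)) as [H _].
assert (E : Series (fun n => INR (sigma 5 n) * x ^ n) = sg 5 x) by exact (is_series_unique _ _ H).
rewrite <- E, Series_incr_1 by (eexists; exact H).
assert (G : is_series (fun n => x * (64 * x) ^ n) (x * / (1 - 64 * x))).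
{ apply (is_series_scal_l x (fun n => (64 * x) ^ n)), is_series_geom; rewrite Rabs_pos_eq; lra. }
apply Rle_lt_trans with (0 + x * / (1 - 64 * x)).
- simpl (sigma 5 0); rewrite Rmult_0_l; apply Rplus_le_compat_l.
  rewrite <- (is_series_unique _ _ G); apply Series_le; [|eexists; exact G].
  intros n; pose proof (pow_le x n Hx) as P; split.
  + apply Rmult_le_pos; [apply pos_INR|apply pow_le, Hx].
  + rewrite <- tech_pow_Rmult, Rpow_mult_distr.
    assert (B : INR (sigma 5 (S n)) <= 64 ^ n).
    { eapply Rle_trans; [apply sigma_growth|].
      replace 64 with (2 ^ 6) by ring; rewrite <- pow_mult, Nat.mul_comm, pow_mult, tech_pow_Rmult.
      apply pow_incr; split; [apply pos_INR|].
      clear; induction n as [|n IH]; [simpl; lra|].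
      rewrite S_INR; change (2 ^ S n) with (2 * 2 ^ n); assert (1 <= 2 ^ n) by (apply pow_R1_Rle; lra); lra. }
    replace (x * (64 ^ n * x ^ n)) with (64 ^ n * (x * x ^ n)) by ring.
    apply Rmult_le_compat_r; [now apply Rmult_le_pos|assumption].
- apply Rmult_lt_reg_r with (1 - 64 * x); [lra|].
  rewrite Rplus_0_l, Rmult_assoc, Rinv_l by lra; lra.
Qed.

Lemma Er_bounds x : 0 <= x <= / 40000 -> 1 <= E4r x /\ 0 < E6r x <= 1.
Proof.
intros Hx; unfold E4r, E6r; pose proof (sg_nonneg 3 x ltac:(lra)).
pose proof (sg_nonneg 5 x ltac:(lra)); pose proof (sg_5_small x Hx); lra.
Qed.

(** * The hypergeometric uniformization *)

Definition theta (a : nat -> R) (n : nat) : R := INR n * a n.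

Lemma unit_disk_ex a x : unit_disk a -> Rabs x < 1 -> ex_pseries a x.
Proof.
intros Ha Hx; apply CV_radius_inside; now apply unit_disk_radius.
Qed.

Lemma unit_disk_theta a : unit_disk a -> unit_disk (theta a).
Proof.
intros Ha x Hx; assert (Hx' : Rabs x < 1) by (rewrite Rabs_pos_eq; lra).
apply ex_series_incr_1, (ex_series_ext (fun n => x * (PS_derive a n * x ^ n))).
- intros n; unfold theta, PS_derive; rewrite <- tech_pow_Rmult.
  change (x * (INR (S n) * a (S n) * x ^ n) = INR (S n) * a (S n) * (x * x ^ n)); ring.
- apply (ex_series_scal_l (K := R_AbsRing) x (fun n => PS_derive a n * x ^ n)), ex_series_Rabs, CV_disk_inside.
  rewrite CV_radius_derive; now apply unit_disk_radius.
Qed.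

Lemma is_derive_theta a t : unit_disk a -> Rabs t < 1 ->
  exists l, is_derive (PSeries a) t l /\ t * l = PSeries (theta a) t.
Proof.
intros Ha Ht; eexists; split; [now apply is_derive_unit_disk|apply PSeries_theta].
Qed.

Definition hc (n : nat) : R :=
  poch (1 / 2) n * poch (1 / 6) n * poch (5 / 6) n / (poch 1 n * poch 1 n * INR (fact n)).

Lemma poch_pos a n : 0 < a -> 0 < poch a n.
Proof.
intros Ha; induction n as [|n IH]; simpl; [lra|].
apply Rmult_lt_0_compat; [assumption|pose proof (pos_INR n); lra].
Qed.

Lemma hc_succ n :
  INR (S n) ^ 3 * hc (S n) = (INR n ^ 3 + 3 / 2 * INR n ^ 2 + 23 / 36 * INR n + 5 / 72) * hc n.
Proof.
unfold hc; pose proof (poch_pos 1 n ltac:(lra)); pose proof (INR_fact_lt_0 n); pose proof (pos_INR n).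
change (fact (S n)) with (S n * fact n)%nat; rewrite mult_INR.
change (poch 1 (S n)) with (poch 1 n * (1 + INR n)); change (poch (1 / 2) (S n)) with (poch (1 / 2) n * (1 / 2 + INR n)).
change (poch (1 / 6) (S n)) with (poch (1 / 6) n * (1 / 6 + INR n)).
change (poch (5 / 6) (S n)) with (poch (5 / 6) n * (5 / 6 + INR n)); rewrite S_INR; field; lra.
Qed.

Lemma hc_bounds n : 0 <= hc n <= 1.
Proof.
induction n as [|n IH]; [unfold hc; simpl; lra|].
pose proof (hc_succ n) as E; pose proof (pos_INR n) as Hn; rewrite S_INR in E.
assert (P : 0 < (INR n + 1) ^ 3) by (apply pow_lt; lra).
set (m := INR n) in *; set (w := m ^ 3 + 3 / 2 * m ^ 2 + 23 / 36 * m + 5 / 72) in *.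
assert (Hm : 0 <= m) by exact Hn; pose proof (pow_le m 2 Hm); pose proof (pow_le m 3 Hm).
assert (Hw : 0 <= w <= (m + 1) ^ 3).
{ unfold w; split; [lra|]; replace ((m + 1) ^ 3) with (m ^ 3 + 3 * m ^ 2 + 3 * m + 1) by ring; lra. }
split; apply Rmult_le_reg_l with ((m + 1) ^ 3); try assumption; rewrite E.
- rewrite Rmult_0_r; apply Rmult_le_pos; lra.
- apply Rmult_le_compat; lra.
Qed.

Lemma hc_unit_disk : unit_disk hc.
Proof.
intros x Hx; apply (ex_series_le (K := R_AbsRing) (V := R_CompleteNormedModule) _ (fun n => x ^ n)).
- intros n; pose proof (hc_bounds n); pose proof (pow_le x n ltac:(lra)).
  change (norm (hc n * x ^ n)) with (Rabs (hc n * x ^ n)); rewrite Rabs_pos_eq by (apply Rmult_le_pos; lra); nra.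
- apply ex_series_geom; rewrite Rabs_pos_eq; lra.
Qed.

Definition h0 (t : R) : R := PSeries hc t.
Definition h1 (t : R) : R := PSeries (theta hc) t.
Definition h2 (t : R) : R := PSeries (theta (theta hc)) t.
Definition h3 (t : R) : R := PSeries (theta (theta (theta hc))) t.

(** The coefficients 3/2, 23/36, 5/72 are those of (n + 1/2)(n + 1/6)(n + 5/6), as in [hc_succ];
    [h1], [h2], [h3] are the first three powers of t d/dt applied to [h0]. *)
Lemma hyper_ODE t : Rabs t < 1 ->
  h3 t = t * (h3 t + 3 / 2 * h2 t + 23 / 36 * h1 t + 5 / 72 * h0 t).
Proof.
intros Ht; pose proof hc_unit_disk as U0; pose proof (unit_disk_theta _ U0) as U1.
pose proof (unit_disk_theta _ U1) as U2; pose proof (unit_disk_theta _ U2) as U3.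
assert (X0 := unit_disk_ex _ _ U0 Ht); assert (X1 := unit_disk_ex _ _ U1 Ht).
assert (X2 := unit_disk_ex _ _ U2 Ht); assert (X3 := unit_disk_ex _ _ U3 Ht).
unfold h0, h1, h2, h3.
assert (Y2 : ex_pseries (PS_scal (3 / 2) (theta (theta hc))) t) by (apply ex_pseries_scal; [apply Rmult_comm|exact X2]).
assert (Y1 : ex_pseries (PS_scal (23 / 36) (theta hc)) t) by (apply ex_pseries_scal; [apply Rmult_comm|exact X1]).
assert (Y0 : ex_pseries (PS_scal (5 / 72) hc) t) by (apply ex_pseries_scal; [apply Rmult_comm|exact X0]).
assert (Z2 := ex_pseries_plus _ _ _ X3 Y2); assert (Z1 := ex_pseries_plus _ _ _ Z2 Y1).
rewrite <- !PSeries_scal, <- (PSeries_plus _ _ _ X3 Y2), <- (PSeries_plus _ _ _ Z2 Y1), <- (PSeries_plus _ _ _ Z1 Y0), <- PSeries_incr_1.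
apply PSeries_ext; intros [|n]; [apply Rmult_0_l|].
transitivity (INR (S n) ^ 3 * hc (S n)); [unfold theta; ring|rewrite hc_succ].
unfold PS_incr_1, PS_plus, PS_scal, theta, plus, scal; simpl; unfold mult; simpl; ring.
Qed.

Lemma hyper_at_0 : h0 0 = 1 /\ h1 0 = 0 /\ h2 0 = 0.
Proof. unfold h0, h1, h2; rewrite !PSeries_0; unfold theta, hc; simpl; lra. Qed.

Lemma hyp3F2_h0 t : hyp3F2 (1 / 2) (1 / 6) (5 / 6) 1 1 t = h0 t.
Proof. reflexivity. Qed.

(** The function 1728/j in terms of the nome. *)
Definition hyper_arg (x : R) : R := 1 - E6r x ^ 2 / E4r x ^ 3.
(** The logarithmic derivative of 1728/j under q d/dq. *)
Definition E6_over_E4 (x : R) : R := E6r x / E4r x.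
Definition inv_sqrt_E4 (x : R) : R := / sqrt (E4r x).
Definition H0_q (x : R) : R := h0 (hyper_arg x).
Definition H1_q (x : R) : R := h1 (hyper_arg x).
Definition H2_q (x : R) : R := h2 (hyper_arg x).
Definition H3_q (x : R) : R := h3 (hyper_arg x).

Lemma hyper_arg_bounds x : 0 <= x <= / 40000 -> 0 <= hyper_arg x < 1.
Proof.
intros Hx; destruct (Er_bounds x Hx) as (H4 & H6); unfold hyper_arg.
assert (P4 : 1 <= E4r x ^ 3) by now apply pow_R1_Rle.
assert (P6 : 0 < E6r x ^ 2 <= 1) by nra.
assert (0 < E6r x ^ 2 / E4r x ^ 3) by (apply Rdiv_lt_0_compat; lra).
assert (E6r x ^ 2 / E4r x ^ 3 <= 1) by (apply Rle_div_l; lra).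
lra.
Qed.

Lemma is_derive_Hi a x : unit_disk a -> 0 <= x <= / 40000 -> forall l,
  is_derive hyper_arg x l -> exists m, is_derive (fun y => PSeries a (hyper_arg y)) x (l * m) /\ hyper_arg x * m = PSeries (theta a) (hyper_arg x).
Proof.
intros Ha Hx l Hl; pose proof (hyper_arg_bounds x Hx) as Ht.
destruct (is_derive_theta a (hyper_arg x) Ha ltac:(rewrite Rabs_pos_eq; lra)) as (m & D & E).
exists m; split; [|assumption].
exact (is_derive_comp (PSeries a) hyper_arg x m l D Hl).
Qed.

Lemma ex_derive_Er x : 0 <= x <= / 40000 -> ex_derive E2r x /\ ex_derive E4r x /\ ex_derive E6r x.
Proof.
intros Hx; assert (D : forall k, ex_derive (fun y : R => sg k y) x).
{ intros k; eexists; apply is_derive_unit_disk; [apply sigma_unit_disk|rewrite Rabs_pos_eq; lra]. }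
unfold E2r, E4r, E6r; split; [|split]; auto_derive; auto.
Qed.

Lemma ex_derive_parts x : 0 <= x <= / 40000 ->
  ex_derive E6_over_E4 x /\ ex_derive inv_sqrt_E4 x /\ ex_derive H0_q x /\ ex_derive H1_q x /\ ex_derive H2_q x.
Proof.
intros Hx; destruct (ex_derive_Er x Hx) as (D2 & D4 & D6); destruct (Er_bounds x Hx) as (B4 & B6).
assert (Dt : ex_derive hyper_arg x).
{ unfold hyper_arg; auto_derive; repeat split; try assumption; apply (pow_nonzero (E4r x) 3); lra. }
destruct Dt as [l Dt].
split; [unfold E6_over_E4; auto_derive; repeat split; try assumption; lra|].
split; [unfold inv_sqrt_E4; auto_derive; repeat split; try assumption; [lra|apply Rgt_not_eq, sqrt_lt_R0; lra]|].
pose proof hc_unit_disk as U0; pose proof (unit_disk_theta _ U0) as U1; pose proof (unit_disk_theta _ U1) as U2.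
split; [|split].
- destruct (is_derive_Hi _ x U0 Hx l Dt) as (m & D & _); eexists; exact D.
- destruct (is_derive_Hi _ x U1 Hx l Dt) as (m & D & _); eexists; exact D.
- destruct (is_derive_Hi _ x U2 Hx l Dt) as (m & D & _); eexists; exact D.
Qed.

Ltac by_derive := auto_derive; [repeat split; try (eexists; eassumption)|].

Lemma is_derive_E6_over_E4 x : 0 < x <= / 40000 ->
  is_derive E6_over_E4 x ((E2r x * E6_over_E4 x / 6 - E4r x / 2 + E6_over_E4 x ^ 2 / 3) / x).
Proof.
intros Hx; destruct (Ramanujan_ODE x ltac:(lra)) as (D2 & D4 & D6); destruct (Er_bounds x ltac:(lra)) as (B4 & B6).
unfold E6_over_E4 at 1; evar_last; [by_derive; [lra|reflexivity]|].
rewrite (is_derive_unique (fun y : R => E4r y) x _ D4), (is_derive_unique (fun y : R => E6r y) x _ D6).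
unfold E6_over_E4; field; lra.
Qed.

Lemma is_derive_hyper_arg x : 0 < x <= / 40000 -> is_derive hyper_arg x (hyper_arg x * E6_over_E4 x / x).
Proof.
intros Hx; destruct (Ramanujan_ODE x ltac:(lra)) as (D2 & D4 & D6); destruct (Er_bounds x ltac:(lra)) as (B4 & B6).
unfold hyper_arg at 1; evar_last; [by_derive; [apply (pow_nonzero (E4r x) 3); lra|reflexivity]|].
rewrite (is_derive_unique (fun y : R => E4r y) x _ D4), (is_derive_unique (fun y : R => E6r y) x _ D6).
unfold hyper_arg, E6_over_E4; simpl; field; lra.
Qed.

Lemma is_derive_inv_sqrt_E4 x : 0 < x <= / 40000 -> is_derive inv_sqrt_E4 x (- inv_sqrt_E4 x * (E2r x - E6_over_E4 x) / 6 / x).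
Proof.
intros Hx; destruct (Ramanujan_ODE x ltac:(lra)) as (D2 & D4 & D6); destruct (Er_bounds x ltac:(lra)) as (B4 & B6).
assert (Hs : 0 < sqrt (E4r x)) by (apply sqrt_lt_R0; lra).
unfold inv_sqrt_E4 at 1; evar_last; [by_derive; [lra|lra|reflexivity]|].
rewrite (is_derive_unique (fun y : R => E4r y) x _ D4).
unfold inv_sqrt_E4, E6_over_E4; assert (E : E4r x = sqrt (E4r x) ^ 2) by (rewrite pow2_sqrt; lra).
set (s := sqrt (E4r x)) in *; rewrite E; field; lra.
Qed.

Lemma is_derive_H x : 0 < x <= / 40000 ->
  is_derive H0_q x (E6_over_E4 x * H1_q x / x) /\ is_derive H1_q x (E6_over_E4 x * H2_q x / x) /\ is_derive H2_q x (E6_over_E4 x * H3_q x / x).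
Proof.
intros Hx; pose proof (is_derive_hyper_arg x Hx) as Dt.
pose proof hc_unit_disk as U0; pose proof (unit_disk_theta _ U0) as U1; pose proof (unit_disk_theta _ U1) as U2.
assert (G : forall a, unit_disk a -> is_derive (fun y => PSeries a (hyper_arg y)) x (E6_over_E4 x * PSeries (theta a) (hyper_arg x) / x)).
{ intros a Ha; destruct (is_derive_Hi a x Ha ltac:(lra) _ Dt) as (m & D & E); rewrite <- E.
  evar_last; [exact D|field; lra]. }
split; [exact (G _ U0)|split; [exact (G _ U1)|exact (G _ U2)]].
Qed.

(* With [D = x d/dx], [u1] and [u2] are [D] and [D^2] of [H / sqrt E4]. *)
Definition u0 (x : R) : R := inv_sqrt_E4 x * H0_q x.

Definition u1 (x : R) : R := inv_sqrt_E4 x * (E6_over_E4 x * H1_q x + (E6_over_E4 x - E2r x) / 6 * H0_q x).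
Definition dg (x : R) : R := E2r x * E6_over_E4 x / 6 - E4r x / 2 + E6_over_E4 x ^ 2 / 3.

Definition u2 (x : R) : R :=
  inv_sqrt_E4 x * (E6_over_E4 x ^ 2 * H2_q x + (2 * ((E6_over_E4 x - E2r x) / 6) * E6_over_E4 x + dg x) * H1_q x
    + (((E6_over_E4 x - E2r x) / 6) ^ 2 + (dg x - (E2r x ^ 2 - E4r x) / 12) / 6) * H0_q x).

Lemma constant_on f x : 0 < x ->
  (forall y, 0 < y <= x -> is_derive f y 0) -> (forall y, 0 <= y <= x -> ex_derive f y) -> f x = f 0.
Proof.
intros Hx Hd Hc; destruct (MVT_gen f 0 x (fun _ => 0)) as (c & _ & E).
- intros y; rewrite Rmin_left, Rmax_right by lra; intros Hy; apply Hd; lra.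
- intros y; rewrite Rmin_left, Rmax_right by lra; intros Hy.
  apply continuity_pt_filterlim, (ex_derive_continuous (K := R_AbsRing) (V := R_NormedModule)), Hc, Hy.
- lra.
Qed.

Lemma Er_0 : E2r 0 = 1 /\ E4r 0 = 1 /\ E6r 0 = 1 /\ E6_over_E4 0 = 1 /\ inv_sqrt_E4 0 = 1 /\ hyper_arg 0 = 0.
Proof.
unfold E6_over_E4, inv_sqrt_E4, hyper_arg, E2r, E4r, E6r; rewrite !sg_0, Rmult_0_r, !Rmult_0_r, Rplus_0_r, sqrt_1; repeat split; field.
Qed.

(** Vanishing of the third derivative alone would still permit log q and its square. These are
    excluded because [u2], [u1] and [u0] are differentiable at 0: each in turn is constant down to q
    = 0, where the values are 0, 0 and 1. *)
Lemma uniformization x : 0 < x <= / 40000 -> h0 (hyper_arg x) = sqrt (E4r x).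
Proof.
intros Hx; destruct Er_0 as (P0 & Q0 & R0 & g0 & w0 & t0); destruct hyper_at_0 as (A0 & A1 & A2).
assert (EX : forall y, 0 <= y <= x -> ex_derive u0 y /\ ex_derive u1 y /\ ex_derive u2 y).
{ intros y Hy; destruct (ex_derive_Er y ltac:(lra)) as (D2 & D4 & D6).
  destruct (ex_derive_parts y ltac:(lra)) as (Dg & Dw & DH0 & DH1 & DH2).
  unfold u0, u1, u2, dg; split; [|split]; auto_derive; repeat split; assumption. }
assert (DU : forall y, 0 < y <= x ->
  is_derive u0 y (u1 y / y) /\ is_derive u1 y (u2 y / y) /\ is_derive u2 y 0).
{ intros y Hy; destruct (Ramanujan_ODE y ltac:(lra)) as (D2 & D4 & D6).
  pose proof (is_derive_E6_over_E4 y ltac:(lra)) as Dg; pose proof (is_derive_inv_sqrt_E4 y ltac:(lra)) as Dw.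
  destruct (is_derive_H y ltac:(lra)) as (DH0 & DH1 & DH2).
  destruct (Er_bounds y ltac:(lra)) as (B4 & B6).
  assert (F2 := is_derive_unique (fun y : R => E2r y) y _ D2).
  assert (F4 := is_derive_unique (fun y : R => E4r y) y _ D4).
  assert (Fg := is_derive_unique (fun y : R => E6_over_E4 y) y _ Dg); assert (Fw := is_derive_unique (fun y : R => inv_sqrt_E4 y) y _ Dw).
  assert (FH0 := is_derive_unique (fun y : R => H0_q y) y _ DH0); assert (FH1 := is_derive_unique (fun y : R => H1_q y) y _ DH1).
  assert (FH2 := is_derive_unique (fun y : R => H2_q y) y _ DH2).
  assert (F6 : E6r y = E6_over_E4 y * E4r y) by (unfold E6_over_E4; field; lra).
  (* The hypergeometric equation at t = 1 - g^2/E4 with g = E6/E4, solved for g^2 times the third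
     derivative. *)
  assert (HO : E6_over_E4 y ^ 2 * H3_q y = (E4r y - E6_over_E4 y ^ 2) * (3 / 2 * H2_q y + 23 / 36 * H1_q y + 5 / 72 * H0_q y)).
  { pose proof (hyper_arg_bounds y ltac:(lra)) as Ht; pose proof (hyper_ODE (hyper_arg y) ltac:(rewrite Rabs_pos_eq; lra)) as O.
    fold (H0_q y) (H1_q y) (H2_q y) (H3_q y) in O.
    assert (Et : hyper_arg y = 1 - E6_over_E4 y ^ 2 / E4r y) by (unfold hyper_arg; rewrite F6; field; lra).
    rewrite Et in O; set (S := 3 / 2 * H2_q y + 23 / 36 * H1_q y + 5 / 72 * H0_q y).
    assert (O2 : E4r y * H3_q y = (E4r y - E6_over_E4 y ^ 2) * (H3_q y + S)).
    { rewrite O at 1; unfold S; field; lra. }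
    lra. }
  split; [|split].
  - unfold u0; evar_last; [by_derive; reflexivity|].
    rewrite Fw, FH0; unfold u1; field; lra.
  - unfold u1; evar_last; [by_derive; reflexivity|].
    rewrite Fw, FH0, FH1, Fg, F2; unfold u2, dg; field; lra.
  - unfold u2, dg; evar_last; [by_derive; reflexivity|].
    rewrite Fw, FH0, FH1, FH2, Fg, F2, F4, F6.
    transitivity (inv_sqrt_E4 y * E6_over_E4 y / y * (E6_over_E4 y ^ 2 * H3_q y - (E4r y - E6_over_E4 y ^ 2) * (3 / 2 * H2_q y + 23 / 36 * H1_q y + 5 / 72 * H0_q y)));
      [field; lra|rewrite HO; ring]. }
assert (V2 : forall y, 0 < y <= x -> u2 y = 0).
{ intros y Hy; rewrite (constant_on u2 y); [|lra| |].
  - unfold u2, dg, H0_q, H1_q, H2_q; rewrite t0, g0, P0, Q0, A0, A1, A2; field.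
  - intros z Hz; apply DU; lra.
  - intros z Hz; apply EX; lra. }
assert (V1 : forall y, 0 < y <= x -> u1 y = 0).
{ intros y Hy; rewrite (constant_on u1 y); [|lra| |].
  - unfold u1, H0_q, H1_q; rewrite t0, g0, P0, A0, A1; field.
  - intros z Hz; destruct (DU z ltac:(lra)) as (_ & D & _); rewrite V2 in D by lra.
    evar_last; [exact D|field; lra].
  - intros z Hz; apply EX; lra. }
assert (V0 : u0 x = 1).
{ rewrite (constant_on u0 x); [|lra| |].
  - unfold u0, H0_q; rewrite t0, w0, A0; ring.
  - intros z Hz; destruct (DU z ltac:(lra)) as (D & _); rewrite V1 in D by lra.
    evar_last; [exact D|field; lra].
  - intros z Hz; apply EX; lra. }
unfold u0, inv_sqrt_E4 in V0; fold (H0_q x); destruct (Er_bounds x ltac:(lra)) as (B4 & _).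
assert (Hs : 0 < sqrt (E4r x)) by (apply sqrt_lt_R0; lra).
replace (H0_q x) with (/ sqrt (E4r x) * H0_q x * sqrt (E4r x)) by (field; lra); rewrite V0; ring.
Qed.

Definition x0 : R := exp (- (PI * sqrt 3)) ^ 2.

Lemma x0_bounds : 0 < x0 <= / 40000.
Proof.
unfold x0; pose proof nome_bound_1 as H; pose proof (exp_pos (- (PI * sqrt 3))) as P.
split; [now apply pow_lt|]; replace (/ 40000) with ((/ 200) ^ 2) by field; apply pow_incr; lra.
Qed.

Lemma qO_sqr : (qO * qO)%C = RtoC x0.
Proof. rewrite qO_real; unfold x0; rewrite RtoC_pow, RtoC_opp; ring. Qed.

Lemma nome_sqrt_m3 : nome sqrt_m3 = RtoC x0.
Proof.
rewrite <- qO_sqr; unfold qO; rewrite <- nome_plus.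
replace sqrt_m3 with (om + om + lat (1, 0)%Z)%C.
- rewrite (nome_plus (om + om)%C); replace (lat (1, 0)%Z) with (RtoC 1) by (unfold lat, ZtoC; simpl; ring).
  rewrite nome_1; ring.
- unfold sqrt_m3, lat, om, ZtoC; apply injective_projections; simpl; field.
Qed.

Lemma E4_E4r : E4 sqrt_m3 = RtoC (E4r x0).
Proof.
pose proof x0_bounds as Hx; unfold E4, E4r; rewrite nome_sqrt_m3, RtoC_plus, RtoC_mult; do 2 f_equal.
destruct (sigma_series 3 x0 ltac:(lra)) as [H _].
assert (E : Series (fun n => INR (sigma 3 n) * x0 ^ n) = sg 3 x0) by exact (is_series_unique _ _ H).
rewrite Series_incr_1 in E by (eexists; exact H).
change (INR (sigma 3 0)) with 0 in E; rewrite Rmult_0_l, Rplus_0_l in E.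
change (RtoC (sg 3 x0)) with (sg 3 x0, 0); unfold CSeries; apply (f_equal2 (@pair R R)).
- rewrite <- E; apply Series_ext; intros n; rewrite <- RtoC_pow, <- RtoC_mult; reflexivity.
- transitivity (0 * Series (fun _ => 0)); [|ring].
  rewrite <- Series_scal_l; apply Series_ext; intros n; rewrite <- RtoC_pow, <- RtoC_mult; symmetry; apply Rmult_0_l.
Qed.

Lemma Eisenstein_value (f : R) : fO = RtoC f -> 0 < f ->
  0 < E4r x0 /\ sqrt (E4r x0) = 3 * sqrt 5 * f / (4 * PI ^ 2) /\ hyper_arg x0 = 4 / 125.
Proof.
intros Ef Hf; pose proof x0_bounds as Hx; pose proof PI_RGT_0 as HPI.
destruct (Er_Eq x0 ltac:(lra)) as (_ & H4 & H6); destruct E2_E4_eval as [_ G4]; pose proof E6_eval as G6.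
rewrite qO_sqr in G4, G6; rewrite H4 in G4; rewrite H6 in G6.
set (e := - (f / (4 * PI ^ 2))).
assert (P4 : 0 < 4 * PI ^ 2) by (assert (0 < PI ^ 2) by (now apply pow_lt); lra).
assert (Ee : eO = RtoC e).
{ unfold eO, e; rewrite Ef, RtoC_opp, RtoC_div, RtoC_mult, RtoC_pow by lra; reflexivity. }
assert (He : e < 0) by (unfold e; assert (0 < f / (4 * PI ^ 2)) by (now apply Rdiv_lt_0_compat); lra).
rewrite Ee in G4, G6.
assert (F4 : E4r x0 = 45 * e ^ 2) by (apply RtoC_inj; rewrite G4, RtoC_mult, RtoC_pow; reflexivity).
assert (F6 : E6r x0 = - 297 * e ^ 3).
{ apply RtoC_inj; rewrite G6, RtoC_mult, RtoC_pow; reflexivity. }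
split; [rewrite F4; nra|]; split.
(* Since f > 0 makes e negative, the positive root is 3 sqrt 5 times -e. *)
- rewrite F4; replace (45 * e ^ 2) with ((3 * (- e)) ^ 2 * 5) by ring.
  rewrite sqrt_mult by (try apply pow2_ge_0; lra); rewrite sqrt_pow2 by lra; unfold e; field; lra.
- unfold hyper_arg; rewrite F4, F6; field; lra.
Qed.

(** * Series of holomorphic functions *)

(* Quantitative complex differentiability: a quadratic remainder with an explicit
   constant is stable under sums and products and can be summed over a lattice. *)
Definition jet (r : R) (f : C -> C) (s f' : C) (F : R) : Prop :=
  Cmod (f s) <= F /\ Cmod f' <= F /\
  forall h, Cmod h <= r -> Cmod (f (s + h) - f s - h * f')%C <= F * Cmod h ^ 2.

Section Jets.
Variable r : R.
Hypothesis Hr : 0 < r <= 1.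

Lemma jet_nonneg f s f' F : jet r f s f' F -> 0 <= F.
Proof. intros (H & _); pose proof (Cmod_ge_0 (f s)); lra. Qed.

Lemma jet_ext f g s f' F : (forall z, f z = g z) -> jet r f s f' F -> jet r g s f' F.
Proof. intros E H; replace g with f; [assumption|]; now apply functional_extensionality. Qed.

Lemma jet_weaken f s f' F G : F <= G -> jet r f s f' F -> jet r f s f' G.
Proof.
intros HFG (H0 & H1 & H2); split; [lra|split; [lra|]].
intros h Hh; eapply Rle_trans; [apply H2, Hh|]; apply Rmult_le_compat_r; [apply pow2_ge_0|assumption].
Qed.

Lemma jet_const a s : jet r (fun _ => a) s 0 (Cmod a).
Proof.
split; [lra|split; [rewrite Cmod_0; apply Cmod_ge_0|]].
intros h _; replace (a - a - h * 0)%C with (RtoC 0) by ring; rewrite Cmod_0.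
apply Rmult_le_pos; [apply Cmod_ge_0|apply pow2_ge_0].
Qed.

Lemma jet_plus f g s f' g' F G : jet r f s f' F -> jet r g s g' G ->
  jet r (fun z => (f z + g z)%C) s (f' + g') (F + G).
Proof.
intros (A0 & A1 & A2) (B0 & B1 & B2); split; [|split].
- eapply Rle_trans; [apply Cmod_triangle|lra].
- eapply Rle_trans; [apply Cmod_triangle|lra].
- intros h Hh; specialize (A2 h Hh); specialize (B2 h Hh).
  replace (f (s + h) + g (s + h) - (f s + g s) - h * (f' + g'))%C
    with ((f (s + h) - f s - h * f') + (g (s + h) - g s - h * g'))%C by ring.
  eapply Rle_trans; [apply Cmod_triangle|lra].
Qed.

Lemma jet_scal c f s f' F : jet r f s f' F -> jet r (fun z => (c * f z)%C) s (c * f') (Cmod c * F).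
Proof.
intros (A0 & A1 & A2); pose proof (Cmod_ge_0 c) as Hc; split; [|split].
- rewrite Cmod_mult; now apply Rmult_le_compat_l.
- rewrite Cmod_mult; now apply Rmult_le_compat_l.
- intros h Hh; specialize (A2 h Hh).
  replace (c * f (s + h) - c * f s - h * (c * f'))%C with (c * (f (s + h) - f s - h * f'))%C by ring.
  rewrite Cmod_mult, Rmult_assoc; now apply Rmult_le_compat_l.
Qed.

Lemma jet_csum {I : Type} (l : list I) (f : I -> C -> C) s (f' : I -> C) F :
  (forall i, In i l -> jet r (f i) s (f' i) F) ->
  jet r (fun z => csum l (fun i => f i z)) s (csum l f') (INR (length l) * F).
Proof.
induction l as [|i l IH]; intros H.
- simpl; rewrite Rmult_0_l; pose proof (jet_const 0 s) as J; rewrite Cmod_0 in J; exact J.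
- change (length (i :: l)) with (S (length l)); rewrite S_INR.
  replace ((INR (length l) + 1) * F) with (F + INR (length l) * F) by ring.
  exact (jet_plus _ _ s _ _ _ _ (H i (or_introl eq_refl)) (IH (fun j Hj => H j (or_intror Hj)))).
Qed.

Lemma jet_shift_bound f s f' F h : jet r f s f' F -> Cmod h <= r -> Cmod (f (s + h)%C) <= 3 * F.
Proof.
intros (A0 & A1 & A2) Hh; specialize (A2 h Hh); pose proof (Cmod_ge_0 h); pose proof (Cmod_ge_0 (f s)).
replace (f (s + h)%C) with ((f (s + h) - f s - h * f') + (f s + h * f'))%C by ring.
eapply Rle_trans; [apply Cmod_triangle|].
pose proof (Cmod_triangle (f s) (h * f')) as T; rewrite Cmod_mult in T; pose proof (Cmod_ge_0 f').
assert (Cmod h * Cmod f' <= 1 * F) by (apply Rmult_le_compat; lra).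
assert (F * Cmod h ^ 2 <= F * 1) by (apply Rmult_le_compat_l; [lra|]; rewrite <- (pow1 2); apply pow_incr; lra).
lra.
Qed.

(** One constant bounding value, derivative and remainder keeps products in the same form: the four
    terms of the remainder contribute 1 + 1 + 3 + 1 = 6. *)
Lemma jet_mult f g s f' g' F G : jet r f s f' F -> jet r g s g' G ->
  jet r (fun z => (f z * g z)%C) s (f' * g s + f s * g') (6 * (F * G)).
Proof.
intros HA HB; pose proof (jet_nonneg _ _ _ _ HA) as F0; pose proof (jet_nonneg _ _ _ _ HB) as G0.
pose proof (fun h => jet_shift_bound g s g' G h HB) as B3.
destruct HA as (A0 & A1 & A2); destruct HB as (B0 & B1 & B2).
assert (P : forall a b X Y, Cmod a <= X -> Cmod b <= Y -> Cmod (a * b)%C <= X * Y).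
{ intros a b X Y Ha Hb; rewrite Cmod_mult; apply Rmult_le_compat; try assumption; apply Cmod_ge_0. }
pose proof (Rmult_le_pos _ _ F0 G0) as FG.
split; [|split].
- eapply Rle_trans; [apply (P _ _ _ _ A0 B0)|lra].
- eapply Rle_trans; [apply Cmod_triangle|].
  pose proof (P _ _ _ _ A1 B0); pose proof (P _ _ _ _ A0 B1); lra.
- intros h Hh; specialize (A2 h Hh); specialize (B2 h Hh); specialize (B3 h Hh).
  set (Rf := (f (s + h) - f s - h * f')%C) in *; set (Rg := (g (s + h) - g s - h * g')%C) in *.
  replace (f (s + h) * g (s + h) - f s * g s - h * (f' * g s + f s * g'))%C
    with (f s * Rg + h * (f' * Rg) + (Rf * g (s + h) + h * h * (f' * g')))%C by (unfold Rf, Rg; ring).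
  set (u := Cmod h ^ 2) in *; assert (Hu : 0 <= u) by apply pow2_ge_0.
  pose proof (P _ _ _ _ A0 B2) as P1; pose proof (P _ _ _ _ A1 B2) as P2.
  pose proof (P _ _ _ _ A2 B3) as P3; pose proof (P _ _ _ _ A1 B1) as P4.
  assert (P2' : Cmod (h * (f' * Rg))%C <= 1 * (F * (G * u))) by (apply P; lra).
  assert (P4' : Cmod (h * h * (f' * g'))%C <= u * (F * G)).
  { apply P; [rewrite Cmod_mult; apply Req_le; unfold u; ring|assumption]. }
  pose proof (Cmod_triangle (f s * Rg + h * (f' * Rg)) (Rf * g (s + h)%C + h * h * (f' * g'))).
  pose proof (Cmod_triangle (f s * Rg) (h * (f' * Rg))).
  pose proof (Cmod_triangle (Rf * g (s + h)%C) (h * h * (f' * g'))).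
  replace (6 * (F * G) * u) with (F * (G * u) + 1 * (F * (G * u)) + (F * u * (3 * G) + u * (F * G))) by ring.
  lra.
Qed.

(** Differentiation produces factors l, and the increment h a factor e^(r l). All are absorbed
    through l <= e^(r l)/r, at the price of lowering Re s by 3 r. *)
Lemma jet_exp (l : R) s : 0 <= l ->
  jet r (fun z => Cexp (- (z * RtoC l))) s (- RtoC l * Cexp (- (s * RtoC l))) (5 / r ^ 2 * exp (- (Re s - 3 * r) * l)).
Proof.
intros Hl.
assert (Hr2 : 0 < r ^ 2 <= 1) by nra.
assert (M : Cmod (Cexp (- (s * RtoC l))) = exp (- (Re s) * l)).
{ rewrite Cmod_Cexp; f_equal; destruct s; simpl; ring. }
set (E := exp (- (Re s) * l)) in *; assert (HE : 0 < E) by apply exp_pos.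
set (w := exp (r * l)); assert (Hw1 : 1 + r * l <= w) by (apply exp_ineq1_le).
assert (Hrl : 0 <= r * l) by (apply Rmult_le_pos; lra).
assert (EE : exp (- (Re s - 3 * r) * l) = E * w ^ 3).
{ unfold E, w; simpl; rewrite Rmult_1_r, <- !exp_plus; f_equal; ring. }
assert (Hlw : l <= w / r).
{ apply Rmult_le_reg_r with r; [lra|]; unfold Rdiv; rewrite Rmult_assoc, Rinv_l by lra; lra. }
assert (K1 : 1 <= 5 / r ^ 2) by (apply Rle_div_r; lra).
assert (W2 : 1 <= w ^ 2) by (apply pow_R1_Rle; lra).
assert (W3 : 1 <= w ^ 3) by (apply pow_R1_Rle; lra).
rewrite EE; split; [|split].
- rewrite M; apply Rle_trans with (1 * (E * 1)); [lra|].
  apply Rmult_le_compat; try lra; apply Rmult_le_compat_l; lra.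
- rewrite Cmod_mult, Cmod_opp, M, Cmod_R, Rabs_pos_eq by assumption.
  apply Rle_trans with (w / r * E); [apply Rmult_le_compat_r; lra|].
  replace (w / r * E) with (r / r ^ 2 * (E * w)) by (field; lra).
  assert (w <= w ^ 3) by (simpl in *; nra).
  apply Rmult_le_compat.
  + apply Rlt_le, Rdiv_lt_0_compat; lra.
  + apply Rmult_le_pos; lra.
  + unfold Rdiv; apply Rmult_le_compat_r; [apply Rlt_le, Rinv_0_lt_compat; lra|lra].
  + apply Rmult_le_compat_l; lra.
- intros h Hh.
  replace (- ((s + h) * RtoC l))%C with (- (s * RtoC l) + - (h * RtoC l))%C by ring; rewrite Cexp_plus.
  set (X := Cexp (- (s * RtoC l))) in *.
  replace (X * Cexp (- (h * RtoC l)) - X - h * (- RtoC l * X))%C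
    with (X * (Cexp (- (h * RtoC l)) - 1 - - (h * RtoC l)))%C by ring.
  rewrite Cmod_mult, M.
  pose proof (Cexp_rem2 (- (h * RtoC l))) as Q.
  rewrite Cmod_opp, Cmod_mult, Cmod_R, (Rabs_pos_eq l Hl) in Q.
  pose proof (Cmod_ge_0 h) as H0.
  assert (Hx : exp (Cmod h * l) <= w).
  { unfold w; destruct (Rle_lt_or_eq_dec (Cmod h * l) (r * l)) as [c|c];
      [apply Rmult_le_compat_r; assumption|left; now apply exp_increasing|rewrite c; lra]. }
  assert (L2 : l ^ 2 <= w ^ 2 / r ^ 2).
  { replace (w ^ 2 / r ^ 2) with ((w / r) ^ 2) by (field; lra); apply pow_incr; lra. }
  assert (Q2 : 5 * exp (Cmod h * l) * (Cmod h * l) ^ 2 <= 5 * w * (Cmod h ^ 2 * (w ^ 2 / r ^ 2))).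
  { rewrite Rpow_mult_distr; apply Rmult_le_compat; try (apply Rmult_le_pos); try apply pow2_ge_0; try lra.
    - left; apply exp_pos.
    - apply Rmult_le_compat_l; [apply pow2_ge_0|assumption]. }
  apply Rle_trans with (E * (5 * w * (Cmod h ^ 2 * (w ^ 2 / r ^ 2)))); [apply Rmult_le_compat_l; lra|].
  apply Req_le; field; lra.
Qed.

(** The factor |d| is what matters: a small difference of logarithms gives a small jet, which saves
    one power of the lattice point in a block. *)
Lemma jet_exp_minus_1 (d B : R) s : Rabs d <= B ->
  jet r (fun z => (Cexp (- (z * RtoC d)) - 1)%C) s (- RtoC d * Cexp (- (s * RtoC d)))
    (5 * exp ((Cmod s + 1) * B) * (Cmod s + 1) * (1 + B) * Rabs d).
Proof.
intros HB; pose proof (Rabs_pos d) as H0; pose proof (Cmod_ge_0 s) as Hs.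
set (S := Cmod s) in *; set (D := Rabs d) in *.
assert (EB : forall u, 0 <= u <= S + 1 -> exp (u * D) <= exp ((S + 1) * B)).
{ intros u Hu; assert (u * D <= (S + 1) * B) by (apply Rmult_le_compat; lra).
  destruct (Rle_lt_or_eq_dec _ _ H) as [c|c]; [left; now apply exp_increasing|rewrite c; lra]. }
set (X := exp ((S + 1) * B)) in *; assert (HX : 0 < X) by apply exp_pos.
assert (M : Cmod (Cexp (- (s * RtoC d))) <= exp (S * D)).
{ rewrite Cmod_Cexp; pose proof (re_le_Cmod (- (s * RtoC d))) as Q.
  rewrite Cmod_opp, Cmod_mult, Cmod_R in Q; fold S D in Q; apply Rabs_le_between in Q.
  destruct (Rle_lt_or_eq_dec _ _ (proj2 Q)) as [c|c]; [left; now apply exp_increasing|rewrite c; lra]. }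
assert (N : forall a b c e, 0 <= a <= 5 -> 0 <= b <= X -> 0 <= c <= S + 1 -> 0 <= e <= 1 + B ->
   a * b * c * e * D <= 5 * X * (S + 1) * (1 + B) * D).
{ intros a b c e Ha Hb Hc He; apply Rmult_le_compat_r; [assumption|].
  repeat (apply Rmult_le_compat; try lra; repeat apply Rmult_le_pos; try lra). }
split; [|split].
- pose proof (Cexp_rem1 (- (s * RtoC d))) as Q; rewrite Cmod_opp, Cmod_mult, Cmod_R in Q; fold S D in Q.
  eapply Rle_trans; [exact Q|].
  replace (3 * exp (S * D) * (S * D)) with (3 * exp (S * D) * S * 1 * D) by ring.
  pose proof (exp_pos (S * D)); pose proof (EB S ltac:(lra)); apply N; lra.
- rewrite Cmod_mult, Cmod_opp, Cmod_R; fold D.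
  apply Rle_trans with (1 * exp (S * D) * 1 * 1 * D).
  + replace (1 * exp (S * D) * 1 * 1 * D) with (D * exp (S * D)) by ring; now apply Rmult_le_compat_l.
  + pose proof (exp_pos (S * D)); pose proof (EB S ltac:(lra)); apply N; lra.
- intros h Hh.
  replace (- ((s + h) * RtoC d))%C with (- (s * RtoC d) + - (h * RtoC d))%C by ring; rewrite Cexp_plus.
  set (Y := Cexp (- (s * RtoC d))) in *.
  replace (Y * Cexp (- (h * RtoC d)) - 1 - (Y - 1) - h * (- RtoC d * Y))%C
    with (Y * (Cexp (- (h * RtoC d)) - 1 - - (h * RtoC d)))%C by ring.
  rewrite Cmod_mult.
  pose proof (Cexp_rem2 (- (h * RtoC d))) as Q; rewrite Cmod_opp, Cmod_mult, Cmod_R in Q; fold D in Q.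
  pose proof (Cmod_ge_0 h) as Hh0.
  apply Rle_trans with (exp (S * D) * (5 * exp (Cmod h * D) * (Cmod h * D) ^ 2)).
  { apply Rmult_le_compat; try assumption; apply Cmod_ge_0. }
  replace (exp (S * D) * (5 * exp (Cmod h * D) * (Cmod h * D) ^ 2))
    with (5 * exp ((S + Cmod h) * D) * 1 * D * D * Cmod h ^ 2)
    by (rewrite Rmult_plus_distr_r, exp_plus; ring).
  apply Rmult_le_compat_r; [apply pow2_ge_0|].
  pose proof (exp_pos ((S + Cmod h) * D)); pose proof (EB (S + Cmod h) ltac:(lra)); apply N; lra.
Qed.

Lemma is_derive_of_jet f s f' F : jet r f s f' F ->
  is_derive (K := C_AbsRing) (V := C_NormedModule) f s f'.
Proof.
intros HJ; pose proof (jet_nonneg _ _ _ _ HJ) as F0; destruct HJ as (_ & _ & HR).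
split; [apply is_linear_scal_l|].
intros x Hx; apply (is_filter_lim_locally_unique (K := C_AbsRing) (V := AbsRing_NormedModule C_AbsRing)) in Hx; subst x.
intros [eps Heps]; simpl.
apply (locally_le_locally_norm (K := C_AbsRing) (V := AbsRing_NormedModule C_AbsRing)).
assert (Hd : 0 < Rmin r (eps / (F + 1))).
{ apply Rmin_pos; [lra|apply Rdiv_lt_0_compat; lra]. }
exists (mkposreal _ Hd); intros y Hy; simpl in Hy.
change (Cmod (y - s)%C < Rmin r (eps / (F + 1))) in Hy.
change (Cmod (f y - f s - (y - s) * f')%C <= eps * Cmod (y - s)%C).
set (h := (y - s)%C) in *; replace y with (s + h)%C by (unfold h; ring).
pose proof (Rmin_l r (eps / (F + 1))); pose proof (Rmin_r r (eps / (F + 1))); pose proof (Cmod_ge_0 h).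
eapply Rle_trans; [apply HR; lra|].
replace (F * Cmod h ^ 2) with (F * Cmod h * Cmod h) by ring.
apply Rmult_le_compat_r; [assumption|].
assert (Cmod h * (F + 1) <= eps).
{ apply Rle_trans with (eps / (F + 1) * (F + 1)); [apply Rmult_le_compat_r; lra|].
  unfold Rdiv; rewrite Rmult_assoc, Rinv_l; lra. }
nra.
Qed.

(** A summable family of jet bounds gives absolute convergence at every point of the disk and
    differentiation term by term. *)
Lemma jet_tsum {I : Type} (U : I -> C -> C) s (V : I -> C) (K : I -> R) (M : R) :
  (forall i, jet r (U i) s (V i) (K i)) -> (forall l, NoDup l -> rsum l K <= M) ->
  summable (fun i => U i s) /\ jet r (fun z => tsum (fun i => U i z)) s (tsum V) M.
Proof.
intros HJ HM.
assert (HS : forall (G : I -> C) c, 0 <= c -> (forall i, Cmod (G i) <= c * K i) ->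
  forall l, NoDup l -> rsum l (fun i => Cmod (G i)) <= c * M).
{ intros G c Hc HG l Hl; apply Rle_trans with (c * rsum l K).
  - clear Hl; induction l as [|i l IH]; simpl; [lra|].
    specialize (HG i); lra.
  - apply Rmult_le_compat_l; [assumption|now apply HM]. }
assert (SU : forall h, Cmod h <= r -> summable (fun i => U i (s + h)%C)).
{ intros h Hh; exists (3 * M); apply HS; [lra|]; intros i; exact (jet_shift_bound _ _ _ _ h (HJ i) Hh). }
assert (S0 : summable (fun i => U i s)).
{ exists (1 * M); apply HS; [lra|]; intros i; destruct (HJ i) as (A & _); lra. }
assert (SV : summable V).
{ exists (1 * M); apply HS; [lra|]; intros i; destruct (HJ i) as (_ & A & _); lra. }
split; [assumption|]; split; [|split].
- rewrite <- (Rmult_1_l M); apply Cmod_tsum_le, HS; [lra|]; intros i; destruct (HJ i) as (A & _); lra.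
- rewrite <- (Rmult_1_l M); apply Cmod_tsum_le, HS; [lra|]; intros i; destruct (HJ i) as (_ & A & _); lra.
- intros h Hh; rewrite <- (tsum_scal h) by assumption.
  rewrite <- !tsum_minus; try assumption; try (now apply SU); try (now apply summable_scal).
  + rewrite Rmult_comm; apply Cmod_tsum_le, HS; [apply pow2_ge_0|].
    intros i; destruct (HJ i) as (_ & _ & A); specialize (A h Hh); lra.
  + apply summable_minus; [now apply SU|assumption].
Qed.

End Jets.

(** * The twisted Dirichlet series *)

Definition norm_form (p : Z * Z) : Z := (fst p * fst p - fst p * snd p + snd p * snd p)%Z.

Lemma Cmod_lat p : Cmod (lat p) ^ 2 = IZR (norm_form p).
Proof.
pose proof (lat_norm 0 0 p) as H.
replace (RtoC 0 + RtoC 0 * om + lat p)%C with (lat p) in H by ring; rewrite H.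
unfold norm_form; rewrite plus_IZR, minus_IZR, !mult_IZR; ring.
Qed.

Lemma norm_form_pos p : p <> (0, 0)%Z -> (0 < norm_form p)%Z.
Proof.
destruct p as [a b]; unfold norm_form; simpl; intros H.
destruct (Z.eq_dec a 0) as [->|Ha]; [destruct (Z.eq_dec b 0) as [->|Hb]; [tauto|nia]|].
assert (0 < a * a)%Z by nia; nia.
Qed.

Lemma Cmod_lat_ge_1 p : p <> (0, 0)%Z -> 1 <= Cmod (lat p).
Proof.
intros H; apply norm_form_pos in H; pose proof (Cmod_lat p) as E; pose proof (Cmod_ge_0 (lat p)).
assert (1 <= IZR (norm_form p)) by (apply (IZR_le 1); lia); nra.
Qed.

Lemma ln_norm_form p : p <> (0, 0)%Z -> ln (IZR (norm_form p)) = 2 * ln (Cmod (lat p)).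
Proof.
intros H; pose proof (Cmod_lat_ge_1 p H); rewrite <- Cmod_lat.
simpl; rewrite Rmult_1_r, ln_mult by lra; ring.
Qed.

Lemma lat_0 : lat (0, 0)%Z = 0.
Proof. unfold lat, ZtoC; simpl; ring. Qed.

Lemma ln_diff_le x y m : 0 < m -> m <= x -> m <= y -> Rabs (ln x - ln y) <= Rabs (x - y) / m.
Proof.
intros Hm; assert (G : forall x y, m <= x -> m <= y -> ln x - ln y <= Rabs (x - y) / m).
{ intros a b Ha Hb; rewrite <- ln_div by lra.
  apply Rle_trans with (a / b - 1).
  - pose proof (exp_ineq1_le (ln (a / b))) as E; rewrite exp_ln in E by (apply Rdiv_lt_0_compat; lra); lra.
  - replace (a / b - 1) with ((a - b) * / b) by (field; lra).
    apply Rle_trans with (Rabs (a - b) * / b).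
    + apply Rmult_le_compat_r; [left; apply Rinv_0_lt_compat; lra|apply Rle_abs].
    + apply Rmult_le_compat_l; [apply Rabs_pos|apply Rinv_le_contravar; lra]. }
intros Hx Hy; apply Rabs_le; pose proof (G x y Hx Hy); pose proof (G y x Hy Hx) as G'.
rewrite Rabs_minus_sym in G'; lra.
Qed.

Lemma Cmod_csum_bound {I : Type} (l : list I) (F : I -> C) B :
  (forall i, In i l -> Cmod (F i) <= B) -> Cmod (csum l F) <= INR (length l) * B.
Proof.
intros H; eapply Rle_trans; [apply Cmod_csum|].
induction l as [|i l IH]; [simpl; lra|].
change (length (i :: l)) with (S (length l)); rewrite S_INR; simpl.
pose proof (H i (or_introl eq_refl)); specialize (IH (fun j Hj => H j (or_intror Hj))); lra.
Qed.

Lemma tsum_csum {I J : Type} (l : list I) (F : I -> J -> C) : (forall i, In i l -> summable (F i)) ->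
  summable (fun j => csum l (fun i => F i j)) /\ tsum (fun j => csum l (fun i => F i j)) = csum l (fun i => tsum (F i)).
Proof.
induction l as [|i l IH]; intros H.
- simpl; assert (E : has_sum (fun _ : J => RtoC 0) (csum nil (fun _ : J => RtoC 0))).
  { apply has_sum_finite; [constructor|reflexivity]. }
  split; [apply (summable_finite nil); reflexivity|exact (tsum_eq _ _ E)].
- specialize (IH (fun j Hj => H j (or_intror Hj))); destruct IH as [S1 E1].
  pose proof (H i (or_introl eq_refl)) as S2; simpl; split; [now apply summable_plus|].
  rewrite tsum_plus by assumption; f_equal; exact E1.
Qed.

(** The exponent 5/2 is twice the exponent 5/4 of [wt], because t is compared with the square root
    of [rho]. *)
Lemma Rpower_wt2 d t k : 0 < d -> d * sqrt (rho k) <= t ->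
  Rpower t (- (5 / 2)) <= Rpower d (- (5 / 2)) * Cmod (wt2 k).
Proof.
intros Hd Ht; pose proof (rho_ge_1 k) as Hk; rewrite Cmod_wt2, <- Rpower_rho.
assert (Hs : 0 < sqrt (rho k)) by (apply sqrt_lt_R0; lra).
replace (- (5 / 4)) with (/ 2 * - (5 / 2)) by field.
rewrite <- Rpower_mult, Rpower_sqrt, Rpower_mult_distr by lra.
rewrite !Rpower_Ropp; apply Rinv_le_contravar; [apply exp_pos|].
apply Rle_Rpower_l; [lra|]; split; [now apply Rmult_lt_0_compat|assumption].
Qed.

Section Twisted.
Variables (N : nat) (c : Z * Z -> C).
Hypothesis HN : (2 <= N)%nat.
Hypothesis c_period : forall r k, c (ladd r (lscale N k)) = c r.
Hypothesis c_sum : csum (residues N) c = 0.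
Hypothesis c_0 : c (0, 0)%Z = 0.

Definition dirichlet_term (s : C) (p : Z * Z) : C :=
  (c p * lat p ^ 2 * Cexp (- (s * RtoC (ln (IZR (norm_form p))))))%C.

(* Grouping the terms by blocks gains one power of [lat p] because [c] sums to
   zero over a block; this moves the abscissa of convergence below 2. *)
Definition block (k : Z * Z) (s : C) : C :=
  csum (residues N) (fun r => dirichlet_term s (ladd r (lscale N k))).

Definition Lser (s : C) : C := tsum (fun k => block k s).
(** A reference point of the block that is never the origin, as the point N k would be for k = 0. *)
Definition base (k : Z * Z) : Z * Z := ladd (1, 0)%Z (lscale N k).

Lemma base_neq_0 k : base k <> (0, 0)%Z.
Proof.
destruct k as [a b]; unfold base, ladd, lscale; simpl; intros E.
apply (f_equal fst) in E; change (1 + Z.of_nat N * a = 0)%Z in E.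
destruct (Z.eq_dec a 0) as [->|Ha]; [lia|].
assert (H : Z.abs (Z.of_nat N * a) = 1%Z) by lia; rewrite Z.abs_mul in H; nia.
Qed.

Lemma base_lower : exists d, 0 < d /\ forall k, d * sqrt (rho k) <= Cmod (lat (base k)).
Proof.
pose proof (ntoC_neq_0 N ltac:(lia)) as Hn.
assert (Ho : off_lattice (/ ntoC N)).
{ intros k E; apply (base_neq_0 k).
  destruct (classic (base k = (0, 0)%Z)) as [e|ne]; [assumption|].
  pose proof (Cmod_lat_ge_1 _ ne) as H; exfalso.
  unfold base in H; rewrite lat_add, lat_scale in H.
  replace (lat (1, 0)%Z + ntoC N * lat k)%C with (ntoC N * (/ ntoC N + lat k))%C in H
    by (unfold lat, ZtoC; simpl; field; assumption).
  rewrite E, Cmult_0_r, Cmod_0 in H; lra. }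
destruct (off_lattice_lower _ Ho) as (d & Hd & H); exists d; split; [assumption|].
intros k; unfold base; rewrite lat_add, lat_scale.
replace (lat (1, 0)%Z + ntoC N * lat k)%C with (ntoC N * (/ ntoC N + lat k))%C
    by (unfold lat, ZtoC; simpl; field; assumption).
rewrite Cmod_mult, Cmod_ntoC; specialize (H k).
assert (1 <= INR N) by (apply (le_INR 1); lia); pose proof (Cmod_ge_0 (/ ntoC N + lat k)); nra.
Qed.

Lemma c_bounded : exists B, 0 < B /\ forall p, Cmod (c p) <= B.
Proof.
exists (1 + rsum (residues N) (fun r => Cmod (c r))).
assert (G : forall (l : list (Z * Z)) r, In r l -> Cmod (c r) <= rsum l (fun r => Cmod (c r))).
{ induction l as [|i l IH]; intros r Hr; [destruct Hr|].
  assert (0 <= rsum l (fun r => Cmod (c r))).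
  { clear; induction l as [|j l IH]; simpl; [lra|]; pose proof (Cmod_ge_0 (c j)); lra. }
  simpl; pose proof (Cmod_ge_0 (c i)); destruct Hr as [<-|Hr]; [lra|]; specialize (IH r Hr); lra. }
split.
- assert (H : In (0, 0)%Z (residues N)) by (apply in_residues; simpl; lia).
  pose proof (G _ _ H); pose proof (Cmod_ge_0 (c (0, 0)%Z)); lra.
- intros p; destruct (lmod_decomp N p ltac:(lia)) as [k Ek]; rewrite <- Ek.
  rewrite c_period; pose proof (G _ _ (lmod_in N p ltac:(lia))); lra.
Qed.

Definition spread : R := 2 * INR N + 1.

Lemma residue_distance r k : In r (residues N) -> Cmod (lat (ladd r (lscale N k)) - lat (base k))%C <= spread.
Proof.
intros Hr; unfold base; rewrite !lat_add.
replace (lat r + lat (lscale N k) - (lat (1, 0)%Z + lat (lscale N k)))%C with (lat r - 1)%C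
  by (unfold lat, ZtoC; simpl; ring).
apply in_residues in Hr; destruct r as [a b]; simpl in Hr; unfold lat; simpl.
pose proof (Cmod_triangle (ZtoC a + ZtoC b * om) (- (1))) as T; rewrite Cmod_opp, Cmod_1 in T.
pose proof (Cmod_triangle (ZtoC a) (ZtoC b * om)) as T2; rewrite Cmod_mult in T2.
assert (Hom : Cmod om = 1).
{ pose proof (Cmod_lat (0, 1)%Z) as E; unfold norm_form, lat, ZtoC in E; simpl in E.
  replace (0 + 1 * om)%C with om in E by ring; pose proof (Cmod_ge_0 om); nra. }
unfold ZtoC in *; rewrite Hom, !Cmod_R, !Rabs_pos_eq in T2 by (apply IZR_le; lia).
assert (IZR a <= INR N) by (rewrite INR_IZR_INZ; apply IZR_le; lia).
assert (IZR b <= INR N) by (rewrite INR_IZR_INZ; apply IZR_le; lia).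
unfold spread; replace (RtoC (IZR a) + RtoC (IZR b) * om - 1)%C with (RtoC (IZR a) + RtoC (IZR b) * om + - (1))%C by ring; lra.
Qed.

(** Relative to the reference point, of modulus t, every nonzero term is e^(-s l0) c lambda^2 e^(-s
    delta) with delta = O(1/t). With e^(-s delta) replaced by 1 the block is O(t), since c sums to
    zero and lambda^2 varies by O(t); the correction is O(t^2/t). The factor e^(-s l0) has modulus
    t^(-2 Re s). After the loss 3/24 = 1/8 in [jet_exp], the condition Re s > 15/8 leaves t^(1 -
    7/2) = t^(-5/2), which is summable. *)
Lemma block_jet s : 15 / 8 < Re s ->
  exists K, 0 <= K /\ forall k, exists V, jet (1 / 24) (block k) s V (K * Rpower (Cmod (lat (base k))) (- (5 / 2))).
Proof.
intros Hs; destruct c_bounded as (B & HB & Hc); set (D := spread).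
assert (HD : 1 <= D) by (unfold D, spread; pose proof (pos_INR N); lra).
set (E0 := D * (2 + D)); set (Q := E0 * (1 + D) ^ 2).
assert (HE0 : 0 <= E0) by (unfold E0; apply Rmult_le_pos; lra).
assert (HQ : 0 <= Q) by (unfold Q; apply Rmult_le_pos; [assumption|apply pow2_ge_0]).
set (X := 5 * exp ((Cmod s + 1) * Q) * (Cmod s + 1) * (1 + Q)).
assert (HX : 0 <= X).
{ unfold X; pose proof (Cmod_ge_0 s); pose proof (exp_pos ((Cmod s + 1) * Q)); repeat apply Rmult_le_pos; lra. }
set (n := INR (length (residues N))); assert (Hn : 0 <= n) by apply pos_INR.
set (C1 := n * (B * E0) + n * (B * (1 + D) ^ 2 * (X * Q))).
set (C2 := 5 / (1 / 24) ^ 2).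
assert (HC1 : 0 <= C1).
{ unfold C1; pose proof (Rmult_le_pos _ _ HX HQ) as HXQ; pose proof (pow2_ge_0 (1 + D)) as HD2.
  pose proof (Rmult_le_pos B _ ltac:(lra) HE0) as HBE; pose proof (Rmult_le_pos B _ ltac:(lra) HD2) as HBD.
  pose proof (Rmult_le_pos _ _ HBD HXQ) as HBDX.
  pose proof (Rmult_le_pos _ _ Hn HBE); pose proof (Rmult_le_pos _ _ Hn HBDX); lra. }
assert (HC2 : 0 <= C2) by (unfold C2; simpl; lra).
exists (6 * (C2 * C1)); split; [apply Rmult_le_pos; [lra|now apply Rmult_le_pos]|].
intros k; set (t := Cmod (lat (base k))); assert (Ht : 1 <= t) by apply Cmod_lat_ge_1, base_neq_0.
assert (HDt : D * 1 <= D * t) by (apply Rmult_le_compat_l; lra).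
set (l0 := ln (IZR (norm_form (base k)))).
assert (El0 : l0 = 2 * ln t) by apply ln_norm_form, base_neq_0.
assert (Hl0 : 0 <= l0) by (rewrite El0; pose proof (ln_le 1 t ltac:(lra) Ht) as H; rewrite ln_1 in H; lra).
set (P := fun r => ladd r (lscale N k)).
set (dl := fun r => ln (IZR (norm_form (P r))) - l0).
set (A := csum (residues N) (fun r => (c (P r) * lat (P r) ^ 2)%C)).
assert (Hsq : forall r, In r (residues N) -> Cmod (lat (P r) ^ 2 - lat (base k) ^ 2)%C <= E0 * t).
{ intros r Hr; pose proof (residue_distance r k Hr) as H; fold D in H; fold (P r) in H.
  replace (lat (P r) ^ 2 - lat (base k) ^ 2)%C
    with ((lat (P r) - lat (base k)) * ((lat (P r) - lat (base k)) + 2 * lat (base k)))%C by ring.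
  rewrite Cmod_mult; pose proof (Cmod_triangle (lat (P r) - lat (base k)) (2 * lat (base k))) as T.
  rewrite Cmod_mult, Cmod_R, Rabs_pos_eq in T by lra; fold t in T.
  unfold E0; rewrite Rmult_assoc; apply Rmult_le_compat; try apply Cmod_ge_0; try assumption; lra. }
assert (Hup : forall r, In r (residues N) -> Cmod (lat (P r) ^ 2)%C <= (1 + D) ^ 2 * t ^ 2).
{ intros r Hr; pose proof (residue_distance r k Hr) as H; fold D in H; fold (P r) in H.
  rewrite Cmod_pow, <- Rpow_mult_distr; apply pow_incr; split; [apply Cmod_ge_0|].
  replace (lat (P r)) with ((lat (P r) - lat (base k)) + lat (base k))%C by ring.
  pose proof (Cmod_triangle (lat (P r) - lat (base k)) (lat (base k))) as T; fold t in T; lra. }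
assert (HA : Cmod A <= n * (B * E0) * t).
{ unfold A; replace (csum (residues N) (fun r => (c (P r) * lat (P r) ^ 2)%C))
    with (csum (residues N) (fun r => (c r * (lat (P r) ^ 2 - lat (base k) ^ 2))%C)).
  - rewrite !Rmult_assoc; apply Cmod_csum_bound; intros r Hr; rewrite Cmod_mult.
    apply Rmult_le_compat; try apply Cmod_ge_0; [apply Hc|now apply Hsq].
  - transitivity (csum (residues N) (fun r => (c (P r) * lat (P r) ^ 2 - lat (base k) ^ 2 * c r)%C)).
    + apply csum_ext; intros r _; unfold P; rewrite c_period; ring.
    + rewrite csum_minus, csum_scal, c_sum; ring. }
assert (Hdl : forall r, In r (residues N) -> P r <> (0, 0)%Z -> Rabs (dl r) <= Q / t).
{ intros r Hr Hp; unfold dl, l0.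
  pose proof (residue_distance r k Hr) as H; fold D in H; fold (P r) in H.
  pose proof (Cmod_lat_ge_1 _ Hp) as H1.
  assert (Hm : t <= (1 + D) * Cmod (lat (P r))).
  { unfold t; replace (lat (base k)) with (lat (P r) - (lat (P r) - lat (base k)))%C by ring.
    pose proof (Cmod_triangle (lat (P r)) (- (lat (P r) - lat (base k)))) as T; rewrite Cmod_opp in T.
    unfold Cminus at 1; nra. }
  set (m := t ^ 2 / (1 + D) ^ 2).
  assert (D2 : 0 < (1 + D) ^ 2) by (apply pow_lt; lra).
  assert (Hm1 : m <= IZR (norm_form (P r))).
  { rewrite <- Cmod_lat; unfold m; apply Rmult_le_reg_r with ((1 + D) ^ 2); [assumption|].
    unfold Rdiv; rewrite Rmult_assoc, Rinv_l, Rmult_1_r by lra.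
    replace (Cmod (lat (P r)) ^ 2 * (1 + D) ^ 2) with (((1 + D) * Cmod (lat (P r))) ^ 2) by ring.
    apply pow_incr; lra. }
  assert (Hm2 : m <= IZR (norm_form (base k))).
  { rewrite <- Cmod_lat; fold t; unfold m; apply Rmult_le_reg_r with ((1 + D) ^ 2); [assumption|].
    unfold Rdiv; rewrite Rmult_assoc, Rinv_l, Rmult_1_r by lra.
    pose proof (pow2_ge_0 t); assert (1 <= (1 + D) ^ 2) by (apply pow_R1_Rle; lra); nra. }
  assert (Hm0 : 0 < m) by (unfold m; apply Rdiv_lt_0_compat; [apply pow_lt; lra|assumption]).
  eapply Rle_trans; [apply (ln_diff_le _ _ m Hm0 Hm1 Hm2)|].
  assert (Hab : Rabs (IZR (norm_form (P r)) - IZR (norm_form (base k))) <= E0 * t).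
  { eapply Rle_trans; [|apply (Hsq r Hr)].
    rewrite <- !Cmod_lat, <- !Cmod_pow.
    apply Rabs_le; pose proof (Cmod_triangle_rev (lat (P r) ^ 2) (lat (base k) ^ 2)) as T1.
    pose proof (Cmod_triangle_rev (lat (base k) ^ 2) (lat (P r) ^ 2)) as T2.
    replace (lat (base k) ^ 2 - lat (P r) ^ 2)%C with (- (lat (P r) ^ 2 - lat (base k) ^ 2))%C in T2 by ring.
    rewrite Cmod_opp in T2; lra. }
  apply Rle_trans with (E0 * t / m).
  - unfold Rdiv; apply Rmult_le_compat_r; [left; now apply Rinv_0_lt_compat|assumption].
  - apply Req_le; unfold m, Q; field; lra. }
assert (HQt : Q / t <= Q).
{ unfold Rdiv; rewrite <- (Rmult_1_r Q) at 2; apply Rmult_le_compat_l; [assumption|].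
  rewrite <- Rinv_1; apply Rinv_le_contravar; lra. }
set (f := fun z => Cexp (- (z * RtoC l0))).
set (g := fun r z => (c (P r) * lat (P r) ^ 2 * (Cexp (- (z * RtoC (dl r))) - 1))%C).
assert (JF := jet_exp (1 / 24) ltac:(lra) l0 s Hl0).
assert (JG : exists V, jet (1 / 24) (fun z => csum (residues N) (fun r => g r z)) s V (n * (B * (1 + D) ^ 2 * (X * Q) * t))).
{ exists (csum (residues N) (fun r => (c (P r) * lat (P r) ^ 2 * (- RtoC (dl r) * Cexp (- (s * RtoC (dl r)))))%C)).
  apply jet_csum; intros r Hr.
  (* The logarithm of the norm is meaningless at the origin, but the coefficient is zero there. *)
  destruct (classic (P r = (0, 0)%Z)) as [e|ne].
  - apply (jet_ext _ (fun _ => RtoC 0)); [intros z; unfold g; rewrite e, c_0; ring|].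
    rewrite e, c_0, !Cmult_0_l; apply (jet_weaken _ _ _ _ (Cmod 0)); [|apply jet_const].
    rewrite Cmod_0; apply Rmult_le_pos; [|lra].
    apply Rmult_le_pos; [apply Rmult_le_pos; [lra|apply pow2_ge_0]|exact (Rmult_le_pos _ _ HX HQ)].
  - assert (J := jet_exp_minus_1 (1 / 24) ltac:(lra) (dl r) Q s (Rle_trans _ _ _ (Hdl r Hr ne) HQt)).
    fold X in J; apply (jet_scal _ (c (P r) * lat (P r) ^ 2)%C) in J.
    revert J; apply jet_weaken; rewrite Cmod_mult.
    specialize (Hup r Hr); specialize (Hdl r Hr ne).
    replace (B * (1 + D) ^ 2 * (X * Q) * t) with (B * ((1 + D) ^ 2 * t ^ 2) * (X * (Q / t))) by (field; lra).
    apply Rmult_le_compat.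
    + apply Rmult_le_pos; apply Cmod_ge_0.
    + apply Rmult_le_pos; [exact HX|apply Rabs_pos].
    + apply Rmult_le_compat; try apply Cmod_ge_0; [apply Hc|exact Hup].
    + apply Rmult_le_compat_l; [exact HX|exact Hdl]. }
destruct JG as (V & JG).
assert (JV := jet_plus _ _ _ s _ _ _ _ (jet_const (1 / 24) A s) JG).
assert (JV' : jet (1 / 24) (fun z => (A + csum (residues N) (fun r => g r z))%C) s (0 + V) (C1 * t)).
{ revert JV; apply jet_weaken; unfold C1; nra. }
eexists; pose proof (jet_mult (1 / 24) ltac:(lra) _ _ s _ _ _ _ JF JV') as J.
apply (jet_ext _ _ (block k)) in J.
- revert J; apply jet_weaken; fold C2.
  replace (6 * (C2 * C1) * Rpower t (- (5 / 2))) with (6 * (C2 * Rpower t (- (7 / 2)) * (C1 * t))).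
  + apply Rmult_le_compat_l; [lra|]; apply Rmult_le_compat_r; [apply Rmult_le_pos; lra|].
    apply Rmult_le_compat_l; [assumption|]; unfold Rpower; rewrite El0.
    assert (0 <= ln t) by lra.
    assert (Hle : - (Re s - 3 * (1 / 24)) * (2 * ln t) <= - (7 / 2) * ln t) by nra.
    destruct (Rle_lt_or_eq_dec _ _ Hle) as [h|h]; [left; now apply exp_increasing|rewrite h; lra].
  + replace (- (5 / 2)) with (- (7 / 2) + 1) by lra; rewrite Rpower_plus, Rpower_1 by lra; ring.
- intros z; unfold block, A, g; rewrite <- csum_plus.
  rewrite <- csum_scal; apply csum_ext; intros r Hr; unfold dirichlet_term; fold (P r).
  replace (Cexp (- (z * RtoC (ln (IZR (norm_form (P r))))))) with (Cexp (- (z * RtoC l0)) * Cexp (- (z * RtoC (dl r))))%C; [ring|].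
  rewrite <- Cexp_plus; f_equal; unfold dl; rewrite RtoC_minus; ring.
Qed.

Lemma Lser_jet s : 15 / 8 < Re s ->
  summable (fun k => block k s) /\ exists V M, jet (1 / 24) Lser s V M.
Proof.
intros Hs; destruct (block_jet s Hs) as (K & HK & HJ); destruct base_lower as (d & Hd & Hb).
destruct summable_wt2 as [M HM].
set (V := fun k => proj1_sig (constructive_indefinite_description _ (HJ k))).
assert (HV : forall k, jet (1 / 24) (block k) s (V k) (K * (Rpower d (- (5 / 2)) * Cmod (wt2 k)))).
{ intros k; unfold V; destruct constructive_indefinite_description as [v Hv]; simpl.
  revert Hv; apply jet_weaken, Rmult_le_compat_l; [assumption|]; now apply Rpower_wt2. }
set (K' := K * Rpower d (- (5 / 2))).
assert (HK' : 0 <= K') by (apply Rmult_le_pos; [assumption|left; apply exp_pos]).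
destruct (jet_tsum (1 / 24) ltac:(lra) block s V _ (K' * M) HV) as [S1 J].
- intros l Hl; apply Rle_trans with (K' * rsum l (fun k => Cmod (wt2 k))).
  + clear Hl; unfold K'; induction l as [|k l IH]; simpl; [lra|].
    rewrite Rmult_plus_distr_l; apply Rplus_le_compat; [apply Req_le; ring|exact IH].
  + apply Rmult_le_compat_l; [assumption|now apply HM].
- split; [assumption|]; exists (tsum V), (K' * M); exact J.
Qed.

Lemma Lser_holomorphic : holomorphic_right_of (15 / 8) Lser.
Proof.
intros s Hs; destruct (Lser_jet s Hs) as (_ & V & M & J); exists V.
apply (is_derive_of_jet (1 / 24) ltac:(lra) Lser s V M J).
Qed.

Lemma summable_dirichlet_term s : 9 / 4 <= Re s -> summable (dirichlet_term s).
Proof.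
intros Hs; destruct c_bounded as (B & HB & Hc).
destruct (off_lattice_lower _ off_half) as (d & Hd & Hl).
(* Lower bounds are available off the lattice, so 1/2 + lambda is used: |1/2 + lambda| <= (3/2)
   |lambda| when |lambda| >= 1, whence the factor 2/3. For Re s >= 9/4 the terms are O(|lambda|^(2 -
   9/2)), again the exponent 5/2. *)
apply (summable_le_scal (B * Rpower (2 / 3 * d) (- (5 / 2))) _ wt2); [|apply summable_wt2].
intros p; unfold dirichlet_term; destruct (classic (p = (0, 0)%Z)) as [->|ne].
- rewrite c_0, !Cmult_0_l, Cmod_0; repeat apply Rmult_le_pos; [lra|left; apply exp_pos|apply Cmod_ge_0].
- pose proof (Cmod_lat_ge_1 p ne) as H1; set (t := Cmod (lat p)) in *.
  assert (Hlow : 2 / 3 * d * sqrt (rho p) <= t).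
  { specialize (Hl p); pose proof (Cmod_triangle (/ 2) (lat p)) as T; fold t in T.
    replace (/ 2)%C with (RtoC (/ 2)) in T, Hl by (rewrite RtoC_inv by lra; reflexivity).
    rewrite Cmod_R, Rabs_pos_eq in T by lra; lra. }
  rewrite !Cmod_mult, Cmod_pow, Cmod_Cexp, ln_norm_form by assumption; fold t.
  rewrite !Rmult_assoc; apply Rmult_le_compat; [apply Cmod_ge_0| |apply Hc|].
  { apply Rmult_le_pos; [apply pow2_ge_0|left; apply exp_pos]. }
  eapply Rle_trans; [|apply (Rpower_wt2 (2 / 3 * d) t p); [lra|assumption]].
  replace (Re (- (s * RtoC (2 * ln t)))) with (- (2 * Re s) * ln t) by (destruct s; simpl; ring).
  change (exp (- (2 * Re s) * ln t)) with (Rpower t (- (2 * Re s))).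
  rewrite <- (Rpower_pow 2), <- Rpower_plus by lra.
  apply Rle_Rpower; [assumption|simpl; lra].
Qed.

Lemma Lser_tsum s : 9 / 4 <= Re s -> Lser s = tsum (dirichlet_term s).
Proof.
intros Hs; pose proof (summable_dirichlet_term s Hs) as HS.
rewrite (tsum_residues N) by (try lia; assumption).
apply (tsum_csum (residues N) (fun r k => dirichlet_term s (ladd r (lscale N k)))).
intros r _; apply (summable_inj (fun k => ladd r (lscale N k))); [|assumption].
intros [a b] [a' b'] E; unfold ladd, lscale in E; simpl in E; injection E; intros.
f_equal; apply (Z.mul_reg_l _ _ (Z.of_nat N)); lia.
Qed.

Definition rep_coef (n : nat) : C :=
  tsum (mask (fun p => norm_form p = Z.of_nat n) (fun p => (c p * lat p ^ 2)%C)).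

Lemma Lser_series s : 9 / 4 <= Re s ->
  is_series (K := C_AbsRing) (V := C_NormedModule)
    (fun n => Cmult (rep_coef (S n)) (npow_opp (S n) s)) (Lser s).
Proof.
intros Hs; rewrite Lser_tsum by assumption; apply has_sum_is_series.
pose proof (summable_dirichlet_term s Hs) as HS.
apply (has_sum_ext (fun n => tsum (mask (fun p => (Z.to_nat (norm_form p - 1)) = n) (dirichlet_term s))));
  [|now apply (has_sum_fiber (fun p => Z.to_nat (norm_form p - 1)))].
intros n; set (w := npow_opp (S n) s).
assert (Hw : w <> 0) by apply Cexp_neq_0.
assert (E : forall p, mask (fun p => Z.to_nat (norm_form p - 1) = n) (dirichlet_term s) p =
  (w * mask (fun p => norm_form p = Z.of_nat (S n)) (fun p => c p * lat p ^ 2) p)%C).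
{ intros p; unfold mask.
  (* The truncation in [Z.to_nat] places the origin, of norm 0, in the fibre of norm 1; its
     coefficient is zero. *)
  destruct (classic (p = (0, 0)%Z)) as [->|ne].
  - unfold dirichlet_term; rewrite c_0.
    destruct excluded_middle_informative; destruct excluded_middle_informative; ring.
  - apply norm_form_pos in ne.
    destruct excluded_middle_informative as [h|h]; destruct excluded_middle_informative as [h'|h'];
      try (exfalso; lia); [|ring].
    unfold dirichlet_term, w, npow_opp; rewrite h', INR_IZR_INZ; ring. }
rewrite (tsum_ext _ _ E), tsum_scal; [unfold rep_coef; apply Cmult_comm|].
apply (summable_ext (fun p => (/ w * mask (fun p => Z.to_nat (norm_form p - 1) = n) (dirichlet_term s) p)%C)).
- intros p; rewrite E; field; assumption.
- apply summable_scal, summable_mask; assumption.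
Qed.

End Twisted.

Lemma off_lattice_residue N r : (0 < N)%nat -> In r (residues N) -> r <> (0, 0)%Z -> off_lattice (lat r / ntoC N).
Proof.
intros HN Hr H0 p E; apply H0; pose proof (ntoC_neq_0 N HN) as Hn.
assert (Er : lat (ladd r (lscale N p)) = 0).
{ rewrite lat_add, lat_scale; replace (lat r + ntoC N * lat p)%C with (ntoC N * (lat r / ntoC N + lat p))%C by (field; assumption).
  rewrite E; ring. }
destruct (classic (ladd r (lscale N p) = (0, 0)%Z)) as [e|ne].
- apply in_residues in Hr; destruct r as [a b], p as [x y]; unfold ladd, lscale in e; simpl in *.
  injection e; intros E2 E1.
  assert (x = 0 \/ Z.abs x >= 1)%Z by lia; assert (y = 0 \/ Z.abs y >= 1)%Z by lia.
  assert (x = 0)%Z by nia; assert (y = 0)%Z by nia; subst; f_equal; lia.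
- apply Cmod_lat_ge_1 in ne; rewrite Er, Cmod_0 in ne; lra.
Qed.

(** Here lambda^2/(lambda conj(lambda))^2 = 1/conj(lambda)^2, so at s = 2 the series is the
    conjugate of a lattice sum of weight 2. *)
Lemma dirichlet_term_2 c p : Cconj (c p) = c p -> p <> (0, 0)%Z ->
  dirichlet_term c (RtoC 2) p = Cconj (c p * / lat p ^ 2)%C.
Proof.
intros Hc Hp; pose proof (norm_form_pos p Hp) as Hn; pose proof (Cmod_lat_ge_1 p Hp) as H1.
assert (Hl : lat p <> 0) by (apply Cmod_neq_0; lra).
unfold dirichlet_term; rewrite Cmult_conj, Hc.
assert (Hx : 0 < IZR (norm_form p)) by (now apply (IZR_lt 0)).
assert (Ex : Cexp (- (RtoC 2 * RtoC (ln (IZR (norm_form p))))) = (/ (lat p * Cconj (lat p)) ^ 2)%C).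
{ rewrite <- RtoC_mult, <- RtoC_opp, Cexp_real, exp_Ropp.
  replace (2 * ln (IZR (norm_form p))) with (ln (IZR (norm_form p)) + ln (IZR (norm_form p))) by ring.
  rewrite exp_plus, exp_ln by assumption; rewrite <- Cmod_lat.
  assert (0 < Cmod (lat p) ^ 2) by (apply pow_lt; lra).
  rewrite <- Cmod2_conj, RtoC_inv by nra; f_equal; rewrite <- RtoC_pow; f_equal; ring. }
rewrite Ex.
assert (Hcl : Cconj (lat p) <> 0).
{ apply Cmod_neq_0; rewrite Cmod_conj; lra. }
rewrite Cinv_conj, Cpow_conj by now apply Cpow_nz.
field; split; assumption.
Qed.

Section Value.
Variables (N : nat) (c : Z * Z -> C).
Hypothesis HN : (2 <= N)%nat.
Hypothesis c_period : forall r k, c (ladd r (lscale N k)) = c r.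
Hypothesis c_sum : csum (residues N) c = 0.
Hypothesis c_0 : c (0, 0)%Z = 0.
Hypothesis c_real : forall p, Cconj (c p) = c p.

(** As c sums to zero, a common term (1/2 + lambda)^(-2) can be subtracted from all residues of a
    block without changing it. This turns the blocks into the absolutely convergent differences of
    [L2], and for the same reason the constant [fO] may be added to pass to [RO]. *)
Lemma Lser_2 : Lser N c (RtoC 2) =
  Cconj (/ ntoC N ^ 2 * csum (residues N) (fun r => (c r * RO (lat r / ntoC N))%C)).
Proof.
pose proof (ntoC_neq_0 N ltac:(lia)) as Hn.
set (G := fun r k => (c r * lat_diff (lat r / ntoC N) (/ 2) k)%C).
assert (HG : forall r, In r (residues N) -> summable (G r) /\ tsum (G r) = (c r * (RO (lat r / ntoC N) - fO))%C).
{ intros r Hr; destruct (classic (r = (0, 0)%Z)) as [->|ne].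
  - assert (Hz : has_sum (G (0, 0)%Z) (csum nil (G (0, 0)%Z))).
    { apply has_sum_finite; [constructor|]; intros k _; unfold G; rewrite c_0; ring. }
    split; [apply (summable_finite nil); intros k _; unfold G; rewrite c_0; ring|].
    rewrite (tsum_eq _ _ Hz), c_0; simpl; ring.
  - pose proof (off_lattice_residue N r ltac:(lia) Hr ne) as Ho.
    pose proof (summable_lat_diff _ _ Ho off_half) as HS; unfold G; split; [now apply summable_scal|].
    rewrite tsum_scal by assumption; unfold RO, Dz, L2; ring. }
assert (HB : forall k, block N c k (RtoC 2) = Cconj (/ ntoC N ^ 2 * csum (residues N) (fun r => G r k))).
{ intros k; unfold block.
  rewrite <- csum_scal, <- csum_conj.
  transitivity (csum (residues N) (fun r => Cconj (/ ntoC N ^ 2 * G r k) +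
    Cconj (/ ntoC N ^ 2 * / (/ 2 + lat k) ^ 2) * c r)%C).
  - apply csum_ext; intros r Hr; set (P := ladd r (lscale N k)).
    destruct (classic (r = (0, 0)%Z)) as [->|ne].
    + assert (EP : c P = 0) by (unfold P; rewrite c_period; assumption).
      unfold dirichlet_term, G; rewrite EP, c_0, !Cmult_0_l, Cmult_0_r, Cmult_0_r, Cconj_RtoC; ring.
    + pose proof (off_lattice_residue N r ltac:(lia) Hr ne k) as Ho.
      assert (EP : lat P = (ntoC N * (lat r / ntoC N + lat k))%C).
      { unfold P; rewrite lat_add, lat_scale; field; assumption. }
      rewrite dirichlet_term_2; [|apply c_real|].
      * unfold P; rewrite c_period; fold P; rewrite <- (c_real r) at 2.
        rewrite <- Cmult_conj, <- Cplus_conj; f_equal; unfold G, lat_diff; rewrite EP.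
        pose proof (off_half k); field; repeat split; try assumption.
        { intros E; apply (off_half k); replace (/ 2 + lat k)%C with ((1 + lat k * 2) / 2)%C by field; rewrite E; field. }
        { intros E; apply Ho; replace (lat r / ntoC N + lat k)%C with ((lat r + lat k * ntoC N) / ntoC N)%C by (field; assumption).
          rewrite E; field; assumption. }
      * intros E; rewrite E, lat_0 in EP; symmetry in EP; revert EP; apply Cmult_neq_0; assumption.
  - rewrite csum_plus, csum_scal, c_sum; ring. }
unfold Lser; rewrite (tsum_ext _ _ HB).
destruct (tsum_csum (residues N) G (fun r Hr => proj1 (HG r Hr))) as [S1 E1].
rewrite tsum_conj by now apply summable_scal.
rewrite tsum_scal, E1 by assumption; do 2 f_equal.
transitivity (csum (residues N) (fun r => c r * RO (lat r / ntoC N) - fO * c r)%C).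
- apply csum_ext; intros r Hr; rewrite (proj2 (HG r Hr)); ring.
- rewrite csum_minus, csum_scal, c_sum; ring.
Qed.

End Value.

(** * The coefficients of f_300 *)

Lemma csum_list_prod {I J : Type} (l : list I) (l' : list J) (F : I * J -> C) :
  csum (list_prod l l') F = csum l (fun i => csum l' (fun j => F (i, j))).
Proof.
induction l as [|i l IH]; [reflexivity|]; simpl; rewrite <- IH.
generalize (list_prod l l'); intros m; clear IH; induction l' as [|j l' IH]; simpl; [ring|].
rewrite IH; ring.
Qed.

Definition centered (B : nat) : list Z := map (fun i => (Z.of_nat i - Z.of_nat B)%Z) (seq 0 (2 * B + 1)).

Lemma in_centered B z : In z (centered B) <-> (Z.abs z <= Z.of_nat B)%Z.
Proof.
unfold centered; rewrite in_map_iff; split.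
- intros (i & <- & Hi); apply in_seq in Hi; lia.
- intros H; exists (Z.to_nat (z + Z.of_nat B)); split; [lia|apply in_seq; lia].
Qed.

Lemma NoDup_centered B : NoDup (centered B).
Proof.
apply NoDup_map_NoDup_ForallPairs; [|apply seq_NoDup].
intros a b _ _ E; lia.
Qed.

Lemma zsum_csum B F : zsum B F = csum (centered B) F.
Proof.
unfold zsum, centered; rewrite csum_map; replace (2 * B + 1)%nat with (S (2 * B)) by lia.
symmetry; exact (csum_seq _ _).
Qed.

Definition ind (b : bool) : C := if b then 1 else 0.

(** [g] parametrises the lattice points of the class [I], and the box in [qcoeff] contains every
    pair of the given norm, so the finite sum is the full sum over the lattice. *)
Lemma has_sum_qcoeff (D : Z -> Z -> bool) (P : Z -> Z -> C) (Q : Z -> Z -> Z) (I : Z * Z -> bool) (g : Z * Z -> Z * Z) N :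
  (forall u v, g u = g v -> u = v) -> (forall u, I (g u) = true) -> (forall p, I p = true -> exists u, g u = p) ->
  (forall m n, P m n = Cpow (lat (g (m, n))) 2) -> (forall m n, Q m n = norm_form (g (m, n))) ->
  (forall m n, Q m n = Z.of_nat N -> (Z.abs m <= Z.of_nat N /\ Z.abs n <= Z.of_nat N)%Z) ->
  (forall m n, Q m n = Z.of_nat N -> D m n = true) ->
  has_sum (mask (fun p => norm_form p = Z.of_nat N) (fun p => (ind (I p) * lat p ^ 2)%C)) (qcoeff D P Q N).
Proof.
intros Hg I1 I2 HP HQ HB HD.
apply (has_sum_inj g Hg).
- intros p Hp; unfold mask; destruct excluded_middle_informative; [|reflexivity].
  destruct (I p) eqn:E; [|unfold ind; ring].
  destruct (I2 p E) as [u Hu]; exfalso; exact (Hp u Hu).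
- set (F := fun u => mask (fun p => norm_form p = Z.of_nat N) (fun p => (ind (I p) * lat p ^ 2)%C) (g u)).
  assert (EF : forall m n, F (m, n) = if (D m n && (Q m n =? Z.of_nat N)%Z)%bool then P m n else 0).
  { intros m n; unfold F, mask; rewrite I1, <- HQ, HP.
    destruct (Z.eqb_spec (Q m n) (Z.of_nat N)) as [h|h].
    - rewrite (HD m n h); destruct excluded_middle_informative; [unfold ind; simpl andb; cbv iota; ring|tauto].
    - rewrite andb_false_r; destruct excluded_middle_informative; [tauto|reflexivity]. }
  replace (qcoeff D P Q N) with (csum (list_prod (centered N) (centered N)) F).
  + apply has_sum_finite; [apply NoDup_list_prod; apply NoDup_centered|].
    intros [m n] Hmn; rewrite EF; destruct (Z.eqb_spec (Q m n) (Z.of_nat N)) as [h|h]; [|now rewrite andb_false_r].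
    destruct (HB m n h); exfalso; apply Hmn, in_prod; now apply in_centered.
  + rewrite csum_list_prod; unfold qcoeff; rewrite zsum_csum; apply csum_ext; intros m _.
    rewrite zsum_csum; apply csum_ext; intros n _; apply EF.
Qed.

Lemma has_sum_sum_n_m {I : Type} (F : nat -> I -> C) (S : nat -> C) n m :
  (forall k, (n <= k <= m)%nat -> has_sum (F k) (S k)) ->
  has_sum (fun i => sum_n_m (fun k => F k i) n m) (sum_n_m S n m).
Proof.
induction m as [|m IH]; intros H.
- destruct n as [|n].
  + rewrite sum_n_n; apply (has_sum_ext (F 0%nat)); [intros i; now rewrite sum_n_n|apply H; lia].
  + rewrite sum_n_m_zero by lia.
    apply (has_sum_ext (fun _ => RtoC 0)); [intros i; rewrite sum_n_m_zero by lia; reflexivity|].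
    apply (has_sum_finite nil); [constructor|reflexivity].
- destruct (le_gt_dec n (Datatypes.S m)) as [h|h].
  + rewrite sum_n_Sm by assumption.
    apply (has_sum_ext (fun i => (sum_n_m (fun k => F k i) n m + F (Datatypes.S m) i)%C));
      [intros i; rewrite sum_n_Sm by assumption; reflexivity|].
    apply has_sum_plus; [apply IH; intros k Hk|]; apply H; lia.
  + rewrite sum_n_m_zero by lia.
    apply (has_sum_ext (fun _ => RtoC 0)); [intros i; rewrite sum_n_m_zero by lia; reflexivity|].
    apply (has_sum_finite nil); [constructor|reflexivity].
Qed.

(* The point [x + y sqrt(-3)] is [lat (x + y, 2 y)]. *)
Definition xc (p : Z * Z) : Z := (fst p - snd p / 2)%Z.

Definition yc (p : Z * Z) : Z := (snd p / 2)%Z.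
Definition mk (x y : Z) : Z * Z := (x + y, 2 * y)%Z.

Lemma xc_mk x y : xc (mk x y) = x.
Proof. unfold xc, mk; cbn [fst snd]; rewrite (Z.mul_comm 2), Z.div_mul by lia; lia. Qed.

Lemma yc_mk x y : yc (mk x y) = y.
Proof. unfold yc, mk; cbn [fst snd]; rewrite (Z.mul_comm 2), Z.div_mul by lia; lia. Qed.

Lemma even_mk x y : Z.even (snd (mk x y)) = true.
Proof. unfold mk; cbn [fst snd]; rewrite Z.even_mul; reflexivity. Qed.

Lemma mk_xc_yc p : Z.even (snd p) = true -> mk (xc p) (yc p) = p.
Proof.
destruct p as [a b]; unfold mk, xc, yc; cbn [fst snd]; intros H.
apply Z.even_spec in H; destruct H as [m ->]; rewrite (Z.mul_comm 2 m), Z.div_mul by lia; f_equal; lia.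
Qed.

Lemma sqrt_m3_om : sqrt_m3 = (1 + 2 * om)%C.
Proof. unfold sqrt_m3, om; apply injective_projections; simpl; field. Qed.

Lemma lat_mk x y : lat (mk x y) = (ZtoC x + ZtoC y * sqrt_m3)%C.
Proof. rewrite sqrt_m3_om; unfold lat, mk; cbn [fst snd]; rewrite ZtoC_plus, ZtoC_mult; change (ZtoC 2) with (RtoC 2); ring. Qed.

Lemma norm_form_mk x y : norm_form (mk x y) = (x ^ 2 + 3 * y ^ 2)%Z.
Proof. unfold norm_form, mk; cbn [fst snd]; ring. Qed.

Definition in_class (j k : Z) (p : Z * Z) : bool :=
  (Z.even (snd p) && ((yc p - k) mod 5 =? 0) && ((xc p - j * yc p) mod 5 =? 0))%Z.

Definition x_class (p : Z * Z) : bool := (Z.even (snd p) && (xc p mod 5 =? 0))%Z.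
Definition y_class (p : Z * Z) : bool := (Z.even (snd p) && (yc p mod 5 =? 0))%Z.

Definition c300 (p : Z * Z) : C :=
  (sum_n_m (fun k : nat => sum_n_m (fun j : nat =>
      (ZtoC (legendre (Z.of_nat j) 5) * ind (in_class (Z.of_nat j) (Z.of_nat k) p))%C) 1 4) 1 2
   - RtoC (1 / 2) * ind (x_class p) + RtoC (1 / 2) * ind (y_class p))%C.

Lemma has_sum_class j k N : (1 <= j <= 4)%Z -> (1 <= k <= 2)%Z ->
  has_sum (mask (fun p => norm_form p = Z.of_nat N) (fun p => (ind (in_class j k p) * lat p ^ 2)%C))
    (qcoeff all_pairs (fun m n => Cpow (beta j k m n) 2) (beta_norm j k) N).
Proof.
intros Hj Hk.
apply (has_sum_qcoeff _ _ _ _ (fun u => mk (5 * fst u + (5 * snd u + k) * j) (5 * snd u + k))).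
- intros [m n] [m' n'] E; cbn [fst snd] in E.
  assert (Ey := f_equal yc E); assert (Ex := f_equal xc E); rewrite !yc_mk in Ey; rewrite !xc_mk in Ex.
  assert (n = n') by lia; subst; f_equal; lia.
- intros [m n]; unfold in_class; rewrite xc_mk, yc_mk, even_mk; cbn [fst snd].
  replace (5 * n + k - k)%Z with (n * 5)%Z by ring; rewrite Z.mod_mul by lia.
  replace (5 * m + (5 * n + k) * j - j * (5 * n + k))%Z with (m * 5)%Z by ring; rewrite Z.mod_mul by lia; reflexivity.
- intros p Hp; unfold in_class in Hp; apply andb_prop in Hp; destruct Hp as [Hp H3].
  apply andb_prop in Hp; destruct Hp as [H1 H2]; apply Z.eqb_eq in H2; apply Z.eqb_eq in H3.
  apply Z.mod_divide in H2; [|lia]; apply Z.mod_divide in H3; [|lia].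
  destruct H2 as [n Hn]; destruct H3 as [m Hm].
  exists (m, n); rewrite <- (mk_xc_yc p H1); cbn [fst snd].
  assert (Ey : (5 * n + k = yc p)%Z) by lia; rewrite Ey; f_equal; lia.
- intros m n; f_equal; rewrite lat_mk; unfold beta; cbn [fst snd].
  rewrite (ZtoC_plus (5 * m)), (ZtoC_mult (5 * n + k) j); ring.
- intros m n; rewrite norm_form_mk; reflexivity.
- intros m n H; exact (beta_norm_box j k m n N Hj Hk H).
- reflexivity.
Qed.

Lemma has_sum_x_class N : (1 <= N)%nat ->
  has_sum (mask (fun p => norm_form p = Z.of_nat N) (fun p => (ind (x_class p) * lat p ^ 2)%C))
    (qcoeff nonzero_pairs (fun m n => Cpow (ZtoC (5 * m) + ZtoC n * sqrt_m3) 2) (fun m n => (25 * m ^ 2 + 3 * n ^ 2)%Z) N).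
Proof.
intros HN; apply (has_sum_qcoeff _ _ _ _ (fun u => mk (5 * fst u) (snd u))).
- intros [m n] [m' n'] E; cbn [fst snd] in E.
  assert (Ey := f_equal yc E); assert (Ex := f_equal xc E); rewrite !yc_mk in Ey; rewrite !xc_mk in Ex.
  f_equal; lia.
- intros [m n]; unfold x_class; rewrite xc_mk, even_mk; cbn [fst snd]; rewrite (Z.mul_comm 5), Z.mod_mul by lia; reflexivity.
- intros p Hp; apply andb_prop in Hp; destruct Hp as [H1 H2]; apply Z.eqb_eq in H2.
  apply Z.mod_divide in H2; [|lia]; destruct H2 as [m Hm].
  exists (m, yc p); cbn [fst snd]; transitivity (mk (xc p) (yc p)); [f_equal; lia|exact (mk_xc_yc p H1)].
- intros m n; now rewrite lat_mk.
- intros m n; rewrite norm_form_mk; cbn [fst snd]; ring.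
- intros m n; apply form_25_3_box.
- intros m n H; unfold nonzero_pairs; destruct (Z.eqb_spec m 0) as [->|]; [|reflexivity].
  destruct (Z.eqb_spec n 0) as [->|]; [lia|reflexivity].
Qed.

Lemma has_sum_y_class N : (1 <= N)%nat ->
  has_sum (mask (fun p => norm_form p = Z.of_nat N) (fun p => (ind (y_class p) * lat p ^ 2)%C))
    (qcoeff nonzero_pairs (fun m n => Cpow (ZtoC m + ZtoC (5 * n) * sqrt_m3) 2) (fun m n => (m ^ 2 + 75 * n ^ 2)%Z) N).
Proof.
intros HN; apply (has_sum_qcoeff _ _ _ _ (fun u => mk (fst u) (5 * snd u))).
- intros [m n] [m' n'] E; cbn [fst snd] in E.
  assert (Ey := f_equal yc E); assert (Ex := f_equal xc E); rewrite !yc_mk in Ey; rewrite !xc_mk in Ex.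
  f_equal; lia.
- intros [m n]; unfold y_class; rewrite yc_mk, even_mk; cbn [fst snd]; rewrite (Z.mul_comm 5), Z.mod_mul by lia; reflexivity.
- intros p Hp; apply andb_prop in Hp; destruct Hp as [H1 H2]; apply Z.eqb_eq in H2.
  apply Z.mod_divide in H2; [|lia]; destruct H2 as [m Hm].
  exists (xc p, m); cbn [fst snd]; transitivity (mk (xc p) (yc p)); [f_equal; lia|exact (mk_xc_yc p H1)].
- intros m n; now rewrite lat_mk.
- intros m n; rewrite norm_form_mk; cbn [fst snd]; ring.
- intros m n; apply form_1_75_box.
- intros m n H; unfold nonzero_pairs; destruct (Z.eqb_spec m 0) as [->|]; [|reflexivity].
  destruct (Z.eqb_spec n 0) as [->|]; [lia|reflexivity].
Qed.

Lemma Cmult_sum_n_m (a : C) (F : nat -> C) n m : (sum_n_m F n m * a)%C = sum_n_m (fun k => (F k * a)%C) n m.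
Proof. symmetry; exact (sum_n_m_mult_r (K := C_Ring) a F n m). Qed.

Lemma f300_rep_coef N : (1 <= N)%nat -> rep_coef c300 N = f300 N.
Proof.
intros HN; apply tsum_eq; unfold f300.
set (M := fun F : Z * Z -> C => mask (fun p => norm_form p = Z.of_nat N) F).
apply (has_sum_ext (fun p =>
  (sum_n_m (fun k : nat => sum_n_m (fun j : nat =>
      (ZtoC (legendre (Z.of_nat j) 5) * M (fun p => ind (in_class (Z.of_nat j) (Z.of_nat k) p) * lat p ^ 2) p)%C) 1 4) 1 2
   + (- RtoC (1 / 2)) * M (fun p => ind (x_class p) * lat p ^ 2) p + RtoC (1 / 2) * M (fun p => ind (y_class p) * lat p ^ 2) p)%C)).
- intros p; unfold M, mask; destruct excluded_middle_informative as [h|h].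
  + symmetry; unfold c300; match goal with |- ((?S - _ + _) * ?L)%C = _ =>
      transitivity (S * L + - RtoC (1 / 2) * (ind (x_class p) * L) + RtoC (1 / 2) * (ind (y_class p) * L))%C; [ring|] end.
    apply f_equal2; [|reflexivity]; apply f_equal2; [|reflexivity].
    rewrite Cmult_sum_n_m; apply sum_n_m_ext; intros k; rewrite Cmult_sum_n_m; apply sum_n_m_ext; intros j; exact (eq_sym (Cmult_assoc _ _ _)).
  + rewrite (sum_n_m_ext _ (fun _ => zero)).
    * rewrite sum_n_m_const_zero; change (@zero C_AbelianMonoid) with (RtoC 0); ring.
    * intros k; rewrite (sum_n_m_ext _ (fun _ => zero)); [apply sum_n_m_const_zero|].
      intros j; exact (Cmult_0_r _).
- apply has_sum_plus; [|apply has_sum_scal, has_sum_y_class, HN].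
  match goal with |- has_sum _ (?a - ?b * ?c)%C => replace (a - b * c)%C with (a + (- b) * c)%C by ring end.
  apply has_sum_plus; [|apply has_sum_scal, has_sum_x_class, HN].
  apply has_sum_sum_n_m; intros k Hk; apply has_sum_sum_n_m; intros j Hj.
  apply has_sum_scal, has_sum_class; lia.
Qed.

(** * The finite sum of torsion values *)

(** Doubled coefficients, as integers, so that identities over all residues modulo 10 can be checked
    by computation. *)
Definition twice_c (p : Z * Z) : Z :=
  (2 * fold_right Z.add 0 (map (fun jk => legendre (fst jk) 5 * Z.b2z (in_class (fst jk) (snd jk) p))
     (list_prod (1 :: 2 :: 3 :: 4 :: nil) (1 :: 2 :: nil)))
   - Z.b2z (x_class p) + Z.b2z (y_class p))%Z.

Lemma ind_b2z b : ind b = ZtoC (Z.b2z b).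
Proof. destruct b; reflexivity. Qed.

Lemma sum_1_2 (F : nat -> C) : sum_n_m F 1 2 = (F 1%nat + F 2%nat)%C.
Proof. rewrite sum_Sn_m, sum_n_n by lia; reflexivity. Qed.

Lemma sum_1_4 (F : nat -> C) : sum_n_m F 1 4 = (F 1%nat + (F 2%nat + (F 3%nat + F 4%nat)))%C.
Proof.
rewrite sum_Sn_m by lia; rewrite (sum_Sn_m F 2) by lia; rewrite (sum_Sn_m F 3) by lia; rewrite sum_n_n; reflexivity.
Qed.

Lemma c300_twice p : c300 p = RtoC (IZR (twice_c p) / 2).
Proof.
unfold c300, twice_c; rewrite sum_1_2, !sum_1_4, !ind_b2z.
unfold list_prod, app, map, fold_right, fst, snd.
change (Z.of_nat 1) with 1%Z; change (Z.of_nat 2) with 2%Z; change (Z.of_nat 3) with 3%Z; change (Z.of_nat 4) with 4%Z.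
repeat match goal with |- context [Z.b2z ?b] => let x := fresh "b" in set (x := Z.b2z b) end.
repeat match goal with |- context [legendre ?j 5] => let x := fresh "l" in set (x := legendre j 5) end.
unfold ZtoC.
rewrite plus_IZR, minus_IZR, !mult_IZR, !plus_IZR, !mult_IZR.
rewrite <- !RtoC_mult, <- !RtoC_plus, <- RtoC_minus, <- RtoC_plus; f_equal; field.
Qed.

Lemma class_period r k :
  Z.even (snd (ladd r (lscale 10 k))) = Z.even (snd r) /\
  yc (ladd r (lscale 10 k)) = (yc r + snd k * 5)%Z /\
  xc (ladd r (lscale 10 k)) = (xc r + (2 * fst k - snd k) * 5)%Z.
Proof.
destruct r as [a b], k as [u v]; unfold ladd, lscale, xc, yc; cbn [fst snd]; change (Z.of_nat 10) with 10%Z.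
assert (E : ((b + 10 * v) / 2 = b / 2 + v * 5)%Z).
{ replace (b + 10 * v)%Z with (b + (v * 5) * 2)%Z by ring; apply Z.div_add; lia. }
rewrite E; split; [|split; lia].
rewrite Z.even_add, Z.even_mul; simpl; destruct (Z.even b); reflexivity.
Qed.

(** The period 10 combines the congruences modulo 5 with the parity of the second coordinate. *)
Lemma c300_period r k : c300 (ladd r (lscale 10 k)) = c300 r.
Proof.
destruct (class_period r k) as (H1 & H2 & H3).
assert (I : forall j l, in_class j l (ladd r (lscale 10 k)) = in_class j l r).
{ intros j l; unfold in_class; rewrite H1, H2, H3.
  replace (yc r + snd k * 5 - l)%Z with (yc r - l + snd k * 5)%Z by ring.
  replace (xc r + (2 * fst k - snd k) * 5 - j * (yc r + snd k * 5))%Z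
    with (xc r - j * yc r + (2 * fst k - snd k - j * snd k) * 5)%Z by ring.
  rewrite !Z_mod_plus_full; reflexivity. }
assert (X : x_class (ladd r (lscale 10 k)) = x_class r) by (unfold x_class; rewrite H1, H3, Z_mod_plus_full; reflexivity).
assert (Y : y_class (ladd r (lscale 10 k)) = y_class r) by (unfold y_class; rewrite H1, H2, Z_mod_plus_full; reflexivity).
rewrite !c300_twice; do 2 f_equal; apply f_equal; unfold twice_c; rewrite X, Y; do 3 f_equal.
apply f_equal, map_ext; intros [j l]; rewrite I; reflexivity.
Qed.

Lemma c300_0 : c300 (0, 0)%Z = 0.
Proof. rewrite c300_twice; replace (twice_c (0, 0)%Z) with 0%Z by (vm_compute; reflexivity); f_equal; field. Qed.

Lemma c300_real p : Cconj (c300 p) = c300 p.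
Proof. rewrite c300_twice; apply Cconj_RtoC. Qed.

Lemma csum_ZtoC {I : Type} (l : list I) (h : I -> Z) :
  csum l (fun i => ZtoC (h i)) = ZtoC (fold_right Z.add 0%Z (map h l)).
Proof. induction l as [|i l IH]; [reflexivity|]; simpl; rewrite IH, ZtoC_plus; reflexivity. Qed.

Lemma c300_sum : csum (residues 10) c300 = 0.
Proof.
transitivity (csum (residues 10) (fun r => / 2 * ZtoC (twice_c r))%C).
- apply csum_ext; intros r _; rewrite c300_twice, RtoC_div by lra; unfold ZtoC; field.
- rewrite csum_scal, csum_ZtoC.
  replace (fold_right Z.add 0%Z (map twice_c (residues 10))) with 0%Z by (vm_compute; reflexivity).
  unfold ZtoC; ring.
Qed.

Definition in_residues_b (N : nat) (r : Z * Z) : bool :=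
  ((0 <=? fst r) && (fst r <? Z.of_nat N) && (0 <=? snd r) && (snd r <? Z.of_nat N))%Z.

Lemma in_residues_bool N r : in_residues_b N r = true <-> In r (residues N).
Proof.
rewrite in_residues; unfold in_residues_b; rewrite !andb_true_iff, !Z.leb_le, !Z.ltb_lt; tauto.
Qed.

Definition pair_eqb (p r : Z * Z) : bool := ((fst p =? fst r) && (snd p =? snd r))%Z.

Lemma pair_eqb_eq p r : pair_eqb p r = true -> p = r.
Proof.
unfold pair_eqb; rewrite andb_true_iff, !Z.eqb_eq; intros [H1 H2].
destruct p, r; simpl in *; subst; reflexivity.
Qed.

Lemma csum_residues_bij N (s s' : Z * Z -> Z * Z) (F : Z * Z -> C) :
  forallb (fun r => in_residues_b N (s r) && pair_eqb (s' (s r)) r && in_residues_b N (s' r) && pair_eqb (s (s' r)) r)%bool (residues N) = true ->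
  csum (residues N) (fun r => F (s r)) = csum (residues N) F.
Proof.
intros H; rewrite forallb_forall in H.
assert (H' : forall r, In r (residues N) -> In (s r) (residues N) /\ s' (s r) = r /\ In (s' r) (residues N) /\ s (s' r) = r).
{ intros r Hr; specialize (H r Hr); rewrite !andb_true_iff in H; destruct H as [[[A B] D] E].
  rewrite in_residues_bool in A, D; apply pair_eqb_eq in B; apply pair_eqb_eq in E; tauto. }
rewrite <- (csum_map s); apply csum_perm.
- apply NoDup_map_NoDup_ForallPairs; [|apply NoDup_residues].
  intros a b Ha Hb E; destruct (H' a Ha) as (_ & <- & _); rewrite E; apply (H' b Hb).
- apply NoDup_residues.
- intros r; rewrite in_map_iff; split.
  + intros (u & <- & Hu); apply (H' u Hu).
  + intros Hr; exists (s' r); destruct (H' r Hr) as (_ & _ & A & B); tauto.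
Qed.

Lemma csum_filter {I : Type} (l : list I) (h : I -> Z) (F : I -> C) :
  csum l (fun i => (ZtoC (h i) * F i)%C) = csum (filter (fun i => negb (h i =? 0)%Z) l) (fun i => (ZtoC (h i) * F i)%C).
Proof.
induction l as [|i l IH]; [reflexivity|]; simpl; destruct (Z.eqb_spec (h i) 0) as [e|n]; simpl; rewrite IH; [|reflexivity].
rewrite e; unfold ZtoC; ring.
Qed.

(** Values at 10-torsion points. The class of the origin, a pole, always comes with coefficient
    zero. *)
Definition gval (r : Z * Z) : C := RO (lat r / ntoC 10).
Definition oddval (r : Z * Z) : C := RO (/ 2 + lat r / ntoC 5).

Lemma gval_off r : r <> (0, 0)%Z -> In r (residues 10) -> off_lattice (lat r / ntoC 10).
Proof. intros; apply off_lattice_residue; try assumption; lia. Qed.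

Lemma ntoC_10 : ntoC 10 = RtoC 10.
Proof. unfold ntoC; f_equal; simpl; lra. Qed.

Lemma ntoC_5 : ntoC 5 = RtoC 5.
Proof. unfold ntoC; f_equal; simpl; lra. Qed.

Lemma gval_lmod r : off_lattice (lat (lmod 10 r) / ntoC 10) -> gval r = gval (lmod 10 r).
Proof.
intros H; destruct (lmod_decomp 10 r ltac:(lia)) as [k Ek]; unfold gval.
rewrite <- (RO_period _ k H); f_equal; rewrite <- Ek at 1; rewrite lat_add, lat_scale, ntoC_10; field.
Qed.

Lemma gval_opp r : In r (residues 10) -> r <> (0, 0)%Z -> gval (lmod 10 (lopp r)) = gval r.
Proof.
intros Hr H0; pose proof (gval_off r H0 Hr) as Ho.
rewrite <- gval_lmod; unfold gval.
- rewrite lat_opp, <- (RO_opp _ Ho); f_equal; field; apply ntoC_neq_0; lia.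
- apply gval_off; [|apply lmod_in; lia].
  intros E; apply H0; apply in_residues in Hr; destruct r as [a b]; unfold lmod, lopp in E; simpl in *.
  injection E; intros E2 E1; apply Z.mod_divide in E1; [|lia]; apply Z.mod_divide in E2; [|lia].
  destruct E1 as [u E1], E2 as [v E2]; f_equal; lia.
Qed.

Lemma gval_rot r : In r (residues 10) -> r <> (0, 0)%Z -> gval (lmod 10 (lrot r)) = (om * gval r)%C.
Proof.
intros Hr H0; pose proof (gval_off r H0 Hr) as Ho.
rewrite <- gval_lmod; unfold gval.
- rewrite lat_rot, <- (RO_om _ Ho); f_equal; field; apply ntoC_neq_0; lia.
- apply gval_off; [|apply lmod_in; lia].
  intros E; apply H0; apply in_residues in Hr; destruct r as [a b]; unfold lmod, lrot in E; simpl in *.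
  injection E; intros E2 E1; apply Z.mod_divide in E1; [|lia]; apply Z.mod_divide in E2; [|lia].
  destruct E1 as [u E1], E2 as [v E2]; f_equal; lia.
Qed.

(** The symmetrised coefficient c(r) + c(-r) is the Legendre symbol of the norm on Z[sqrt(-3)]. If
    both coordinates are even, r/10 is a 5-torsion point; if the first is odd, it is such a point
    translated by 1/2. *)
Definition even_part (r : Z * Z) : Z := (if Z.even (fst r) && Z.even (snd r) then legendre (norm_form r) 5 else 0)%Z.
Definition odd_part (r : Z * Z) : Z := (if Z.odd (fst r) && Z.even (snd r) then legendre (norm_form r) 5 else 0)%Z.

(** Only the even part of the coefficients matters, because [RO] is even. *)
Lemma c300_symmetrized :
  csum (residues 10) (fun r => c300 r * gval r)%C =
  (/ 2 * (csum (residues 10) (fun r => ZtoC (even_part r) * gval r) + csum (residues 10) (fun r => ZtoC (odd_part r) * gval r)))%C.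
Proof.
set (s := fun r => lmod 10 (lopp r)).
assert (E : csum (residues 10) (fun r => c300 (s r) * gval (s r))%C = csum (residues 10) (fun r => c300 r * gval r)%C).
{ apply (csum_residues_bij 10 s s (fun r => c300 r * gval r)%C); vm_compute; reflexivity. }
assert (K : forallb (fun r => twice_c r + twice_c (s r) =? 2 * (even_part r + odd_part r))%Z (residues 10) = true) by (vm_compute; reflexivity).
rewrite forallb_forall in K.
transitivity (/ 2 * (csum (residues 10) (fun r => c300 r * gval r) + csum (residues 10) (fun r => c300 (s r) * gval (s r))))%C;
  [rewrite E; field|].
f_equal; rewrite <- !csum_plus; apply csum_ext; intros r Hr; specialize (K r Hr); apply Z.eqb_eq in K.
destruct (classic (r = (0, 0)%Z)) as [->|ne].
- replace (s (0, 0)%Z) with (0, 0)%Z by reflexivity; rewrite c300_0.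
  replace (even_part (0, 0)%Z) with 0%Z by (vm_compute; reflexivity).
  replace (odd_part (0, 0)%Z) with 0%Z by (vm_compute; reflexivity); unfold ZtoC; ring.
- unfold s; rewrite gval_opp by assumption; rewrite !c300_twice; fold (s r).
  rewrite <- !Cmult_plus_distr_r; f_equal; unfold ZtoC; rewrite <- !RtoC_plus; f_equal.
  apply (f_equal IZR) in K; rewrite mult_IZR, !plus_IZR in K; lra.
Qed.

(** Residues with both coordinates even are permuted by om with invariant coefficients, while [RO]
    picks up a factor om, so the sum equals om times itself. The odd part has no such symmetry,
    since om moves 1/2 to om/2. *)
Lemma even_part_sum : csum (residues 10) (fun r => ZtoC (even_part r) * gval r)%C = 0.
Proof.
set (s := fun r => lmod 10 (lrot r)); set (T := csum _ _).
assert (E : csum (residues 10) (fun r => ZtoC (even_part (s r)) * gval (s r))%C = T).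
{ apply (csum_residues_bij 10 s (fun r => lmod 10 (lrot2 r)) (fun r => ZtoC (even_part r) * gval r)%C); vm_compute; reflexivity. }
assert (K : forallb (fun r => even_part (s r) =? even_part r)%Z (residues 10) = true) by (vm_compute; reflexivity).
rewrite forallb_forall in K.
assert (E2 : (om * T)%C = T).
{ rewrite <- E at 2; unfold T; rewrite <- csum_scal; apply csum_ext; intros r Hr; specialize (K r Hr); apply Z.eqb_eq in K.
  rewrite K; destruct (classic (r = (0, 0)%Z)) as [->|ne].
  - replace (even_part (0, 0)%Z) with 0%Z by (vm_compute; reflexivity); unfold ZtoC; ring.
  - unfold s; rewrite gval_rot by assumption; ring. }
destruct (classic (T = 0)) as [e|n]; [assumption|exfalso].
apply (Cmult_neq_0 _ _ om_minus_1 n); transitivity (om * T - T)%C; [ring|rewrite E2; ring].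
Qed.

Lemma five_half_off : off_lattice (ntoC 5 * / 2).
Proof.
rewrite ntoC_5; replace (5 * / 2)%C with (/ 2 + lat (2, 0)%Z)%C by (unfold lat, ZtoC; simpl; field).
apply off_lattice_add, off_half.
Qed.

Lemma oddval_off s : off_lattice (/ 2 + lat s / ntoC 5).
Proof. apply off_lattice_div; [lia|apply five_half_off]. Qed.

Lemma oddval_lmod s : oddval (lmod 5 s) = oddval s.
Proof.
destruct (lmod_decomp 5 s ltac:(lia)) as [k Ek]; unfold oddval.
rewrite <- (RO_period _ k (oddval_off (lmod 5 s))); f_equal.
rewrite <- Ek at 2; rewrite lat_add, lat_scale; field; apply ntoC_neq_0; lia.
Qed.

Lemma oddval_opp s : oddval (lopp s) = oddval s.
Proof.
unfold oddval; rewrite <- (RO_opp _ (oddval_off s)).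
rewrite <- (RO_period (- (/ 2 + lat s / ntoC 5)) (1, 0)%Z) by apply off_lattice_opp, oddval_off.
replace (lat (1, 0)%Z) with (RtoC 1) by (unfold lat, ZtoC; simpl; ring).
f_equal; rewrite lat_opp; field; apply ntoC_neq_0; lia.
Qed.

(** A canonical representative modulo 5 and up to sign, so that equal values become the same atom
    for [ring]. *)
Definition red (s : Z * Z) : Z * Z :=
  let u := lmod 5 s in let v := lmod 5 (lopp s) in
  if (fst u * 5 + snd u <=? fst v * 5 + snd v)%Z then u else v.

Lemma oddval_red s : oddval s = oddval (red s).
Proof.
unfold red; destruct Z.leb; rewrite oddval_lmod; [|rewrite oddval_opp]; reflexivity.
Qed.

Lemma gval_oddval a b : gval (2 * a + 5, 2 * b)%Z = oddval (a, b).
Proof.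
unfold gval, oddval; f_equal; rewrite ntoC_10, ntoC_5; unfold lat; cbn [fst snd].
rewrite ZtoC_plus, !ZtoC_mult; change (ZtoC 2) with (RtoC 2); change (ZtoC 5) with (RtoC 5); field.
Qed.

Lemma oddval_0 : oddval (0, 0)%Z = fO.
Proof. unfold oddval; rewrite lat_0, <- RO_half; f_equal; field; apply ntoC_neq_0; lia. Qed.

Lemma oddval_sum : csum (residues 5) oddval = (25 * fO)%C.
Proof.
pose proof (RO_distribution 5 (/ 2) ltac:(lia) five_half_off) as H; unfold oddval; rewrite H, ntoC_5.
replace (5 * / 2)%C with (/ 2 + lat (2, 0)%Z)%C by (unfold lat, ZtoC; simpl; field).
rewrite RO_period, RO_half by apply off_half; ring.
Qed.

(** A nonzero class modulo 5 has square or nonsquare norm. The sum over all classes is 25 f by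
    distribution and the zero class contributes f, so the signed sum is 24 f minus twice the
    nonsquare part, whose twelve classes are the six listed and their negatives. *)
Lemma odd_part_sum :
  csum (residues 10) (fun r => ZtoC (odd_part r) * gval r)%C =
  (24 * fO - 4 * (oddval (1, 2)%Z + oddval (-2, -1)%Z + oddval (1, -1)%Z
     + (oddval (2, 4)%Z + oddval (-4, -2)%Z + oddval (2, -2)%Z)))%C.
Proof.
set (L := filter (fun r => negb (odd_part r =? 0)%Z) (residues 10)).
set (half := fun r : Z * Z => ((fst r - 5) / 2, snd r / 2)%Z).
assert (K : forallb (fun r => pair_eqb r (2 * fst (half r) + 5, 2 * snd (half r))%Z) L = true) by (vm_compute; reflexivity).
rewrite forallb_forall in K; rewrite csum_filter; fold L.
transitivity (csum (map (fun r => (odd_part r, red (half r))) L) (fun e => ZtoC (fst e) * oddval (snd e))%C).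
{ rewrite csum_map; apply csum_ext; intros r Hr; cbn [fst snd]; f_equal; rewrite <- oddval_red.
  specialize (K r Hr); apply pair_eqb_eq in K; rewrite K at 1; rewrite gval_oddval; destruct (half r); reflexivity. }
pose proof oddval_sum as S; pose proof oddval_0 as S0.
assert (S1 : csum (map red (residues 5)) oddval = (25 * fO)%C).
{ rewrite csum_map, <- S; apply csum_ext; intros r _; symmetry; apply oddval_red. }
rewrite (oddval_red (1, 2)%Z), (oddval_red (-2, -1)%Z), (oddval_red (1, -1)%Z), (oddval_red (2, 4)%Z), (oddval_red (-4, -2)%Z), (oddval_red (2, -2)%Z).
match goal with |- context [csum ?l _] => let l' := eval vm_compute in l in change l with l' end.
match type of S1 with csum ?l _ = _ => let l' := eval vm_compute in l in change l with l' in S1 end.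
repeat match goal with |- context [red ?l] => let l' := eval vm_compute in (red l) in change (red l) with l' end.
unfold csum, fold_right, fst, snd in *; unfold ZtoC; rewrite <- S0 in *.
replace (24 * oddval (0, 0)%Z)%C with (25 * oddval (0, 0)%Z - oddval (0, 0)%Z)%C by ring.
rewrite <- S1; ring.
Qed.

(** The translates are f + 3 f/(om^i x - 1), and the sum of 1/(om^i x - 1) over i = 0, 1, 2 is
    3/(x^3 - 1). *)
Lemma translate_orbit (f x A B D : C) : f <> 0 -> (x ^ 3 - 1)%C <> 0 ->
  ((f * x - f) * (A - f))%C = (3 * f ^ 2)%C -> ((om * (f * x) - f) * (B - f))%C = (3 * f ^ 2)%C ->
  ((om * (om * (f * x)) - f) * (D - f))%C = (3 * f ^ 2)%C ->
  (A + B + D)%C = (3 * f + 9 * f / (x ^ 3 - 1))%C.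
Proof.
intros Hf Hx EA EB ED.
assert (G : forall a b : C, (f * a)%C = (f * b)%C -> a = b).
{ intros a b E; transitivity (f * a / f)%C; [field; assumption|rewrite E; field; assumption]. }
assert (EA' : ((x - 1) * (A - f))%C = (3 * f)%C) by (apply G; transitivity ((f * x - f) * (A - f))%C; [ring|rewrite EA; ring]).
assert (EB' : ((om * x - 1) * (B - f))%C = (3 * f)%C) by (apply G; transitivity ((om * (f * x) - f) * (B - f))%C; [ring|rewrite EB; ring]).
assert (ED' : ((om * (om * x) - 1) * (D - f))%C = (3 * f)%C) by (apply G; transitivity ((om * (om * (f * x)) - f) * (D - f))%C; [ring|rewrite ED; ring]).
assert (E : ((x ^ 3 - 1) * (A + B + D - 3 * f))%C = (9 * f)%C).
{ transitivity (((x - 1) * (A - f)) * ((om * x - 1) * (om * (om * x) - 1)) + ((om * x - 1) * (B - f)) * ((x - 1) * (om * (om * x) - 1))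
    + ((om * (om * x) - 1) * (D - f)) * ((x - 1) * (om * x - 1)))%C; [ring [om_eq]|].
  rewrite EA', EB', ED'; ring [om_eq]. }
transitivity (3 * f + (x ^ 3 - 1) * (A + B + D - 3 * f) / (x ^ 3 - 1))%C; [field; assumption|rewrite E; reflexivity].
Qed.

Lemma oddval_orbit (s : Z * Z) (t : R) (x f : R) : lat s = (RtoC 5 * (0, t))%C -> 0 < t < sqrt 3 / 2 ->
  fO = RtoC f -> 0 < f -> RO (0, t) = RtoC (f * x) -> x ^ 3 <> 1 ->
  (oddval s + oddval (lrot s) + oddval (lrot (lrot s)))%C = RtoC (3 * f + 9 * f * / (x ^ 3 - 1)).
Proof.
intros Hs Ht Ef Hf Ex Hx; destruct (imaginary_translates t Ht) as (T0 & T1 & T2 & Ho).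
assert (Ho1 : off_lattice (om * (0, t))) by now apply off_lattice_om.
assert (E : forall u y, lat u = (5 * y)%C -> RO (y + / 2) = oddval u).
{ intros u y Hu; unfold oddval; rewrite Hu, ntoC_5; f_equal; field. }
unfold translates in T0, T1, T2.
rewrite (E s) in T0 by assumption.
rewrite (E (lrot s)) in T1 by (rewrite lat_rot, Hs; ring).
rewrite (E (lrot (lrot s))) in T2 by (rewrite !lat_rot, Hs; ring).
rewrite RO_om in T1 by assumption; rewrite !RO_om in T2 by assumption.
rewrite Ex, Ef, RtoC_mult in T0, T1, T2.
assert (Hx' : x ^ 3 - 1 <> 0) by lra.
rewrite (translate_orbit (RtoC f) (RtoC x) _ _ _) by
  first [assumption | apply RtoC_neq_0; lra | rewrite <- RtoC_pow, <- RtoC_minus; now apply RtoC_neq_0].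
rewrite RtoC_plus, !RtoC_mult, RtoC_inv by assumption; rewrite RtoC_minus, RtoC_pow; reflexivity.
Qed.

Lemma Lser_c300_2 (f : R) : fO = RtoC f -> 0 < f -> Lser 10 c300 (RtoC 2) = RtoC (3 * sqrt 5 * f / 25).
Proof.
intros Ef0 Hf0; destruct RO_five_torsion as (f' & x & x' & Ef & Hf & E1 & E2 & H1 & H2 & Hs & _).
assert (f' = f) by (apply RtoC_inj; congruence); subst f'.
rewrite (Lser_2 10 c300 ltac:(lia) c300_period c300_sum c300_0 c300_real).
change (fun r => (c300 r * RO (lat r / ntoC 10))%C) with (fun r => (c300 r * gval r)%C).
rewrite c300_symmetrized, even_part_sum, odd_part_sum.
pose proof sqrt3_pos as H3.
(* k sqrt(-3) has the coordinates (k, 2 k), so the residues (1, 2) and (2, 4) belong to [v5] and its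
   double. *)
assert (Ev : forall k : Z, lat (k, 2 * k)%Z = (RtoC 5 * (0, IZR k * (sqrt 3 / 5))%R)%C).
{ intros k; unfold lat, om; cbn [fst snd]; unfold ZtoC; rewrite mult_IZR; apply injective_projections; simpl; field. }
assert (A : (oddval (1, 2)%Z + oddval (-2, -1)%Z + oddval (1, -1)%Z)%C = RtoC (3 * f + 9 * f * / (x ^ 3 - 1))).
{ change (-2, -1)%Z with (lrot (1, 2)%Z); change (1, -1)%Z with (lrot (lrot (1, 2)%Z)).
  apply (oddval_orbit _ (1 * (sqrt 3 / 5))); try assumption; [exact (Ev 1%Z)|lra|].
  rewrite <- E1; unfold v5; do 2 f_equal; ring. }
assert (B : (oddval (2, 4)%Z + oddval (-4, -2)%Z + oddval (2, -2)%Z)%C = RtoC (3 * f + 9 * f * / (x' ^ 3 - 1))).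
{ change (-4, -2)%Z with (lrot (2, 4)%Z); change (2, -2)%Z with (lrot (lrot (2, 4)%Z)).
  apply (oddval_orbit _ (2 * (sqrt 3 / 5))); try assumption; [exact (Ev 2%Z)|lra|].
  rewrite <- E2; unfold v5; f_equal; apply injective_projections; simpl; ring. }
rewrite A, B, Ef, ntoC_10.
transitivity (Cconj (RtoC (/ 100 * (/ 2 * (24 * f - 4 * (6 * f + 9 * f * (/ (x ^ 3 - 1) + / (x' ^ 3 - 1)))))))).
- f_equal; rewrite ?RtoC_mult, ?RtoC_minus, ?RtoC_plus, ?RtoC_mult, ?RtoC_minus, ?RtoC_plus, ?RtoC_mult, ?RtoC_plus.
  rewrite (RtoC_inv 100), (RtoC_inv 2) by lra; field.
- rewrite Hs, Cconj_RtoC; f_equal; field.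
Qed.

Theorem theorem5p7 :
  exists e : R,
    0 < e /\ E4 sqrt_m3 = RtoC e /\
    is_L_value f300 (RtoC 2) (RtoC (4 / 25 * PI ^ 2 * sqrt e)) /\
    4 / 25 * PI ^ 2 * sqrt e =
      4 / 25 * PI ^ 2 * hyp3F2 (1 / 2) (1 / 6) (5 / 6) 1 1 (4 / 125).
Proof.
destruct fO_real as (f & _ & Ef & Hf & _).
destruct (Eisenstein_value f Ef Hf) as (He & Es & Et).
pose proof PI_RGT_0 as HPI; exists (E4r x0); split; [assumption|split; [exact E4_E4r|split]].
(* 3 lies inside the range Re s >= 9/4 where the ungrouped series was summed; 15/8 is the bound
   reached by grouping into blocks. *)
- exists (Lser 10 c300), 3, (15 / 8); split; [|split; [|split]].
  + intros s Hs; apply (is_series_ext (fun n => (rep_coef c300 (S n) * npow_opp (S n) s)%C)).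
    * intros n; rewrite f300_rep_coef by lia; reflexivity.
    * apply Lser_series; try lia; try lra; [exact c300_period|exact c300_0].
  + apply Lser_holomorphic; [lia|exact c300_period|exact c300_sum|exact c300_0].
  + simpl; lra.
  + rewrite (Lser_c300_2 f Ef Hf), Es; f_equal; field; lra.
- rewrite hyp3F2_h0, <- Et, uniformization by apply x0_bounds; reflexivity.
Qed.
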